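(* Let $d\ge1$ and $s>0$. For $n\in\mathbb{N}$ let $a_n:=4\pi^2(2d)^{-1}n^{-2}$ and let $(\sigma(z))_{z\in\mathbb{Z}_n^d}$ be sampled from the jointly Gaussian distribution $\mathcal{N}\big(0,a_n^{2s}(-\Delta_g)^{-2s}\big)$, i.e. the $\sigma$'s are centered jointly Gaussian with $$\mathbb{E}[\sigma(x)\sigma(y)]=K_n(x-y),\qquad K_n(x):=a_n^{2s}\sum_{\xi\in\mathbb{Z}_n^d\setminus\{0\}}(-\lambda_\xi)^{-2s}\exp\Big(2\pi\imath\,x\cdot\frac{\xi}{n}\Big).$$ Let $(u_n(z))_{z\in\mathbb{Z}_n^d}$ be the odometer of the divisible sandpile with initial configuration $$S(x)=1+\sigma(x)-\frac1{n^d}\sum_{z\in\mathbb{Z}_n^d}\sigma(z),$$ and define the formal field $$\Xi_n^K(x):=\sum_{z\in\mathbb{T}_n^d}u_n(nz)\,\mathbf{1}_{B(z,\frac1{2n})}(x),\qquad x\in\mathbb{T}^d.$$ Then, for every $\varepsilon>\max\{d/2,\,1+d/4\}$, as $n\to\infty$ the field $a_n\Xi_n^K$ converges in law to $\Xi^K$ in the Sobolev space $H_K^{-\varepsilon}(\mathbb{T}^d)$ associated with the multiplier $\widehat K(\xi)=\|\xi\|^{-4s}$, $\xi\in\mathbb{Z}^d\setminus\{0\}$, where $\Xi^K$ is the Gaussian field on $\mathbb{T}^d$ such that for each $f\in C^\infty(\mathbb{T}^d)/\!\sim$ $$\langle\Xi^K,f\rangle\sim\mathcal{N}\Big(0,\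 \|(-\Delta)^{-(s+1)}f\|_{L^2(\mathbb{T}^d)}^2\Big).$$
   Context: $\mathbb{Z}_n^d=[-n/2,n/2]^d\cap\mathbb{Z}^d$ denotes the discrete torus of side-length $n$ (opposite sides identified, so it has $n^d$ points and differences are taken modulo $n$); $\mathbb{T}^d=[-1/2,1/2]^d$ is the unit torus; $\mathbb{T}_n^d:=\frac1n\mathbb{Z}_n^d\subset\mathbb{T}^d$; $B(z,\rho)$ is the $\ell^\infty$-ball of center $z$ and radius $\rho$; $\|\cdot\|$ is the Euclidean norm on $\mathbb{R}^d$. Discrete fractional Laplacian: let $\psi_\xi(z)=\exp(2\pi\imath z\cdot\xi/n)$, which are eigenfunctions of the graph Laplacian $\Delta_gf(x)=\frac1{2d}\sum_{\|y-x\|=1}(f(y)-f(x))$ on $\mathbb{Z}_n^d$, with eigenvalues $\lambda_\xi=-\frac4{2d}\sum_{i=1}^d\sin^2(\pi\xi_i/n)$. With $\widehat f(\xi)=\frac1{n^d}\sum_{z\in\mathbb{Z}_n^d}f(z)\overline{\psi_\xi(z)}$, for $f$ on $\mathbb{Z}_n^d$ with $\sum_z f(z)=0$ and $r>0$ one sets $(-\Delta_g)^{-r}f=\sum_{\xi\in\mathbb{Z}_n^d\setminus\{0\}}(-\lambda_\xi)^{-r}\widehat f(\xi)\psi_\xi$. Its kernel is taken with respect to the normalized inner product $\langle f,g\rangle=\frac1{n^d}\sum_z f(z)\overline{g(z)}$, which gives the covariance displayed in the claim; equivalently $\widehat{K_n}(\xi)=a_n^{2s}(-\lambda_\xi)^{-2s}$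 for $\xi\ne0$. Continuum objects: $\widehat f(\xi)=\int_{\mathbb{T}^d}f(z)e^{-2\pi\imath\xi\cdot z}dz$ for $\xi\in\mathbb{Z}^d$; $(-\Delta)^{a}f(x)=\sum_{\nu\in\mathbb{Z}^d\setminus\{0\}}\|\nu\|^{2a}\widehat f(\nu)e^{2\pi\imath\nu\cdot x}$. $C^\infty(\mathbb{T}^d)/\!\sim$ is the space of smooth functions on $\mathbb{T}^d$ with zero mean (smooth functions modulo constants); test functions in pairings are real-valued. For $a<0$, $H_K^a(\mathbb{T}^d)$ is the Hilbert space completion of $C^\infty(\mathbb{T}^d)/\!\sim$ with respect to the norm given by $\|f\|_{K,a}^2=\sum_{\xi\in\mathbb{Z}^d\setminus\{0\}}\widehat K(\xi)\|\xi\|^{4a}|\widehat f(\xi)|^2$. Fields are regarded modulo constants, and $\langle\cdot,f\rangle$ is the pairing extending the $L^2(\mathbb{T}^d)$ pairing. Divisible sandpile: a configuration is a function $S:\mathbb{Z}_n^d\to\mathbb{R}$. A vertex $x$ is unstable if $S(x)>1$; it topples by keeping mass $1$ and distributing the excess $S(x)-1$ uniformly among its $2d$ nearest neighbours. At each discrete time step all unstable vertices topple simultaneously. If $\sum_xS(x)=n^d$ the configuration stabilizes (in the limit of infinitely many time steps) to the all $1$ configuration. The odometer $u_n(x)\ge0$ is the total mass emitted from $x$ during stabilization. *)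

(* Defs.v *)
From HB Require Import structures.
From mathcomp Require Import all_boot all_order all_algebra.
From mathcomp Require Import all_classical all_reals all_analysis.
From mathcomp Require Import complex.

Set Implicit Arguments.
Unset Strict Implicit.
Unset Printing Implicit Defensive.

Import Order.TTheory GRing.Theory Num.Theory.
Import numFieldNormedType.Exports.

Local Open Scope classical_set_scope.
Local Open Scope ring_scope.
Local Open Scope complex_scope.

Definition cis (R : realType) (t : R) : R[i] := cos t +i* sin t.

(* A function on T^d = [-1/2, 1/2]^d is a Z^d-periodic function on R^d. *)

(* Integral over [-1/2, 1/2]^d, as an iterated Lebesgue integral.  It is only
   applied to products of step functions on cubes and continuous functions,
   for which it is the d-dimensional Lebesgue integral. *)
Fixpoint torus_int (R : realType) (d : nat) : ('rV[R]_d -> R) -> R :=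
  match d with
  | 0 => fun f => f 0
  | d'.+1 => fun f =>
      \int[@lebesgue_measure R]_(t in `[- 2^-1, 2^-1]%classic)
        torus_int (fun x : 'rV[R]_d' => f (row_mx (const_mx t : 'rV_1) x))
  end.

Definition torus_intC (R : realType) (d : nat) (f : 'rV[R]_d -> R[i]) : R[i] :=
  torus_int (fun x => complex.Re (f x)) +i* torus_int (fun x => complex.Im (f x)).

Definition zdot (R : realType) (d : nat) (xi : 'rV[int]_d) (x : 'rV[R]_d) : R :=
  \sum_i (xi 0 i)%:~R * x 0 i.

Definition enorm (R : realType) (d : nat) (xi : 'rV[int]_d) : R :=
  Num.sqrt (\sum_i ((xi 0 i)%:~R ^+ 2)).

Definition fourier (R : realType) (d : nat) (f : 'rV[R]_d -> R)
    (xi : 'rV[int]_d) : R[i] :=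
  torus_intC (fun x => (f x)%:C * cis (- (2 * pi * zdot xi x))).

Definition periodic (R : realType) (d : nat) (f : 'rV[R]_d -> R) : Prop :=
  forall (k : 'rV[int]_d) (x : 'rV[R]_d), f (x + map_mx intr k) = f x.

Definition iter_partial (R : realType) (d : nat) (l : seq 'I_d)
    (f : 'rV[R]_d -> R) : 'rV[R]_d -> R :=
  foldr (fun i (g : 'rV[R]_d -> R) x => 'D_(delta_mx 0 i) g x) f l.

Definition smooth (R : realType) (d : nat) (f : 'rV[R]_d -> R) : Prop :=
  forall l : seq 'I_d,
    continuous (iter_partial l f) /\
    forall (i : 'I_d) (x : 'rV[R]_d),
      derivable (iter_partial l f) x (delta_mx 0 i).

(* C^oo(T^d) / ~, each class being represented by its zero-mean element *)
Definition test_function (R : realType) (d : nat) : set ('rV[R]_d -> R) :=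
  [set f | [/\ periodic f, smooth f & torus_int f = 0]].

Definition l2dot (R : realType) (d : nat) (f g : 'rV[R]_d -> R) : R :=
  torus_int (fun x => f x * g x).

Definition punctured_box (d : nat) (N : nat) : set 'rV[int]_d :=
  [set nu | nu != 0 /\ forall i, `|nu 0 i| <= N%:Z].

(* (-Delta)^a f; the series over Z^d \ {0} is the limit of its partial sums
   over the boxes [-N, N]^d. *)
Definition frac_laplacian (R : realType) (d : nat) (a : R) (f : 'rV[R]_d -> R)
    (x : 'rV[R]_d) : R[i] :=
  let S (N : nat) : R[i] := \sum_(nu \in @punctured_box d N)
    (enorm R nu `^ (2 * a))%:C * fourier f nu * cis (2 * pi * zdot nu x) in
  lim ((fun N => complex.Re (S N)) @ \oo) +i*
  lim ((fun N => complex.Im (S N)) @ \oo).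

Definition l2norm_sq (R : realType) (d : nat) (f : 'rV[R]_d -> R[i]) : R :=
  torus_int (fun x => ComplexField.Normc.normc (f x) ^+ 2).

Definition sobolev_norm_sq (R : realType) (d : nat) (Khat : 'rV[int]_d -> R)
    (a : R) (f : 'rV[R]_d -> R) : \bar R :=
  (\esum_(xi in [set xi : 'rV[int]_d | xi != 0%R])
    (Khat xi * enorm R xi `^ (4 * a) *
     ComplexField.Normc.normc (fourier f xi) ^+ 2)%R%:E)%E.

(* H_K^a: a completion of the zero-mean smooth functions for the norm above.
   Completions are unique up to isometry, and the norm comes from an inner
   product since its restriction to a dense subspace does.  [sob_emb] is only
   meaningful on test functions. *)
Record sobolev_space (R : realType) (d : nat) (Khat : 'rV[int]_d -> R)
    (a : R) := SobolevSpace {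
  sob_carrier :> completeNormedModType R ;
  sob_emb : ('rV[R]_d -> R) -> sob_carrier ;
  sob_emb_linear : forall (c : R) (f g : 'rV[R]_d -> R),
    test_function f -> test_function g ->
    sob_emb (fun x => c * f x + g x) = c *: sob_emb f + sob_emb g ;
  sob_emb_norm : forall f : 'rV[R]_d -> R, test_function f ->
    (`|sob_emb f| ^+ 2)%:E = sobolev_norm_sq Khat a f ;
  sob_emb_dense : dense (sob_emb @` @test_function R d)
}.

(* <., f> on H_K^a: the (unique) continuous extension of g |-> <g, f>_{L^2}. *)
Definition sob_pairing (R : realType) (d : nat) (Khat : 'rV[int]_d -> R)
    (a : R) (H : sobolev_space Khat a) (f : 'rV[R]_d -> R) : H -> R :=
  xget (fun=> 0) [set L : H -> R | continuous L /\
    forall g, test_function g -> L (sob_emb H g) = l2dot g f].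

(* h is the element of H_K^a given by the function F on the torus. *)
Definition represents (R : realType) (d : nat) (Khat : 'rV[int]_d -> R)
    (a : R) (H : sobolev_space Khat a) (h : H) (F : 'rV[R]_d -> R) : Prop :=
  forall f, test_function f -> sob_pairing f h = l2dot F f.

(* Z_n^d, by residues modulo n in each coordinate; everything below that uses
   the representatives 0, ..., n-1 is n-periodic in them (for [formal_field]
   because [torus_ball] is a ball of R^d / Z^d). *)
Definition dtorus (d n : nat) := {ffun 'I_d -> 'I_n}.

Definition dnonzero (d n : nat) (xi : dtorus d n) : bool :=
  [exists i, (xi i : nat) != 0%N].

Definition shift_up (d n : nat) (x : dtorus d n) (i : 'I_d) : dtorus d n :=
  [ffun j => if j == i then ordS (x j) else x j].

Definition shift_down (d n : nat) (x : dtorus d n) (i : 'I_d) : dtorus d n :=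
  [ffun j => if j == i then ord_pred (x j) else x j].

Definition excess (R : realType) (d n : nat) (S : dtorus d n -> R)
    (x : dtorus d n) : R :=
  if 1 < S x then S x - 1 else 0.

(* One time step, all unstable sites toppling.  The 2d neighbours of x are the
   x + e_i and x - e_i, counted with multiplicity when n <= 2. *)
Definition topple (R : realType) (d n : nat) (S : dtorus d n -> R) :
    dtorus d n -> R :=
  fun x => S x - excess S x + (2 * d%:R)^-1 *
    \sum_(i < d) (excess S (shift_up x i) + excess S (shift_down x i)).

(* Total mass emitted from x over all time steps *)
Definition odometer (R : realType) (d n : nat) (S : dtorus d n -> R)
    (x : dtorus d n) : R :=
  lim ((fun t : nat => \sum_(k < t) excess (iter k (@topple R d n) S) x) @ \oo).

Definition sandpile_init (R : realType) (d n : nat) (sigma : dtorus d n -> R)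
    (x : dtorus d n) : R :=
  1 + sigma x - (n%:R ^+ d)^-1 * \sum_z sigma z.

Definition eigval (R : realType) (d n : nat) (xi : dtorus d n) : R :=
  - (4 / (2 * d%:R)) * \sum_(i < d) sin (pi * (xi i)%:R / n%:R) ^+ 2.

Definition scale_a (R : realType) (d n : nat) : R :=
  4 * pi ^+ 2 * (2 * d%:R)^-1 * (n%:R ^+ 2)^-1.

(* K_n as an n-periodic function on Z^d *)
Definition kernel_K (R : realType) (d : nat) (s : R) (n : nat)
    (x : 'I_d -> int) : R[i] :=
  (scale_a R d n `^ (2 * s))%:C * \sum_(xi : dtorus d n | dnonzero xi)
    ((- eigval R xi) `^ (- (2 * s)))%:C *
    cis (2 * pi * \sum_(i < d) (x i)%:~R * ((xi i)%:R / n%:R)).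

Definition torus_ball (R : realType) (d : nat) (c : 'rV[R]_d) (r : R) :
    set 'rV[R]_d :=
  [set x | exists k : 'rV[int]_d, ball c r (x + map_mx intr k)].

Definition formal_field (R : realType) (d n : nat) (u : dtorus d n -> R)
    (x : 'rV[R]_d) : R :=
  \sum_(z : dtorus d n)
    u z * \1_(torus_ball (\row_i ((z i)%:R / n%:R)) (2 * n%:R)^-1) x.

(* N(m, v), a Dirac mass when v = 0; [normal_prob] is parametrized by the
   standard deviation, and for 0 is not a Dirac mass. *)
Definition gaussian_law (R : realType) (m v : R) (A : set R) : \bar R :=
  if v == 0 then dirac m A else normal_prob m (Num.sqrt v) A.

Definition has_gaussian_law (R : realType) (disp : measure_display)
    (T : measurableType disp) (P : probability T R) (X : T -> R) (m v : R) :
    Prop :=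
  measurable_fun setT X /\
  forall A : set R, measurable A -> P (X @^-1` A) = gaussian_law m v A.

Definition jointly_gaussian (R : realType) (disp : measure_display)
    (T : measurableType disp) (P : probability T R) (I : finType)
    (X : I -> T -> R) : Prop :=
  forall c : I -> R, exists m v : R,
    0 <= v /\ has_gaussian_law P (fun w => \sum_i c i * X i w) m v.

Definition gaussian_with_cov (R : realType) (disp : measure_display)
    (T : measurableType disp) (P : probability T R) (d n : nat)
    (K : ('I_d -> int) -> R[i]) (sigma : dtorus d n -> T -> R) : Prop :=
  [/\ jointly_gaussian P sigma,
      forall x, ('E_P[sigma x] = 0)%E
    & forall x y, (fine 'E_P[(fun w => sigma x w * sigma y w)%R]%E)%:C =
        K (fun i => (x i)%:Z - (y i)%:Z)].

Definition borel (T : topologicalType) := g_sigma_algebraType (@open T).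

(* mu is the law on H of the Gaussian field Xi^K with
   <Xi^K, f> ~ N(0, ||(-Delta)^{-(s+1)} f||^2). *)
Definition is_limit_field_law (R : realType) (d : nat)
    (Khat : 'rV[int]_d -> R) (a : R) (H : sobolev_space Khat a) (s : R)
    (mu : probability (borel H) R) : Prop :=
  forall f, test_function f ->
    has_gaussian_law mu (sob_pairing f : borel H -> R) 0
      (l2norm_sq (frac_laplacian (- (s + 1)) f)).

Definition converges_in_law (R : realType) (H : normedModType R)
    (disp : nat -> measure_display)
    (Omega : forall n, measurableType (disp n))
    (P : forall n, probability (Omega n) R)
    (X : forall n, Omega n -> H) (mu : probability (borel H) R) : Prop :=
  forall phi : H -> R, continuous phi ->
    (exists M : R, forall h, `|phi h| <= M) ->
    (fun n => \int[P n]_w phi (X n w)) @ \oo -->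
      \int[mu]_(h in [set: borel H]) phi h.

(* Main.v *)
Require Import Defs.
From HB Require Import structures.
From mathcomp Require Import all_boot all_order all_algebra.
From mathcomp Require Import all_classical all_reals all_analysis.
From mathcomp Require Import measurable_realfun complex zify ring lra.

(** * Scaling limit of the odometer

    Why the theorem holds.  The odometer u of the sandpile started from S
    solves S + Lap u = 1, Lap being the graph Laplacian ([odometer_eq]).
    Summation by parts then turns the pairing of u with a mean zero function f
    on the grid into a linear combination of the initial noise, so this pairing is
    exactly Gaussian for every n ([odometer_gaussian]).  Its variance is
    diagonal in the discrete Fourier basis: the noise contributes the power 2s
    of the inverse eigenvalues, and the inversion of the Laplacian the power 2.
    For the pairing of the rescaled field with a test function f on the torus,
    the variance is the squared discrete Sobolev norm of order - (2s + 2) of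
    the cell averages of f ([formal_field_pairing], [pairing_varE]).

    Convergence of the variances.  For a fixed frequency, the discrete Fourier
    coefficient tends to the one of f ([coef_cvg]) and the eigenvalue divided
    by a_n tends to the squared norm of the frequency ([lam_cvg]).  The
    Dirichlet energy of the cell averages is bounded uniformly in n
    ([cell_energy]), so the high frequencies are uniformly negligible
    ([dspec_tail], [dsob_cvg]).  The limit is the squared norm of the
    fractional Laplacian of f ([frac_laplacian_norm]).  The case of order 0 of
    the same argument is Parseval's identity ([parseval]), from which the
    Fourier theory of test functions is developed.

    Convergence in law of finitely many pairings.  For centered Gaussian
    vectors it suffices that the variances of all linear combinations converge
    ([gaussian_family_cvg]).  Expectations of trigonometric polynomials only
    depend on these variances, and a Bernstein operator in the variables
    sin (y / N) approximates a bounded Lipschitz function by trigonometric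
    polynomials, up to an error with quadratic growth in y.

    From finitely many modes to the Sobolev space.  The mode of frequency nu
    has norm at most |nu|^(-2(s + eps)) in the completion ([emb_mode_le]),
    which is summable over the lattice as d < 2(s + eps) ([lattice_sum]).  The
    Fourier coefficients of all the fields have first absolute moments bounded
    by one constant, since the modes are bounded and variances are controlled
    by sup norms ([dsob_le], [gaussian_abs_le]).  Hence the mean norm of the
    Fourier remainder is small uniformly in n ([proj_remainder]), and the
    expectations of bounded Lipschitz functions converge
    ([gaussian_fields_cvg]).  Inf-convolutions extend this to bounded
    continuous functions ([cvg_law_of_lipschitz]).

    The random elements themselves are absolutely convergent series of modes
    ([series_elt]).  For the sandpile the coefficients are those of the step
    function ([field_elt_represents]).  For the limit they are independent
    centered Gaussians of standard deviation |nu|^(-2(s + 1))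
    ([limit_field_exists]), which are built on the unit interval by splitting
    the binary digits of a uniform number ([normal_seq_law]). *)

Set Implicit Arguments.
Unset Strict Implicit.
Unset Printing Implicit Defensive.

Import Order.TTheory GRing.Theory Num.Theory.
Import numFieldNormedType.Exports.

Local Open Scope classical_set_scope.
Local Open Scope ring_scope.

(** * Sums and limits *)

Lemma cvg_sumr (R : realType) (V : normedModType R) (I : Type) (r : seq I)
    (p : pred I) (u : I -> nat -> V) (l : I -> V) :
  (forall i, u i @ \oo --> l i) ->
  (fun n => \sum_(i <- r | p i) u i n) @ \oo --> \sum_(i <- r | p i) l i.
Proof.
move=> ul; elim: r => [|i r IH].
  by rewrite big_nil; under eq_fun do rewrite big_nil; exact: cvg_cst.
rewrite big_cons; case: ifPn => pi.
  under eq_fun do rewrite big_cons pi; exact: cvgD (ul i) IH.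
by under eq_fun do rewrite big_cons (negbTE pi).
Qed.

(** The epsilon/3 argument, for sequences of expectations or of norms that are
    only approximated by convergent ones. *)
Lemma cvg_uniform_approx (R : realType) (x_ : nat -> R) (x : R) :
  (forall e, 0 < e -> exists a l, [/\ a @ \oo --> l,
     (\forall n \near \oo, `|a n - x_ n| <= e) & `|l - x| <= e]) -> x_ @ \oo --> x.
Proof.
move=> H; apply/cvgrPdist_lt => e e0.
have e4 : 0 < e / 4 by rewrite divr_gt0.
have [a [l [al an lx]]] := H _ e4.
move/cvgrPdist_lt : al => /(_ _ e4); apply: filterS2 an => n an ln.
have -> : x - x_ n = - (l - x) + (l - a n) + (a n - x_ n) by ring.
apply: (le_lt_trans (ler_normD _ _)).
have := ler_normD (- (l - x)) (l - a n); rewrite normrN; lra.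
Qed.

Lemma sum_split_sub (V : nmodType) (T : eqType) (r r' : seq T) (F : T -> V) :
  uniq r -> uniq r' -> {subset r <= r'} ->
  \sum_(i <- r') F i = \sum_(i <- r) F i + \sum_(i <- r' | i \notin r) F i.
Proof.
move=> ur ur' rr'; rewrite (bigID (mem r))/=; congr (_ + _).
rewrite -big_filter; apply: perm_big; apply: uniq_perm => //.
  exact: filter_uniq.
by move=> i; rewrite mem_filter; apply/andP/idP => [[]//|ir]; split => //; exact: rr'.
Qed.

Lemma ler_sum_sub (R : numDomainType) (T : eqType) (r r' : seq T) (F : T -> R) :
  uniq r -> uniq r' -> {subset r <= r'} -> (forall i, 0 <= F i) ->
  \sum_(i <- r) F i <= \sum_(i <- r') F i.
Proof.
by move=> ur ur' rr' F0; rewrite (sum_split_sub _ ur ur' rr') lerDl sumr_ge0.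
Qed.

(** * Gaussian integrals on the line *)

(** Intervals are rescaled exactly, and they determine the measure; the integral
    formula is then that of a pushforward. *)
Lemma ge0_lebesgue_affine (R : realType) (a b : R) (f : R -> \bar R) :
  0 < a -> measurable_fun setT f -> (forall x, (0 <= f x)%E) ->
  (\int[@lebesgue_measure R]_y f y =
   a%:E * \int[@lebesgue_measure R]_x f (a * x + b)%R)%E.
Proof.
move=> a0 mf f0.
pose phi := fun x : measurableTypeR R => (a * x + b)%R : measurableTypeR R.
have mphi : measurable_fun setT phi.
  by apply: measurable_funD => //; apply: measurable_funM.
pose nu : {measure set (measurableTypeR R) -> \bar R} :=
  mscale (NngNum (ltW a0)) (pushforward (@lebesgue_measure R) phi).
have E A : measurable A -> lebesgue_measure A = nu mphi A.
  apply: lebesgue_measure_unique => _ [[u v] _ <-] /=.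
  have pE : phi @^-1` `]u, v]%classic = `](u - b) / a, (v - b) / a]%classic.
    apply/seteqP; split => x /=; rewrite !in_itv/= ltr_pdivrMr// ler_pdivlMr//;
    by rewrite ltrBlDr lerBrDr [x * a]mulrC.
  have -> : nu mphi `]u, v]%classic = (a%:E * lebesgue_measure (phi @^-1` `]u, v]%classic))%E by [].
  rewrite pE !lebesgue_measure_itv/= !lte_fin ltr_pM2r ?invr_gt0// ltrD2r.
  case: ifPn => _; last by rewrite mule0.
  by rewrite -!EFinD -EFinM; congr EFin; field; rewrite gt_eqF.
rewrite (@eq_measure_integral _ _ _ _ (nu mphi)); last by move=> A mA _; exact: E.
rewrite ge0_integral_mscale//=.
by rewrite ge0_integral_pushforward.
Qed.

Section density.
Import HBNNSimple.
Context d (T : measurableType d) (R : realType).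
Variables (mu nu : {measure set T -> \bar R}) (g : T -> R).
Hypotheses (mg : measurable_fun setT g) (g0 : forall x, 0 <= g x).
Hypothesis nuE :
  forall A, measurable A -> (nu A = \int[mu]_(x in A) (g x)%:E)%E.

Let dens_indic A : measurable A ->
  (\int[nu]_x (\1_A x)%:E = \int[mu]_x ((\1_A x)%:E * (g x)%:E))%E.
Proof.
move=> mA; rewrite integral_indic//= setIT nuE// [LHS]integral_mkcond/=.
apply: eq_integral => x _; rewrite patchE indicE.
by case: ifPn => _; rewrite ?mul1e ?mul0e.
Qed.

Let dens_nnsfun (f : {nnsfun T >-> R}) :
  (\int[nu]_x (f x)%:E = \int[mu]_x ((f x)%:E * (g x)%:E))%E.
Proof.
under [LHS]eq_integral do rewrite fimfunE -fsumEFin//.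
rewrite [LHS]ge0_integral_fsum//; last 2 first.
  - by move=> r; exact/measurable_EFinP/measurableT_comp.
  - by move=> n x _; rewrite EFinM nnfun_muleindic_ge0.
have gE x : ((f x)%:E * (g x)%:E = \sum_(r \in range f)
    (r * \1_(f @^-1` [set r]) x)%:E * (g x)%:E)%E.
  rewrite fimfunE -fsumEFin// ge0_mule_fsuml//.
  by move=> r; rewrite EFinM nnfun_muleindic_ge0.
under [RHS]eq_integral do rewrite gE.
rewrite [RHS]ge0_integral_fsum//; last 2 first.
  - move=> r; apply: emeasurable_funM; last exact/measurable_EFinP.
    by apply/measurable_EFinP; do 2 apply/measurableT_comp => //.
  - move=> n x _; rewrite mule_ge0// ?lee_fin//.
    by have := nnfun_muleindic_ge0 f n x; rewrite -EFinM lee_fin.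
apply: eq_fsbigr => r; rewrite inE => -[t _ rE].
have r0 : 0 <= r by rewrite -rE.
under [LHS]eq_integral do rewrite EFinM.
under [RHS]eq_integral do rewrite EFinM -muleA.
have mI : measurable_fun setT (\1_(f @^-1` [set r]) : T -> R).
  exact: measurable_indic.
rewrite !ge0_integralZl ?lee_fin//; first by rewrite dens_indic.
- by apply: emeasurable_funM; exact/measurable_EFinP.
- by move=> x _; rewrite mule_ge0 ?lee_fin.
- exact/measurable_EFinP.
Qed.

(** Integration against a measure with density, from simple functions by
    monotone convergence. *)
Lemma ge0_integral_density (f : T -> \bar R) :
  measurable_fun setT f -> (forall x, 0 <= f x)%E ->
  (\int[nu]_x f x = \int[mu]_x (f x * (g x)%:E))%E.
Proof.
move=> mf f0.
pose f_ := nnsfun_approx measurableT mf.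
have cf x : (f_ n x)%:E @[n --> \oo] --> f x by exact: cvg_nnsfun_approx.
transitivity (lim (\int[nu]_x (f_ n x)%:E @[n --> \oo])%E).
  rewrite -monotone_convergence//=.
  - by apply: eq_integral => x _; apply/esym/cvg_lim.
  - by move=> n; exact/measurable_EFinP/measurable_funTS.
  - by move=> n ? _; rewrite lee_fin.
  - by move=> ? _ ? ? mn; rewrite lee_fin; exact/lefP/nd_nnsfun_approx.
transitivity (lim (\int[mu]_x ((f_ n x)%:E * (g x)%:E) @[n --> \oo])%E).
  by apply: congr_lim; apply/funext => n; exact: dens_nnsfun.
rewrite -monotone_convergence//=.
- apply: eq_integral => x _; apply/cvg_lim => //.
  by apply: cvgeZr => //; exact: cf.
- move=> n; apply: emeasurable_funM; last exact/measurable_EFinP.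
  exact/measurable_EFinP/measurable_funTS.
- by move=> n ? _; rewrite mule_ge0 ?lee_fin.
- move=> x _ m n mn; rewrite lee_wpmul2r ?lee_fin//.
  exact/lefP/nd_nnsfun_approx.
Qed.

End density.

Section gaussian.
Variable R : realType.
Notation leb := (@lebesgue_measure R).

Lemma ge0_integral_normal (m s : R) (f : R -> \bar R) :
  measurable_fun [set: R] f -> (forall x, 0 <= f x)%E ->
  (\int[normal_prob m s]_x f x = \int[leb]_x (f x * (normal_pdf m s x)%:E))%E.
Proof.
move=> mf f0; apply: ge0_integral_density => //.
- exact: measurable_normal_pdf.
- by move=> x; exact: normal_pdf_ge0.
Qed.

Lemma normal_pdf_scale (m s x : R) : 0 < s ->
  s * normal_pdf m s (s * x + m) = normal_pdf 0 1 x.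
Proof.
move=> s0; rewrite !normal_pdfE ?gt_eqF ?oner_eq0// /normal_fun /normal_peak.
have -> : Num.sqrt (s ^+ 2 * pi *+ 2) = s * Num.sqrt (1 ^+ 2 * pi *+ 2).
  by rewrite expr1n mul1r -mulrnAr sqrtrM ?sqr_ge0// sqrtr_sqr gtr0_norm.
have -> : - (s * x + m - m) ^+ 2 / (s ^+ 2 *+ 2) =
          - (x - 0) ^+ 2 / (1 ^+ 2 *+ 2) :> R.
  by field; rewrite gt_eqF /=.
move: (Num.sqrt _) (expR _) => u v.
by rewrite invfM mulrA (mulrA s) mulfV ?gt_eqF// mul1r.
Qed.

(** Every normal law is an affine image of the standard one, so that all later
    Gaussian computations take place under the standard law. *)
Lemma ge0_integral_normal_affine (m s : R) (f : R -> \bar R) : 0 < s ->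
  measurable_fun [set: R] f -> (forall x, 0 <= f x)%E ->
  (\int[normal_prob m s]_y f y = \int[normal_prob 0 1]_x f (s * x + m)%R)%E.
Proof.
move=> s0 mf f0.
have ma : measurable_fun [set: R] (fun x : R => s * x + m).
  by apply: measurable_funD => //; exact: measurable_funM.
have mfa : measurable_fun [set: R] (fun x => f (s * x + m)%R).
  exact: (measurableT_comp mf).
rewrite (ge0_integral_normal _ _ mf f0).
rewrite (ge0_integral_normal _ _ mfa (fun x => f0 _)).
rewrite (@ge0_lebesgue_affine R s m _ s0).
- rewrite -ge0_integralZl ?lee_fin ?(ltW s0)//.
  + apply: eq_integral => x _.
    by rewrite muleCA -EFinM normal_pdf_scale.
  + apply: emeasurable_funM; first exact: (measurableT_comp mf).
    apply/measurable_EFinP.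
    by apply: (measurableT_comp _ ma); exact: measurable_normal_pdf.
  + by move=> x _; rewrite mule_ge0// lee_fin normal_pdf_ge0.
- apply: emeasurable_funM => //; apply/measurable_EFinP.
  exact: measurable_normal_pdf.
- by move=> x; rewrite mule_ge0// lee_fin normal_pdf_ge0.
Qed.

End gaussian.

Local Opaque normal_pdf normal_prob lebesgue_measure integral.

Section gaussian_moments.
Variable R : realType.
Notation leb := (@lebesgue_measure R).
Notation gam := (@normal_prob R 0 1).

Lemma ge0_lebesgue_opp (f : R -> \bar R) :
  measurable_fun setT f -> (forall x, (0 <= f x)%E) ->
  (\int[leb]_y f y = \int[leb]_x f (- x)%R)%E.
Proof.
move=> mf f0.
pose phi := fun x : measurableTypeR R => (- x)%R : measurableTypeR R.
have mphi : measurable_fun setT phi by exact: oppr_measurable.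
pose nu : {measure set (measurableTypeR R) -> \bar R} := pushforward leb phi.
have E A : measurable A -> lebesgue_measure A = nu mphi A.
  apply: lebesgue_measure_unique => _ [[u v] _ <-] /=.
  have pE : phi @^-1` `]u, v]%classic = `[- v, - u[%classic.
    by apply/seteqP; split => x /=; rewrite !in_itv/= ltrNr lerNl andbC.
  have -> : nu mphi `]u, v]%classic = leb (phi @^-1` `]u, v]%classic) by [].
  rewrite pE !lebesgue_measure_itv/= !lte_fin ltrN2.
  by case: ifPn => // _; rewrite -!EFinD opprK addrC.
rewrite (@eq_measure_integral _ _ _ _ (nu mphi)); last by move=> A mA _; exact: E.
by rewrite ge0_integral_pushforward.
Qed.

Lemma normal_peakE (s : R) : 0 < s -> normal_peak s = (s * Num.sqrt (pi *+ 2))^-1.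
Proof.
move=> s0; rewrite /normal_peak -mulrnAr sqrtrM ?sqr_ge0// sqrtr_sqr.
by rewrite gtr0_norm.
Qed.

Let sp : 0 < Num.sqrt (pi *+ 2) :> R.
Proof. by rewrite sqrtr_gt0 pmulrn_lgt0// pi_gt0. Qed.

Lemma ge0_integral_normal_opp (f : R -> \bar R) :
  measurable_fun [set: R] f -> (forall x, 0 <= f x)%E ->
  (\int[gam]_x f (- x)%R = \int[gam]_x f x)%E.
Proof.
move=> mf f0.
have mN : measurable_fun [set: R] (fun x => f (- x)%R).
  by apply: (measurableT_comp mf); exact: oppr_measurable.
rewrite (ge0_integral_normal _ _ mN (fun x => f0 _)).
rewrite (ge0_integral_normal _ _ mf f0) [RHS]ge0_lebesgue_opp.
- apply: eq_integral => x _; congr (_ * _%:E)%E.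
  by rewrite !normal_pdfE ?oner_eq0// /normal_fun !subr0 sqrrN.
- apply: emeasurable_funM => //; apply/measurable_EFinP.
  exact: measurable_normal_pdf.
- by move=> x; rewrite mule_ge0// lee_fin normal_pdf_ge0.
Qed.

(** Completing the square in the exponent of the joint density of x and a x + b
    y. Integrating out x leaves the density of variance a^2 + b^2. *)
Lemma normal_pdf_square (a b x y : R) : 0 < a -> 0 < b ->
  let c := Num.sqrt (a ^+ 2 + b ^+ 2) in
  normal_pdf (a * x) b y * normal_pdf 0 1 x =
  normal_pdf 0 c y * normal_pdf (a * y / c ^+ 2) (b / c) x.
Proof.
move=> a0 b0 c.
have c2 : c ^+ 2 = a ^+ 2 + b ^+ 2 by rewrite sqr_sqrtr// addr_ge0 ?sqr_ge0.
have c0 : 0 < c by rewrite sqrtr_gt0 addr_gt0// exprn_gt0.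
have bc0 : 0 < b / c by rewrite divr_gt0.
rewrite !normal_pdfE ?gt_eqF// ?oner_eq0// !normal_peakE// /normal_fun.
rewrite mulrACA [RHS]mulrACA -!expRD; congr (_ * expR _).
  by field; rewrite !gt_eqF.
rewrite !subr0 !expr_div_n expr1n.
have -> : b ^+ 2 = c ^+ 2 - a ^+ 2 by rewrite c2; ring.
have h : c ^+ 2 - a ^+ 2 != 0 by rewrite c2 addrC addKr gt_eqF ?exprn_gt0.
field.
by rewrite gt_eqF// c2 addrC addKr gt_eqF ?exprn_gt0.
Qed.

Lemma ge0_integral_normal_conv_pos (a b : R) (h : R -> \bar R) :
  0 < a -> 0 < b ->
  measurable_fun [set: R] h -> (forall x, 0 <= h x)%E ->
  (\int[gam]_x \int[gam]_y h (a * x + b * y)%R =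
   \int[gam]_z h (Num.sqrt (a ^+ 2 + b ^+ 2) * z)%R)%E.
Proof.
move=> a0 b0 mh h0; set c := Num.sqrt _.
have c0 : 0 < c by rewrite sqrtr_gt0 addr_gt0// exprn_gt0.
have mlin (u v : R) : measurable_fun [set: R] (fun x : R => u * x + v).
  by apply: measurable_funD => //; exact: measurable_funM.
pose F (z : R * R) : \bar R :=
  (h z.2 * (normal_pdf (a * z.1) b z.2 * normal_pdf 0 1 z.1)%:E)%E.
have mF : measurable_fun setT F.
  apply: emeasurable_funM; first exact: (measurableT_comp mh).
  apply/measurable_EFinP; apply: measurable_funM; last first.
    by apply: (measurableT_comp _ measurable_fst); exact: measurable_normal_pdf.
  Local Transparent normal_pdf.
  rewrite /normal_pdf gt_eqF//; apply: measurable_funM => //.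
  Local Opaque normal_pdf.
  apply: measurableT_comp => //; apply: measurable_funM => //.
  apply: measurableT_comp => /=; first exact: oppr_measurable.
  apply: measurable_funX; apply: measurable_funB => //.
  by apply: measurable_funM.
have F0 z : (0 <= F z)%E.
  by rewrite mule_ge0// lee_fin mulr_ge0// normal_pdf_ge0.
have E1 x : (\int[gam]_y h (a * x + b * y)%R =
  \int[leb]_y (h y * (normal_pdf (a * x) b y)%:E))%E.
  rewrite -(ge0_integral_normal _ _ mh h0) (ge0_integral_normal_affine _ b0 mh h0).
  by apply: eq_integral => y _; rewrite addrC.
under eq_integral do rewrite E1.
rewrite [LHS]ge0_integral_normal; last 2 first.
- under eq_fun do rewrite -E1.
  pose H (z : R * R) := h (a * z.1 + b * z.2).
  have mH : measurable_fun setT H.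
    apply: (measurableT_comp mh).
    by apply: measurable_funD; apply: measurable_funM.
  exact: (@measurable_fun_fubini_tonelli_F _ _ _ _ _ gam _ mH (fun z => h0 _)).
- move=> x; apply: integral_ge0 => y _.
  by rewrite mule_ge0// lee_fin normal_pdf_ge0.
transitivity (\int[leb]_x \int[leb]_y F (x, y))%E.
  apply: eq_integral => x _; rewrite -ge0_integralZr ?lee_fin ?normal_pdf_ge0//.
  - by apply: eq_integral => y _; rewrite /F/= EFinM muleA.
  - apply: emeasurable_funM => //; apply/measurable_EFinP.
    exact: measurable_normal_pdf.
  - by move=> y _; rewrite mule_ge0// lee_fin normal_pdf_ge0.
(* The order of integration is exchanged, so that the factorized density is
   integrated in x first. *)
rewrite (@fubini_tonelli _ _ _ _ _ leb leb F mF F0).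
transitivity (\int[normal_prob 0 c]_z h z)%E; last first.
  rewrite (ge0_integral_normal_affine _ c0 mh h0).
  by apply: eq_integral => z _; rewrite addr0.
rewrite (ge0_integral_normal _ _ mh h0).
apply: eq_integral => y _.
transitivity (\int[leb]_x ((h y * (normal_pdf 0 c y)%:E) *
   (normal_pdf (a * y / c ^+ 2) (b / c) x)%:E))%E.
  apply: eq_integral => x _.
  by rewrite /F/= normal_pdf_square// EFinM muleA.
rewrite ge0_integralZl//.
- by rewrite integral_normal_pdf mule1.
- by apply/measurable_EFinP; exact: measurable_normal_pdf.
- by move=> x _; rewrite lee_fin normal_pdf_ge0.
- by rewrite mule_ge0// lee_fin normal_pdf_ge0.
Qed.

(** Stability of the standard normal law: a x + b y has the law of c z with c^2
    = a^2 + b^2. The signs of a and b are absorbed by the symmetry of the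
    density, and when one of them vanishes the statement is trivial. *)
Lemma ge0_integral_normal_conv (a b : R) (h : R -> \bar R) :
  measurable_fun [set: R] h -> (forall x, 0 <= h x)%E ->
  (\int[gam]_x \int[gam]_y h (a * x + b * y)%R =
   \int[gam]_z h (Num.sqrt (a ^+ 2 + b ^+ 2) * z)%R)%E.
Proof.
move=> mh h0.
have mlin (u v : R) : measurable_fun [set: R] (fun x : R => u * x + v).
  by apply: measurable_funD => //; exact: measurable_funM.
have mhl (u v : R) : measurable_fun [set: R] (fun x : R => h (u * x + v)).
  exact: (measurableT_comp mh).
have mhl0 (u : R) : measurable_fun [set: R] (fun x : R => h (u * x)).
  by have := mhl u 0; under eq_fun do rewrite addr0.
have absb u v : (\int[gam]_y h (v + u * y)%R = \int[gam]_y h (v + `|u| * y)%R)%E.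
  have [u0|u0] := leP 0 u; first by rewrite (ger0_norm u0).
  rewrite (ltr0_norm u0) -[RHS](@ge0_integral_normal_opp (fun y => h (v + - u * y)%R))//.
    by apply: eq_integral => y _; rewrite mulrNN.
  by under eq_fun do rewrite addrC; exact: mhl.
have abs0 u : (\int[gam]_y h (u * y)%R = \int[gam]_y h (`|u| * y)%R)%E.
  have := absb u 0; under eq_integral do rewrite add0r.
  by under [in X in _ = X -> _]eq_integral do rewrite add0r.
have cint (r : \bar R) : (\int[gam]_x (cst r x) = r)%E.
  rewrite integral_cst; last exact: measurableT.
  by have := @probability_setT _ _ _ gam => /= ->; rewrite mule1.
have [->|a0] := eqVneq a 0.
  rewrite expr0n/= add0r sqrtr_sqr -abs0.
  transitivity (\int[gam]_x (cst (\int[gam]_y h (b * y)%R) x))%E.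
    by apply: eq_integral => x _; apply: eq_integral => y _; rewrite mul0r add0r.
  exact: cint.
have [->|b0] := eqVneq b 0.
  rewrite expr0n/= addr0 sqrtr_sqr -abs0.
  apply: eq_integral => x _; rewrite -[RHS]cint.
  by apply: eq_integral => y _; rewrite mul0r addr0.
rewrite -(real_normK (num_real a)) -(real_normK (num_real b)).
rewrite -ge0_integral_normal_conv_pos ?normr_gt0; [|by []..].
under eq_integral do rewrite absb.
have [u0|u0] := leP 0 a; first by rewrite (ger0_norm u0).
rewrite (ltr0_norm u0).
rewrite -[RHS](@ge0_integral_normal_opp
  (fun x => \int[gam]_y h (- a * x + `|b| * y)%R)%E).
- by apply: eq_integral => y _; rewrite mulrNN.
- pose H (z : R * R) := h (- a * z.1 + `|b| * z.2).
  have mH : measurable_fun setT H.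
    apply: (measurableT_comp mh).
    by apply: measurable_funD; apply: measurable_funM.
  exact: (@measurable_fun_fubini_tonelli_F _ _ _ _ _ gam _ mH (fun z => h0 _)).
- by move=> x; exact: integral_ge0.
Qed.

End gaussian_moments.

(** * Laws on the line and Lipschitz functions *)

Definition std_normal (R : realType) : probability (measurableTypeR R) R :=
  @normal_prob R 0 1.

Definition lipschitz_by (R : realType) (L : R) (h : R -> R) : Prop :=
  forall x y, `|h x - h y| <= L * `|x - y|.

Section measure_by_lipschitz.
Variable R : realType.

Lemma lipschitz_by_measurable (L : R) (h : R -> R) :
  lipschitz_by L h -> measurable_fun [set: R] h.
Proof.
move=> hL; apply: continuous_measurable_fun => x.
apply/cvgrPdist_lt => e e0.
have d0 : 0 < e / (`|L| + 1) by rewrite divr_gt0// ltr_wpDl.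
apply/nbhs_ballP; exists (e / (`|L| + 1)) => //= y xy.
apply: (le_lt_trans (hL _ _)).
move: xy; rewrite /ball/= ltr_pdivlMr ?ltr_wpDl// mulrC; apply: le_lt_trans.
by rewrite ler_wpM2r// (le_trans (ler_norm _))// lerDl.
Qed.

End measure_by_lipschitz.

(** Rays are stable by intersection and generate the Borel sets. *)
Lemma measure_eq_rays (R : realType)
    (mu nu : {measure set (measurableTypeR R) -> \bar R}) :
  (forall x, mu `]-oo, x[%classic < +oo)%E ->
  (forall x, mu `]-oo, x[%classic = nu `]-oo, x[%classic) ->
  forall A, measurable A -> mu A = nu A.
Proof.
move=> mufin H A mA.
pose g (k : nat) : set R := `]-oo, k%:R[%classic.
apply: (@measure_unique _ R (measurableTypeR R) (@RGenInftyO.G R) g) => //.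
- exact: RGenInftyO.measurableE.
- move=> _ _ [x ->] [y ->]; exists (Num.min x y).
  by apply/seteqP; split => z /=; rewrite !in_itv/= lt_min => /andP.
- by move=> i; exists i%:R.
- apply/seteqP; split => // x _; exists (Num.truncn `|x|).+1 => //=.
  rewrite /g/= in_itv/=; apply: le_lt_trans (ler_norm x) _.
  exact: truncnS_gt.
- by move=> _ [x ->]; exact: H.
- by move=> k; exact: mufin.
Qed.

(** Continuous tent functions increasing to the indicator of a ray; they
    transfer identities from Lipschitz functions to rays. *)
Definition ray_approx (R : realType) (x : R) (k : nat) (y : R) : R :=
  Num.min 1 (k%:R * Num.max 0 (x - y)).

Section ray_approx.
Variables (R : realType) (x : R).

Lemma ray_approx_lipschitz k : lipschitz_by k%:R (ray_approx x k).
Proof.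
move=> y z; rewrite /ray_approx.
apply: le_trans (_ : `|k%:R * Num.max 0 (x - y) - k%:R * Num.max 0 (x - z)| <= _).
  move: (_ * _) (_ * _) => u v; rewrite /Num.min.
  have h1 := ler_norm (u - v); have := ler_norm (v - u).
  rewrite distrC ler_norml => h2.
  by case: (ltP 1 u) => ?; case: (ltP 1 v) => ?; apply/andP; split; lra.
rewrite -mulrBr normrM ger0_norm ?ler0n// ler_wpM2l ?ler0n//.
have h1 := ler_norm (y - z); have := ler_norm (z - y).
rewrite distrC ler_norml /Num.max => h2.
by case: ltP => ?; case: ltP => ?; apply/andP; split; lra.
Qed.

Lemma ray_approx01 k y : 0 <= ray_approx x k y <= 1.
Proof.
rewrite /ray_approx le_min ler01 ge_min lexx/= mulr_ge0//.
by rewrite le_max lexx.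
Qed.

Lemma ray_approx_nd y m n : (m <= n)%N ->
  ((ray_approx x m y)%:E <= (ray_approx x n y)%:E)%E.
Proof.
move=> mn; rewrite lee_fin /ray_approx le_min ge_min lexx/= ge_min.
by rewrite ler_wpM2r ?orbT ?ler_nat// le_max lexx.
Qed.

Lemma cvg_ray_approx y : (ray_approx x k y)%:E @[k --> \oo] -->
  (\1_(`]-oo, x[%classic : set R) y)%:E.
Proof.
apply: cvg_EFin; first by near=> k.
rewrite indicE; have [yx|yx] := ltP y x; last first.
  rewrite memNset/=; last by rewrite in_itv/= ltNge yx.
  apply: (@cvg_trans _ ((fun=> 0 : R) @ \oo)); last exact: cvg_cst.
  apply: near_eq_cvg; near=> k; rewrite /= /ray_approx max_l ?subr_le0// mulr0.
  by rewrite min_r.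
rewrite mem_set/=; last by rewrite in_itv.
apply: (@cvg_trans _ ((fun=> 1 : R) @ \oo)); last exact: cvg_cst.
apply: near_eq_cvg; near=> k; rewrite /= /ray_approx max_r ?subr_ge0 ?ltW//.
rewrite min_l// -ler_pdivrMr ?subr_gt0//.
near: k; exact: nbhs_infty_ger.
Unshelve. all: by end_near. Qed.

Lemma ray_approx_measurable k : measurable_fun [set: R] (ray_approx x k).
Proof. exact: lipschitz_by_measurable (ray_approx_lipschitz k). Qed.

End ray_approx.

(** Indicators of rays are increasing limits of Lipschitz functions, so
    Lipschitz integrals determine a measure on the line. *)
Lemma measure_eq_lipschitz (R : realType) (mu nu : {measure set (measurableTypeR R) -> \bar R}) :
  (forall x, mu `]-oo, x[%classic < +oo)%E ->
  (forall (L : R) (h : R -> R), lipschitz_by L h -> (forall x, 0 <= h x <= 1) ->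
    (\int[mu]_x (h x)%:E = \int[nu]_x (h x)%:E)%E) ->
  forall A, measurable A -> mu A = nu A.
Proof.
move=> mufin H; apply: measure_eq_rays => // x.
have key (m : {measure set (measurableTypeR R) -> \bar R}) :
    (\int[m]_y (ray_approx x k y)%:E)%E @[k --> \oo] --> m `]-oo, x[%classic.
  have -> : m `]-oo, x[%classic = (\int[m]_y (\1_(`]-oo, x[%classic : set R) y)%:E)%E.
    by rewrite integral_indic// setIT.
  rewrite (_ : (\int[m]_y _)%E =
    (\int[m]_y (limn (fun k => (ray_approx x k y)%:E)))%E); last first.
    by apply: eq_integral => y _; apply/esym/cvg_lim => //; exact: cvg_ray_approx.
  apply: cvg_monotone_convergence => //.
  - by move=> k; apply/measurable_EFinP; exact: ray_approx_measurable.
  - by move=> k y _; rewrite lee_fin; case/andP: (ray_approx01 x k y).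
  - by move=> y _ p q; exact: ray_approx_nd.
have E k : (\int[mu]_y (ray_approx x k y)%:E = \int[nu]_y (ray_approx x k y)%:E)%E.
  exact: H (ray_approx_lipschitz x k) (ray_approx01 x k).
have Emu := cvg_lim (@ereal_hausdorff R) (key mu).
have Enu := cvg_lim (@ereal_hausdorff R) (key nu).
rewrite -Emu -Enu; congr (lim (_ @ \oo)); exact/funext.
Qed.

(** * Moments and limits of Gaussian laws *)

Local Opaque std_normal.

Section bounded_integrals.
Context d (T : measurableType d) (R : realType) (P : probability T R).

Lemma integrable_bounded_prob (f : T -> R) (M : R) :
  measurable_fun setT f -> (forall x, `|f x| <= M) ->
  P.-integrable setT (EFin \o f).
Proof.
move=> mf fM; apply: (@le_integrable _ _ _ P setT measurableT _ (cst M%:E)).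
- exact/measurable_EFinP.
- move=> x _ /=; rewrite lee_fin.
  exact: le_trans (fM x) (ler_norm M).
- exact: finite_measure_integrable_cst.
Qed.

Lemma Rintegral_cvg_bounded (f_ : nat -> T -> R) (f : T -> R) (M : R) :
  (forall n, measurable_fun setT (f_ n)) -> (forall n x, `|f_ n x| <= M) ->
  (forall x, f_ ^~ x @ \oo --> f x) ->
  (fun n => \int[P]_x f_ n x) @ \oo --> \int[P]_x f x.
Proof.
move=> mf fM ff; have mlim : measurable_fun setT f.
  by apply: (@measurable_fun_cvg _ _ _ setT f_) => // x _; exact: ff.
have [|||||fi _ fc] := @dominated_convergence _ T R P setT measurableT
  (fun n x => (f_ n x)%:E) (fun x => (f x)%:E) (cst M%:E).
- by move=> n; exact/measurable_EFinP.
- exact/measurable_EFinP.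
- by apply: aeW => x _; apply: cvg_EFin; [exact: nearW|exact: ff].
- exact: finite_measure_integrable_cst.
- by apply: aeW => x n _ /=; rewrite lee_fin.
by move: fc; rewrite -(fineK (integrable_fin_num measurableT fi)) => /fine_cvg.
Qed.

End bounded_integrals.

Section gaussian_second_moment.
Variable R : realType.
Notation leb := (@lebesgue_measure R).
Notation gam := (std_normal R).

Let mE (c : R) : measurable_fun [set: R] (fun x : R => expR (c * x ^+ 2)).
Proof.
apply: measurableT_comp => //; apply: measurable_funM => //.
Qed.

(** The Gaussian weight times a Gaussian function is again, up to the factor
    1/t, a normal density, here of standard deviation 1/t. *)
Lemma integral_std_normal_expR (t : R) : 0 < t ->
  (\int[gam]_x (expR (- ((t ^+ 2 - 1) / 2) * x ^+ 2))%:E = (t^-1)%:E)%E.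
Proof.
move=> t0; rewrite ge0_integral_normal; last 2 first.
- by apply/measurable_EFinP; exact: mE.
- by move=> x; rewrite lee_fin expR_ge0.
have ti0 : 0 < t^-1 by rewrite invr_gt0.
transitivity (\int[leb]_x ((t^-1)%:E * (normal_pdf 0 t^-1 x)%:E))%E.
  apply: eq_integral => x _; rewrite -!EFinM; congr EFin.
  rewrite !normal_pdfE ?gt_eqF ?oner_eq0// !normal_peakE// /normal_fun.
  rewrite mulrCA -expRD [RHS]mulrA; congr (_ * expR _).
    have sp : 0 < Num.sqrt (pi *+ 2) :> R by rewrite sqrtr_gt0 pmulrn_lgt0// pi_gt0.
    by field; rewrite !gt_eqF.
  by field; rewrite gt_eqF.
rewrite ge0_integralZl ?lee_fin ?(ltW ti0)//.
- by rewrite integral_normal_pdf mule1.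
- by apply/measurable_EFinP; exact: measurable_normal_pdf.
- by move=> x _; rewrite lee_fin normal_pdf_ge0.
Qed.

(** The Laplace transform of x^2 is differentiated at 0 by hand: with h small, 1
    - exp(- h x^2) lies between h x^2 / (1 + h x^2) and h x^2, and its integral
    is known exactly from the previous lemma. *)
Lemma std_normal_moment2 : (\int[gam]_x (x ^+ 2)%:E = 1)%E.
Proof.
have compl (e : R) : 0 < e -> (\int[gam]_x
   (1 - expR (- (((1 + e) ^+ 2 - 1) / 2) * x ^+ 2))%:E = (1 - (1 + e)^-1)%:E)%E.
  move=> e0; have t0 : 0 < 1 + e by rewrite addr_gt0.
  set c := - _.
  have cx x : 0 <= 1 - expR (c * x ^+ 2).
    rewrite subr_ge0 -expR0 ler_expR mulr_le0_ge0 ?sqr_ge0// /c.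
    have : 0 < e ^+ 2 by rewrite exprn_gt0.
    by nra.
  have : (\int[gam]_x ((1 - expR (c * x ^+ 2))%:E + (expR (c * x ^+ 2))%:E) = 1)%E.
    under eq_integral do rewrite -EFinD subrK.
    rewrite integral_cst; last exact: measurableT.
    by rewrite [X in (_ * X)%E = _](@probability_setT _ _ _ gam) mule1.
  have m1 : measurable_fun [set: R] (fun x => (1 - expR (c * x ^+ 2))%:E).
    apply/measurable_EFinP; apply: measurable_funB => //; exact: mE.
  have m2 : measurable_fun [set: R] (fun x => (expR (c * x ^+ 2))%:E).
    apply/measurable_EFinP; exact: mE.
  rewrite (@ge0_integralD _ _ _ gam setT measurableT
    (fun x => (1 - expR (c * x ^+ 2))%:E) (fun x => (expR (c * x ^+ 2))%:E))//;
    last by move=> x _; rewrite lee_fin.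
  rewrite integral_std_normal_expR//.
  move=> /(congr1 (fun z => z - ((1 + e)^-1)%:E)%E).
  by rewrite addeK// -EFinB.
(* Lower bound, from 1 - exp (- y) <= y. *)
have low (e : R) : 0 < e -> ((1 - 2 * e)%:E <= \int[gam]_x (x ^+ 2)%:E)%E.
  move=> e0; set h := ((1 + e) ^+ 2 - 1) / 2.
  have h0 : 0 < h by rewrite /h; nra.
  have : ((1 - (1 + e)^-1)%:E <= h%:E * \int[gam]_x (x ^+ 2)%:E)%E.
    rewrite -compl// -/h -ge0_integralZl//; last 3 first.
    - exact/measurable_EFinP.
    - by move=> x _; rewrite lee_fin sqr_ge0.
    - by rewrite lee_fin ltW.
    apply: ge0_le_integral => //.
    - move=> x _; rewrite lee_fin subr_ge0 -expR0 ler_expR mulNr oppr_le0.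
      by rewrite mulr_ge0 ?sqr_ge0// ltW.
    - apply/measurable_EFinP; apply: measurable_funB => //; exact: mE.
    - by apply/measurable_EFinP; exact: measurable_funM.
    - move=> x _; rewrite -EFinM lee_fin.
      by have := expR_ge1Dx (- h * x ^+ 2); lra.
  case: (\int[gam]_x _)%E => [r| |]; last 2 first.
  - by rewrite leey.
  - by rewrite mulrNy gtr0_sg// mul1e leeNy_eq.
  rewrite -EFinM !lee_fin => hr.
  have : 1 - (1 + e)^-1 = e / (1 + e) by field; rewrite gt_eqF// addr_gt0.
  move=> E; move: hr; rewrite E ler_pdivrMr ?addr_gt0// /h => hr.
  have A0 : 0 < (2 + e) * (1 + e) / 2 by rewrite !mulr_gt0 ?addr_gt0 ?invr_gt0.
  have k : 1 <= (2 + e) * (1 + e) / 2 * r.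
    by rewrite -(ler_pM2l e0); move: hr; lra.
  rewrite leNgt -(ltr_pM2l A0); apply/negP => r1.
  have e2 : 0 < e ^+ 2 by rewrite exprn_gt0.
  have e3 : 0 < e ^+ 3 by rewrite exprn_gt0.
  have : (2 + e) * (1 + e) / 2 * (1 - 2 * e) = 1 - (e + 5 * e ^+ 2 + 2 * e ^+ 3) / 2.
    by field.
  lra.
(* Upper bound, from y / (1 + y) <= 1 - exp (- y) and Fatou as h tends to 0. *)
have up : (\int[gam]_x (x ^+ 2)%:E <= 1)%E.
  pose e (n : nat) : R := n.+1%:R^-1.
  have e0 n : 0 < e n by rewrite invr_gt0.
  pose h n : R := ((1 + e n) ^+ 2 - 1) / 2.
  have h0 n : 0 < h n by rewrite /h; have := e0 n; nra.
  pose f n (x : R) : R := x ^+ 2 / (1 + h n * x ^+ 2).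
  have d0 n x : 0 < 1 + h n * x ^+ 2.
    by rewrite ltr_wpDr// mulr_ge0 ?sqr_ge0// ltW.
  have f0 n x : 0 <= f n x by rewrite divr_ge0 ?sqr_ge0// ltW.
  have mf n : measurable_fun [set: R] (f n).
    apply: measurable_funM => //; apply: continuous_measurable_fun => x.
    apply: cvgV; first by rewrite gt_eqF.
    apply: cvgD; first exact: cvg_cst.
    by apply: cvgM; [exact: cvg_cst|exact: exprn_continuous].
  have he : h n @[n --> \oo] --> 0.
    have -> : (0 : R) = ((1 + 0) ^+ 2 - 1) / 2 by rewrite addr0 expr1n subrr mul0r.
    apply: cvgMr_tmp; apply: cvgB; last exact: cvg_cst.
    have c1 : (1 + e n) @[n --> \oo] --> (1 + 0 : R).
      by apply: cvgD; [exact: cvg_cst|exact: cvg_harmonic].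
    by rewrite expr2; under eq_fun do rewrite expr2; exact: cvgM.
  have fcv x : (f n x)%:E @[n --> \oo] --> (x ^+ 2)%:E.
    apply: cvg_EFin; first by near=> n.
    rewrite -[X in _ --> X]divr1 /=; apply: cvgMl_tmp.
    apply: cvgV; first exact: oner_neq0.
    have -> : (1 : R) = 1 + 0 * x ^+ 2 by rewrite mul0r addr0.
    apply: cvgD; [rewrite mul0r addr0; exact: cvg_cst|exact: cvgMr_tmp].
  have fub n : (\int[gam]_x (f n x)%:E <= 1)%E.
    have : (\int[gam]_x ((h n)%:E * (f n x)%:E) <= (1 - (1 + e n)^-1)%:E)%E.
      rewrite -compl// -/(h n); apply: ge0_le_integral => //.
      - by move=> x _; rewrite mule_ge0 ?lee_fin// ltW.
      - by apply: emeasurable_funM => //; apply/measurable_EFinP; exact: mf.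
      - apply/measurable_EFinP; apply: measurable_funB => //; exact: mE.
      - move=> x _; rewrite -EFinM lee_fin /f.
        set y := h n * x ^+ 2.
        have y0 : 0 < 1 + y by exact: d0.
        have -> : h n * (x ^+ 2 / (1 + y)) = 1 - (1 + y)^-1.
          by rewrite mulrA -/y; field; rewrite gt_eqF.
        rewrite lerD2l lerN2 mulNr expRN lef_pV2 ?posrE ?expR_gt0//.
        exact: expR_ge1Dx.
    rewrite ge0_integralZl ?lee_fin//; last 3 first.
    - by apply/measurable_EFinP; exact: mf.
    - by move=> x _; rewrite lee_fin.
    - exact: ltW.
    case: (\int[gam]_x _)%E => [r| |].
    - rewrite -EFinM !lee_fin.
      have e1 := e0 n.
      have -> : 1 - (1 + e n)^-1 = e n / (1 + e n).
        by field; rewrite gt_eqF// addr_gt0.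
      rewrite ler_pdivlMr ?addr_gt0// /h => hr.
      rewrite leNgt; apply/negP => r1.
      have : e n < ((1 + e n) ^+ 2 - 1) / 2 * r * (1 + e n).
        have e2 : 0 < e n ^+ 2 by rewrite exprn_gt0.
        have e3 : 0 < e n ^+ 3 by rewrite exprn_gt0.
        have -> : ((1 + e n) ^+ 2 - 1) / 2 * r * (1 + e n) =
          (e n + (3 * e n ^+ 2 + e n ^+ 3) / 2) * r by field.
        nra.
      lra.
    - by rewrite mulry gtr0_sg// mul1e leye_eq.
    - by rewrite leNye.
  have -> : (\int[gam]_x (x ^+ 2)%:E = \int[gam]_x limn_einf (fun n => (f n x)%:E))%E.
    apply: eq_integral => x _; rewrite is_cvg_limn_einfE; last by apply: cvgP; exact: fcv.
    by apply/esym/cvg_lim => //; exact: fcv.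
  apply: (le_trans (fatou _ _ _ _)) => //.
  - by move=> n; apply/measurable_EFinP; exact: mf.
  - by move=> n x _; rewrite lee_fin.
  rewrite limn_einf_lim; apply: lime_le; first exact: is_cvg_einfs.
  near=> n; apply: ge_ereal_inf; exists (\int[gam]_x (f n x)%:E)%E => //.
  by exists n => /=.
apply/eqP; rewrite eq_le up/=; apply/lee_addgt0Pr => e e0.
have := low (e / 2) (divr_gt0 e0 (ltr0n _ 2)).
rewrite [2 * _]mulrC divfK// => le1.
case: (\int[gam]_x _)%E le1 up => [r| |]//.
by rewrite -EFinD !lee_fin => ? ?; lra.
Unshelve. all: by end_near. Qed.

End gaussian_second_moment.

(** Makes the two cases of [gaussian_law] uniform: for v = 0 the affine map is
    constant and its law is the Dirac mass. *)
Lemma ge0_integral_std_affine (R : realType) (m v : R) (f : R -> \bar R) :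
  0 <= v -> measurable_fun [set: R] f -> (forall x, 0 <= f x)%E ->
  forall nu : {measure set (measurableTypeR R) -> \bar R},
  (forall A, measurable A -> nu A = gaussian_law m v A) ->
  (\int[nu]_y f y = \int[std_normal R]_x f (Num.sqrt v * x + m)%R)%E.
Proof.
move=> v0 mf f0 nu nuE; have [v_eq0|vn0] := eqVneq v 0.
  transitivity (\int[@dirac _ (measurableTypeR R) m R]_y f y)%E.
    apply: eq_measure_integral => A mA _.
    by rewrite nuE// /gaussian_law v_eq0 eqxx.
  rewrite integral_dirac; [|exact: measurableT|exact: mf].
  rewrite diracE in_setT mul1e v_eq0 sqrtr0.
  transitivity (\int[std_normal R]_x (cst (f m) x))%E; last first.
    by apply: eq_integral => x _; rewrite mul0r add0r.
  rewrite integral_cst; last exact: measurableT.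
  by rewrite [X in (_ * X)%E](@probability_setT _ _ _ (std_normal R)) mule1.
have sv : 0 < Num.sqrt v by rewrite sqrtr_gt0 lt0r vn0.
rewrite -(ge0_integral_normal_affine _ sv mf f0).
apply: eq_measure_integral => A mA _.
by rewrite nuE// /gaussian_law (negbTE vn0).
Qed.

Section laws.
Context d (T : measurableType d) (R : realType) (P : probability T R).
Notation gam := (std_normal R).

Lemma ge0_integral_gaussian (X : T -> R) (m v : R) (f : R -> \bar R) :
  0 <= v -> has_gaussian_law P X m v ->
  measurable_fun [set: R] f -> (forall x, 0 <= f x)%E ->
  (\int[P]_w f (X w) = \int[gam]_x f (Num.sqrt v * x + m)%R)%E.
Proof.
move=> v0 [mX lX] mf f0.
have mX' : measurable_fun setT (X : T -> measurableTypeR R) by [].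
pose nu : {measure set (measurableTypeR R) -> \bar R} :=
  pushforward P (X : T -> measurableTypeR R).
rewrite -(@ge0_integral_std_affine _ m v f v0 mf f0 (nu mX')).
  by rewrite ge0_integral_pushforward.
by move=> A mA; exact: lX.
Qed.

Lemma integral_gaussian (X : T -> R) (m v : R) (f : R -> \bar R) :
  0 <= v -> has_gaussian_law P X m v -> measurable_fun [set: R] f ->
  (\int[P]_w f (X w) = \int[gam]_x f (Num.sqrt v * x + m)%R)%E.
Proof.
move=> v0 lX mf.
rewrite [LHS]integralE [RHS]integralE; congr (_ - _)%E.
- have mp : measurable_fun [set: R] (f^\+)%E by exact: measurable_funepos.
  have := ge0_integral_gaussian v0 lX mp (fun x => funepos_ge0 f x).
  rewrite [LHS](@eq_integral _ _ _ P setT (fun w => ((fun y => f (X y))^\+ w)%E)); last first.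
    by move=> x _; rewrite !funeposE.
  move=> ->; by apply: eq_integral => x _; rewrite !funeposE.
- have mn : measurable_fun [set: R] (f^\-)%E by exact: measurable_funeneg.
  have := ge0_integral_gaussian v0 lX mn (fun x => funeneg_ge0 f x).
  rewrite [LHS](@eq_integral _ _ _ P setT (fun w => ((fun y => f (X y))^\- w)%E)); last first.
    by move=> x _; rewrite !funenegE.
  move=> ->; by apply: eq_integral => x _; rewrite !funenegE.
Qed.

Lemma Rintegral_gaussian (X : T -> R) (m v : R) (f : R -> R) :
  0 <= v -> has_gaussian_law P X m v -> measurable_fun [set: R] f ->
  \int[P]_w f (X w) = \int[gam]_x f (Num.sqrt v * x + m).
Proof.
move=> v0 lX mf; rewrite /Rintegral; congr fine.
apply: (@integral_gaussian X m v (EFin \o f)) => //.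
exact/measurable_EFinP.
Qed.

(** Converse direction: a variable whose Lipschitz integrals agree with those of
    sqrt v times a standard normal one is Gaussian. This is how all Gaussian
    laws below are established. *)
Lemma gaussian_law_lipschitz (X : T -> R) (v : R) : 0 <= v ->
  measurable_fun setT X ->
  (forall (L : R) (h : R -> R), lipschitz_by L h -> (forall x, 0 <= h x <= 1) ->
    (\int[P]_w (h (X w))%:E = \int[gam]_x (h (Num.sqrt v * x))%:E)%E) ->
  has_gaussian_law P X 0 v.
Proof.
move=> v0 mX H; split => // A mA.
have mX' : measurable_fun setT (X : T -> measurableTypeR R) by [].
pose nuX : {measure set (measurableTypeR R) -> \bar R} :=
  pushforward P (X : T -> measurableTypeR R).
have Elaw (nu : {measure set (measurableTypeR R) -> \bar R}) :
    (forall A, measurable A -> nu A = gaussian_law 0 v A) ->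
    nuX mX' A = nu A.
  move=> nuE; apply: (@measure_eq_lipschitz R (nuX mX') nu) => //.
  - move=> x; apply: (le_lt_trans (probability_le1 P _)); last exact: ltry.
    by rewrite -[X in measurable X]setTI; apply: mX.
  - move=> L h hL h01.
    have mh := lipschitz_by_measurable hL.
    have h0 x : (0 <= (h x)%:E)%E by rewrite lee_fin; case/andP: (h01 x).
    have mhE : measurable_fun [set: R] (fun x => (h x)%:E) by exact/measurable_EFinP.
    rewrite ge0_integral_pushforward// (H L)//.
    rewrite (@ge0_integral_std_affine _ 0 v _ v0 mhE h0 nu nuE).
    by apply: eq_integral => x _; rewrite addr0.
rewrite [LHS](_ : _ = nuX mX' A)//.
have [v_eq0|vn0] := eqVneq v 0.
  rewrite (Elaw (@dirac _ (measurableTypeR R) 0 R)) /gaussian_law ?v_eq0 ?eqxx//.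
rewrite (Elaw (normal_prob 0 (Num.sqrt v))) /gaussian_law ?(negbTE vn0)//.
Qed.

End laws.

Section std_moments.
Variable R : realType.
Notation gam := (std_normal R).

Lemma integrable_std_sqr : gam.-integrable setT (fun x : R => (x ^+ 2)%:E).
Proof.
apply/integrableP; split; first exact/measurable_EFinP.
under eq_integral do rewrite gee0_abs ?lee_fin ?sqr_ge0//.
by rewrite std_normal_moment2 ltry.
Qed.

Lemma integrable_std_id : gam.-integrable setT (fun x : R => x%:E).
Proof.
apply: (@le_integrable _ _ _ gam _ measurableT _ (fun x : R => (1 + x ^+ 2)%:E)).
- exact/measurable_EFinP.
- move=> x _; rewrite lee_fin [X in _ <= X]ger0_norm ?addr_ge0 ?sqr_ge0//.
  by rewrite ler_norml; apply/andP; split; nra.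
- under eq_fun do rewrite EFinD; apply: integrableD => //.
  + exact: finite_measure_integrable_cst.
  + exact: integrable_std_sqr.
Qed.

Lemma std_normal_mean0 : (\int[gam]_x (x : R)%:E = 0)%E.
Proof.
have mI : measurable_fun [set: R] (fun x : R => x%:E) by exact/measurable_EFinP.
rewrite integralE.
have -> : (\int[gam]_x (fun x : R => x%:E)^\+ x =
           \int[gam]_x (fun x : R => x%:E)^\- x)%E.
  rewrite -(@ge0_integral_normal_opp _ (fun x : R => x%:E)^\+%E).
  - by apply: eq_integral => x _; rewrite funeposE funenegE EFinN.
  - exact: measurable_funepos.
  - by move=> x; exact: funepos_ge0.
rewrite subee//; apply: integrable_fin_num => //.
exact: (integrable_funeneg measurableT integrable_std_id).
Qed.

(** From |x| <= (1 + x^2) / 2 and the second moment. *)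
Lemma std_normal_abs1 : (\int[gam]_x (`|x : R|)%:E <= 1)%E.
Proof.
apply: (@le_trans _ _ (\int[gam]_x ((2^-1 : R)%:E * (1 + x ^+ 2)%:E))%E).
  apply: ge0_le_integral => //.
  - apply/measurable_EFinP; exact: normr_measurable.
  - apply: emeasurable_funM => //; apply/measurable_EFinP.
    exact: measurable_funD.
  - move=> x _; rewrite -EFinM lee_fin.
    have := sqr_ge0 (x - 1); have := sqr_ge0 (x + 1) => h1 h2.
    by rewrite ler_norml; apply/andP; split; nra.
rewrite ge0_integralZl ?lee_fin//; last 2 first.
- by apply/measurable_EFinP; exact: measurable_funD.
- by move=> x _; rewrite lee_fin addr_ge0 ?sqr_ge0.
under eq_integral do rewrite EFinD.
rewrite ge0_integralD//; last 2 first.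
- by move=> x _; rewrite lee_fin sqr_ge0.
- exact/measurable_EFinP.
rewrite std_normal_moment2 integral_cst; last exact: measurableT.
rewrite [X in (_ * (_ * X + _))%E](@probability_setT _ _ _ gam) mule1.
by rewrite -EFinD -EFinM lee_fin; lra.
Qed.

End std_moments.

Lemma lipschitz_by_continuous (R : realType) (L : R) (h : R -> R) :
  lipschitz_by L h -> continuous h.
Proof.
move=> hL x; apply/cvgrPdist_lt => e e0.
have d0 : 0 < e / (`|L| + 1) by rewrite divr_gt0// ltr_wpDl.
apply/nbhs_ballP; exists (e / (`|L| + 1)) => //= y xy.
apply: (le_lt_trans (hL _ _)).
move: xy; rewrite /ball/= ltr_pdivlMr ?ltr_wpDl// mulrC; apply: le_lt_trans.
by rewrite ler_wpM2r// (le_trans (ler_norm _))// lerDl.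
Qed.

Section law_moments.
Context d (T : measurableType d) (R : realType) (P : probability T R).
Notation gam := (std_normal R).
Variables (X : T -> R) (m v : R).
Hypotheses (v0 : 0 <= v) (lX : has_gaussian_law P X m v).

Let mX : measurable_fun setT X. Proof. by case: lX. Qed.

Lemma gaussian_moment2 : (\int[P]_w (X w ^+ 2)%:E = (m ^+ 2 + v)%:E)%E.
Proof.
have mf : measurable_fun [set: R] (fun x : R => (x ^+ 2)%:E).
  exact/measurable_EFinP.
rewrite (ge0_integral_gaussian v0 lX mf); last by move=> x; rewrite lee_fin sqr_ge0.
have i1 : gam.-integrable setT (fun x : R => (v%:E * (x ^+ 2)%:E)%E).
  by apply: integrableZl => //; exact: integrable_std_sqr.
have i2 : gam.-integrable setT (fun x : R => ((2 * m * Num.sqrt v)%:E * x%:E)%E).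
  by apply: integrableZl => //; exact: integrable_std_id.
have i3 : gam.-integrable setT (fun x : R => ((m ^+ 2)%:E : \bar R)).
  exact: finite_measure_integrable_cst.
transitivity (\int[gam]_x ((v%:E * (x ^+ 2)%:E + (2 * m * Num.sqrt v)%:E * x%:E)
    + (m ^+ 2)%:E))%E.
  apply: eq_integral => x _; rewrite -!EFinM -!EFinD; congr EFin.
  by rewrite sqrrD exprMn sqr_sqrtr//; ring.
rewrite integralD//; last exact: integrableD.
rewrite integralD// !integralZl//; [|exact: integrable_std_id|exact: integrable_std_sqr].
rewrite std_normal_moment2 std_normal_mean0 mule1 mule0 adde0.
rewrite integral_cst; last exact: measurableT.
by rewrite [X in (_ + _ * X)%E](@probability_setT _ _ _ gam) mule1 -EFinD addrC.
Qed.

Lemma gaussian_integrable_sqr : P.-integrable setT (fun w => (X w ^+ 2)%:E).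
Proof.
apply/integrableP; split; first by apply/measurable_EFinP; exact: measurable_funX.
under eq_integral do rewrite gee0_abs ?lee_fin ?sqr_ge0//.
by rewrite gaussian_moment2 ltry.
Qed.

Lemma gaussian_integrable : P.-integrable setT (fun w => (X w)%:E).
Proof.
apply: (@le_integrable _ _ _ P _ measurableT _ (fun w => (1 + X w ^+ 2)%:E)).
- exact/measurable_EFinP.
- move=> x _; rewrite lee_fin [X in _ <= X]ger0_norm ?addr_ge0 ?sqr_ge0//.
  by rewrite ler_norml; apply/andP; split; nra.
- under eq_fun do rewrite EFinD; apply: integrableD => //.
  + exact: finite_measure_integrable_cst.
  + exact: gaussian_integrable_sqr.
Qed.

Lemma gaussian_mean : (\int[P]_w (X w)%:E = m%:E)%E.
Proof.
have mf : measurable_fun [set: R] (fun x : R => x%:E) by exact/measurable_EFinP.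
rewrite (integral_gaussian v0 lX mf).
under eq_integral do rewrite EFinD EFinM.
have i1 : gam.-integrable setT (fun x : R => ((Num.sqrt v)%:E * x%:E)%E).
  by apply: integrableZl => //; exact: integrable_std_id.
have i3 : gam.-integrable setT (fun x : R => (m%:E : \bar R)).
  exact: finite_measure_integrable_cst.
rewrite integralD// integralZl//; last exact: integrable_std_id.
rewrite std_normal_mean0 mule0 add0e.
rewrite integral_cst; last exact: measurableT.
by rewrite [X in (_ * X)%E](@probability_setT _ _ _ gam) mule1.
Qed.

(** First moments are controlled by the standard deviation; this is the bound
    that makes the Fourier remainders uniformly small. *)
Lemma gaussian_abs_le : m = 0 -> (\int[P]_w `|X w|%:E <= (Num.sqrt v)%:E)%E.
Proof.
move=> m0; have mf : measurable_fun [set: R] (fun x : R => `|x|%:E).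
  by apply/measurable_EFinP; exact: normr_measurable.
rewrite (ge0_integral_gaussian v0 lX mf); last by move=> x; rewrite lee_fin.
have mn : measurable_fun [set: measurableTypeR R] (fun x : R => `|x|%:E) by [].
apply: (@le_trans _ _ (\int[gam]_x ((Num.sqrt v)%:E * `|x : R|%:E))%E).
  rewrite le_eqVlt; apply/orP; left; apply/eqP; apply: eq_integral => x _.
  by rewrite m0 addr0 normrM (ger0_norm (sqrtr_ge0 v)) EFinM.
rewrite (ge0_integralZl _ measurableT mn) ?lee_fin ?sqrtr_ge0//; last first.
rewrite -[leRHS]mule1; apply: lee_wpmul2l; first by rewrite lee_fin sqrtr_ge0.
exact: std_normal_abs1.
Qed.

End law_moments.

Section gaussian_limits.
Variable R : realType.
Notation gam := (std_normal R).

Lemma std_normal_lipschitz_cvg (v_ : nat -> R) (v L M : R) (h : R -> R) :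
  v_ @ \oo --> v -> lipschitz_by L h -> (forall x, `|h x| <= M) ->
  (fun n => \int[gam]_x h (Num.sqrt (v_ n) * x)) @ \oo -->
    \int[gam]_x h (Num.sqrt v * x).
Proof.
move=> vv hL hM.
have mh := lipschitz_by_measurable hL.
apply: (@Rintegral_cvg_bounded _ _ R gam (fun n x => h (Num.sqrt (v_ n) * x)) _ M).
- by move=> n; apply: (measurableT_comp mh); exact: measurable_funM.
- by move=> n x; exact: hM.
- move=> x; apply: continuous_cvg; first exact: (lipschitz_by_continuous hL).
  apply: cvgMr_tmp; apply: continuous_cvg => //.
  exact: sqrt_continuous.
Qed.

(** One-dimensional case of the convergence of Gaussian laws; all variables are
    transported to the standard normal law, where the convergence is dominated.
    *)
Lemma gaussian_cvg (disp : nat -> measure_display)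
    (Om : forall n, measurableType (disp n)) (P : forall n, probability (Om n) R)
    (X : forall n, Om n -> R) (v_ : nat -> R)
    d (T : measurableType d) (Q : probability T R) (Y : T -> R) (v L M : R)
    (h : R -> R) :
  (forall n, 0 <= v_ n) -> 0 <= v -> v_ @ \oo --> v ->
  (forall n, has_gaussian_law (P n) (X n) 0 (v_ n)) ->
  has_gaussian_law Q Y 0 v ->
  lipschitz_by L h -> (forall x, `|h x| <= M) ->
  (fun n => \int[P n]_w h (X n w)) @ \oo --> \int[Q]_w h (Y w).
Proof.
move=> v_0 v0 vv lX lY hL hM.
have mh := lipschitz_by_measurable hL.
rewrite (Rintegral_gaussian v0 lY mh).
under eq_fun do rewrite (Rintegral_gaussian (v_0 _) (lX _) mh).
under [in X in X @ _]eq_fun do under eq_Rintegral do rewrite addr0.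
under eq_Rintegral do rewrite addr0.
exact: (std_normal_lipschitz_cvg vv hL hM).
Qed.

(** Pointwise limits of centered Gaussian variables are Gaussian, by dominated
    convergence of Lipschitz integrals. *)
Lemma gaussian_law_limit d (T : measurableType d) (P : probability T R)
    (X_ : nat -> T -> R) (X : T -> R) (v_ : nat -> R) (v : R) :
  (forall n, 0 <= v_ n) -> v_ @ \oo --> v ->
  (forall n, has_gaussian_law P (X_ n) 0 (v_ n)) ->
  (forall w, X_ ^~ w @ \oo --> X w) ->
  has_gaussian_law P X 0 v.
Proof.
move=> v_0 vv lX XX.
have v0 : 0 <= v.
  have cv : cvgn v_ by apply/cvg_ex; exists v.
  rewrite -(cvg_lim (@Rhausdorff R) vv); apply: limr_ge => //; exact: nearW.
have mX_ n : measurable_fun setT (X_ n) by case: (lX n).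
have mX : measurable_fun setT X.
  by apply: (@measurable_fun_cvg _ _ _ setT X_) => // x _; exact: XX.
apply: gaussian_law_lipschitz => // L h hL h01.
have mh := lipschitz_by_measurable hL.
have h1 x : `|h x| <= 1 by case/andP: (h01 x) => a b; rewrite ger0_norm.
have cl := std_normal_lipschitz_cvg vv hL h1.
have cr : (fun n => \int[P]_w h (X_ n w)) @ \oo --> \int[P]_w h (X w).
  apply: (@Rintegral_cvg_bounded _ _ R P (fun n x => h (X_ n x)) _ 1) => //.
  - by move=> n; exact: (measurableT_comp mh).
  - move=> x; apply: continuous_cvg; first exact: (lipschitz_by_continuous hL).
    exact: XX.
have E : \int[P]_w h (X w) = \int[gam]_x h (Num.sqrt v * x).
  rewrite -(cvg_lim (@Rhausdorff R) cr) -(cvg_lim (@Rhausdorff R) cl).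
  congr (lim (_ @ \oo)); apply/funext => n.
  rewrite (Rintegral_gaussian (v_0 n) (lX n) mh).
  by apply: eq_Rintegral => x _; rewrite addr0.
have fi1 : P.-integrable setT (EFin \o (h \o X)).
  by apply: (integrable_bounded_prob P (measurableT_comp mh mX)) => x; exact: h1.
have ms : measurable_fun [set: R] (fun x => h (Num.sqrt v * x)).
  by apply: (measurableT_comp mh); exact: measurable_funM.
have fi2 := integrable_bounded_prob gam ms (fun x => h1 _).
rewrite -(fineK (integrable_fin_num measurableT fi1)).
rewrite -(fineK (integrable_fin_num measurableT fi2)).
by congr EFin.
Qed.

End gaussian_limits.

(** Joint Gaussianity provides some mean and variance for each linear
    combination; they are identified with those given by the covariance through
    the first two moments. *)
Lemma gaussian_with_cov_law (R : realType) (disp : measure_display)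
    (T : measurableType disp) (P : probability T R) (d n : nat)
    (K : ('I_d -> int) -> R[i]) (sigma : dtorus d n -> T -> R)
    (c : dtorus d n -> R) :
  gaussian_with_cov P K sigma ->
  let v := \sum_x \sum_y c x * c y *
     complex.Re (K (fun i => (x i)%:Z - (y i)%:Z)) in
  0 <= v /\ has_gaussian_law P (fun w => \sum_z c z * sigma z w) 0 v.
Proof.
move=> [jg mean0 cov] v.
have law1 x : exists v, 0 <= v /\ has_gaussian_law P (sigma x) 0 v.
  have [m [u [u0 lu]]] := jg (fun z => (z == x)%:R).
  have E : (fun w => \sum_i (i == x)%:R * sigma i w) = sigma x.
    apply/funext => w; rewrite (bigD1 x)//= eqxx mul1r big1 ?addr0//.
    by move=> i /negbTE ->; rewrite mul0r.
  rewrite E in lu; exists u; split => //.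
  have := gaussian_mean u0 lu; have := mean0 x.
  rewrite expectation.unlock => -> [] m0; move: lu; rewrite -m0; exact.
have isq x : P.-integrable setT (fun w => (sigma x w ^+ 2)%:E).
  by have [u [u0 lu]] := law1 x; exact: (gaussian_integrable_sqr u0 lu).
have i1 x : P.-integrable setT (fun w => (sigma x w)%:E).
  by have [u [u0 lu]] := law1 x; exact: (gaussian_integrable u0 lu).
have ms x : measurable_fun setT (sigma x).
  by have [u [u0 [? _]]] := law1 x.
have ixy x y : P.-integrable setT (fun w => (sigma x w * sigma y w)%:E).
  apply: (@le_integrable _ _ _ P _ measurableT _
    (fun w => (sigma x w ^+ 2 + sigma y w ^+ 2)%:E)).
  - by apply/measurable_EFinP; exact: measurable_funM.
  - move=> w _; rewrite lee_fin [X in _ <= X]ger0_norm ?addr_ge0 ?sqr_ge0//.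
    have := sqr_ge0 (sigma x w - sigma y w).
    have := sqr_ge0 (sigma x w + sigma y w) => ? ?.
    by rewrite ler_norml; apply/andP; split; nra.
  - by under eq_fun do rewrite EFinD; exact: integrableD.
have [m [u [u0 lu]]] := jg c.
have m0 : m = 0.
  have := gaussian_mean u0 lu.
  under eq_integral do rewrite -sumEFin.
  rewrite integral_sum//; last first.
    by move=> x; under eq_fun do rewrite EFinM; exact: integrableZl.
  rewrite big1 => [[]//|x _].
  under eq_integral do rewrite EFinM.
  rewrite integralZl//; have := mean0 x; rewrite expectation.unlock => ->.
  by rewrite mule0.
have uv : u = v.
  have := gaussian_moment2 u0 lu; rewrite m0 expr0n/= add0r => E.
  apply: (@EFin_inj R); rewrite -E.
  transitivity (\int[P]_w \sum_x \sum_y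
      ((c x * c y)%:E * (sigma x w * sigma y w)%:E)%E)%E.
    apply: eq_integral => w _; rewrite expr2 mulr_suml -sumEFin.
    apply: eq_bigr => x _; rewrite mulr_sumr -sumEFin.
    by apply: eq_bigr => y _; rewrite -EFinM mulrACA.
  rewrite integral_sum//; last first.
    move=> x; apply: integrable_sum => // y _; exact: integrableZl.
  rewrite /v -sumEFin; apply: eq_bigr => x _.
  rewrite integral_sum//; last by move=> y; exact: integrableZl.
  rewrite -sumEFin; apply: eq_bigr => y _.
  rewrite integralZl// [RHS]EFinM -(cov x y)/= expectation.unlock fineK//.
  exact: integrable_fin_num.
by rewrite -uv; split => //; move: lu; rewrite m0.
Qed.

(** * Independent uniform and Gaussian variables from binary digits *)

Definition unif (R : realType) : probability (measurableTypeR R) R :=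
  uniform_prob (@ltr01 R).

Section bits.
Variable R : realType.
Notation leb := (@lebesgue_measure R).
Notation U01 := (unif R).

Lemma ge0_integral_unif (f : R -> \bar R) : measurable_fun [set: R] f ->
  (forall x, 0 <= f x)%E -> (\int[U01]_x f x = \int[leb]_(x in `[0%R, 1%R]) f x)%E.
Proof.
move=> mf f0; rewrite (integral_uniform ltr01 mf f0).
by rewrite subr0 invr1 mul1e.
Qed.

(** Conditionally on its first binary digit, the rest of a uniform number is
    uniform. *)
Lemma ge0_integral_unif_digit (F0 F1 : R -> \bar R) :
  measurable_fun [set: R] F0 -> measurable_fun [set: R] F1 ->
  (forall x, 0 <= F0 x)%E -> (forall x, 0 <= F1 x)%E ->
  (\int[U01]_w (if (w < 2^-1)%R then F0 (2 * w)%R else F1 (2 * w - 1)%R) =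
   (2^-1)%:E * (\int[U01]_w F0 w + \int[U01]_w F1 w))%E.
Proof.
move=> m0 m1 p0 p1.
have mS (a b : R) : measurable_fun [set: R] (fun w : R => a * w + b).
  by apply: measurable_funD => //; exact: measurable_funM.
have mF0 : measurable_fun [set: R] (fun w => F0 (2 * w)%R).
  by apply: (measurableT_comp m0); exact: measurable_funM.
have mF1 : measurable_fun [set: R] (fun w => F1 (2 * w - 1)%R).
  exact: (measurableT_comp m1 (mS _ _)).
rewrite !ge0_integral_unif//; last 2 first.
- apply: measurable_fun_ifT => //.
  by apply: measurable_fun_ltr.
- by move=> w; case: ifP.
have h0 : (\int[leb]_(x in `[0%R, 1%R]) F0 x =
    2%:E * \int[leb]_(x in `[0%R, 2^-1%R[) F0 (2 * x)%R)%E.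
  rewrite -integral_itv_bndo_bndc; last exact: measurable_funTS.
  rewrite integral_mkcond (@ge0_lebesgue_affine _ 2 0)//; last 2 first.
  - by apply/(measurable_restrictT _ _).1; [exact: measurable_itv|exact: measurable_funTS].
  - by apply: erestrict_ge0.
  congr (_ * _)%E; rewrite [RHS]integral_mkcond; apply: eq_integral => x _.
  rewrite addr0 !patchE !mem_setE !in_itv/=.
  have -> : (0 <= 2 * x < 1) = (0 <= x < 2^-1).
    by apply/andP/andP => -[? ?]; split; lra.
  by [].
have h1 : (\int[leb]_(x in `[0%R, 1%R]) F1 x =
    2%:E * \int[leb]_(x in `[2^-1%R, 1%R]) F1 (2 * x - 1)%R)%E.
  rewrite integral_mkcond (@ge0_lebesgue_affine _ 2 (-1))//; last 2 first.
  - by apply/(measurable_restrictT _ _).1; [exact: measurable_itv|exact: measurable_funTS].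
  - by apply: erestrict_ge0.
  congr (_ * _)%E; rewrite [RHS]integral_mkcond; apply: eq_integral => x _.
  rewrite !patchE !mem_setE !in_itv/=.
  have -> : (0 <= 2 * x - 1 <= 1) = (2^-1 <= x <= 1).
    by apply/andP/andP => -[? ?]; split; lra.
  by [].
rewrite {}h0 {}h1 -ge0_muleDr ?integral_ge0// muleA -EFinM mulVf// mul1e.
have -> : `[0%R, 1%R]%classic = `[0%R, 2^-1%R[ `|` `[2^-1%R, 1%R]%classic :> set R.
  apply/seteqP; split => x /=; rewrite !in_itv/=.
    by move=> /andP[-> ->]; case: (ltP x 2^-1) => _; [left|right].
  by case=> /andP[? ?]; apply/andP; split; lra.
rewrite ge0_integral_setU//=; last 3 first.
- apply: measurable_funTS; apply: measurable_fun_ifT => //.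
  by apply: measurable_fun_ltr.
- by move=> w; case: ifP.
- rewrite disj_set2E; apply/eqP/seteqP; split => x //=; rewrite !in_itv/=.
  by move=> [/andP[_ a] /andP[+ _]]; rewrite leNgt a.
congr (_ + _)%E; apply: eq_integral => x; rewrite inE/= in_itv/=.
- by move=> /andP[_ ->].
- by move=> /andP[]; rewrite leNgt => /negbTE ->.
Qed.

End bits.

Local Opaque unif.

(** Removes the first binary digit. *)
Definition bit_shift (R : realType) (w : R) : R :=
  if w < 2^-1 then 2 * w else 2 * w - 1.

Definition first_bit (R : realType) (w : R) : R := if w < 2^-1 then 0 else 1.

(** The digits of rank 0, 2, 4, and so on of [w], taken as the successive digits
    of a new number. *)
Fixpoint even_bits_approx (R : realType) (n : nat) (w : R) : R :=
  if n is m.+1 then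
    (first_bit w + even_bits_approx m (bit_shift (bit_shift w))) / 2
  else 0.

Definition even_bits (R : realType) (w : R) : R :=
  limn (fun n => even_bits_approx n w).

Definition odd_bits (R : realType) (w : R) : R := even_bits (bit_shift w).

Section bits.
Variable R : realType.
Notation U01 := (unif R).
Implicit Types (w : R) (h : R -> R).

Lemma measurable_bit_shift : measurable_fun [set: R] (@bit_shift R).
Proof.
apply: measurable_fun_ifT; first exact: measurable_fun_ltr.
  exact: measurable_funM.
by apply: measurable_funB => //; exact: measurable_funM.
Qed.

Lemma measurable_first_bit : measurable_fun [set: R] (@first_bit R).
Proof. by apply: measurable_fun_ifT => //; exact: measurable_fun_ltr. Qed.

Lemma measurable_even_bits_approx n :
  measurable_fun [set: R] (@even_bits_approx R n).
Proof.
elim: n => [|n IH] //=.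
apply: measurable_funM => //; apply: measurable_funD; first exact: measurable_first_bit.
exact: (measurableT_comp IH (measurableT_comp measurable_bit_shift measurable_bit_shift)).
Qed.

Lemma first_bit01 w : 0 <= first_bit w <= 1.
Proof. by rewrite /first_bit; case: ifP; rewrite lexx ler01. Qed.

Lemma even_bits_approx01 n w : 0 <= even_bits_approx n w <= 1.
Proof.
elim: n w => [|n IH] w /=; first by rewrite lexx ler01.
move: (IH (bit_shift (bit_shift w))) (first_bit01 w).
by move=> /andP[? ?] /andP[? ?]; apply/andP; split; lra.
Qed.

Lemma even_bits_approx_nd w : nondecreasing_seq (fun n => even_bits_approx n w).
Proof.
apply/nondecreasing_seqP => n.
elim: n w => [|n IH] w; first by case/andP: (even_bits_approx01 1 w).
by rewrite ler_pM2r ?invr_gt0// lerD2l; exact: IH.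
Qed.

Lemma cvg_even_bits w : even_bits_approx n w @[n --> \oo] --> even_bits w.
Proof.
apply: nondecreasing_is_cvgn; first exact: even_bits_approx_nd.
by exists 1 => _ [n _ <-]; case/andP: (even_bits_approx01 n w).
Qed.

Lemma measurable_even_bits : measurable_fun [set: R] (@even_bits R).
Proof.
apply: (@measurable_fun_cvg _ _ _ setT (@even_bits_approx R)).
- by move=> n; exact: measurable_even_bits_approx.
- by move=> w _; exact: cvg_even_bits.
Qed.

Lemma measurable_odd_bits : measurable_fun [set: R] (@odd_bits R).
Proof. exact: (measurableT_comp measurable_even_bits measurable_bit_shift). Qed.

Lemma even_bits01 w : 0 <= even_bits w <= 1.
Proof.
have c : cvgn (fun n => even_bits_approx n w) by apply/cvg_ex; eexists; exact: cvg_even_bits.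
by apply/andP; split; [apply: limr_ge|apply: limr_le] => //; apply: nearW => n;
  case/andP: (even_bits_approx01 n w).
Qed.

(** The digit expansions interleave: removing one digit exchanges the even and
    odd ones. All properties of the pair of numbers follow from this functional
    equation. *)
Lemma even_bitsE w : even_bits w = (first_bit w + odd_bits (bit_shift w)) / 2.
Proof.
apply: (@cvg_lim _ (@Rhausdorff R)).
rewrite -(cvg_shiftS (fun n => even_bits_approx n w)) /=.
apply: cvgMr_tmp; apply: cvgD; first exact: cvg_cst.
exact: cvg_even_bits.
Qed.

Let half (b : R) (u : R) : R := (b + u) / 2.

Let mhalf b : measurable_fun [set: R] (half b).
Proof. by apply: measurable_funM => //; exact: measurable_funD. Qed.

Lemma Rintegral_unif_digit (F0 F1 : R -> R) :
  measurable_fun [set: R] F0 -> measurable_fun [set: R] F1 ->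
  (forall x, 0 <= F0 x <= 1) -> (forall x, 0 <= F1 x <= 1) ->
  \int[U01]_w (if w < 2^-1 then F0 (2 * w) else F1 (2 * w - 1)) =
  2^-1 * (\int[U01]_w F0 w + \int[U01]_w F1 w).
Proof.
move=> m0 m1 p0 p1.
have fin (F : R -> R) : measurable_fun [set: R] F -> (forall x, 0 <= F x <= 1) ->
    (\int[U01]_w (F w)%:E)%E \is a fin_num.
  move=> mF pF; apply: integrable_fin_num => //.
  apply: (integrable_bounded_prob U01 (M := 1) mF) => x.
  by case/andP: (pF x) => ? ?; rewrite ger0_norm.
rewrite {1}/Rintegral.
under eq_integral do rewrite (fun_if EFin).
rewrite (@ge0_integral_unif_digit R (EFin \o F0) (EFin \o F1)).
- by rewrite -(fineK (fin F0 m0 p0)) -(fineK (fin F1 m1 p1)) -EFinD -EFinM.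
- by apply/measurable_EFinP; exact: m0.
- by apply/measurable_EFinP; exact: m1.
- by move=> x; rewrite lee_fin; case/andP: (p0 x).
- by move=> x; rewrite lee_fin; case/andP: (p1 x).
Qed.

(** The joint and the marginal expectations under comparison; equality for
    Lipschitz arguments is independence of the two numbers together with their
    uniformity. *)
Let I h1 h2 := \int[U01]_w (h1 (even_bits w) * h2 (odd_bits w)).
Let E1 h := \int[U01]_w h w.

Let mul01 (x y : R) : 0 <= x <= 1 -> 0 <= y <= 1 -> 0 <= x * y <= 1.
Proof.
by move=> /andP[x0 x1] /andP[y0 y1]; rewrite mulr_ge0//= mulr_ile1.
Qed.

(** The functional equation for the joint expectation: reading one digit swaps
    the two test functions and contracts one of them by half. *)
Let I_step h1 h2 : measurable_fun [set: R] h1 -> measurable_fun [set: R] h2 ->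
  (forall x, 0 <= h1 x <= 1) -> (forall x, 0 <= h2 x <= 1) ->
  I h1 h2 = 2^-1 * (I h2 (h1 \o half 0) + I h2 (h1 \o half 1)).
Proof.
move=> m1 m2 p1 p2; rewrite /I -Rintegral_unif_digit.
- apply: eq_Rintegral => w _; rewrite even_bitsE /odd_bits /first_bit /bit_shift.
  by case: ifP => _; rewrite mulrC.
- apply: measurable_funM; first exact: (measurableT_comp m2 measurable_even_bits).
  exact: (measurableT_comp m1 (measurableT_comp (mhalf _) measurable_odd_bits)).
- apply: measurable_funM; first exact: (measurableT_comp m2 measurable_even_bits).
  exact: (measurableT_comp m1 (measurableT_comp (mhalf _) measurable_odd_bits)).
- by move=> x; exact: (mul01 (p2 _) (p1 _)).
- by move=> x; exact: (mul01 (p2 _) (p1 _)).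
Qed.

Let E1_step h : measurable_fun [set: R] h -> (forall x, 0 <= h x <= 1) ->
  E1 h = 2^-1 * (E1 (h \o half 0) + E1 (h \o half 1)).
Proof.
move=> m p; rewrite /E1 -Rintegral_unif_digit.
- congr (Rintegral _ _ _); apply/funext => w; rewrite /half /=.
  by case: ifP => _; congr h; field.
- exact: (measurableT_comp m (mhalf _)).
- exact: (measurableT_comp m (mhalf _)).
- by move=> x; exact: p.
- by move=> x; exact: p.
Qed.

(** The uniform law only charges the unit interval, where a Lipschitz function
    oscillates little. *)
Let osc (f : R -> R) (c e : R) : measurable_fun [set: R] f ->
  (forall x, 0 <= f x <= 1) ->
  (forall x, 0 <= x <= 1 -> `|f x - c| <= e) -> `|E1 f - c| <= e.
Proof.
move=> mf p H.
have mfE : measurable_fun [set: R] (EFin \o f) by apply/measurable_EFinP; exact: mf.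
have f0 x : (0 <= (EFin \o f) x)%E by rewrite lee_fin; case/andP: (p x).
have cst01 (r : R) : (\int[@lebesgue_measure R]_(x in `[0%R, 1%R]) r%:E = r%:E)%E.
  rewrite integral_cst; last exact: measurable_itv.
  rewrite [X in (_ * X)%E](lebesgue_measure_itv `[0%R, 1%R]) /= lte_fin ltr01.
  by rewrite -EFinB subr0 mule1.
have up : (\int[U01]_x (f x)%:E <= (c + e)%:E)%E.
  rewrite (ge0_integral_unif mfE f0) -[leRHS]cst01.
  apply: ge0_le_integral; first exact: measurable_itv.
  - by move=> x _; exact: f0.
  - exact: measurable_funTS.
  - exact: measurable_cst.
  - move=> x /=; rewrite in_itv/= => /H; rewrite ler_distl => /andP[_ ?].
    by rewrite lee_fin.
have lo : ((c - e)%:E <= \int[U01]_x (f x)%:E)%E.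
  apply: (@le_trans _ _ (Num.max 0 (c - e))%:E); first by rewrite lee_fin le_max lexx orbT.
  rewrite (ge0_integral_unif mfE f0) -[leLHS]cst01.
  apply: ge0_le_integral; first exact: measurable_itv.
  - by move=> x _; rewrite lee_fin le_max lexx.
  - exact: measurable_cst.
  - exact: measurable_funTS.
  - move=> x /=; rewrite in_itv/= => /H; rewrite ler_distl => /andP[? _].
    by rewrite lee_fin ge_max; case/andP: (p x) => -> _.
rewrite ler_distl /E1 /Rintegral.
by case: (\int[U01]_x _)%E lo up => [r| |]//=; rewrite !lee_fin => -> ->.
Qed.

Let prob_osc (d : measure_display) (T : measurableType d) (P : probability T R)
  (f : T -> R) (c e : R) : measurable_fun setT f ->
  (forall x, 0 <= f x <= 1) ->
  (forall x, `|f x - c| <= e) -> `|\int[P]_x f x - c| <= e.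
Proof.
move=> mf p H.
have fi : P.-integrable setT (EFin \o f).
  by apply: (integrable_bounded_prob P (M := 1) mf) => x; case/andP: (p x) => ? ?; rewrite ger0_norm.
have ci (r : R) : P.-integrable setT (EFin \o cst r) by exact: finite_measure_integrable_cst.
have cE (r : R) : \int[P]_x (cst r x) = r.
  by rewrite Rintegral_cst// [X in fine X](@probability_setT _ _ _ P) mulr1.
rewrite ler_distl -[c - e]cE -[c + e]cE; apply/andP; split.
- apply: le_Rintegral => // x _; have := H x; rewrite ler_distl => /andP[//].
- apply: le_Rintegral => // x _; have := H x; rewrite ler_distl => /andP[//].
Qed.

Let lip01 (L : R) h : 0 <= L -> lipschitz_by L h ->
  forall x, 0 <= x <= 1 -> `|h x - h 0| <= L.
Proof.
move=> L0 hL x /andP[x0 x1]; apply: (le_trans (hL x 0)).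
by rewrite subr0 ger0_norm// ler_piMr.
Qed.

Let lip_half (L b : R) h : lipschitz_by L h -> lipschitz_by (L / 2) (h \o half b).
Proof.
move=> hL x y; apply: (le_trans (hL _ _)); rewrite /half.
have -> : (b + x) / 2 - (b + y) / 2 = 2^-1 * (x - y) by field.
by rewrite normrM ger0_norm// mulrA.
Qed.

(** Both sides satisfy the same recursion when two digits are read, under which
    the Lipschitz constants are halved; after n rounds the test functions are
    constant up to 2^-n. *)
Let I_bound n (L1 L2 : R) h1 h2 : 0 <= L1 -> 0 <= L2 ->
  lipschitz_by L1 h1 -> lipschitz_by L2 h2 ->
  (forall x, 0 <= h1 x <= 1) -> (forall x, 0 <= h2 x <= 1) ->
  `|I h1 h2 - E1 h1 * E1 h2| <= 2 ^- n * (2 * (L1 + L2)).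
Proof.
elim: n L1 L2 h1 h2 => [|n IH] L1 L2 h1 h2 l1 l2 H1 H2 p1 p2.
  rewrite expr0 invr1 mul1r.
  have m1 := lipschitz_by_measurable H1; have m2 := lipschitz_by_measurable H2.
  have b1 : `|I h1 h2 - h1 0 * h2 0| <= L1 + L2.
    apply: prob_osc.
    - by apply: measurable_funM; [exact: (measurableT_comp m1 measurable_even_bits)
        |exact: (measurableT_comp m2 measurable_odd_bits)].
    - by move=> x; exact: (mul01 (p1 _) (p2 _)).
    - move=> w; have a1 := lip01 l1 H1 (even_bits01 w).
      have a2 := lip01 l2 H2 (even_bits01 (bit_shift w)).
      move: (p1 (even_bits w)) (p2 0) => /andP[? ?] /andP[? ?].
      have -> : h1 (even_bits w) * h2 (odd_bits w) - h1 0 * h2 0 =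
        h1 (even_bits w) * (h2 (odd_bits w) - h2 0) + h2 0 * (h1 (even_bits w) - h1 0).
        by ring.
      apply: (le_trans (ler_normD _ _)); rewrite addrC !normrM.
      apply: lerD; rewrite -[leRHS]mul1r; apply: ler_pM => //; by rewrite ger0_norm.
  have c1 := osc m1 p1 (lip01 l1 H1); have c2 := osc m2 p2 (lip01 l2 H2).
  have E01 h : measurable_fun [set: R] h -> (forall x, 0 <= h x <= 1) -> 0 <= E1 h <= 1.
    move=> m p; have := @prob_osc _ _ U01 h 2^-1 2^-1 m p.
    rewrite ler_distl => H; have /andP[? ?] : 2^-1 - 2^-1 <= E1 h <= 2^-1 + 2^-1.
      apply: H => x; rewrite ler_distl; have /andP[? ?] := p x.
      by apply/andP; split; lra.
    by apply/andP; split; lra.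
  have b2 : `|E1 h1 * E1 h2 - h1 0 * h2 0| <= L1 + L2.
    move: (E01 _ m1 p1) (p2 0) => /andP[? ?] /andP[? ?].
    have -> : E1 h1 * E1 h2 - h1 0 * h2 0 =
      E1 h1 * (E1 h2 - h2 0) + h2 0 * (E1 h1 - h1 0) by ring.
    apply: (le_trans (ler_normD _ _)); rewrite addrC !normrM.
    by apply: lerD; rewrite -[leRHS]mul1r; apply: ler_pM => //; rewrite ger0_norm.
  have -> : I h1 h2 - E1 h1 * E1 h2 =
    (I h1 h2 - h1 0 * h2 0) - (E1 h1 * E1 h2 - h1 0 * h2 0) by ring.
  by apply: (le_trans (ler_normB _ _)); lra.
have m1 := lipschitz_by_measurable H1; have m2 := lipschitz_by_measurable H2.
(* Two digits are read, so that the roles of the test functions are restored. *)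
have I2 : I h1 h2 = 2^-1 * (2^-1 * (I (h1 \o half 0) (h2 \o half 0) +
    I (h1 \o half 0) (h2 \o half 1)) + 2^-1 * (I (h1 \o half 1) (h2 \o half 0) +
    I (h1 \o half 1) (h2 \o half 1))).
  rewrite (I_step m1 m2 p1 p2); congr (_ * (_ + _)); apply: I_step => //.
  - exact: (measurableT_comp m1 (mhalf _)).
  - by move=> x; exact: p1.
  - exact: (measurableT_comp m1 (mhalf _)).
  - by move=> x; exact: p1.
rewrite I2 (E1_step m1 p1) (E1_step m2 p2).
have l1' : 0 <= L1 / 2 by lra.
have l2' : 0 <= L2 / 2 by lra.
have B b c := IH (L1 / 2) (L2 / 2) (h1 \o half b) (h2 \o half c) l1' l2'
  (lip_half b H1) (lip_half c H2) (fun x => p1 _) (fun x => p2 _).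
have eB : 2 ^- n * (2 * (L1 / 2 + L2 / 2)) = 2 ^- n.+1 * (2 * (L1 + L2)) :> R.
  by rewrite exprS invfM; field; rewrite expf_neq0.
move: (B 0 0) (B 0 1) (B 1 0) (B 1 1); rewrite eB.
move: (I _ _) (I _ _) (I _ _) (I _ _) (E1 _) (E1 _) (E1 _) (E1 _) (2 ^- _ * _).
move=> a b c e x y z t r; rewrite !ler_distl.
by move=> /andP[? ?] /andP[? ?] /andP[? ?] /andP[? ?]; apply/andP; split; lra.
Qed.

Let I_lipschitz (L1 L2 : R) h1 h2 : 0 <= L1 -> 0 <= L2 ->
  lipschitz_by L1 h1 -> lipschitz_by L2 h2 ->
  (forall x, 0 <= h1 x <= 1) -> (forall x, 0 <= h2 x <= 1) ->
  I h1 h2 = E1 h1 * E1 h2.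
Proof.
move=> l1 l2 H1 H2 p1 p2; apply/eqP; rewrite -subr_eq0 -normr_eq0 eq_le normr_ge0 andbT.
have c : (fun n => 2 ^- n * (2 * (L1 + L2)) : R) @ \oo --> (0 * (2 * (L1 + L2)) : R).
  apply: cvgMr_tmp.
  have -> : (fun n => 2 ^- n : R) = (fun n => 2^-1 ^+ n).
    by apply/funext => n; rewrite exprVn.
  by apply: cvg_expr; rewrite ger0_norm// invf_lt1// ltr1n.
rewrite mul0r in c; rewrite -(cvg_lim (@Rhausdorff R) c).
apply: limr_ge; first by apply/cvg_ex; eexists; exact: c.
by apply: nearW => n; exact: (I_bound n l1 l2 H1 H2).
Qed.

Let I_ray (x y : R) :
  I (\1_(`]-oo, x[%classic : set R)) (\1_(`]-oo, y[%classic : set R)) =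
  E1 (\1_(`]-oo, x[%classic : set R)) * E1 (\1_(`]-oo, y[%classic : set R)).
Proof.
have cr (z w : R) : ray_approx z k w @[k --> \oo] --> (\1_(`]-oo, z[%classic : set R) w : R).
  by have := @cvg_ray_approx R z w => /fine_cvg.
have mr (z : R) k := ray_approx_measurable z k.
have nr (z : R) k w : `|ray_approx z k w| <= 1.
  by case/andP: (ray_approx01 z k w) => ? ?; rewrite ger0_norm.
have cE z : (fun k => E1 (ray_approx z k)) @ \oo --> E1 (\1_(`]-oo, z[%classic : set R)).
  apply: (@Rintegral_cvg_bounded _ _ R U01 (fun k w => ray_approx z k w) _ 1).
  - by move=> k; exact: mr.
  - by move=> k w; exact: nr.
  - by move=> w; exact: cr.
have cI : (fun k => I (ray_approx x k) (ray_approx y k)) @ \oo -->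
    I (\1_(`]-oo, x[%classic : set R)) (\1_(`]-oo, y[%classic : set R)).
  apply: (@Rintegral_cvg_bounded _ _ R U01
    (fun k w => ray_approx x k (even_bits w) * ray_approx y k (odd_bits w)) _ 1).
  - move=> k; apply: measurable_funM; first exact: (measurableT_comp (mr _ _) measurable_even_bits).
    exact: (measurableT_comp (mr _ _) measurable_odd_bits).
  - by move=> k w; rewrite normrM mulr_ile1.
  - by move=> w; apply: cvgM; exact: cr.
rewrite -(cvg_lim (@Rhausdorff R) cI).
apply: (@cvg_lim _ (@Rhausdorff R)).
under eq_fun do rewrite (I_lipschitz (ler0n _ _) (ler0n _ _)
  (@ray_approx_lipschitz _ _ _) (@ray_approx_lipschitz _ _ _) (@ray_approx01 _ _ _)
  (@ray_approx01 _ _ _)).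
by apply: cvgM; exact: cE.
Qed.

(** Lipschitz functions are replaced by indicators of rays by dominated
    convergence. *)
Lemma ray_indep (x y : R) :
  U01 (@even_bits R @^-1` `]-oo, x[%classic `&` @odd_bits R @^-1` `]-oo, y[%classic) =
  (U01 `]-oo, x[%classic * U01 `]-oo, y[%classic)%E.
Proof.
have mI (z : R) : measurable (`]-oo, z[%classic : set (measurableTypeR R)).
  exact: measurable_itv.
have mU : measurable (@even_bits R @^-1` `]-oo, x[%classic : set (measurableTypeR R)).
  by rewrite -[X in measurable X]setTI; apply: measurable_even_bits.
have mV : measurable (@odd_bits R @^-1` `]-oo, y[%classic : set (measurableTypeR R)).
  by rewrite -[X in measurable X]setTI; apply: measurable_odd_bits.
have := I_ray x y; rewrite /I /E1 /Rintegral.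
rewrite !integral_indic//= ?setIT.
have -> : (\int[U01]_w (\1_(`]-oo, x[%classic : set R) (even_bits w) *
   \1_(`]-oo, y[%classic : set R) (odd_bits w))%:E)%E =
   U01 (@even_bits R @^-1` `]-oo, x[%classic `&` @odd_bits R @^-1` `]-oo, y[%classic).
  rewrite -[X in _ = U01 X]setIT -integral_indic//;
    last exact: measurableI.
  by apply: eq_integral => w _; rewrite indicI.
move=> H; rewrite -[LHS]fineK ?fin_num_measure//; last exact: measurableI.
by rewrite H EFinM !fineK ?fin_num_measure.
Qed.

End bits.

Section bits_law.
Variable R : realType.
Notation U01 := (unif R).

Let mU (A : set (measurableTypeR R)) : measurable A ->
  measurable (@even_bits R @^-1` A : set (measurableTypeR R)).
Proof.
by move=> mA; rewrite -[X in measurable X]setTI; exact: (@measurable_even_bits R).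
Qed.

Let mV (A : set (measurableTypeR R)) : measurable A ->
  measurable (@odd_bits R @^-1` A : set (measurableTypeR R)).
Proof.
by move=> mA; rewrite -[X in measurable X]setTI; exact: (@measurable_odd_bits R).
Qed.

(** From rays to Borel sets, one factor at a time; on each factor both sides are
    measures in that set. *)
Lemma bits_indep (A B : set (measurableTypeR R)) : measurable A -> measurable B ->
  U01 (@even_bits R @^-1` A `&` @odd_bits R @^-1` B) = (U01 A * U01 B)%E.
Proof.
move=> mA mB.
have mUf : measurable_fun setT (@even_bits R : measurableTypeR R -> measurableTypeR R).
  exact: measurable_even_bits.
have mVf : measurable_fun setT (@odd_bits R : measurableTypeR R -> measurableTypeR R).
  exact: measurable_odd_bits.
have mI (z : R) : measurable (`]-oo, z[%classic : set (measurableTypeR R)).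
  exact: measurable_itv.
have nn (C : set (measurableTypeR R)) : 0 <= fine (U01 C) by exact: fine_ge0.
have fU (C : set (measurableTypeR R)) : measurable C -> (fine (U01 C))%:E = U01 C.
  by move=> mC; rewrite fineK// fin_num_measure.
have lty (C : set (measurableTypeR R)) : measurable C -> (U01 C < +oo)%E.
  by move=> mC; rewrite -fU// ltry.
have step1 y (C : set (measurableTypeR R)) : measurable C ->
    U01 (@even_bits R @^-1` C `&` @odd_bits R @^-1` `]-oo, y[%classic) =
    (U01 C * U01 `]-oo, y[%classic)%E.
  move=> mC.
  pose m1 : {measure set (measurableTypeR R) -> \bar R} :=
    pushforward (mrestr U01 (mV (mI y)))
     (@even_bits R : measurableTypeR R -> measurableTypeR R).
  pose m2 : {measure set (measurableTypeR R) -> \bar R} :=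
    mscale (NngNum (nn `]-oo, y[%classic)) U01.
  have := @measure_eq_rays R (m1 mUf) m2.
  move=> /(_ _ _ C mC) H; rewrite [LHS](_ : _ = m1 mUf C)// H.
  - by rewrite /m2 /= /mscale/= fU// muleC.
  - move=> x; rewrite (_ : m1 mUf _ = U01 (@even_bits R @^-1` `]-oo, x[%classic
      `&` @odd_bits R @^-1` `]-oo, y[%classic))//.
    by apply: lty; apply: measurableI; [exact: mU|exact: mV].
  - move=> x; rewrite (_ : m1 mUf _ = U01 (@even_bits R @^-1` `]-oo, x[%classic
      `&` @odd_bits R @^-1` `]-oo, y[%classic))// ray_indep.
    by rewrite /m2 /= /mscale/= fU// muleC.
pose m1 : {measure set (measurableTypeR R) -> \bar R} :=
  pushforward (mrestr U01 (mU mA))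
   (@odd_bits R : measurableTypeR R -> measurableTypeR R).
pose m2 : {measure set (measurableTypeR R) -> \bar R} :=
  mscale (NngNum (nn A)) U01.
have := @measure_eq_rays R (m1 mVf) m2.
move=> /(_ _ _ B mB) H; rewrite setIC [LHS](_ : _ = m1 mVf B)// H.
- by rewrite /m2 /= /mscale/= fU.
- move=> x; rewrite (_ : m1 mVf _ = U01 (@odd_bits R @^-1` `]-oo, x[%classic
    `&` @even_bits R @^-1` A))//.
  by apply: lty; apply: measurableI; [exact: mV|exact: mU].
- move=> x; rewrite (_ : m1 mVf _ = U01 (@odd_bits R @^-1` `]-oo, x[%classic
    `&` @even_bits R @^-1` A))// setIC step1//.
  by rewrite /m2 /= /mscale/= fU.
Qed.

(** By uniqueness of the product measure, the pair of digit sequences has the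
    law of two independent uniform numbers. *)
Lemma ge0_integral_bits (F : R * R -> \bar R) : measurable_fun setT F ->
  (forall z, 0 <= F z)%E ->
  (\int[U01]_w F (even_bits w, odd_bits w) = \int[U01]_u \int[U01]_v F (u, v))%E.
Proof.
move=> mF F0.
pose phi (w : measurableTypeR R) : measurableTypeR R * measurableTypeR R :=
  (even_bits w, odd_bits w).
have mphi : measurable_fun setT phi.
  by apply: measurable_fun_pair; [exact: measurable_even_bits|exact: measurable_odd_bits].
pose m' : {measure set (measurableTypeR R * measurableTypeR R) -> \bar R} :=
  pushforward U01 phi.
have E : forall X, measurable X -> (U01 \x U01)%E X = m' mphi X.
  apply: product_measure_unique => A B mA mB.
  by rewrite -bits_indep.
transitivity (\int[m' mphi]_z F z)%E; first by rewrite ge0_integral_pushforward.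
rewrite -(@eq_measure_integral _ _ _ _ _ (U01 \x U01)%E); last first.
  by move=> A mA _; exact: E.
exact: fubini_tonelli1.
Qed.

End bits_law.

Section quantile.
Variable R : realType.
Notation gam := (std_normal R).
Notation U01 := (unif R).

Let mIy (x : R) : measurable (`[x, +oo[%classic : set (measurableTypeR R)).
Proof. exact: measurable_itv. Qed.

Definition normal_tail (x : R) : R := fine (gam `[x, +oo[%classic).

Let tailE x : (normal_tail x)%:E = gam `[x, +oo[%classic.
Proof. by rewrite fineK// fin_num_measure. Qed.

(** Inverse of the decreasing tail function, so that it is decreasing in u. *)
Definition normal_quantile (u : R) : R := sup [set x | u <= normal_tail x].

Let tail_ni x y : x <= y -> normal_tail y <= normal_tail x.
Proof.
move=> xy; rewrite -lee_fin !tailE; apply: le_measure; rewrite ?inE//.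
by apply: subset_itvr; rewrite bnd_simp.
Qed.

Let tail_left_cont (x u : R) :
  (forall n : nat, u <= normal_tail (x - n.+1%:R^-1)) -> u <= normal_tail x.
Proof.
move=> H; rewrite -lee_fin tailE.
have capE : \bigcap_n `[x - n.+1%:R^-1, +oo[%classic = `[x, +oo[%classic :> set R.
  apply/seteqP; split => y /=; rewrite in_itv/= andbT; last first.
    by move=> xy n _ /=; rewrite in_itv/= andbT lerBlDr (le_trans xy)// lerDl.
  move=> K; rewrite leNgt; apply/negP => yx.
  have [n nP] : exists n : nat, n.+1%:R^-1 < x - y.
    have xy : 0 < x - y by rewrite subr_gt0.
    exists (Num.truncn (x - y)^-1); rewrite invf_plt ?posrE//.
    exact: truncnS_gt.
  by have := K n I; rewrite /= in_itv/= andbT lerBlDr -lerBlDl leNgt nP.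
have c : gam `[x - n.+1%:R^-1, +oo[%classic @[n --> \oo] --> gam `[x, +oo[%classic.
  rewrite -capE; apply: (@nonincreasing_cvg_mu _ _ _ gam
    (fun n => `[x - n.+1%:R^-1, +oo[%classic)).
  - by apply: (le_lt_trans (probability_le1 gam _)); rewrite ?ltry//; exact: mIy.
  - by move=> n; exact: mIy.
  - by rewrite capE; exact: mIy.
  - move=> m n mn; apply/subsetPset; apply: subset_itvr; rewrite bnd_simp.
    by rewrite lerD2l lerN2 lef_pV2 ?posrE// ler_nat.
have cE := cvg_lim (@ereal_hausdorff R) c.
rewrite -cE; apply: lime_ge; first by apply/cvg_ex; eexists; exact: c.
by apply: nearW => n; rewrite -tailE lee_fin.
Qed.

Let tail_cvg0 (u : R) : 0 < u -> exists n : nat, normal_tail n%:R < u.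
Proof.
move=> u0.
have capE : \bigcap_n `[n%:R, +oo[%classic = set0 :> set R.
  apply/seteqP; split => y //= /(_ (Num.truncn y).+1 I) /=.
  by rewrite in_itv/= andbT leNgt truncnS_gt.
have c : gam `[n%:R, +oo[%classic @[n --> \oo] --> gam set0.
  rewrite -capE; apply: (@nonincreasing_cvg_mu _ _ _ gam (fun n => `[n%:R, +oo[%classic)).
  - by apply: (le_lt_trans (probability_le1 gam _)); rewrite ?ltry//; exact: mIy.
  - by move=> n; exact: mIy.
  - by rewrite capE.
  - move=> m n mn; apply/subsetPset; apply: subset_itvr; rewrite bnd_simp.
    by rewrite ler_nat.
apply/not_existsP => H.
have : (u%:E <= gam set0)%E.
  rewrite -(cvg_lim (@ereal_hausdorff R) c); apply: lime_ge.
    by apply/cvg_ex; eexists; exact: c.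
  by apply: nearW => n; rewrite -tailE lee_fin leNgt; apply/negP/H.
by rewrite measure0 lee_fin leNgt u0.
Qed.

Let tail_cvg1 (u : R) : u < 1 -> exists n : nat, u < normal_tail (- n%:R).
Proof.
move=> u1.
have cupE : \bigcup_n `[- n%:R, +oo[%classic = setT :> set R.
  apply/seteqP; split => y //= _; exists (Num.truncn `|y|).+1 => //=.
  rewrite in_itv/= andbT lerNl (le_trans (ler_norm _))// normrN ltW//.
  exact: truncnS_gt.
have c : gam `[- n%:R, +oo[%classic @[n --> \oo] --> gam setT.
  rewrite -cupE; apply: (@nondecreasing_cvg_mu _ _ _ gam (fun n => `[- n%:R, +oo[%classic)).
  - by move=> n; exact: mIy.
  - by rewrite cupE; exact: measurableT.
  - move=> m n mn; apply/subsetPset; apply: subset_itvr; rewrite bnd_simp.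
    by rewrite lerN2 ler_nat.
apply/not_existsP => H.
have : (gam setT <= u%:E)%E.
  rewrite -(cvg_lim (@ereal_hausdorff R) c); apply: lime_le.
    by apply/cvg_ex; eexists; exact: c.
  by apply: nearW => n; rewrite -tailE lee_fin leNgt; apply/negP/H.
by rewrite probability_setT lee_fin leNgt u1.
Qed.

(** The Galois connection between the tail and its generalized inverse; left
    continuity of the closed tails makes it exact. *)
Lemma normal_quantile_ge (u x : R) : 0 < u < 1 ->
  (x <= normal_quantile u) = (u <= normal_tail x).
Proof.
move=> /andP[u0 u1].
have hs : has_sup [set x | u <= normal_tail x].
  split.
    by have [n hn] := tail_cvg1 u1; exists (- n%:R) => /=; exact: ltW.
  have [n hn] := tail_cvg0 u0; exists n%:R => y /= hy.
  rewrite leNgt; apply/negP => /ltW /tail_ni; rewrite leNgt.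
  by rewrite (lt_le_trans hn hy).
apply/idP/idP => [xq|ux]; last exact: (sup_upper_bound hs).
apply: tail_left_cont => n.
have : x - n.+1%:R^-1 < sup [set x | u <= normal_tail x].
  by apply: lt_le_trans xq; rewrite ltrBlDr ltrDl.
move=> /(sup_gt hs.1)[y /= uy]; move=> /ltW /tail_ni; exact: le_trans.
Qed.

Let unif_leb (A : set (measurableTypeR R)) : measurable A ->
  U01 A = @lebesgue_measure R (A `&` `]0, 1[%classic).
Proof.
move=> mA.
have mo : measurable (`]0, 1[%classic : set (measurableTypeR R)).
  exact: measurable_itv.
have mI : measurable_fun [set: R] (EFin \o (\1_(A : set R) : R -> R)).
  by apply/measurable_EFinP; exact: measurable_indic.
rewrite -[in LHS](setIT A) -integral_indic; [|exact: measurableT|exact: mA].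
rewrite (ge0_integral_unif mI); last by move=> x; rewrite lee_fin.
rewrite (@integral_itv_bndoo R 0 1 _ true false); last exact: measurable_funTS.
exact: integral_indic.
Qed.

(** The value outside the open unit interval, a null set for the uniform law,
    only has to be measurable. *)
Definition normal_of_unif (u : R) : R :=
  if (0 < u < 1) then normal_quantile u else 0.

Let preim_ge (x : R) : [set u | x <= normal_of_unif u] `&` `]0, 1[%classic =
  `]0, normal_tail x]%classic `&` `]0, 1[%classic.
Proof.
apply/seteqP; split => u [] /=; rewrite !in_itv/= => h u01.
- split; last by []; move: h; rewrite /normal_of_unif u01.
  by rewrite normal_quantile_ge// => ->; case/andP: u01 => ->.
- split; last by [].
  by rewrite /normal_of_unif u01 normal_quantile_ge//; case/andP: h.
Qed.

Lemma measurable_normal_of_unif : measurable_fun [set: R] normal_of_unif.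
Proof.
have mI (i : interval R) : measurable [set` i] by exact: measurable_itv.
apply: (measurability _ (RGenCInfty.measurableE R)).
move=> _ [_ [x ->] <-]; rewrite setTI.
have -> : normal_of_unif @^-1` `[x, +oo[%classic =
    (`]0, normal_tail x]%classic `&` `]0, 1[%classic) `|`
    (if x <= 0 then ~` `]0, 1[%classic else set0).
  rewrite -preim_ge; apply/seteqP; split => u /=; rewrite !in_itv/= andbT.
  - move=> xu; have [u01|u01] := boolP (0 < u < 1); first by left.
    right; move: xu; rewrite /normal_of_unif (negbTE u01) => ->/=.
    by rewrite in_itv/= => /idP; rewrite (negbTE u01).
  - case; first by case.
    case: ifP => //= x0; rewrite in_itv/= => /negP u01.
    by rewrite /normal_of_unif (negbTE u01).
apply: measurableU; first by apply: measurableI; exact: mI.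
by case: ifP => _ //; apply: measurableC; exact: mI.
Qed.

Lemma ge0_integral_normal_of_unif (f : R -> \bar R) : measurable_fun [set: R] f ->
  (forall x, 0 <= f x)%E ->
  (\int[U01]_u f (normal_of_unif u) = \int[gam]_x f x)%E.
Proof.
move=> mf f0.
have mI (i : interval R) : measurable ([set` i] : set (measurableTypeR R)).
  exact: measurable_itv.
have mq : measurable_fun setT (normal_of_unif : measurableTypeR R -> measurableTypeR R).
  exact: measurable_normal_of_unif.
pose nu : {measure set (measurableTypeR R) -> \bar R} :=
  pushforward U01 (normal_of_unif : measurableTypeR R -> measurableTypeR R).
have tail x : U01 (normal_of_unif @^-1` `[x, +oo[%classic) = gam `[x, +oo[%classic.
  rewrite unif_leb; last by rewrite -[X in measurable X]setTI; apply: mq; [exact: measurableT|exact: mI].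
  have -> : normal_of_unif @^-1` `[x, +oo[%classic = [set u | x <= normal_of_unif u].
    by apply/seteqP; split => u /=; rewrite in_itv/= andbT.
  rewrite preim_ge -tailE.
  have t0 : 0 <= normal_tail x by exact: fine_ge0.
  have t1 : normal_tail x <= 1 by rewrite -lee_fin tailE probability_le1.
  have [t1'|t1'] := ltP (normal_tail x) 1.
    rewrite setIidl; last first.
      move=> u /=; rewrite !in_itv/= => /andP[-> h]/=; exact: le_lt_trans h t1'.
    rewrite lebesgue_measure_itv/= lte_fin.
    case: ltP => h; first by rewrite -EFinB subr0.
    by congr EFin; apply/eqP; rewrite eq_le t0 h.
  have -> : normal_tail x = 1 by apply/eqP; rewrite eq_le t1 t1'.
  rewrite setIidr; last by move=> u /=; rewrite !in_itv/= => /andP[-> /ltW ->].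
  by rewrite lebesgue_measure_itv/= lte_fin ltr01 -EFinB subr0.
have E A : measurable A -> nu mq A = gam A.
  apply: measure_eq_rays => x.
    rewrite (_ : nu mq _ = U01 (normal_of_unif @^-1` `]-oo, x[%classic))//.
    apply: (le_lt_trans (probability_le1 U01 _)); last exact: ltry.
    by rewrite -[X in measurable X]setTI; apply: mq; [exact: measurableT|exact: mI].
  rewrite (_ : nu mq _ = U01 (normal_of_unif @^-1` `]-oo, x[%classic))//.
  have mp : measurable (normal_of_unif @^-1` `[x, +oo[%classic : set (measurableTypeR R)).
    by rewrite -[X in measurable X]setTI; apply: mq; [exact: measurableT|exact: mI].
  have h1 := @probability_setC _ _ _ U01 _ mp.
  have h2 := @probability_setC _ _ _ gam _ (mIy x).
  rewrite -[X in _ = gam X]setCitvr -[X in _ @^-1` X]setCitvr.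
  by rewrite preimage_setC h1 h2 tail.
transitivity (\int[nu mq]_x f x)%E; first by rewrite ge0_integral_pushforward.
by apply: eq_measure_integral => A mA _; exact: E.
Qed.

End quantile.

(** The odd digits are split again and again; the even digits of the k-th
    remainder feed the k-th variable. *)
Definition normal_seq (R : realType) (k : nat) (w : measurableTypeR R) : R :=
  normal_of_unif (even_bits (iter k (@odd_bits R) w)).

Section normal_seq.
Variable R : realType.
Notation U01 := (unif R).
Notation gam := (std_normal R).

Lemma measurable_normal_seq k : measurable_fun setT (@normal_seq R k).
Proof.
have mi : measurable_fun [set: R] (iter k (@odd_bits R)).
  elim: k => [|k IH]; first exact: measurable_id.
  exact: (measurableT_comp (@measurable_odd_bits R) IH).
exact: (measurableT_comp (@measurable_normal_of_unif R)
  (measurableT_comp (@measurable_even_bits R) mi)).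
Qed.

Lemma normal_seqS k (w : R) : normal_seq k.+1 w = normal_seq k (odd_bits w).
Proof. by rewrite /normal_seq iterSr. Qed.

Let msum N (c : nat -> R) :
  measurable_fun [set: R] (fun w : R => \sum_(k < N) c k * normal_seq k (w : measurableTypeR R)).
Proof.
apply: measurable_sum => k; apply: measurable_funM => //.
exact: measurable_normal_seq.
Qed.

(** Induction on the number of terms: the first variable and the remainder are
    independent, and stability of the normal law adds the variances. *)
Lemma ge0_integral_normal_seq N (c : nat -> R) (f : R -> \bar R) :
  measurable_fun [set: R] f -> (forall x, 0 <= f x)%E ->
  (\int[U01]_w f (\sum_(k < N) c k * normal_seq k (w : measurableTypeR R))%R =
   \int[gam]_x f (Num.sqrt (\sum_(k < N) c k ^+ 2) * x)%R)%E.
Proof.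
elim: N c f => [|N IH] c f mf f0.
  under eq_integral do rewrite big_ord0.
  under [RHS]eq_integral do rewrite big_ord0 sqrtr0 mul0r.
  rewrite !integral_cst; [|exact: measurableT..].
  by rewrite [X in (_ * X)%E = _](@probability_setT _ _ _ U01)
    [X in _ = (_ * X)%E](@probability_setT _ _ _ gam).
pose c' k := c k.+1.
pose s := Num.sqrt (\sum_(k < N) c' k ^+ 2).
have s2 : s ^+ 2 = \sum_(k < N) c' k ^+ 2.
  by rewrite sqr_sqrtr// sumr_ge0// => k _; rewrite sqr_ge0.
pose F (z : R * R) := f (c 0%N * normal_of_unif z.1 + \sum_(k < N) c' k * normal_seq k z.2).
have mF : measurable_fun setT F.
  apply: (measurableT_comp mf); apply: measurable_funD.
    apply: measurable_funM => //.
    exact: (measurableT_comp (@measurable_normal_of_unif R) measurable_fst).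
  exact: (measurableT_comp (msum N c') measurable_snd).
transitivity (\int[U01]_w F (even_bits w, odd_bits w))%E.
  apply: eq_integral => w _; rewrite /F big_ord_recl/=; congr (f (_ + _)).
  by apply: eq_bigr => k _; rewrite normal_seqS.
rewrite (ge0_integral_bits mF (fun z => f0 _)).
transitivity (\int[U01]_u \int[gam]_y f (c 0%N * normal_of_unif u + s * y)%R)%E.
  apply: eq_integral => u _; rewrite /F/=.
  have mfu : measurable_fun [set: R] (fun x => f (c 0%N * normal_of_unif u + x)%R).
    by apply: (measurableT_comp mf); exact: measurable_funD.
  exact: (IH c' (fun x => f (c 0%N * normal_of_unif u + x)%R) mfu (fun x => f0 _)).
pose H (z : R * R) := f (c 0%N * z.1 + s * z.2).
have mH : measurable_fun setT H.
  by apply: (measurableT_comp mf); apply: measurable_funD; apply: measurable_funM.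
have mG := @measurable_fun_fubini_tonelli_F _ _ _ _ _ gam _ mH (fun z => f0 _).
rewrite (@ge0_integral_normal_of_unif R (fun x => \int[gam]_y f (c 0%N * x + s * y)%R)%E mG);
  last by move=> x; exact: integral_ge0.
have := @ge0_integral_normal_conv R (c 0%N) s f mf f0.
by rewrite s2 big_ord_recl. 
Qed.

(** The variables are indexed by an arbitrary countable type through its
    numbering, which is how the Fourier coefficients of the limit field will be
    indexed. *)
Lemma normal_seq_law (I : countType) (r : seq I) (a : I -> R) : uniq r ->
  has_gaussian_law U01 (fun w => \sum_(i <- r) a i * normal_seq (pickle i) (w : measurableTypeR R))
    0 (\sum_(i <- r) a i ^+ 2).
Proof.
move=> ur.
pose N := (\max_(i <- r) pickle i).+1.
pose c k := \sum_(i <- r | pickle i == k) a i.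
have ltN i : i \in r -> (pickle i < N)%N.
  by move=> ir; rewrite ltnS; exact: leq_bigmax_seq.
have cE i : i \in r -> c (pickle i) = a i.
  move=> ir; rewrite /c (big_rem i)//= eqxx big_seq_cond big1 ?addr0// => j.
  rewrite mem_rem_uniq// => /andP[/andP[ji _] /eqP/(pcan_inj pickleK) jE].
  by rewrite jE eqxx in ji.
have sumE (F : nat -> R -> R) : (forall k, F k 0 = 0) ->
    \sum_(k < N) F k (c k) = \sum_(i <- r) F (pickle i) (a i).
  move=> F0.
  transitivity (\sum_(i <- r) \sum_(k < N | k == pickle i :> nat) F k (c k)); last first.
    apply: eq_big_seq => i ir /=; rewrite (big_pred1 (Ordinal (ltN i ir))) ?cE//.
  rewrite (exchange_big_dep predT)//=; apply: eq_bigr => k _.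
  have [/hasP[i ir /eqP ik]|nh] := boolP (has (fun i => pickle i == k) r).
    rewrite -ik (eq_bigl (fun j => j == i)); last first.
      by move=> j; apply/eqP/eqP => [/(pcan_inj pickleK)->|->].
    by rewrite -big_filter filter_pred1_uniq// big_seq1.
  rewrite big_hasC; last by rewrite (eq_has (a2 := fun i => pickle i == k))// => i; rewrite eq_sym.
  by rewrite /c big_hasC.
have v0 : 0 <= \sum_(i <- r) a i ^+ 2.
  by apply: sumr_ge0 => i _; rewrite sqr_ge0.
apply: gaussian_law_lipschitz => //.
  apply: measurable_sum => i; apply: measurable_funM => //.
  exact: measurable_normal_seq.
move=> L h hL h01.
have mh : measurable_fun [set: R] (fun x => (h x)%:E).
  by apply/measurable_EFinP; exact: lipschitz_by_measurable hL.
have := @ge0_integral_normal_seq N c (fun x => (h x)%:E) mh.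
move=> /(_ _)H.
rewrite -(sumE (fun _ x => x ^+ 2)); last by move=> _; rewrite expr0n.
rewrite -H; last by move=> x; rewrite lee_fin; case/andP: (h01 x).
apply: eq_integral => w _; congr (h _)%:E.
rewrite (sumE (fun k x => x * normal_seq k (w : measurableTypeR R)))//.
by move=> k; rewrite mul0r.
Qed.

End normal_seq.

(** * Iterated integrals on the torus *)

Section slices.
Variable R : realType.

Definition cons_mx d (t : R) (x : 'rV[R]_d) : 'rV[R]_d.+1 :=
  row_mx (const_mx t : 'rV_1) x.

Lemma cons_mx0 d t (x : 'rV[R]_d) : cons_mx t x 0 ord0 = t.
Proof.
by rewrite /cons_mx mxE; case: splitP => [j _|j //]; rewrite mxE.
Qed.

Lemma cons_mxS d t (x : 'rV[R]_d) i : cons_mx t x 0 (lift ord0 i) = x 0 i.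
Proof.
rewrite /cons_mx mxE; case: splitP => [[[]//]|j /= [] ij].
by congr (x 0 _); exact/val_inj/esym.
Qed.

Lemma cons_mxD d t s (x y : 'rV[R]_d) :
  cons_mx t x + cons_mx s y = cons_mx (t + s) (x + y).
Proof.
apply/rowP => i; rewrite mxE; case: (unliftP ord0 i) => [j ->|->].
  by rewrite !cons_mxS mxE.
by rewrite !cons_mx0.
Qed.

Lemma cons_mxP d (x : 'rV[R]_d.+1) :
  x = cons_mx (x 0 ord0) (\row_i x 0 (lift ord0 i)).
Proof.
apply/rowP => i; case: (unliftP ord0 i) => [j ->|->].
  by rewrite cons_mxS mxE.
by rewrite cons_mx0.
Qed.

Definition torus1 : set R := `[- 2^-1, 2^-1]%classic.

Lemma torus_intS d (f : 'rV[R]_d.+1 -> R) :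
  torus_int f = \int[@lebesgue_measure R]_(t in torus1)
    torus_int (fun x : 'rV[R]_d => f (cons_mx t x)).
Proof. by []. Qed.

Lemma measurable_torus1 : measurable (torus1 : set (measurableTypeR R)).
Proof. exact: measurable_itv. Qed.

Lemma lebesgue_torus1 : @lebesgue_measure R torus1 = 1%E.
Proof.
rewrite lebesgue_measure_itv/= lte_fin ifT; last by lra.
by rewrite -EFinD; congr EFin; lra.
Qed.

Lemma integrable_torus1 (f : R -> R) (M : R) : measurable_fun [set: R] f ->
  (forall t, `|f t| <= M) ->
  (@lebesgue_measure R).-integrable torus1 (EFin \o f).
Proof.
move=> mf fM.
apply: (@le_integrable _ _ _ (@lebesgue_measure R) torus1 measurable_torus1 _ (cst M%:E)).
- by apply/measurable_EFinP; exact: measurable_funTS.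
- by move=> x _ /=; rewrite lee_fin (le_trans (fM x))// ler_norm.
- apply/integrableP; split; first exact: measurable_cst.
  rewrite integral_cst; last exact: measurable_torus1.
  by rewrite [X in (_ * X)%E]lebesgue_torus1 mule1/= ltry.
Qed.

Lemma Rintegral_torus1_cst (c : R) :
  \int[@lebesgue_measure R]_(t in torus1) c = c.
Proof.
rewrite Rintegral_cst; last exact: measurable_torus1.
by rewrite [X in _ * fine X]lebesgue_torus1 mulr1.
Qed.

(** Measurability in the sense required by an iterated integral: every inner
    integral is a measurable function of the outer variable, recursively.
    Together with boundedness it makes the iterated integral linear and
    monotone. *)
Fixpoint slice_measurable d : ('rV[R]_d -> R) -> Prop :=
  if d is d'.+1 then fun f =>
    (forall t, slice_measurable (fun x : 'rV[R]_d' => f (cons_mx t x))) /\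
    measurable_fun [set: R] (fun t => torus_int (fun x : 'rV[R]_d' => f (cons_mx t x)))
  else fun=> True.

Definition torus_nice d (f : 'rV[R]_d -> R) : Prop :=
  (exists M, forall x, `|f x| <= M) /\ slice_measurable f.

Lemma torus_nice_slice d (f : 'rV[R]_d.+1 -> R) t :
  torus_nice f -> torus_nice (fun x => f (cons_mx t x)).
Proof. by move=> [[M fM] [sm _]]; split; [exists M => x; exact: fM|exact: sm]. Qed.

Lemma torus_int_cst d (c : R) : torus_int (fun _ : 'rV[R]_d => c) = c.
Proof.
elim: d => [|d IH] //; rewrite torus_intS.
by under eq_Rintegral do rewrite IH; rewrite Rintegral_torus1_cst.
Qed.

Lemma torus_int_bounds d (f : 'rV[R]_d -> R) (M : R) : torus_nice f ->
  (forall x, `|f x| <= M) -> `|torus_int f| <= M.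
Proof.
elim: d f => [|d IH] f nf fM; first exact: fM.
have sM t : `|torus_int (fun x : 'rV[R]_d => f (cons_mx t x))| <= M.
  by apply: IH => //; exact: torus_nice_slice.
have [_ [_ mf]] := nf.
rewrite torus_intS ler_norml; apply/andP; split.
- rewrite -[leLHS]Rintegral_torus1_cst; apply: le_Rintegral.
  + exact: measurable_torus1.
  + by apply: (@integrable_torus1 _ `|M|) => // t; rewrite normrN.
  + exact: integrable_torus1 mf sM.
  + by move=> t _; have := sM t; rewrite ler_norml => /andP[].
- rewrite -[leRHS]Rintegral_torus1_cst; apply: le_Rintegral.
  + exact: measurable_torus1.
  + exact: integrable_torus1 mf sM.
  + by apply: (@integrable_torus1 _ `|M|).
  + by move=> t _; have := sM t; rewrite ler_norml => /andP[].
Qed.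

Let slice_int d (f : 'rV[R]_d.+1 -> R) : torus_nice f ->
  (@lebesgue_measure R).-integrable torus1
    (EFin \o (fun t => torus_int (fun x : 'rV[R]_d => f (cons_mx t x)))).
Proof.
move=> nf; have [[M fM] [_ mf]] := nf.
apply: (integrable_torus1 mf (M := M)) => t.
by apply: torus_int_bounds => //; exact: torus_nice_slice.
Qed.

Lemma torus_niceD d (f g : 'rV[R]_d -> R) : torus_nice f -> torus_nice g ->
  torus_nice (fun x => f x + g x) /\
  torus_int (fun x => f x + g x) = torus_int f + torus_int g.
Proof.
elim: d f g => [|d IH] f g nf ng.
  split => //; split => //; have [[M fM] _] := nf; have [[N gN] _] := ng.
  by exists (M + N) => x; apply: (le_trans (ler_normD _ _)); exact: lerD.
have H t := IH _ _ (torus_nice_slice t nf) (torus_nice_slice t ng).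
have E : (fun t => torus_int (fun x : 'rV[R]_d => f (cons_mx t x) + g (cons_mx t x))) =
    (fun t => torus_int (fun x : 'rV[R]_d => f (cons_mx t x)) +
              torus_int (fun x : 'rV[R]_d => g (cons_mx t x))).
  by apply/funext => t; rewrite (H t).2.
have [[M fM] [sf mf]] := nf; have [[N gN] [sg mg]] := ng.
split.
  split.
    by exists (M + N) => x; apply: (le_trans (ler_normD _ _)); exact: lerD.
  split; first by move=> t; have [[]] := H t.
  by rewrite E; exact: measurable_funD.
rewrite !torus_intS E RintegralD//; [exact: measurable_torus1|exact: slice_int..].
Qed.

Lemma torus_niceZ d (c : R) (f : 'rV[R]_d -> R) : torus_nice f ->
  torus_nice (fun x => c * f x) /\ torus_int (fun x => c * f x) = c * torus_int f.
Proof.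
elim: d f => [|d IH] f nf.
  split => //; split => //; have [[M fM] _] := nf.
  by exists (`|c| * M) => x; rewrite normrM ler_wpM2l.
have H t := IH _ (torus_nice_slice t nf).
have E : (fun t => torus_int (fun x : 'rV[R]_d => c * f (cons_mx t x))) =
    (fun t => c * torus_int (fun x : 'rV[R]_d => f (cons_mx t x))).
  by apply/funext => t; rewrite (H t).2.
have [[M fM] [sf mf]] := nf.
split.
  split; first by exists (`|c| * M) => x; rewrite normrM ler_wpM2l.
  split; first by move=> t; have [[]] := H t.
  by rewrite E; exact: measurable_funM.
rewrite !torus_intS E RintegralZl//; [exact: measurable_torus1|exact: slice_int].
Qed.

Lemma torus_nice_cst d (c : R) : torus_nice (fun _ : 'rV[R]_d => c).
Proof.
split; first by exists `|c|.
elim: d => [|d IH]; first by [].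
split; first by move=> t; exact: IH.
have -> : (fun t : R => torus_int (fun _ : 'rV[R]_d => c)) = cst c.
  by apply/funext => t; exact: torus_int_cst.
exact: measurable_cst.
Qed.

Lemma torus_nice_sum d (I : Type) (r : seq I) (F : I -> 'rV[R]_d -> R) :
  (forall i, torus_nice (F i)) ->
  torus_nice (fun x => \sum_(i <- r) F i x) /\
  torus_int (fun x => \sum_(i <- r) F i x) = \sum_(i <- r) torus_int (F i).
Proof.
move=> nF; elim: r => [|i r [nS IH]].
  rewrite big_nil; under eq_fun do rewrite big_nil.
  by split; [exact: torus_nice_cst|exact: torus_int_cst].
have [nD DE] := torus_niceD (nF i) nS.
rewrite big_cons -IH -DE; under eq_fun do rewrite big_cons.
by split => //; congr torus_int; apply/funext => x; rewrite big_cons.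
Qed.

Lemma torus_int_ge0 d (f : 'rV[R]_d -> R) : (forall x, 0 <= f x) -> 0 <= torus_int f.
Proof.
elim: d f => [|d IH] f f0; first exact: f0.
by rewrite torus_intS; apply: Rintegral_ge0 => t _; exact: IH.
Qed.

Lemma torus_niceB d (f g : 'rV[R]_d -> R) : torus_nice f -> torus_nice g ->
  torus_nice (fun x => f x - g x) /\
  torus_int (fun x => f x - g x) = torus_int f - torus_int g.
Proof.
move=> nf ng; have [n1 e1] := torus_niceZ (-1) ng.
have [n2 e2] := torus_niceD nf n1.
have E : (fun x => f x - g x) = (fun x => f x + -1 * g x).
  by apply/funext => x; rewrite mulN1r.
by rewrite E e2 e1 mulN1r.
Qed.

Lemma le_torus_int d (f g : 'rV[R]_d -> R) : torus_nice f -> torus_nice g ->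
  (forall x, f x <= g x) -> torus_int f <= torus_int g.
Proof.
move=> nf ng fg; rewrite -subr_ge0 -(torus_niceB ng nf).2.
by apply: torus_int_ge0 => x; rewrite subr_ge0.
Qed.

Definition l1dist d (x y : 'rV[R]_d) : R := \sum_i `|x 0 i - y 0 i|.

Definition l1_lipschitz d (L : R) (f : 'rV[R]_d -> R) : Prop :=
  forall x y, `|f x - f y| <= L * l1dist x y.

Definition box_indic d (A : 'I_d -> set R) (x : 'rV[R]_d) : R :=
  \prod_i \1_(A i) (x 0 i).

Lemma box_indic01 d (A : 'I_d -> set R) x : 0 <= box_indic A x <= 1.
Proof.
rewrite /box_indic; apply: (big_ind (fun y : R => 0 <= y <= 1)).
- by rewrite ler01 lexx.
- by move=> u v /andP[u0 u1] /andP[v0 v1]; rewrite mulr_ge0//= mulr_ile1.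
- by move=> i _; rewrite indicE; case: (_ \in _); rewrite /= ?lexx ?ler01.
Qed.

(** The class that is actually used: Lipschitz functions times products of
    one-dimensional indicators. A slice is of the same form, and its integral is
    Lipschitz in the outer variable times an indicator. *)
Lemma torus_nice_lip_box d (L M : R) (f : 'rV[R]_d -> R) (A : 'I_d -> set R) :
  l1_lipschitz L f -> (forall x, `|f x| <= M) -> (forall i, measurable (A i)) ->
  torus_nice (fun x => f x * box_indic A x).
Proof.
elim: d L M f A => [|d IH] L M f A fL fM mA.
  split => //; exists M => x; rewrite /box_indic big_ord0 mulr1; exact: fM.
have bnd x : `|f x * box_indic A x| <= M.
  rewrite normrM; have /andP[b0 b1] := box_indic01 A x.
  rewrite (ger0_norm b0); apply: le_trans (fM x).
  by rewrite ler_piMr.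
have E t (x : 'rV[R]_d) : f (cons_mx t x) * box_indic A (cons_mx t x) =
    \1_(A ord0) t * (f (cons_mx t x) * box_indic (fun i => A (lift ord0 i)) x).
  rewrite /box_indic big_ord_recl cons_mx0 mulrCA; congr (_ * (_ * _)).
  by apply: eq_bigr => i _; rewrite cons_mxS.
have ls t : l1_lipschitz L (fun x : 'rV[R]_d => f (cons_mx t x)).
  move=> x y; apply: (le_trans (fL _ _)); rewrite /l1dist big_ord_recl !cons_mx0.
  by rewrite subrr normr0 add0r; under eq_bigr do rewrite !cons_mxS.
have ns t := IH L M _ (fun i => A (lift ord0 i)) (ls t) (fun x => fM _) (fun i => mA _).
split; first by exists M.
have EE t : (fun x : 'rV[R]_d => f (cons_mx t x) * box_indic A (cons_mx t x)) =
    (fun x => \1_(A ord0) t * (f (cons_mx t x) * box_indic (fun i => A (lift ord0 i)) x)).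
  by apply/funext.
split => [t|]; first by rewrite EE; exact: (torus_niceZ _ (ns t)).1.2.
have -> : (fun t => torus_int (fun x : 'rV[R]_d => f (cons_mx t x) * box_indic A (cons_mx t x))) =
    (fun t => \1_(A ord0) t *
      torus_int (fun x => f (cons_mx t x) * box_indic (fun i => A (lift ord0 i)) x)).
  by apply/funext => t; rewrite EE (torus_niceZ _ (ns t)).2.
apply: measurable_funM; first exact: measurable_indic.
apply: continuous_measurable_fun.
have GL t s : `|torus_int (fun x => f (cons_mx t x) * box_indic (fun i => A (lift ord0 i)) x) -
    torus_int (fun x => f (cons_mx s x) * box_indic (fun i => A (lift ord0 i)) x)| <= L * `|t - s|.
  have [nb <-] := torus_niceB (ns t) (ns s).
  apply: torus_int_bounds => // x; rewrite -mulrBl normrM.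
  have /andP[b0 b1] := box_indic01 (fun i => A (lift ord0 i)) x.
  rewrite (ger0_norm b0); apply: le_trans (_ : `|f (cons_mx t x) - f (cons_mx s x)| <= _).
    by rewrite ler_piMr.
  apply: (le_trans (fL _ _)); rewrite /l1dist big_ord_recl !cons_mx0 big1 ?addr0//.
  by move=> i _; rewrite !cons_mxS subrr normr0.
move=> t; apply/cvgrPdist_lt => e e0.
have d0 : 0 < e / (`|L| + 1) by rewrite divr_gt0// ltr_wpDl.
apply/nbhs_ballP; exists (e / (`|L| + 1)) => //= s ts.
apply: (le_lt_trans (GL _ _)).
move: ts; rewrite /ball/= ltr_pdivlMr ?ltr_wpDl// mulrC; apply: le_lt_trans.
by rewrite ler_wpM2r// (le_trans (ler_norm _))// lerDl.
Qed.

Lemma torus_nice_lip d (L M : R) (f : 'rV[R]_d -> R) :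
  l1_lipschitz L f -> (forall x, `|f x| <= M) -> torus_nice f.
Proof.
move=> fL fM.
have := torus_nice_lip_box fL fM (fun _ : 'I_d => @measurableT _ R).
have -> // : (fun x => f x * box_indic (fun=> setT) x) = f.
apply/funext => x; rewrite /box_indic big1 ?mulr1// => i _.
by rewrite indicE in_setT.
Qed.

End slices.

Section translation.
Variable R : realType.
Notation leb := (@lebesgue_measure R).

Let ge0_shift (F : R -> \bar R) (a b h : R) : measurable_fun [set: R] F ->
  (forall x, 0 <= F x)%E ->
  (\int[leb]_(t in `[a, b[) F (t + h)%R = \int[leb]_(t in `[(a + h)%R, (b + h)%R[) F t)%E.
Proof.
move=> mF F0; rewrite [LHS]integral_mkcond [RHS]integral_mkcond.
rewrite [RHS](@ge0_lebesgue_affine R 1 h)//; last 2 first.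
- by apply/(measurable_restrictT _ _).1; [exact: measurable_itv|exact: measurable_funTS].
- by apply: erestrict_ge0.
rewrite mul1e; apply: eq_integral => t _; rewrite mul1r !patchE.
by rewrite !mem_setE !in_itv/= lerD2r ltrD2r.
Qed.

Let ge0_split (F : R -> \bar R) (a b c : R) : measurable_fun [set: R] F ->
  (forall x, 0 <= F x)%E -> a <= b -> b <= c ->
  (\int[leb]_(t in `[a, c[) F t =
   \int[leb]_(t in `[a, b[) F t + \int[leb]_(t in `[b, c[) F t)%E.
Proof.
move=> mF F0 ab bc.
have -> : `[a, c[%classic = `[a, b[ `|` `[b, c[%classic :> set R.
  apply/seteqP; split => x /=; rewrite !in_itv/=.
    by move=> /andP[-> ->]; case: (ltP x b) => _; [left|right].
  by case=> /andP[h1 h2]; apply/andP; split; lra.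
rewrite ge0_integral_setU//=; first by exact: measurable_funTS.
rewrite disj_set2E; apply/eqP/seteqP; split => x //=; rewrite !in_itv/=.
by move=> [/andP[_ h1] /andP[+ _]]; rewrite leNgt h1.
Qed.

Lemma periodic1_int (T : Type) (F : R -> T) : (forall t, F (t + 1) = F t) ->
  forall (k : int) t, F (t + k%:~R) = F t.
Proof.
move=> FP; have Fn (n : nat) t : F (t + n%:R) = F t.
  by elim: n => [|n IH]; rewrite ?addr0// -natr1 addrA FP.
case=> n t; first exact: Fn.
by rewrite NegzE mulrNz -[RHS](Fn n.+1) -(Fn n.+1 (t - _)) subrK -(Fn n.+1 t).
Qed.

(** Reduced to a shift in [0, 1), where the piece leaving on the right is
    brought back on the left by periodicity. *)
Lemma ge0_integral_periodic_shift (F : R -> \bar R) (h : R) :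
  measurable_fun [set: R] F -> (forall x, 0 <= F x)%E ->
  (forall t, F (t + 1)%R = F t) ->
  (\int[leb]_(t in @torus1 R) F (t + h)%R = \int[leb]_(t in @torus1 R) F t)%E.
Proof.
move=> mF F0 FP.
have mFh : measurable_fun [set: R] (fun t => F (t + h)%R).
  by apply: (measurableT_comp mF); exact: measurable_funD.
rewrite -(@integral_itv_bndo_bndc R (BLeft (- 2^-1)) 2^-1); last exact: measurable_funTS.
rewrite -(@integral_itv_bndo_bndc R (BLeft (- 2^-1)) 2^-1); last exact: measurable_funTS.
pose r := h - (Num.floor h)%:~R.
have r01 : 0 <= r < 1.
  rewrite /r; have := floor_itv h; rewrite intrD => /andP[h1 h2].
  by apply/andP; split; lra.
have -> : (fun t => F (t + h)%R) = (fun t => F (t + r)%R).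
  by apply/funext => t; rewrite -(periodic1_int FP (Num.floor h) (t + r)) /r addrA subrK.
have /andP[r0 r1] := r01.
rewrite ge0_shift// (@ge0_split _ _ 2^-1)//; [|lra|lra].
rewrite [RHS](@ge0_split _ _ (- 2^-1 + r))//; [|lra|lra].
have e1 : - 2^-1 + 1 = 2^-1 :> R by lra.
have e2 : - 2^-1 + r + 1 = 2^-1 + r :> R by lra.
have e : (\int[leb]_(t in `[(2^-1)%R, (2^-1 + r)%R[) F t = \int[leb]_(t in `[(- 2^-1)%R, (- 2^-1 + r)%R[) F t)%E.
  rewrite -e2 -[X in `[X, _[]e1 -ge0_shift//.
  by apply: eq_integral => t _; rewrite FP.
by rewrite e addeC.
Qed.

Lemma Rintegral_periodic_shift (G : R -> R) (M h : R) :
  measurable_fun [set: R] G -> (forall t, `|G t| <= M) ->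
  (forall t, G (t + 1) = G t) ->
  \int[leb]_(t in @torus1 R) G (t + h) = \int[leb]_(t in @torus1 R) G t.
Proof.
move=> mG GM GP.
have mGh : measurable_fun [set: R] (fun t => G (t + h)).
  by apply: (measurableT_comp mG); exact: measurable_funD.
have i1 := integrable_torus1 mGh (fun t => GM _).
have i2 := integrable_torus1 mG GM.
have i3 : leb.-integrable (@torus1 R) (EFin \o cst M).
  by apply: (@integrable_torus1 R _ `|M|) => //; exact: measurable_cst.
have H : \int[leb]_(t in @torus1 R) (G (t + h) + M) = \int[leb]_(t in @torus1 R) (G t + M).
  rewrite /Rintegral; congr fine.
  apply: (@ge0_integral_periodic_shift (fun t => (G t + M)%:E)).
  - by apply/measurable_EFinP; exact: measurable_funD.
  - by move=> t; rewrite lee_fin -lerBlDr sub0r; have := GM t; rewrite ler_norml => /andP[].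
  - by move=> t; rewrite GP.
move: H; rewrite RintegralD//; [|exact: measurable_torus1].
by rewrite RintegralD//; [move=> /addIr|exact: measurable_torus1].
Qed.

Lemma rowDE d (x y : 'rV[R]_d) i : (x + y) 0 i = x 0 i + y 0 i.
Proof. by rewrite mxE. Qed.

Lemma row_intrE d (k : 'rV[int]_d) i : (map_mx intr k : 'rV[R]_d) 0 i = (k 0 i)%:~R.
Proof. by rewrite mxE. Qed.

Lemma periodic_slice d (f : 'rV[R]_d.+1 -> R) t :
  Defs.periodic f -> Defs.periodic (fun x => f (cons_mx t x)).
Proof.
move=> pf k x.
rewrite -[RHS](pf (\row_i oapp (fun j => k 0 j) 0 (unlift ord0 i))); congr f.
apply/rowP => i; rewrite rowDE row_intrE [X in X%:~R]mxE.
case: (unliftP ord0 i) => [j ->|->].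
  by rewrite !cons_mxS rowDE row_intrE.
by rewrite !cons_mx0 /= addr0.
Qed.

Lemma torus_int_shift d (f : 'rV[R]_d -> R) (v : 'rV[R]_d) :
  Defs.periodic f -> torus_nice f -> torus_int (fun x => f (x + v)) = torus_int f.
Proof.
elim: d f v => [|d IH] f v pf nf.
  by rewrite /=; congr f; apply/rowP => -[].
have [[M fM] [_ mf]] := nf.
rewrite !torus_intS.
pose G t := torus_int (fun x : 'rV[R]_d => f (cons_mx t x)).
have -> : (fun t => torus_int (fun x : 'rV[R]_d => f (cons_mx t x + v))) =
    (fun t => G (t + v 0 ord0)).
  apply/funext => t; rewrite /G -(IH (fun x => f (cons_mx (t + v 0 ord0) x)) (\row_i v 0 (lift ord0 i))).
  - by congr torus_int; apply/funext => x; rewrite -cons_mxD -cons_mxP.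
  - exact: periodic_slice.
  - exact: torus_nice_slice.
apply: (@Rintegral_periodic_shift G M) => // t.
  by apply: torus_int_bounds => //; exact: torus_nice_slice.
rewrite /G; congr torus_int; apply/funext => x.
rewrite -[RHS](pf (\row_i oapp (fun=> 0) 1 (unlift ord0 i))); congr f.
apply/rowP => i; rewrite rowDE row_intrE [X in X%:~R]mxE.
case: (unliftP ord0 i) => [j ->|->].
  by rewrite !cons_mxS /= addr0.
by rewrite !cons_mx0 /= mulr1z.
Qed.

End translation.

(** * Fourier modes *)

Section trig_bounds.
Variable R : realType.
Implicit Types x y : R.

Lemma derive_lipschitz (f : R -> R) (L : R) :
  (forall x, derivable f x 1) -> (forall x, `|'D_1 f x| <= L) ->
  lipschitz_by L f.
Proof.
move=> df fL; suff H a b : a <= b -> `|f a - f b| <= L * `|a - b|.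
  move=> a b; have [ab|ba] := leP a b; first exact: H.
  by rewrite distrC [`|a - b|]distrC; apply: H; exact: ltW.
move=> ab.
have [||c _ E] := @MVT_segment R f (fun x => 'D_1 f x) a b ab.
- by move=> x _; apply: DeriveDef.
- apply: continuous_subspaceT => x; apply: differentiable_continuous.
  exact/derivable1_diffP.
by rewrite distrC E normrM [`|a - b|]distrC ler_wpM2r.
Qed.

Lemma sin_lipschitz : lipschitz_by 1 (@sin R).
Proof.
apply: derive_lipschitz => x; first exact: derivable_sin.
by rewrite derive_val cos_max.
Qed.

Lemma cos_lipschitz : lipschitz_by 1 (@cos R).
Proof.
apply: derive_lipschitz => x; first exact: derivable_cos.
by rewrite derive_val normrN sin_max.
Qed.

Lemma normr_sin_le x : `|sin x| <= `|x|.
Proof. by have := sin_lipschitz x 0; rewrite sin0 !subr0 mul1r. Qed.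

Lemma cos_ge_sqr x : 1 - x ^+ 2 / 2 <= cos x.
Proof.
have E : cos x = 1 - 2 * sin (x / 2) ^+ 2.
  have {1}-> : x = (x / 2) *+ 2 by field.
  by rewrite cos_mulr2n cos2sin2; ring.
have h : sin (x / 2) ^+ 2 <= (x / 2) ^+ 2.
  by rewrite -(real_normK (num_real (sin _))) -(real_normK (num_real (x / 2)))
    lerXn2r ?nnegrE// normr_sin_le.
rewrite E; move: h; rewrite expr_div_n; lra.
Qed.

(** A crude Jordan inequality; the constant only has to be positive. *)
Lemma sin_ge_quarter x : 0 <= x <= pi / 2 -> x / 4 <= sin x.
Proof.
have small y : 0 <= y <= 1 -> y / 2 <= sin y.
  move=> /andP[y0 y1].
  have [|c + E] := @MVT_segment R (@sin R) (@cos R) 0 y y0.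
    exact: (continuous_subspaceT (@continuous_sin R)).
  rewrite in_itv/= => /andP[c0 cy].
  move: E; rewrite sin0 !subr0 => ->; rewrite mulrC ler_wpM2r//.
  have := cos_ge_sqr c; have : c ^+ 2 <= 1 by rewrite expr_le1// (le_trans cy).
  by move=> ? ?; lra.
move=> /andP[x0 x2]; have [x1|x1] := leP x 1.
  have := small x; rewrite x0 x1 => /(_ isT); lra.
have px := pihalf_lt2 R.
have : sin 1 <= sin x.
  rewrite le_eqVlt; apply/orP; right; rewrite ltr_sin ?in_itv//=.
  - by rewrite pihalf_ge1 andbT (le_trans _ ler01)// oppr_le0 divr_ge0// pi_ge0.
  - by rewrite x2 andbT (le_trans _ x0)// oppr_le0 divr_ge0// pi_ge0.
have := small 1; rewrite ler01 lexx => /(_ isT); lra.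
Qed.

Lemma sin2pi_int (k : int) x : sin (x + 2 * pi * k%:~R) = sin x.
Proof.
have P : forall t, sin (2 * pi * (t + 1)) = sin (2 * pi * t) :> R.
  move=> t; by rewrite mulrDr mulr1 [2 * pi]mulrC mulr_natr sinD2pi.
have Q := periodic1_int P k (x / (2 * pi)).
have pi0 : 2 * pi != 0 :> R by rewrite mulf_neq0// gt_eqF// pi_gt0.
have E t : x + 2 * pi * t = 2 * pi * (x / (2 * pi) + t).
  by rewrite (mulrDr (2 * pi)) (mulrCA (2 * pi) x) mulfV// mulr1.
by rewrite E Q (mulrCA (2 * pi) x) mulfV// mulr1.
Qed.

Lemma cos2pi_int (k : int) x : cos (x + 2 * pi * k%:~R) = cos x.
Proof.
have P : forall t, cos (2 * pi * (t + 1)) = cos (2 * pi * t) :> R.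
  move=> t; by rewrite mulrDr mulr1 [2 * pi]mulrC mulr_natr cosD2pi.
have Q := periodic1_int P k (x / (2 * pi)).
have pi0 : 2 * pi != 0 :> R by rewrite mulf_neq0// gt_eqF// pi_gt0.
have E t : x + 2 * pi * t = 2 * pi * (x / (2 * pi) + t).
  by rewrite (mulrDr (2 * pi)) (mulrCA (2 * pi) x) mulfV// mulr1.
by rewrite E Q (mulrCA (2 * pi) x) mulfV// mulr1.
Qed.

End trig_bounds.

Section modes.
Variables (R : realType) (d : nat).
Implicit Types (nu mu : 'rV[int]_d) (x y v : 'rV[R]_d) (b c : bool).

Definition bounded_lipschitz (f : 'rV[R]_d -> R) : Prop :=
  exists L M, [/\ 0 <= L, 0 <= M, l1_lipschitz L f & forall x, `|f x| <= M].

Lemma l1dist_ge0 x y : 0 <= l1dist x y.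
Proof. exact: sumr_ge0. Qed.

Lemma bounded_lipschitzD f g : bounded_lipschitz f -> bounded_lipschitz g ->
  bounded_lipschitz (fun x => f x + g x).
Proof.
move=> [L [M [L0 M0 fL fM]]] [K [N [K0 N0 gK gN]]].
exists (L + K), (M + N); split; rewrite ?addr_ge0//.
- move=> x y; rewrite opprD addrACA mulrDl.
  by apply: (le_trans (ler_normD _ _)); apply: lerD.
- by move=> x; apply: (le_trans (ler_normD _ _)); apply: lerD.
Qed.

Lemma bounded_lipschitzM f g : bounded_lipschitz f -> bounded_lipschitz g ->
  bounded_lipschitz (fun x => f x * g x).
Proof.
move=> [L [M [L0 M0 fL fM]]] [K [N [K0 N0 gK gN]]].
exists (L * N + M * K), (M * N); split; rewrite ?addr_ge0 ?mulr_ge0//.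
- move=> x y.
  have -> : f x * g x - f y * g y = (f x - f y) * g x + f y * (g x - g y) by ring.
  apply: (le_trans (ler_normD _ _)); rewrite !normrM mulrDl; apply: lerD.
  + rewrite -mulrA [N * _]mulrC mulrA; exact: ler_pM.
  + rewrite -mulrA; exact: ler_pM.
- by move=> x; rewrite normrM; exact: ler_pM.
Qed.

Lemma bounded_lipschitz_cst (a : R) : bounded_lipschitz (fun=> a).
Proof.
exists 0, `|a|; split => //.
by move=> x y; rewrite subrr normr0 mul0r.
Qed.

Lemma bounded_lipschitz_sum (I : Type) (r : seq I) (F : I -> 'rV[R]_d -> R) :
  (forall i, bounded_lipschitz (F i)) ->
  bounded_lipschitz (fun x => \sum_(i <- r) F i x).
Proof.
move=> nF; elim: r => [|i r IH].
  under eq_fun do rewrite big_nil; exact: bounded_lipschitz_cst.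
under eq_fun do rewrite big_cons; exact: bounded_lipschitzD.
Qed.

Lemma bounded_lipschitz_nice f : bounded_lipschitz f -> torus_nice f.
Proof. by move=> [L [M [_ _ fL fM]]]; exact: torus_nice_lip fL fM. Qed.

Lemma bounded_lipschitz_box_nice f (A : 'I_d -> set R) : bounded_lipschitz f ->
  (forall i, measurable (A i)) -> torus_nice (fun x => f x * box_indic A x).
Proof. by move=> [L [M [_ _ fL fM]]] mA; exact: torus_nice_lip_box fL fM mA. Qed.

Lemma zdotD nu x y : zdot nu (x + y) = zdot nu x + zdot nu y :> R.
Proof. by rewrite /zdot -big_split/=; apply: eq_bigr => i _; rewrite mxE mulrDr. Qed.

Lemma zdot_int nu (k : 'rV[int]_d) :
  zdot nu (map_mx intr k) = (\sum_i nu 0 i * k 0 i)%:~R :> R.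
Proof. by rewrite /zdot rmorph_sum; apply: eq_bigr => i _; rewrite mxE rmorphM. Qed.

Lemma zdotDl nu mu x : zdot (nu + mu) x = zdot nu x + zdot mu x :> R.
Proof.
by rewrite /zdot -big_split/=; apply: eq_bigr => i _; rewrite mxE intrD mulrDl.
Qed.

Lemma zdotNl nu x : zdot (- nu) x = - zdot nu x :> R.
Proof.
by rewrite /zdot -sumrN; apply: eq_bigr => i _; rewrite mxE mulrNz mulNr.
Qed.

Lemma zdot0l x : zdot 0 x = 0 :> R.
Proof. by rewrite /zdot big1// => i _; rewrite mxE mul0r. Qed.

(** The real Fourier basis, cosine for [false] and sine for [true]. Both a
    frequency and its opposite are kept in all sums, so that the expansion of f
    is the sum of coef f * mode over all frequencies, without a choice of
    half-lattice. *)
Definition mode (nu : 'rV[int]_d) (b : bool) (x : 'rV[R]_d) : R :=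
  if b then sin (2 * pi * zdot nu x) else cos (2 * pi * zdot nu x).

Arguments mode : simpl never.

Lemma mode_le1 nu b x : `|mode nu b x| <= 1.
Proof. by case: b; [exact: sin_max|exact: cos_max]. Qed.

Lemma mode_lipschitz nu b :
  l1_lipschitz (2 * pi * \sum_i `|(nu 0 i)%:~R|) (mode nu b).
Proof.
move=> x y.
have p0 : 0 <= 2 * pi :> R by rewrite mulr_ge0// pi_ge0.
apply: (@le_trans _ _ (`|2 * pi * zdot nu x - 2 * pi * zdot nu y|)).
  by rewrite -[leRHS]mul1r; case: b; [exact: sin_lipschitz|exact: cos_lipschitz].
rewrite -mulrBr normrM ger0_norm// -mulrA ler_wpM2l//.
rewrite /zdot -sumrB; apply: (le_trans (ler_norm_sum _ _ _)).
rewrite mulr_suml; apply: ler_sum => i _; rewrite -mulrBr normrM ler_wpM2l//.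
by rewrite /l1dist (bigD1 i)//= lerDl sumr_ge0.
Qed.

Lemma mode_bounded_lipschitz nu b : bounded_lipschitz (mode nu b).
Proof.
exists (2 * pi * \sum_i `|(nu 0 i)%:~R|), 1; split => //.
- by rewrite !mulr_ge0// ?pi_ge0// sumr_ge0.
- exact: mode_lipschitz.
- exact: mode_le1.
Qed.

Lemma mode_periodic nu b : Defs.periodic (mode nu b).
Proof.
move=> k x; rewrite /mode zdotD zdot_int mulrDr.
by rewrite sin2pi_int cos2pi_int.
Qed.

Lemma mode0 b x : mode 0 b x = (~~ b)%:R.
Proof. by rewrite /mode zdot0l mulr0 sin0 cos0; case: b. Qed.

Lemma modeN nu b x : mode (- nu) b x = (-1) ^+ b * mode nu b x.
Proof.
rewrite /mode zdotNl mulrN cosN sinN; case: b; first by rewrite expr1 mulN1r.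
by rewrite expr0 mul1r.
Qed.

(** Translating by half a period changes the sign of the mode and not its
    integral. *)
Lemma mode_int_eq0 nu b : nu != 0 -> torus_int (mode nu b) = 0.
Proof.
move=> nu0; have [i nui] : exists i, nu 0 i != 0.
  apply/existsP; apply: contraNT nu0; rewrite negb_exists => /forallP H.
  by apply/eqP/rowP => i; rewrite mxE; have := H i; rewrite negbK => /eqP.
have nuR : (nu 0 i)%:~R != 0 :> R by rewrite intr_eq0.
pose v : 'rV[R]_d := \row_j if j == i then (2 * (nu 0 i)%:~R)^-1 else 0.
have zv : 2 * pi * zdot nu v = pi.
  rewrite /zdot (bigD1 i)//= big1 ?addr0; last first.
    by move=> j ji; rewrite mxE (negbTE ji) mulr0.
  by rewrite mxE eqxx; field.
have nm := bounded_lipschitz_nice (mode_bounded_lipschitz nu b).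
have := torus_int_shift v (@mode_periodic nu b) nm.
have -> : (fun x => mode nu b (x + v)) = (fun x => -1 * mode nu b x).
  apply/funext => x; rewrite mulN1r /mode zdotD mulrDr zv.
  by rewrite (sinDpi (2 * pi * zdot nu x)) (cosDpi (2 * pi * zdot nu x)); case: (b).
rewrite (torus_niceZ _ nm).2 mulN1r => /eqP; rewrite eq_sym -addr_eq0 -mulr2n.
by rewrite mulrn_eq0 => /eqP.
Qed.

Lemma torus_int_mode nu b : torus_int (mode nu b) = ((nu == 0) && ~~ b)%:R.
Proof.
have [->|nu0] := eqVneq nu 0; last exact: mode_int_eq0.
rewrite (_ : mode 0 b = fun=> (~~ b)%:R) ?torus_int_cst//.
by apply/funext => x; exact: mode0.
Qed.

(** The product formulas in one statement; only the coefficients of the case b =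
    c matter afterwards, since a mode of odd type has zero integral. *)
Lemma mode_prod nu mu b c : exists2 a : R * R,
  (forall x, mode nu b x * mode mu c x =
    a.1 * mode (nu - mu) (b (+) c) x + a.2 * mode (nu + mu) (b (+) c) x) &
  b = c -> a = (2^-1, (-1) ^+ b * 2^-1).
Proof.
have h x : (mode (nu - mu) false x = mode nu false x * mode mu false x +
    mode nu true x * mode mu true x) /\
  (mode (nu + mu) false x = mode nu false x * mode mu false x -
    mode nu true x * mode mu true x).
  by rewrite /mode; split; rewrite zdotDl ?zdotNl ?mulrBr ?cosB// mulrDr cosD.
have h' x : (mode (nu - mu) true x = mode nu true x * mode mu false x -
    mode nu false x * mode mu true x) /\
  (mode (nu + mu) true x = mode nu true x * mode mu false x +
    mode nu false x * mode mu true x).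
  by rewrite /mode; split; rewrite zdotDl ?zdotNl ?mulrBr ?sinB// mulrDr sinD.
case: b; case: c => /=.
- exists (2^-1, (-1) ^+ 1 * 2^-1) => // x /=; have [-> ->] := h x; by field.
- exists (2^-1, 2^-1) => // x /=; have [-> ->] := h' x; by field.
- exists (- 2^-1, 2^-1) => // x /=; have [-> ->] := h' x; by field.
- exists (2^-1, (-1) ^+ 0 * 2^-1) => // x /=; have [-> ->] := h x; by field.
Qed.

(** Orthogonality, with the coupling of a frequency and its opposite. *)
Lemma torus_int_modeM nu mu b c :
  torus_int (fun x => mode nu b x * mode mu c x) =
  (b == c)%:R * 2^-1 * ((nu == mu)%:R + (-1) ^+ b * (nu == - mu)%:R).
Proof.
have [[a a'] H1 H2] := mode_prod nu mu b c.
have n1 := bounded_lipschitz_nice (mode_bounded_lipschitz (nu - mu) (b (+) c)).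
have n2 := bounded_lipschitz_nice (mode_bounded_lipschitz (nu + mu) (b (+) c)).
rewrite (_ : (fun x => _) = (fun x => a * mode (nu - mu) (b (+) c) x +
  a' * mode (nu + mu) (b (+) c) x)); last by apply/funext => x; rewrite H1.
have [n1' e1] := torus_niceZ a n1; have [n2' e2] := torus_niceZ a' n2.
rewrite (torus_niceD n1' n2').2 e1 e2 !torus_int_mode subr_eq0 addr_eq0.
have [bc|bc] := eqVneq b c; last first.
  by rewrite -addbC -negb_eqb [c == b]eq_sym bc /= !andbF !mulr0 !mul0r addr0.
by have [-> ->] := H2 bc; rewrite bc addbb !andbT mul1r mulrDr mulrCA mulrA.
Qed.

End modes.

(** * Smooth periodic functions *)

Section smooth_periodic.
Variables (R : realType) (d : nat).
Implicit Types (f g : 'rV[R]_d -> R) (x y v : 'rV[R]_d) (i : 'I_d).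

Notation dir i := (delta_mx 0 i : 'rV[R]_d).

Lemma line_quotient f x v (t : R) :
  (fun h : R => h^-1 *: (((fun u : R => f (u *: v + x)) \o shift t) (h *: 1) -
     f (t *: v + x))) =
  (fun h : R => h^-1 *: ((f \o shift (t *: v + x)) (h *: v) - f (t *: v + x))).
Proof.
apply/funext => h /=; congr (_ *: (f _ - _)).
by rewrite /GRing.scale/= mulr1 -/(GRing.scale _ _) scalerDl addrA.
Qed.

(** Partial derivatives are derivatives along lines, which gives access to the
    one-variable calculus and its mean value theorem. *)
Lemma is_derive_line f x v (t df : R) : is_derive (t *: v + x) v f df ->
  is_derive t 1 (fun u : R => f (u *: v + x)) df.
Proof.
move=> [ex e]; apply: DeriveDef.
  by rewrite /derivable line_quotient.
by rewrite /derive line_quotient.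
Qed.

Lemma is_derive_of_line f x v (df : R) :
  is_derive (0 : R) 1 (fun u : R => f (u *: v + x)) df -> is_derive x v f df.
Proof.
have E := line_quotient f x v 0; rewrite scale0r add0r in E.
move=> [ex e]; apply: DeriveDef.
  by move: ex; rewrite /derivable scale0r add0r E.
by move: e; rewrite /derive scale0r add0r E.
Qed.

Lemma deriv_periodic f v : Defs.periodic f -> Defs.periodic (fun x => 'D_v f x).
Proof.
move=> pf k x; rewrite /derive.
suff -> : (fun h : R => h^-1 *: ((f \o shift (x + map_mx intr k)) (h *: v) -
    f (x + map_mx intr k))) = (fun h => h^-1 *: ((f \o shift x) (h *: v) - f x)) by [].
by apply/funext => h /=; rewrite addrA !pf.
Qed.

Lemma smooth_deriv f i : smooth f -> smooth (fun x => 'D_(dir i) f x).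
Proof.
move=> sf l; have := sf (rcons l i).
by rewrite /iter_partial -cats1 foldr_cat.
Qed.

Lemma shift_quotient f v x (w : 'rV[R]_d) :
  (fun h : R => h^-1 *: (((fun y => f (y + v)) \o shift x) (h *: w) - f (x + v))) =
  (fun h : R => h^-1 *: ((f \o shift (x + v)) (h *: w) - f (x + v))).
Proof. by apply/funext => h /=; rewrite addrA. Qed.

Lemma iter_partial_shift f v l :
  iter_partial l (fun x => f (x + v)) = (fun x => iter_partial l f (x + v)).
Proof.
elim: l => [//|i l IH] /=; rewrite IH; apply/funext => x; rewrite /derive.
by rewrite shift_quotient.
Qed.

Lemma smooth_shift f v : smooth f -> smooth (fun x => f (x + v)).
Proof.
move=> sf l; rewrite iter_partial_shift; have [cf df] := sf l; split.
  move=> x; apply: (@continuous_comp _ _ _ (fun y => y + v)); last exact: cf.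
  by apply: continuousD; [move=> ?|exact: cst_continuous].
by move=> i x; have := df i (x + v); rewrite /derivable shift_quotient.
Qed.

Lemma smooth_continuous f : smooth f -> continuous f.
Proof. by move=> sf; have [] := sf [::]. Qed.

Lemma smooth_derivable f i x : smooth f -> derivable f x (dir i).
Proof. by move=> sf; have [_] := sf [::]; apply. Qed.

(** Every point is a lattice translate of a point of a compact cube. *)
Lemma continuous_periodic_bounded f : continuous f -> Defs.periodic f ->
  exists2 M, 0 <= M & forall x, `|f x| <= M.
Proof.
move=> cf pf.
have cK : compact [set v : 'rV[R]_d | forall i, `[0, 1]%classic (v ord0 i)].
  by apply: (@rV_compact R d (fun=> `[0, 1]%classic)) => i; exact: segment_compact.
have [M [_ HM]] := compact_bounded (continuous_compact (continuous_subspaceT cf) cK).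
have M1 : M < `|M| + 1 by rewrite (le_lt_trans (ler_norm M))// ltrDl.
exists (`|M| + 1); first by rewrite addr_ge0.
move=> x; rewrite -(pf (\row_i - Num.floor (x 0 i)) x).
apply: (HM _ M1); exists (x + map_mx intr (\row_i - Num.floor (x 0 i))) => //= i.
rewrite in_itv/= rowDE row_intrE mxE.
have := floor_itv (x 0 i); rewrite intrD rmorphN/= => /andP[h1 h2].
by apply/andP; split; lra.
Qed.

(** Mean value theorem along a coordinate line. *)
Lemma partial_lipschitz f i (M h : R) x : smooth f ->
  (forall y, `|'D_(dir i) f y| <= M) ->
  `|f (x + h *: dir i) - f x| <= M * `|h|.
Proof.
move=> sf fM; pose g (u : R) := f (u *: dir i + x).
have dg (t : R) : is_derive t 1 g ('D_(dir i) f (t *: dir i + x)).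
  by apply: is_derive_line; apply: DeriveDef => //; exact: smooth_derivable.
have gL : lipschitz_by M g.
  apply: derive_lipschitz => t; first by have [] := dg t.
  by have [_ ->] := dg t.
by have := gL h 0; rewrite /g scale0r add0r subr0 [_ *: _ + x]addrC.
Qed.

(** Moving one coordinate at a time, with the bounded partial derivatives. *)
Lemma smooth_periodic_lipschitz f : smooth f -> Defs.periodic f ->
  bounded_lipschitz f.
Proof.
move=> sf pf.
have [M M0 fM] := continuous_periodic_bounded (smooth_continuous sf) pf.
have H i : exists2 L, 0 <= L & forall x, `|'D_(dir i) f x| <= L.
  apply: continuous_periodic_bounded; last exact: deriv_periodic.
  exact: smooth_continuous (smooth_deriv i sf).
pose Li i := xget 0 [set L | 0 <= L /\ forall x, `|'D_(dir i) f x| <= L].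
have LiP i : 0 <= Li i /\ forall x, `|'D_(dir i) f x| <= Li i.
  have [L L0 HL] := H i.
  by apply: (@xgetPex _ 0 [set L | 0 <= L /\ forall x, `|'D_(dir i) f x| <= L]); exists L.
pose L := \sum_i Li i.
have L0 : 0 <= L by apply: sumr_ge0 => i _; have [] := LiP i.
have LL i : Li i <= L.
  by rewrite /L (bigD1 i)//= lerDl sumr_ge0// => j _; have [] := LiP j.
exists L, M; split => // x y.
pose z (k : nat) : 'rV[R]_d := \row_j if (j < k)%N then y 0 j else x 0 j.
have z0 : z 0%N = x by apply/rowP => j; rewrite mxE.
have zd : z d = y by apply/rowP => j; rewrite mxE ltn_ord.
have step (k : 'I_d) : `|f (z k.+1) - f (z k)| <= L * `|x 0 k - y 0 k|.
  have -> : z k.+1 = z k + (y 0 k - x 0 k) *: dir k.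
    apply/rowP => j; rewrite !mxE eqxx/= ltnS leq_eqVlt val_eqE.
    have [->|jk] := eqVneq j k; first by rewrite ltnn mulr1 addrC subrK.
    by rewrite /= mulr0 addr0.
  rewrite distrC [`|x 0 k - _|]distrC.
  apply: (le_trans _ (ler_wpM2r (normr_ge0 _) (LL k))).
  by rewrite distrC; apply: partial_lipschitz => //; have [] := LiP k.
rewrite -z0 -zd distrC -(telescope_sumr (fun k => f (z k)))// big_mkord.
rewrite z0 zd; apply: (le_trans (ler_norm_sum _ _ _)).
rewrite /l1dist mulr_sumr; apply: ler_sum => k _; exact: step.
Qed.

Lemma iter_partial_lin (c : R) f g l : smooth f -> smooth g ->
  iter_partial l (fun x => c * f x + g x) =
  (fun x => c * iter_partial l f x + iter_partial l g x).
Proof.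
move=> sf sg; elim: l => [//|i l IH] /=; rewrite IH; apply/funext => x.
have [_ df] := sf l; have [_ dg] := sg l.
have h1 := df i x; have h2 := dg i x.
rewrite (_ : (fun x => _) = c *: iter_partial l f + iter_partial l g)//.
by rewrite deriveD ?deriveZ//; exact: derivableZ.
Qed.

Lemma smooth_lin (c : R) f g : smooth f -> smooth g ->
  smooth (fun x => c * f x + g x).
Proof.
move=> sf sg l; rewrite iter_partial_lin//.
have [cf df] := sf l; have [cg dg] := sg l; split.
- move=> x.
  have h1 : {for x, continuous (fun x => c * iter_partial l f x)}.
    by apply: (@continuousM _ _ (fun=> c)); [exact: cst_continuous|exact: cf].
  exact: (continuousD h1 (cg x)).
- move=> i x.
  rewrite (_ : (fun x => _) = c *: iter_partial l f + iter_partial l g)//.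
  by apply: derivableD; [apply: derivableZ; exact: df|exact: dg].
Qed.

Lemma smooth_cst (c : R) : smooth (fun _ : 'rV[R]_d => c).
Proof.
have E l : exists c', iter_partial l (fun _ : 'rV[R]_d => c) = fun=> c'.
  elim: l => [|i l [c' IH]] /=; first by exists c.
  by exists 0; rewrite IH; apply/funext => x; rewrite (derive_cst c').
move=> l; have [c' ->] := E l; split; first by move=> x; exact: cst_continuous.
by move=> i x; exact: derivable_cst.
Qed.

Lemma mode_deriv nu b i x :
  is_derive x (dir i) (@mode R d nu b)
    (((-1) ^+ (~~ b) * (2 * pi * (nu 0 i)%:~R)) * mode nu (~~ b) x).
Proof.
apply: is_derive_of_line.
pose A := 2 * pi * zdot nu x; pose B : R := 2 * pi * (nu 0 i)%:~R.
have zE u : 2 * pi * zdot nu (u *: dir i + x) = B * u + A.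
  rewrite zdotD mulrDr; congr (_ + _); rewrite /zdot (bigD1 i)//= big1 ?addr0.
    by rewrite mxE mxE !eqxx mulr1 /B; ring.
  by move=> j ji; rewrite !mxE (negbTE ji) andbF !mulr0.
have dl : is_derive (0 : R) 1 (fun u : R => B * u + A) B.
  have := is_deriveD (is_deriveZ B (is_derive_id (0 : R) 1)) (is_derive_cst A (0 : R) 1).
  by rewrite addr0 /GRing.scale/= mulr1.
have l0 : B * 0 + A = A by rewrite mulr0 add0r.
case: b; rewrite /mode/=.
- rewrite (_ : (fun u => _) = (@sin R) \o (fun u => B * u + A)); last first.
    by apply/funext => u /=; rewrite zE.
  have ds : is_derive ((fun u : R => B * u + A) 0) 1 (@sin R) (cos A).
    by rewrite l0; exact: is_derive_sin.
  rewrite expr0 mul1r mulrC; exact: is_derive1_comp.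
- rewrite (_ : (fun u => _) = (@cos R) \o (fun u => B * u + A)); last first.
    by apply/funext => u /=; rewrite zE.
  have ds : is_derive ((fun u : R => B * u + A) 0) 1 (@cos R) (- sin A).
    by rewrite l0; exact: is_derive_cos.
  rewrite expr1 mulN1r mulNr -mulrN mulrC; exact: is_derive1_comp.
Qed.

Lemma l1_lipschitz_continuous (L : R) f : l1_lipschitz L f -> continuous f.
Proof.
move=> fL x A /nbhs_ballP[e e0 HA].
have D0 : 0 < (`|L| + 1) * d.+1%:R by rewrite mulr_gt0// ltr_wpDl.
have d0 : 0 < e / ((`|L| + 1) * d.+1%:R) by rewrite divr_gt0.
apply/nbhs_ballP; exists (e / ((`|L| + 1) * d.+1%:R)) => //= y xy; apply: HA.
apply: (le_lt_trans (fL _ _)).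
have lt1 i : `|x 0 i - y 0 i| <= e / ((`|L| + 1) * d.+1%:R).
  by apply: ltW; exact: (xy.2 0 i).
have : l1dist x y <= d%:R * (e / ((`|L| + 1) * d.+1%:R)).
  apply: (@le_trans _ _ (\sum_(i < d) (e / ((`|L| + 1) * d.+1%:R)))).
    by apply: ler_sum => i _; exact: lt1.
  by rewrite sumr_const card_ord mulr_natl.
have l0 := l1dist_ge0 x y.
move=> h; apply: (@le_lt_trans _ _ ((`|L| + 1) * (d%:R * (e / ((`|L| + 1) * d.+1%:R))))).
  apply: (@le_trans _ _ ((`|L| + 1) * l1dist x y)).
    by apply: ler_wpM2r => //; rewrite (le_trans (ler_norm L))// lerDl.
  by apply: ler_wpM2l => //; rewrite addr_ge0.
have L1 : 0 < `|L| + 1 by rewrite ltr_wpDl.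
have -> : (`|L| + 1) * (d%:R * (e / ((`|L| + 1) * d.+1%:R))) = e * (d%:R / d.+1%:R).
  move: (lt0r_neq0 L1) (lt0r_neq0 (ltr0Sn R d)); move: (`|L| + 1) d.+1%:R => a b a0 b0.
  by field; rewrite a0 b0.
by rewrite gtr_pMr// ltr_pdivrMr// mul1r ltr_nat.
Qed.

(** Partial derivatives exchange the two modes of a frequency up to a constant,
    so all iterated derivatives are multiples of modes. *)
Lemma mode_smooth nu b : smooth (@mode R d nu b).
Proof.
have E l : exists c b', iter_partial l (@mode R d nu b) = fun x => c * mode nu b' x.
  elim: l => [|i l [c [b' IH]]] /=.
    by exists 1, b; apply/funext => x; rewrite mul1r.
  exists (c * ((-1) ^+ (~~ b') * (2 * pi * (nu 0 i)%:~R))), (~~ b').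
  rewrite IH; apply/funext => x.
  have [ex e] := mode_deriv nu b' i x.
  rewrite (_ : (fun x => _) = c *: mode nu b')//.
  by rewrite deriveZ// e /GRing.scale/= mulrA.
move=> l; have [c [b' ->]] := E l; split.
- move=> x; apply: continuousM; first exact: cst_continuous.
  exact: (l1_lipschitz_continuous (@mode_lipschitz _ _ nu b')).
- move=> i x; rewrite (_ : (fun x => _) = c *: mode nu b')//.
  by apply: derivableZ; have [] := mode_deriv nu b' i x.
Qed.

Lemma test_function_lin (c : R) f g : test_function f -> test_function g ->
  test_function (fun x => c * f x + g x).
Proof.
move=> [pf sf f0] [pg sg g0]; split.
- by move=> k x; rewrite pf pg.
- exact: smooth_lin.
- have nf := bounded_lipschitz_nice (smooth_periodic_lipschitz sf pf).
  have ng := bounded_lipschitz_nice (smooth_periodic_lipschitz sg pg).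
  have [nZ eZ] := torus_niceZ c nf.
  by rewrite (torus_niceD nZ ng).2 eZ f0 g0 mulr0 addr0.
Qed.

Lemma test_function0 : test_function (fun _ : 'rV[R]_d => 0).
Proof.
split; first by [].
- exact: smooth_cst.
- exact: torus_int_cst.
Qed.

Lemma test_function_sum (I : Type) (r : seq I) (a : I -> R)
    (F : I -> 'rV[R]_d -> R) : (forall j, test_function (F j)) ->
  test_function (fun x => \sum_(i <- r) a i * F i x).
Proof.
move=> tF; elim: r => [|i r IH].
  under eq_fun do rewrite big_nil; exact: test_function0.
under eq_fun do rewrite big_cons; exact: test_function_lin.
Qed.

Lemma mode_test_function nu b : nu != 0 -> test_function (@mode R d nu b).
Proof.
move=> nu0; split; [exact: mode_periodic|exact: mode_smooth|exact: mode_int_eq0].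
Qed.

Lemma test_function_lipschitz f : test_function f -> bounded_lipschitz f.
Proof. by move=> [pf sf _]; exact: smooth_periodic_lipschitz. Qed.

End smooth_periodic.

(** * Convergence of finite Gaussian families *)

Section trig_polynomials.
Variables (R : realType) (I : finType).
Implicit Types (y c : I -> R) (g h : (I -> R) -> R).

(** Real combinations of the functions y -> cos (c . y + t). Their expectations
    only involve one-dimensional laws, those of the linear combinations c . y.
    *)
Inductive trig_poly : ((I -> R) -> R) -> Prop :=
| TrigCos c t : trig_poly (fun y => cos (\sum_i c i * y i + t))
| TrigLin (a : R) g h : trig_poly g -> trig_poly h ->
    trig_poly (fun y => a * g y + h y).

Lemma trig_cst (a : R) : trig_poly (fun=> a).
Proof.
have E : (fun y : I -> R => a) = (fun y =>
    (a - 1) * cos (\sum_i 0 * y i + 0) + cos (\sum_i 0 * y i + 0)).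
  apply/funext => y; rewrite big1 ?addr0 ?cos0 ?mulr1 ?subrK//.
  by move=> i _; rewrite mul0r.
rewrite E; exact: TrigLin (TrigCos (fun=> 0) 0) (TrigCos (fun=> 0) 0).
Qed.

Lemma trig_scale (a : R) g : trig_poly g -> trig_poly (fun y => a * g y).
Proof.
move=> tg; have := TrigLin a tg (trig_cst 0).
by congr trig_poly; apply/funext => y; rewrite addr0.
Qed.

Lemma trig_add g h : trig_poly g -> trig_poly h -> trig_poly (fun y => g y + h y).
Proof.
move=> tg th; have := TrigLin 1 tg th.
by congr trig_poly; apply/funext => y; rewrite mul1r.
Qed.

Lemma trig_mul g h : trig_poly g -> trig_poly h -> trig_poly (fun y => g y * h y).
Proof.
move=> tg th; elim: tg => {g} [c t|a g1 g2 _ IH1 _ IH2]; last first.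
  have := TrigLin a IH1 IH2; congr trig_poly; apply/funext => y; ring.
elim: th => {h} [e s|a g1 g2 _ IH1 _ IH2]; last first.
  have := TrigLin a IH1 IH2; congr trig_poly; apply/funext => y; ring.
have := trig_scale 2^-1 (trig_add (TrigCos (fun i => c i - e i) (t - s))
  (TrigCos (fun i => c i + e i) (t + s))).
congr trig_poly; apply/funext => y.
set A := \sum_i c i * y i + t; set B := \sum_i e i * y i + s.
have -> : \sum_i (c i - e i) * y i + (t - s) = A - B.
  rewrite /A /B opprD addrACA -sumrB; congr (_ + _); apply: eq_bigr => i _; ring.
have -> : \sum_i (c i + e i) * y i + (t + s) = A + B.
  rewrite /A /B addrACA -big_split; congr (_ + _); apply: eq_bigr => i _ /=; ring.
by rewrite (cosB A B) (cosD A B); move: (cos A) (sin A) (cos B) (sin B) => *; field.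
Qed.

Lemma trig_sum (J : Type) (r : seq J) (F : J -> (I -> R) -> R) :
  (forall j, trig_poly (F j)) -> trig_poly (fun y => \sum_(j <- r) F j y).
Proof.
move=> tF; elim: r => [|j r IH].
  by under eq_fun do rewrite big_nil; exact: trig_cst.
by under eq_fun do rewrite big_cons; exact: trig_add.
Qed.

Lemma trig_prod (J : Type) (r : seq J) (F : J -> (I -> R) -> R) :
  (forall j, trig_poly (F j)) -> trig_poly (fun y => \prod_(j <- r) F j y).
Proof.
move=> tF; elim: r => [|j r IH].
  by under eq_fun do rewrite big_nil; exact: trig_cst.
by under eq_fun do rewrite big_cons; exact: trig_mul.
Qed.

Lemma trig_exp g k : trig_poly g -> trig_poly (fun y => g y ^+ k).
Proof.
move=> tg; elim: k => [|k IH]; first exact: trig_cst.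
by under eq_fun do rewrite exprS; exact: trig_mul.
Qed.

Lemma trig_sin_coord (a : R) i : trig_poly (fun y => sin (y i * a)).
Proof.
have := TrigCos (fun j => if j == i then a else 0) (- (pi / 2)).
congr trig_poly; apply/funext => y.
rewrite (bigD1 i)//= eqxx big1 ?addr0.
  by rewrite cosB cos_pihalf sin_pihalf mulr0 add0r mulr1 mulrC.
by move=> j ji; rewrite (negbTE ji) mul0r.
Qed.

Lemma trig_bounded g : trig_poly g -> exists2 M, 0 <= M & forall y, `|g y| <= M.
Proof.
elim=> {g} [c t|a g h _ [M M0 gM] _ [N N0 hN]].
  by exists 1 => // y; exact: cos_max.
exists (`|a| * M + N); first by rewrite addr_ge0 ?mulr_ge0.
by move=> y; apply: (le_trans (ler_normD _ _)); rewrite normrM lerD ?ler_wpM2l.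
Qed.

End trig_polynomials.

Section bernstein.
Variable R : realType.
Implicit Types (p t : R) (m k : nat).

Definition bern m p k : R := p ^+ k * (1 - p) ^+ (m - k) *+ 'C(m, k).

Lemma bern_ge0 m p k : 0 <= p <= 1 -> 0 <= bern m p k.
Proof.
by move=> /andP[p0 p1]; rewrite mulrn_wge0// mulr_ge0// exprn_ge0// subr_ge0.
Qed.

Lemma sum_bern m p : \sum_(k < m.+1) bern m p k = 1.
Proof.
have := exprDn (1 - p) p m; rewrite subrK expr1n => ->.
by apply: eq_bigr => k _; rewrite /bern mulrC.
Qed.

Lemma bern_moments m p :
  (\sum_(k < m.+1) bern m p k * k%:R = m%:R * p) /\
  (\sum_(k < m.+1) bern m p k * (k%:R * (k%:R - 1)) = m%:R * (m%:R - 1) * p ^+ 2).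
Proof.
have M1 j : \sum_(k < j.+1) bern j p k * k%:R = j%:R * p.
  case: j => [|j]; first by rewrite big_ord1 mulr0 mul0r.
  rewrite big_ord_recl mulr0 add0r.
  transitivity (j.+1%:R * p * \sum_(k < j.+1) bern j p k); last by rewrite sum_bern mulr1.
  rewrite mulr_sumr.
  apply: eq_bigr => k _; rewrite /bern lift0 subSS exprS.
  have := mul_bin_diag j.+1 k; move=> /(congr1 (fun u => u%:R : R)); rewrite !natrM => E.
  rewrite -[_ *+ 'C(j.+1, _)]mulr_natr -[_ *+ 'C(j, _)]mulr_natr.
 transitivity (p * p ^+ k * (1 - p) ^+ (j - k) * (k.+1%:R * 'C(j.+1, k.+1)%:R)); first by ring.
  by rewrite -E; ring.
split; first exact: M1.
case: m => [|j]; first by rewrite big_ord1 !mul0r mulr0.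
rewrite big_ord_recl mul0r mulr0 add0r.
transitivity (j.+1%:R * p * (j%:R * p)); last by rewrite -natr1; ring.
rewrite -(M1 j) mulr_sumr; apply: eq_bigr => k _; rewrite /bern lift0 subSS exprS.
have := mul_bin_diag j.+1 k; move=> /(congr1 (fun u => u%:R : R)); rewrite !natrM => E.
rewrite -[_ *+ 'C(j.+1, _)]mulr_natr -[_ *+ 'C(j, _)]mulr_natr.
transitivity (p * p ^+ k * (1 - p) ^+ (j - k) * (k.+1%:R * 'C(j.+1, k.+1)%:R) * (k.+1%:R - 1)); first by ring.
by rewrite -E -natr1; ring.
Qed.

(** The variance of the binomial law gives concentration at scale m^(-1/2). The
    first moment is bounded by |t| <= u/2 + t^2/(2u) in place of
    Cauchy--Schwarz, the scale u being chosen later. *)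
Lemma bern_dev m p (u : R) : (0 < m)%N -> 0 <= p <= 1 -> 0 < u ->
  \sum_(k < m.+1) bern m p k * `|k%:R / m%:R - p| <= u / 2 + (m%:R * u)^-1.
Proof.
move=> m0 p01 u0; have m0R : m%:R != 0 :> R by rewrite pnatr_eq0 -lt0n.
have u0' := lt0r_neq0 u0; have /andP[p0 p1] := p01.
have [M1 M2] := bern_moments m p; have M0 := sum_bern m p.
have V : \sum_(k < m.+1) bern m p k * (k%:R / m%:R - p) ^+ 2 = p * (1 - p) / m%:R.
  transitivity (\sum_(k < m.+1) ((m%:R ^+ 2)^-1 * (bern m p k * (k%:R * (k%:R - 1)))
      + ((m%:R ^+ 2)^-1 - 2 * p / m%:R) * (bern m p k * k%:R) + p ^+ 2 * bern m p k)).
    by apply: eq_bigr => k _; field.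
  rewrite !big_split/= -!mulr_sumr M0 M1 M2; by field.
apply: (@le_trans _ _ (\sum_(k < m.+1) (u / 2 * bern m p k +
   (2 * u)^-1 * (bern m p k * (k%:R / m%:R - p) ^+ 2)))).
  apply: ler_sum => k _; set x := _ - p.
  rewrite mulrCA [u / 2 * _]mulrC -mulrDr ler_wpM2l ?bern_ge0//.
  have -> : u / 2 + (2 * u)^-1 * x ^+ 2 = `|x| + (2 * u)^-1 * (`|x| - u) ^+ 2.
    by rewrite -(real_normK (num_real x)); field.
  by rewrite lerDl mulr_ge0 ?sqr_ge0// invr_ge0 mulr_ge0// ltW.
rewrite big_split/= -!mulr_sumr M0 V mulr1 lerD2l.
have -> : (2 * u)^-1 * (p * (1 - p) / m%:R) = (m%:R * u)^-1 * (p * (1 - p) / 2) by field; rewrite u0' m0R.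
rewrite ler_piMr ?invr_ge0 ?mulr_ge0 ?(ltW u0)//.
have : p * (1 - p) <= 1 * 1 by apply: ler_pM => //; lra.
lra.
Qed.

End bernstein.

Lemma Rintegral_dist_le (R : realType) d (T : measurableType d)
    (P : probability T R) (f g h : T -> R) (M K : R) :
  measurable_fun setT f -> (forall w, `|f w| <= M) ->
  measurable_fun setT g -> (forall w, `|g w| <= M) ->
  measurable_fun setT h -> (forall w, `|f w - g w| <= h w) ->
  (\int[P]_w (h w)%:E <= K%:E)%E ->
  `|\int[P]_w f w - \int[P]_w g w| <= K.
Proof.
move=> mf fM mg gM mh fgh hK.
have i1 := integrable_bounded_prob P mf fM; have i2 := integrable_bounded_prob P mg gM.
rewrite -(@RintegralB _ _ _ P _ _ _ measurableT i1 i2).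
have i3 := integrableB measurableT i1 i2.
have mB : measurable_fun setT (fun w => f w - g w) by exact: measurable_funB.
rewrite -lee_fin (EFin_normr_Rintegral measurableT i3).
apply: le_trans hK.
apply: (le_trans (le_abse_integral P measurableT (measurable_int P i3))).
apply: ge0_le_integral => //.
- by apply: measurableT_comp => //; apply/measurable_EFinP; exact: mB.
- by apply/measurable_EFinP; exact: mh.
- by move=> w _; rewrite lee_fin; exact: fgh.
Qed.

Section bernstein_sine.
Variable R : realType.
Implicit Types (t u : R).

(** The difference of sines is 2 cos u sin v with u and v the half-sum and
    half-difference, and cos u is bounded below because b stays away from the
    endpoints. *)
Lemma sin_expand a b : `|b| <= 2^-1 :> R -> `|a| <= pi / 2 ->
  `|a - b| <= 20 * `|sin a - sin b|.
Proof.
rewrite ler_norml => /andP[b0 b1]; rewrite ler_norml => /andP[a0 a1].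
have p2 : (pi : R) / 2 < 2 := pihalf_lt2 R.
have p1 : 1 <= (pi : R) / 2 := pihalf_ge1 R.
set u := (a + b) / 2; set v := (a - b) / 2.
have au : a = u + v by rewrite /u /v; field.
have bu : b = u - v by rewrite /u /v; field.
have vlo : - (pi / 2) <= v by rewrite /v; lra.
have vhi : v <= pi / 2 by rewrite /v; lra.
have ul : `|u| <= 5 / 4 by rewrite ler_norml /u; apply/andP; split; lra.
have -> : sin a - sin b = 2 * cos u * sin v by rewrite au bu sinD sinB; ring.
have -> : a - b = 2 * v by rewrite /v; field.
clearbody u v.
have cu : 5^-1 <= cos u.
  apply: le_trans (cos_ge_sqr u).
  have : u ^+ 2 <= (5 / 4) ^+ 2.
    by rewrite -(real_normK (num_real u)) lerXn2r ?nnegrE.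
  lra.
have sv : `|v| / 4 <= `|sin v|.
  have [v0|v0] := leP 0 v.
    by rewrite ger0_norm// (le_trans (sin_ge_quarter _))// ?v0// ler_norm.
  rewrite ltr0_norm// -[sin v]opprK -sinN normrN (le_trans (sin_ge_quarter _)) ?ler_norm//.
  by rewrite oppr_ge0 (ltW v0) lerNl.
rewrite !normrM [`|2|]ger0_norm// [`|cos u|]ger0_norm; last lra.
have : 5^-1 * (`|v| / 4) <= cos u * `|sin v| by apply: ler_pM => //; rewrite divr_ge0.
lra.
Qed.

(** Success probability whose Bernstein weights are trigonometric polynomials in
    t. *)
Definition sine_prob (T t : R) : R := (1 + sin (t * T^-1)) / 2.

(** The point whose success probability is k / m. *)
Definition sine_node (m : nat) (T : R) (k : nat) : R :=
  T * asin (2 * (k%:R / m%:R) - 1).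

Lemma sine_prob01 T t : 0 <= sine_prob T t <= 1.
Proof.
by rewrite /sine_prob; have := sin_geN1 (t * T^-1); have := sin_le1 (t * T^-1); lra.
Qed.

(** For |t| <= N/2 the sine is invertible around t/N and the binomial
    concentration applies; for larger t all nodes are at distance at most 5 |t|,
    and |t| is at most 2 t^2 / N. The quadratic growth in t is harmless since
    Gaussian variables have bounded second moments. *)
Lemma sine_bern_dev (j : nat) t  :
  \sum_(k < (j.+1 ^ 4).+1) bern (j.+1 ^ 4) (sine_prob j.+1%:R t) k *
     `|sine_node (j.+1 ^ 4) j.+1%:R k - t| <= (60 + 10 * t ^+ 2) / j.+1%:R.
Proof.
set N : R := j.+1%:R.
set m := (j.+1 ^ 4)%N; set p := sine_prob N t.
have N0 : 0 < N by rewrite ltr0n.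
have m0 : (0 < m)%N by rewrite expn_gt0.
have mR : m%:R = N ^+ 4 :> R by rewrite natrX.
have p01 := sine_prob01 N t.
have w0 k : 0 <= bern m p k by apply: bern_ge0.
have nd (k : 'I_m.+1) : (-1 : R) <= 2 * (k%:R / m%:R) - 1 <= (1 : R).
  have : 0 <= k%:R / m%:R :> R by rewrite divr_ge0.
  have : k%:R / m%:R <= 1 :> R.
    by rewrite ler_pdivrMr ?ltr0n// mul1r ler_nat -ltnS.
  move: (k%:R / m%:R : R) => q q0 q1; apply/andP; split; lra.
have an (k : 'I_m.+1) : `|asin (2 * (k%:R / m%:R) - 1)| <= pi / 2 :> R.
  by have [h _] := asin_def (nd k); rewrite ler_norml.
(* The scale u = 1/N^2 balances the two terms of the binomial bound, m = N^4. *)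
have [tN|tN] := leP `|t| (N / 2).
  apply: (@le_trans _ _ (\sum_(k < m.+1) 40 * N * (bern m p k * `|k%:R / m%:R - p|))).
    apply: ler_sum => k _; rewrite mulrCA ler_wpM2l//.
    have th : `|t * N^-1| <= 2^-1.
      by rewrite normrM [`|N^-1|]gtr0_norm ?invr_gt0// ler_pdivrMr// mulrC.
    have := sin_expand th (an k).
    rewrite asinK ?in_itv ?nd//= => h.
    have -> : sine_node m N k - t = N * (asin (2 * (k%:R / m%:R) - 1) - t * N^-1).
      by rewrite /sine_node mulrBr [N * (t / N)]mulrCA mulfV ?mulr1// gt_eqF.
    rewrite normrM gtr0_norm// [40 * N]mulrC -mulrA ler_pM2l// (le_trans h)//.
    have -> : 2 * (k%:R / m%:R) - 1 - sin (t * N^-1) = 2 * (k%:R / m%:R - p).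
      by rewrite /p /sine_prob; field; rewrite mR expf_neq0// gt_eqF.
    by rewrite normrM [`|2|]ger0_norm// mulrA; lra.
  rewrite -mulr_sumr.
  have u0 : 0 < (N ^+ 2)^-1 by rewrite invr_gt0 exprn_gt0.
  have := bern_dev m0 p01 u0; rewrite mR.
  have -> : (N ^+ 4 * (N ^+ 2)^-1)^-1 = (N ^+ 2)^-1 by field; rewrite gt_eqF.
  move=> h; apply: (@le_trans _ _ (40 * N * ((N ^+ 2)^-1 / 2 + (N ^+ 2)^-1))).
    by rewrite ler_wpM2l// mulr_ge0// ltW.
  have -> : 40 * N * ((N ^+ 2)^-1 / 2 + (N ^+ 2)^-1) = 60 / N by field; rewrite gt_eqF.
  by rewrite ler_pM2r ?invr_gt0// lerDl mulr_ge0 ?sqr_ge0.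
apply: (@le_trans _ _ (\sum_(k < m.+1) 10 * t ^+ 2 / N * bern m p k)); last first.
  rewrite -mulr_sumr sum_bern mulr1 ler_pM2r ?invr_gt0// lerDr//.
apply: ler_sum => k _; rewrite mulrC ler_wpM2r//.
have p2 : (pi : R) / 2 < 2 := pihalf_lt2 R.
have h1 : `|sine_node m N k| <= 2 * N.
  rewrite /sine_node normrM gtr0_norm// mulrC ler_wpM2r ?ltW//.
  by rewrite (le_lt_trans (an k)).
apply: (le_trans (ler_normB _ _)).
apply: (@le_trans _ _ (5 * `|t|)); first lra.
rewrite ler_pdivlMr// -(real_normK (num_real t)); have := normr_ge0 t; nra.
Qed.

End bernstein_sine.

Section multivariate.
Variables (R : realType) (I : finType).
Implicit Types (y z : I -> R).

Definition sum_lipschitz (L : R) (psi : (I -> R) -> R) : Prop :=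
  forall y z, `|psi y - psi z| <= L * \sum_i `|y i - z i|.

Variables (psi : (I -> R) -> R) (L : R).
Hypothesis psiL : sum_lipschitz L psi.
Hypothesis L0 : 0 <= L.

(** Bernstein operator in the variables sin (y_i / N) with N = j + 1: a
    trigonometric polynomial close to psi in expectation under every law with
    moderate second moments. *)
Definition bernstein (j : nat) (y : I -> R) : R :=
  \sum_(k : {ffun I -> 'I_(j.+1 ^ 4).+1})
     psi (fun i => sine_node (j.+1 ^ 4) j.+1%:R (k i)) *
     \prod_i bern (j.+1 ^ 4) (sine_prob j.+1%:R (y i)) (k i).

Lemma bernstein_trig j : trig_poly (bernstein j).
Proof.
apply: trig_sum => k; apply: trig_scale; apply: trig_prod => i.
have tp : trig_poly (fun y => sine_prob j.+1%:R (y i)).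
  have := trig_add (trig_cst I (2^-1 : R)) (trig_scale 2^-1 (trig_sin_coord (j.+1%:R^-1 : R) i)).
  by congr trig_poly; apply/funext => y; rewrite /sine_prob; field.
have tq : trig_poly (fun y => 1 - sine_prob j.+1%:R (y i)).
  have := TrigLin (-1) tp (trig_cst I (1 : R)).
  by congr trig_poly; apply/funext => y; rewrite mulN1r addrC.
rewrite /bern; set m := (j.+1 ^ 4)%N.
have := trig_scale 'C(m, k i)%:R (trig_mul (trig_exp (k i) tp) (trig_exp (m - k i) tq)).
by congr trig_poly; apply/funext => y; rewrite mulr_natl.
Qed.

(** The weights are a product of probabilities, under which the i-th node only
    depends on the i-th index. *)
Lemma bernstein_approx j y :
  `|bernstein j y - psi y| <= L * \sum_i (60 + 10 * y i ^+ 2) / j.+1%:R.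
Proof.
set m := (j.+1 ^ 4)%N; set N : R := j.+1%:R.
pose w i (k : 'I_m.+1) : R := bern m (sine_prob N (y i)) k.
have w0 i k : 0 <= w i k by apply: bern_ge0; exact: sine_prob01.
have w1 i : \sum_k w i k = 1 by exact: sum_bern.
have one : \sum_(k : {ffun I -> 'I_m.+1}) \prod_i w i (k i) = 1.
  by rewrite -(bigA_distr_bigA w) big1.
have -> : bernstein j y - psi y = \sum_(k : {ffun I -> 'I_m.+1})
    (psi (fun i => sine_node m N (k i)) - psi y) * \prod_i w i (k i).
  rewrite -[psi y]mulr1 -{1}one mulr_sumr -sumrB; apply: eq_bigr => k _.
  by rewrite mulr1 -mulrBl.
apply: (le_trans (ler_norm_sum _ _ _)).
apply: (@le_trans _ _ (\sum_(k : {ffun I -> 'I_m.+1}) \sum_i L *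
    (`|sine_node m N (k i) - y i| * \prod_i w i (k i)))).
  apply: ler_sum => k _; rewrite normrM [`|\prod_i _|]ger0_norm ?prodr_ge0//.
  by rewrite -mulr_sumr -mulr_suml mulrA ler_wpM2r ?prodr_ge0//; exact: psiL.
rewrite exchange_big mulr_sumr; apply: ler_sum => i _.
rewrite -mulr_sumr ler_wpM2l//; apply: le_trans (sine_bern_dev j (y i)).
rewrite le_eqVlt; apply/orP; left; apply/eqP.
(* The i-th deviation is attached to the i-th factor, so that the sum over k
   factorizes. *)
pose F (i' : I) (k : 'I_m.+1) : R :=
  if i' == i then `|sine_node m N k - y i| * w i k else w i' k.
transitivity (\sum_(k : {ffun I -> 'I_m.+1}) \prod_i' F i' (k i')).
  apply: eq_bigr => k _; rewrite (bigD1 i)//= [in RHS](bigD1 i)//= mulrA.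
  congr (_ * _); first by rewrite /F eqxx.
  by apply: eq_bigr => i' ii; rewrite /F (negbTE ii).
rewrite -(bigA_distr_bigA F) (bigD1 i)//= [X in _ * X]big1 ?mulr1; last first.
  by move=> i' ii; rewrite /F (negbTE ii).
by apply: eq_bigr => k _; rewrite /F eqxx mulrC.
Qed.

Lemma bernstein_cvg y : (fun j => bernstein j y) @ \oo --> psi y.
Proof.
apply/cvgrPdist_le => e e0.
set C := L * \sum_i (60 + 10 * y i ^+ 2).
have : (fun j : nat => C * j.+1%:R^-1) @ \oo --> C * 0.
  by apply: cvgMl_tmp; exact: cvg_harmonic.
rewrite mulr0 => /cvgrPdist_le /(_ e e0); apply: filterS => j.
rewrite sub0r normrN => h; rewrite distrC (le_trans (bernstein_approx _ _))//.
by rewrite (le_trans _ h)// -mulr_suml mulrA ler_norm.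
Qed.

End multivariate.

Section gaussian_families.
Variables (R : realType) (I : finType).
Implicit Types (c : I -> R).

Definition gaussian_family d (T : measurableType d) (P : probability T R)
    (Y : I -> T -> R) (v : (I -> R) -> R) : Prop :=
  forall c, 0 <= v c /\ has_gaussian_law P (fun w => \sum_i c i * Y i w) 0 (v c).

Section one_family.
Context d (T : measurableType d) (P : probability T R) (Y : I -> T -> R).
Variable v : (I -> R) -> R.
Hypothesis gY : gaussian_family P Y v.

Definition coord (i : I) : I -> R := fun j => (j == i)%:R.

Lemma gaussian_family_coord i : 0 <= v (coord i) /\ has_gaussian_law P (Y i) 0 (v (coord i)).
Proof.
have [v0 lY] := gY (coord i); split => //; move: lY; congr has_gaussian_law.
apply/funext => w; rewrite (bigD1 i)//= /coord eqxx mul1r big1 ?addr0// => j ji.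
by rewrite (negbTE ji) mul0r.
Qed.

Lemma measurable_trig_family g : trig_poly g ->
  measurable_fun setT (fun w => g (fun i => Y i w)).
Proof.
elim=> {g} [c t|a g h _ mg _ mh].
  apply: (measurableT_comp (@continuous_measurable_fun R _ (@continuous_cos R))).
  by apply: measurable_funD => //; have [_ []] := gY c.
by apply: measurable_funD => //; apply: measurable_funM.
Qed.

Variables (psi : (I -> R) -> R) (L M : R).
Hypothesis psiL : sum_lipschitz L psi.
Hypothesis L0 : 0 <= L.
Hypothesis psiM : forall y, `|psi y| <= M.

Lemma measurable_lip_family : measurable_fun setT (fun w => psi (fun i => Y i w)).
Proof.
apply: (@measurable_fun_cvg _ _ _ _ (fun j w => bernstein psi j (fun i => Y i w))).
  by move=> j; apply: measurable_trig_family; exact: bernstein_trig.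
by move=> w _; exact: bernstein_cvg.
Qed.

Lemma bernstein_expectation j :
  `|\int[P]_w bernstein psi j (fun i => Y i w) - \int[P]_w psi (fun i => Y i w)|
  <= L * \sum_i (60 + 10 * v (coord i)) / j.+1%:R.
Proof.
have [K K0 bK] := trig_bounded (bernstein_trig psi j).
pose E i w := (60 + 10 * Y i w ^+ 2) / j.+1%:R : R.
have mE i : measurable_fun setT (E i).
  have [_ [mYi _]] := gaussian_family_coord i.
  apply: measurable_funM => //; apply: measurable_funD => //.
  by apply: measurable_funM => //; exact: measurable_funX.
have E0 i w : 0 <= E i w by rewrite divr_ge0// addr_ge0// mulr_ge0// sqr_ge0.
have iE i : (\int[P]_w (E i w)%:E = ((60 + 10 * v (coord i)) / j.+1%:R)%:E)%E.
  have [vi li] := gaussian_family_coord i.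
  have isq := gaussian_integrable_sqr vi li.
  have ic : P.-integrable setT (fun _ => ((60 : R)%:E : \bar R)).
    exact: finite_measure_integrable_cst.
  have E1 : (fun w => (E i w)%:E) = (fun w => ((j.+1%:R^-1)%:E * ((60 : R)%:E + (10 : R)%:E * (Y i w ^+ 2)%:E))%E).
    by apply/funext => w; rewrite /E [(_ + _) / _]mulrC EFinM EFinD EFinM.
  have iz := integrableZl measurableT (10 : R) isq.
  have iD := integrableD measurableT ic iz.
  rewrite E1 (@integralZl _ _ _ P _ measurableT _ iD).
  rewrite (@integralD _ _ _ P _ measurableT _ _ ic iz).
  rewrite (@integralZl _ _ _ P _ measurableT _ isq) (gaussian_moment2 vi li).
  rewrite integral_cst// [X in (_ * (_ * X + _))%E](@probability_setT _ _ _ P).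
  rewrite mule1 expr0n/= add0r [X in _ = EFin X]mulrC.
  by [].
apply: (@Rintegral_dist_le _ _ _ P _ _ (fun w => L * \sum_i E i w) (Num.max K M)).
- exact: measurable_trig_family (bernstein_trig psi j).
- by move=> w; rewrite le_max bK.
- exact: measurable_lip_family.
- by move=> w; rewrite le_max psiM orbT.
- by apply: measurable_funM => //; exact: measurable_sum.
- by move=> w; exact: bernstein_approx.
- under eq_integral do rewrite EFinM -sumEFin.
  rewrite ge0_integralZl//; last 2 first.
  + by apply: emeasurable_sum => i; apply/measurable_EFinP; exact: mE.
  + by move=> w _; apply: sume_ge0 => i _; rewrite lee_fin.
  rewrite ge0_integral_sum//; first by under eq_bigr do rewrite iE; rewrite sumEFin -EFinM.
  + by move=> i; apply/measurable_EFinP; exact: mE.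
  + by move=> i w _; rewrite lee_fin.
Qed.

End one_family.

(** Trigonometric polynomials have convergent expectations because these only
    involve the laws of linear combinations, which are governed by the
    variances; the Bernstein operator approximates psi by such polynomials
    uniformly in n. *)
Theorem gaussian_family_cvg (disp : nat -> measure_display)
    (Om : forall n, measurableType (disp n)) (P : forall n, probability (Om n) R)
    (Y : forall n, I -> Om n -> R) (v : nat -> (I -> R) -> R)
    d (T : measurableType d) (Q : probability T R) (Z : I -> T -> R)
    (v' : (I -> R) -> R) (psi : (I -> R) -> R) (L M : R) :
  (forall n, gaussian_family (P n) (Y n) (v n)) -> gaussian_family Q Z v' ->
  (forall c, (fun n => v n c) @ \oo --> v' c) ->
  0 <= L -> sum_lipschitz L psi -> (forall y, `|psi y| <= M) ->
  (fun n => \int[P n]_w psi (fun i => Y n i w)) @ \oo --> \int[Q]_w psi (fun i => Z i w).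
Proof.
move=> gY gZ vv L0 psiL psiM.
have trig g : trig_poly g ->
    (fun n => \int[P n]_w g (fun i => Y n i w)) @ \oo --> \int[Q]_w g (fun i => Z i w).
  elim=> {g} [c t|a g h tg IHg th IHh].
    have cL : lipschitz_by 1 (fun x : R => cos (x + t)).
      move=> x y; apply: (le_trans (cos_lipschitz _ _)).
      by rewrite opprD addrACA subrr addr0.
    apply: (@gaussian_cvg R disp Om P (fun n w => \sum_i c i * Y n i w) (fun n => v n c)
      _ T Q (fun w => \sum_i c i * Z i w) (v' c) 1 1 (fun x => cos (x + t))) => //.
    - by move=> n; have [] := gY n c.
    - by have [] := gZ c.
    - by move=> n; have [] := gY n c.
    - by have [] := gZ c.
    - by move=> x; exact: cos_max.
  have [K K0 bg] := trig_bounded tg; have [K' K0' bh] := trig_bounded th.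
  have Elin d1 (T1 : measurableType d1) (P1 : probability T1 R) (Y1 : I -> T1 -> R) v1 :
      gaussian_family P1 Y1 v1 -> \int[P1]_w (a * g (fun i => Y1 i w) + h (fun i => Y1 i w)) =
      a * \int[P1]_w g (fun i => Y1 i w) + \int[P1]_w h (fun i => Y1 i w).
    move=> g1; have ig := integrable_bounded_prob P1 (measurable_trig_family g1 tg) (fun w => bg _).
    have ih := integrable_bounded_prob P1 (measurable_trig_family g1 th) (fun w => bh _).
    have iag := integrableZl measurableT a ig.
    rewrite (@RintegralD _ _ _ P1 _ _ _ measurableT iag ih).
    by rewrite (@RintegralZl _ _ _ P1 _ _ _ measurableT ig).
  rewrite (Elin _ _ _ _ _ gZ); under eq_fun do rewrite (Elin _ _ _ _ _ (gY _)).
  by apply: cvgD => //; exact: cvgMl_tmp.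
have vbd i : exists2 B, 0 <= B & (forall n, v n (coord i) <= B) /\ v' (coord i) <= B.
  have /cvg_seq_bounded [B [_ HB]] := cvgP _ (vv (coord i)).
  have := HB (`|B| + 1); rewrite (le_lt_trans (ler_norm B)) ?ltrDl// => /(_ isT) H.
  exists (`|B| + 1); first by rewrite addr_ge0.
  split=> [n|]; first by rewrite (le_trans (ler_norm _))// H.
  apply: (ler_cvg_to (vv (coord i)) (cvg_cst (`|B| + 1))).
  by apply: nearW => n /=; rewrite (le_trans (ler_norm _))// H.
pose B i := projT1 (cid2 (vbd i)).
have BP i : 0 <= B i /\ ((forall n, v n (coord i) <= B i) /\ v' (coord i) <= B i).
  by rewrite /B; case: cid2.
pose C := L * \sum_i (60 + 10 * B i).
have C0 : 0 <= C.
  by rewrite mulr_ge0// sumr_ge0// => i _; have [B0 _] := BP i; rewrite addr_ge0// mulr_ge0.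
apply: cvg_uniform_approx => e e0.
pose j := Num.truncn (C / e).
have jC : C / j.+1%:R <= e.
  rewrite ler_pdivrMr// mulrC -ler_pdivrMr//; apply: ltW.
  exact: real_truncnS_gt (num_real _).
have bd (vi : I -> R) : (forall i, vi i <= B i) ->
    L * \sum_i (60 + 10 * vi i) / j.+1%:R <= e.
  move=> viB; apply: le_trans jC; rewrite -mulr_suml mulrA ler_wpM2r ?invr_ge0//.
  by rewrite ler_wpM2l//; apply: ler_sum => i _; rewrite lerD2l ler_wpM2l.
exists (fun n => \int[P n]_w bernstein psi j (fun i => Y n i w)),
  (\int[Q]_w bernstein psi j (fun i => Z i w)); split.
- exact: trig (bernstein_trig psi j).
- apply: nearW => n; apply: (le_trans (bernstein_expectation (gY n) psiL L0 psiM j)).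
  by apply: bd => i; have [_ []] := BP i.
- apply: (le_trans (bernstein_expectation gZ psiL L0 psiM j)).
  by apply: bd => i; have [_ []] := BP i.
Qed.

End gaussian_families.

(** * Harmonic analysis on the discrete torus *)

Section discrete_torus.
Variables (R : realType) (d n : nat).
Hypothesis n0 : (0 < n)%N.
Implicit Types (x y z xi : dtorus d n) (i : 'I_d) (nu : 'rV[int]_d) (b : bool).
Implicit Types (f g u v : dtorus d n -> R).

Definition grid_pt (z : dtorus d n) : 'rV[R]_d := \row_i ((z i)%:R / n%:R).
Definition freq (xi : dtorus d n) : 'rV[int]_d := \row_i (xi i)%:Z.

Let nR : n%:R != 0 :> R. Proof. by rewrite pnatr_eq0 -lt0n. Qed.

Lemma shift_upK i : cancel (fun x => shift_up x i) (fun x => shift_down x i).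
Proof.
move=> x; apply/ffunP => j; rewrite !ffunE.
by have [->|ji] := eqVneq j i; rewrite ?ordSK.
Qed.

Lemma shift_downK i : cancel (fun x => shift_down x i) (fun x => shift_up x i).
Proof.
move=> x; apply/ffunP => j; rewrite !ffunE.
by have [->|ji] := eqVneq j i; rewrite ?ord_predK.
Qed.

Lemma sum_shift_up (F : dtorus d n -> R) i : \sum_x F (shift_up x i) = \sum_x F x.
Proof.
rewrite [RHS](reindex (fun x => shift_up x i))//.
by apply: onW_bij; exists (fun x => shift_down x i); [exact: shift_upK|exact: shift_downK].
Qed.

Lemma sum_shift_down (F : dtorus d n -> R) i : \sum_x F (shift_down x i) = \sum_x F x.
Proof. by rewrite -(sum_shift_up _ i); apply: eq_bigr => x _; rewrite shift_upK. Qed.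

Lemma periodic_shift_up (T : Type) (h : 'rV[R]_d -> T) (z : dtorus d n) i :
  (forall (k : 'rV[int]_d) (x : 'rV[R]_d), h (x + map_mx intr k) = h x) ->
  h (grid_pt (shift_up z i)) = h (grid_pt z + n%:R^-1 *: delta_mx 0 i).
Proof.
move=> ph.
pose k : 'rV[int]_d := \row_j if (j == i) && ((z i).+1 == n) then 1 else 0.
rewrite -(ph k (grid_pt (shift_up z i))); congr h; apply/rowP => j.
rewrite !mxE !ffunE eqxx /=; have [->|ji] := eqVneq j i; last first.
  by rewrite /= addr0 mulr0 addr0.
rewrite /= mulr1; have [zn|zn] := eqVneq (z i).+1 n.
  have zR : (z i)%:R + 1 = n%:R :> R by rewrite natr1 zn.
  by rewrite zn modnn mul0r add0r mulr1z -[X in _ = _ + X]mul1r -mulrDl zR mulfV.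
have zl : ((z i).+1 < n)%N by rewrite ltn_neqAle zn ltn_ord.
by rewrite modn_small// rmorph0 addr0 -natr1 mulrDl mul1r.
Qed.

Lemma periodic_shift_down (T : Type) (h : 'rV[R]_d -> T) (z : dtorus d n) i :
  (forall (k : 'rV[int]_d) (x : 'rV[R]_d), h (x + map_mx intr k) = h x) ->
  h (grid_pt (shift_down z i)) = h (grid_pt z - n%:R^-1 *: delta_mx 0 i).
Proof.
move=> ph; rewrite -{2}(shift_downK i z).
rewrite (@periodic_shift_up _ (fun x : 'rV[R]_d => h (x - n%:R^-1 *: delta_mx 0 i))) ?addrK//.
by move=> k x; rewrite addrAC ph.
Qed.

Lemma mode_addsub nu b (x v : 'rV[R]_d) :
  mode nu b (x + v) + mode nu b (x - v) =
  2 * cos (2 * pi * zdot nu v) * mode nu b x.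
Proof.
have zN : zdot nu (- v) = - zdot nu v :> R.
  by rewrite /zdot -sumrN; apply: eq_bigr => j _; rewrite mxE mulrN.
rewrite /mode !zdotD zN !mulrDr mulrN; case: b.
  by rewrite sinD sinB; ring.
by rewrite cosD cosB; ring.
Qed.

Lemma zdot_step nu i (h : R) : zdot nu (h *: delta_mx 0 i) = (nu 0 i)%:~R * h.
Proof.
rewrite /zdot (bigD1 i)//= big1 ?addr0; first by rewrite !mxE !eqxx mulr1.
by move=> j ji; rewrite !mxE (negbTE ji) andbF !mulr0.
Qed.

Definition grid_laplacian (u : dtorus d n -> R) (x : dtorus d n) : R :=
  (2 * d%:R)^-1 * \sum_(i < d) (u (shift_up x i) + u (shift_down x i)) - u x.

(** The eigenvalue is written on all of Z^d, where it is n-periodic; residues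
    and symmetric representatives can then be exchanged. *)
Definition grid_eig (nu : 'rV[int]_d) : R :=
  4 / (2 * d%:R) * \sum_(i < d) sin (pi * (nu 0 i)%:~R / n%:R) ^+ 2.

(** Summation by parts: the two shifts are inverse bijections of the torus. *)
Lemma grid_laplacian_sym u g :
  \sum_x grid_laplacian u x * g x = \sum_x u x * grid_laplacian g x.
Proof.
rewrite /grid_laplacian; under eq_bigr do rewrite mulrBl.
under [RHS]eq_bigr do rewrite mulrBr.
rewrite !sumrB; congr (_ - _).
transitivity ((2 * d%:R)^-1 * \sum_(i < d) \sum_x (u (shift_up x i) + u (shift_down x i)) * g x).
  rewrite exchange_big mulr_sumr; apply: eq_bigr => x _.
  by rewrite -mulrA mulr_suml.
transitivity ((2 * d%:R)^-1 * \sum_(i < d) \sum_x u x * (g (shift_up x i) + g (shift_down x i))).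
  congr (_ * _); apply: eq_bigr => i _.
  under eq_bigr do rewrite mulrDl; under [RHS]eq_bigr do rewrite mulrDr.
  rewrite !big_split /= addrC; congr (_ + _).
  - rewrite -[RHS](sum_shift_down _ i); apply: eq_bigr => x _.
    by rewrite shift_downK.
  - rewrite -[RHS](sum_shift_up _ i); apply: eq_bigr => x _.
    by rewrite shift_upK.
rewrite exchange_big mulr_sumr; apply: eq_bigr => x _.
by rewrite -mulr_sumr mulrCA.
Qed.

Lemma grid_laplacianD u v x :
  grid_laplacian (fun z => u z + v z) x = grid_laplacian u x + grid_laplacian v x.
Proof.
rewrite /grid_laplacian opprD addrACA -mulrDr -big_split/=; congr (_ * _ + _).
by apply: eq_bigr => i _; rewrite addrACA.
Qed.

Lemma grid_laplacianZ (c : R) u x :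
  grid_laplacian (fun z => c * u z) x = c * grid_laplacian u x.
Proof.
rewrite /grid_laplacian mulrBr; congr (_ - _).
rewrite [RHS]mulrCA; congr (_ * _); rewrite mulr_sumr.
by apply: eq_bigr => i _; rewrite mulrDr.
Qed.

Lemma grid_laplacian_sum (I : Type) (r : seq I) (F : I -> dtorus d n -> R) x :
  grid_laplacian (fun z => \sum_(j <- r) F j z) x = \sum_(j <- r) grid_laplacian (F j) x.
Proof.
elim: r => [|j r IH].
  rewrite big_nil /grid_laplacian big_nil subr0 big1 ?mulr0// => i _.
  by rewrite !big_nil addr0.
rewrite big_cons -IH -grid_laplacianD /grid_laplacian big_cons; congr (_ * _ - _).
by apply: eq_bigr => i _; rewrite !big_cons.
Qed.

Hypothesis d0 : (0 < d)%N.
Let dR : d%:R != 0 :> R. Proof. by rewrite pnatr_eq0 -lt0n. Qed.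

Lemma grid_laplacian_cst (c : R) x : grid_laplacian (fun=> c) x = 0.
Proof.
rewrite /grid_laplacian sumr_const card_ord -mulr_natr -(mulr2n c) -(mulr_natr c).
by field; rewrite dR.
Qed.

Lemma grid_laplacian_mode nu b x :
  grid_laplacian (fun z => mode nu b (grid_pt z)) x =
  - grid_eig nu * mode nu b (grid_pt x).
Proof.
rewrite /grid_laplacian.
under eq_bigr => i _ do rewrite (periodic_shift_up _ _ (@mode_periodic _ _ nu b))
  (periodic_shift_down _ _ (@mode_periodic _ _ nu b)) mode_addsub zdot_step.
rewrite -mulr_suml.
have E i : 2 * cos (2 * pi * ((nu 0 i)%:~R * n%:R^-1)) =
    2 - 4 * sin (pi * (nu 0 i)%:~R / n%:R) ^+ 2 :> R.
  have -> : 2 * pi * ((nu 0 i)%:~R * n%:R^-1) = (pi * (nu 0 i)%:~R / n%:R) *+ 2 :> R.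
    by rewrite -[RHS]mulr_natr; ring.
  by rewrite cos_mulr2n cos2sin2; ring.
under eq_bigr do rewrite E.
rewrite sumrB sumr_const card_ord -mulr_sumr /grid_eig -mulr_natr.
by field; rewrite dR.
Qed.

Lemma eigvalE xi : - eigval R xi = grid_eig (freq xi).
Proof.
rewrite /eigval /grid_eig mulNr opprK; congr (_ * _); apply: eq_bigr => i _.
by rewrite mxE.
Qed.

Lemma sin_frac_neq0 (k : int) : k != 0 -> `|k| < n%:Z ->
  sin (pi * (k%:~R / n%:R)) != 0 :> R.
Proof.
wlog k0 : k / 0 <= k.
  move=> W kn kl; have [k0|k0] := leP 0 k; first exact: W.
  have := W (- k); rewrite oppr_ge0 (ltW k0) normrN oppr_eq0 => /(_ isT kn kl).
  by rewrite rmorphN/= mulNr mulrN sinN oppr_eq0.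
case: k k0 => // k _ kn kl; rewrite gt_eqF// sin_gt0_pi//.
have nR0 : 0 < n%:R :> R by rewrite ltr0n.
have k0 : 0 < k%:R :> R by rewrite ltr0n lt0n.
rewrite mulr_gt0 ?pi_gt0 ?divr_gt0//=.
by rewrite -[ltRHS]mulr1 ltr_pM2l ?pi_gt0// ltr_pdivrMr// mul1r ltr_nat.
Qed.

(** Shifting the summation frequency in a coordinate where x and y differ
    rotates the pair (sum of cosines, sum of sines) by a nonzero angle, hence
    this pair vanishes. *)
Lemma sum_freq_cos x y :
  \sum_(xi : dtorus d n)
     cos (2 * pi * (zdot (freq xi) (grid_pt x) - zdot (freq xi) (grid_pt y))) =
  (n%:R ^+ d * (x == y)%:R : R).
Proof.
have [->|xy] := eqVneq x y.
  under eq_bigr do rewrite subrr mulr0 cos0.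
  by rewrite sumr_const card_ffun !card_ord mulr1 natrX.
have [i xyi] : exists i, x i != y i.
  apply/existsP; apply: contraNT xy; rewrite negb_exists => /forallP H.
  by apply/eqP/ffunP => i; have := H i; rewrite negbK => /eqP.
pose k : int := (x i)%:Z - (y i)%:Z.
pose a : R := 2 * pi * (k%:~R / n%:R).
pose D j : R := ((x j)%:R - (y j)%:R) / n%:R.
pose th xi : R := 2 * pi * (zdot (freq xi) (grid_pt x) - zdot (freq xi) (grid_pt y)).
have thE xi : th xi = 2 * pi * \sum_j (xi j)%:R * D j.
  rewrite /th /zdot -sumrB; congr (_ * _); apply: eq_bigr => j _.
  by rewrite !mxE -mulrBr /D mulrBl.
have kE : k%:~R = (x i)%:R - (y i)%:R :> R by rewrite /k intrB.
have thS xi : exists j : int, th (shift_up xi i) = th xi + a + 2 * pi * j%:~R.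
  exists (if (xi i).+1 == n then - k else 0).
  rewrite !thE (bigD1 i)//= [in RHS](bigD1 i)//=.
  rewrite [X in 2 * pi * (_ + X) = _](_ : _ = \sum_(j | j != i) (xi j)%:R * D j); last first.
    by apply: eq_bigr => j ji; rewrite ffunE (negbTE ji).
  rewrite ffunE eqxx /= /a /D.
  have [zn|zn] := eqVneq (xi i).+1 n.
    have zR : (xi i)%:R + 1 = n%:R :> R by rewrite natr1 zn.
    have -> : (xi i)%:R = n%:R - 1 :> R by rewrite -zR addrK.
    by rewrite zn modnn rmorphN/= kE; field.
  rewrite modn_small; last by rewrite ltn_neqAle zn ltn_ord.
  by rewrite kE -natr1 mulr0z; field.
pose C := \sum_xi cos (th xi); pose S := \sum_xi sin (th xi).
have eC : C = C * cos a - S * sin a.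
  rewrite {1}/C -(sum_shift_up _ i) !mulr_suml -sumrB; apply: eq_bigr => xi _.
  by have [j ->] := thS xi; rewrite cos2pi_int cosD.
have eS : S = S * cos a + C * sin a.
  rewrite {1}/S -(sum_shift_up _ i) !mulr_suml -big_split; apply: eq_bigr => xi _ /=.
  by have [j ->] := thS xi; rewrite sin2pi_int sinD.
have ca : cos a < 1.
  have aE : a = (pi * (k%:~R / n%:R)) *+ 2 by rewrite /a -[RHS]mulr_natr; ring.
  rewrite aE cos_mulr2n cos2sin2.
  suff : 0 < sin (pi * (k%:~R / n%:R)) ^+ 2 :> R by lra.
  rewrite lt0r sqr_ge0 andbT expf_neq0// sin_frac_neq0//.
    by rewrite subr_eq0 eqz_nat.
  by rewrite /k; move: (ltn_ord (x i)) (ltn_ord (y i)); lia.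
have Z : C * (2 * (1 - cos a)) = 0.
  have := cos2Dsin2 a.
  transitivity (C * (1 - cos a) ^+ 2 + C * (cos a ^+ 2 + sin a ^+ 2 - cos a ^+ 2)).
    by rewrite H; ring.
  have e1 : C * (1 - cos a) = - (S * sin a) by rewrite {1}mulrBr mulr1 {1}eC; ring.
  have e2 : S * (1 - cos a) = C * sin a by rewrite {1}mulrBr mulr1 {1}eS; ring.
  rewrite expr2 mulrA e1 mulNr -mulrA [sin a * _]mulrC mulrA e2; ring.
move/eqP: Z; rewrite !mulf_eq0 pnatr_eq0 /= subr_eq0 [1 == _]eq_sym (lt_eqF ca) orbF.
by rewrite -/C mulr0 => /eqP.
Qed.

Definition dco (g : dtorus d n -> R) nu b : R := \sum_z g z * mode nu b (grid_pt z).

Lemma dco_laplacian g nu b : dco (grid_laplacian g) nu b = - grid_eig nu * dco g nu b.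
Proof.
rewrite /dco grid_laplacian_sym mulr_sumr; apply: eq_bigr => x _.
by rewrite grid_laplacian_mode mulrCA.
Qed.

Lemma sum_bool_mode nu (x y : 'rV[R]_d) :
  \sum_b mode nu b x * mode nu b y = cos (2 * pi * (zdot nu x - zdot nu y)).
Proof. by rewrite big_bool /= mulrBr cosB /mode addrC. Qed.

Lemma dco_inversion g x :
  \sum_xi \sum_b dco g (freq xi) b * mode (freq xi) b (grid_pt x) = n%:R ^+ d * g x.
Proof.
transitivity (\sum_z g z * \sum_xi
   cos (2 * pi * (zdot (freq xi) (grid_pt z) - zdot (freq xi) (grid_pt x)))).
  under [RHS]eq_bigr do rewrite mulr_sumr.
  rewrite [RHS]exchange_big; apply: eq_bigr => xi _.
  transitivity (\sum_b \sum_z g z * mode (freq xi) b (grid_pt z) * mode (freq xi) b (grid_pt x)).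
    by apply: eq_bigr => b _; rewrite /dco mulr_suml.
  rewrite exchange_big; apply: eq_bigr => z _.
  by rewrite -sum_bool_mode mulr_sumr; apply: eq_bigr => b _; rewrite mulrA.
under eq_bigr do rewrite sum_freq_cos.
rewrite (bigD1 x)//= eqxx big1; first by rewrite addr0 mulr1 mulrC.
by move=> z zx; rewrite (negbTE zx) !mulr0.
Qed.

Lemma dco_parseval f g :
  \sum_xi \sum_b dco f (freq xi) b * dco g (freq xi) b = n%:R ^+ d * \sum_z f z * g z.
Proof.
rewrite mulr_sumr; under [RHS]eq_bigr do rewrite mulrA -dco_inversion.
under [RHS]eq_bigr do rewrite mulr_suml.
rewrite [RHS]exchange_big; apply: eq_bigr => xi _.
under [RHS]eq_bigr do rewrite mulr_suml.
rewrite [RHS]exchange_big; apply: eq_bigr => b _.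
rewrite {2}/dco mulr_sumr; apply: eq_bigr => z _; ring.
Qed.

Lemma grid_eig_gt0 xi : dnonzero xi -> 0 < grid_eig (freq xi).
Proof.
move=> /existsP[i xi0]; rewrite mulr_gt0// ?divr_gt0// ?mulr_gt0// ?ltr0n//.
rewrite (bigD1 i)//= ltr_wpDr//; first by apply: sumr_ge0 => j _; rewrite sqr_ge0.
have sn : sin (pi * ((xi i)%:Z%:~R / n%:R)) != 0 :> R.
  by apply: sin_frac_neq0 => //; rewrite ger0_norm// ltz_nat ltn_ord.
by rewrite lt0r sqr_ge0 andbT expf_neq0// mxE -mulrA.
Qed.

Lemma freq0 xi : ~~ dnonzero xi -> freq xi = 0.
Proof.
rewrite negb_exists => /forallP H; apply/rowP => i; rewrite !mxE.
by have := H i; rewrite negbK => /eqP ->.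
Qed.

Lemma dco0 g b : \sum_z g z = 0 -> dco g 0 b = 0.
Proof.
move=> g0; rewrite /dco; under eq_bigr do rewrite mode0.
by rewrite -mulr_suml g0 mul0r.
Qed.

(** The Fourier coefficients are divided by the eigenvalues; at frequency zero,
    where the eigenvalue vanishes, so does the coefficient of f. *)
Lemma poisson_solution f : \sum_z f z = 0 ->
  exists2 g, \sum_z g z = 0 & forall x, grid_laplacian g x = - f x.
Proof.
move=> f0.
pose t (j : dtorus d n * bool) (z : dtorus d n) : R :=
  ((n%:R ^+ d)^-1 * (grid_eig (freq j.1))^-1 * dco f (freq j.1) j.2) *
    mode (freq j.1) j.2 (grid_pt z).
exists (fun z => \sum_j t j z).
  rewrite exchange_big big1// => -[xi b] _; rewrite /t /= -mulr_sumr.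
  have := dco_laplacian (fun=> 1) (freq xi) b.
  rewrite {1}/dco; under eq_bigr do rewrite grid_laplacian_cst mul0r.
  rewrite big1// => /esym/eqP; rewrite mulf_eq0 oppr_eq0 => /orP[/eqP ->|].
    by rewrite invr0 !(mulr0, mul0r).
  rewrite /dco; under eq_bigr do rewrite mul1r.
  by move=> /eqP ->; rewrite mulr0.
move=> x; rewrite grid_laplacian_sum.
have nd0 : n%:R ^+ d != 0 :> R by rewrite expf_neq0.
transitivity (- ((n%:R ^+ d)^-1 *
    \sum_xi \sum_b dco f (freq xi) b * mode (freq xi) b (grid_pt x))); last first.
  by rewrite dco_inversion mulKf.
rewrite pair_big/= mulr_sumr -sumrN; apply: eq_bigr => -[xi b] _ /=.
rewrite /t /= grid_laplacianZ grid_laplacian_mode.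
have [xi0|/freq0 ->] := boolP (dnonzero xi); last by rewrite dco0// !(mulr0,mul0r) oppr0.
have e0 := lt0r_neq0 (grid_eig_gt0 xi0).
field.
by rewrite nd0 e0.
Qed.

End discrete_torus.

(** * The odometer of the divisible sandpile *)

Section sandpile.
Variables (R : realType) (d n : nat).
Hypotheses (n0 : (0 < n)%N) (d0 : (0 < d)%N).
Variable S : dtorus d n -> R.
Hypothesis total_mass : \sum_x S x = n%:R ^+ d.
Implicit Types (x : dtorus d n).

Notation St t := (iter t (@topple R d n) S).

Definition emitted (t : nat) x : R := \sum_(k < t) excess (St k) x.

Lemma excess_ge0 (T : dtorus d n -> R) x : 0 <= excess T x.
Proof. by rewrite /excess; case: ifPn => // /ltW; rewrite subr_ge0. Qed.

(** Toppling acts on the configuration as the Laplacian of the emitted mass. *)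
Lemma iter_topple t x : St t x = S x + grid_laplacian (emitted t) x.
Proof.
elim: t x => [|t IH] x.
  rewrite (_ : emitted 0 = fun=> 0) ?grid_laplacian_cst ?addr0//.
  by apply/funext => y; rewrite /emitted big_ord0.
have -> : emitted t.+1 = fun y => emitted t y + excess (St t) y.
  by apply/funext => y; rewrite /emitted big_ord_recr.
rewrite grid_laplacianD addrA -IH iterS /topple /grid_laplacian; ring.
Qed.

Lemma dtorus_card : #|{: dtorus d n}|%:R = n%:R ^+ d :> R.
Proof. by rewrite card_ffun !card_ord natrX. Qed.

(** Least action principle: a nonnegative function that stabilizes the
    configuration dominates the emitted mass, by induction on time and
    monotonicity of the neighbour averages. *)
Lemma emitted_le (v : dtorus d n -> R) : (forall x, 0 <= v x) ->
  (forall x, S x + grid_laplacian v x = 1) -> forall t x, emitted t x <= v x.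
Proof.
move=> v0 vE; elim=> [|t IH] x; first by rewrite /emitted big_ord0.
rewrite /emitted big_ord_recr/= -/(emitted t x) /excess.
case: ifPn => [_|_]; last by rewrite addr0.
rewrite iter_topple; have := vE x; rewrite /grid_laplacian.
set A := \sum_i _ => vx; set B := \sum_i _.
have : (2 * d%:R)^-1 * B <= (2 * d%:R)^-1 * A.
  by rewrite ler_wpM2l ?invr_ge0 ?mulr_ge0//; apply: ler_sum => i _; rewrite lerD.
lra.
Qed.

(** A solution of the Poisson equation, raised by a constant to be nonnegative.
    *)
Lemma stabilizing_function : exists2 v : dtorus d n -> R,
  (forall x, 0 <= v x) & (forall x, S x + grid_laplacian v x = 1).
Proof.
have [|g _ gE] := @poisson_solution R d n n0 d0 (fun x => S x - 1).
  by rewrite sumrB total_mass sumr_const dtorus_card subrr.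
exists (fun x => g x + \sum_y `|g y|) => x; last first.
  by rewrite grid_laplacianD grid_laplacian_cst// addr0 gE; ring.
rewrite (bigD1 x)//= addrA addr_ge0 ?sumr_ge0//.
by have := ler_norm (- g x); rewrite normrN; lra.
Qed.

(** Increasing and bounded by least action. *)
Lemma emitted_cvg x : (emitted ^~ x) @ \oo --> odometer S x.
Proof.
have [v v0 vE] := stabilizing_function.
apply: nondecreasing_is_cvgn.
  apply/nondecreasing_seqP => t; rewrite /emitted big_ord_recr/= lerDl.
  exact: excess_ge0.
by exists (v x) => _ [t _ <-]; exact: emitted_le.
Qed.

(** The excess tends to zero because the emitted mass converges, so the limit
    configuration is at most 1; conservation of mass forces equality. *)
Lemma odometer_eq x : S x + grid_laplacian (odometer S) x = 1.
Proof.
pose Soo y := S y + grid_laplacian (odometer S) y.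
have lap_cvg y : (fun t => grid_laplacian (emitted t) y) @ \oo --> grid_laplacian (odometer S) y.
  apply: cvgB; last exact: emitted_cvg.
  apply: cvgMl_tmp; apply: cvg_sumr => i.
  by apply: cvgD; exact: emitted_cvg.
have S_cvg y : (fun t => St t y) @ \oo --> Soo y.
  under eq_fun do rewrite iter_topple.
  by apply: cvgD; [exact: cvg_cst|exact: lap_cvg].
(* The excess is the increment of the emitted mass. *)
have ex_cvg y : (fun t => excess (St t) y) @ \oo --> (0 : R).
  have -> : (fun t => excess (St t) y) = (fun t => emitted t.+1 y - emitted t y).
    by apply/funext => t; rewrite /emitted big_ord_recr/= addrAC subrr add0r.
  rewrite -(subrr (odometer S y)); apply: cvgB; last exact: emitted_cvg.
  have := @emitted_cvg y; rewrite -(cvg_shiftS (emitted ^~ y)); exact.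
have Soo1 y : Soo y <= 1.
  rewrite -subr_le0.
  have h : (fun t => St t y - 1) @ \oo --> Soo y - 1.
    by apply: cvgB; [exact: S_cvg|exact: cvg_cst].
  apply: (ler_cvg_to h (ex_cvg y)); apply: nearW => t.
  rewrite /excess; case: ifPn => //; rewrite -leNgt; lra.
have Ssum : \sum_y (1 - Soo y) = 0.
  rewrite sumrB big_split/= total_mass sumr_const dtorus_card opprD addrA subrr add0r.
  rewrite (_ : \sum_y _ = \sum_y grid_laplacian (odometer S) y * 1); last first.
    by apply: eq_bigr => y _; rewrite mulr1.
  rewrite grid_laplacian_sym big1 ?oppr0// => y _.
  by rewrite grid_laplacian_cst// mulr0.
have /eqP := Ssum; rewrite psumr_eq0; last by move=> y _; rewrite subr_ge0.
by move=> /allP/(_ x (mem_index_enum _)); rewrite subr_eq0 => /eqP.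
Qed.

End sandpile.

Section sandpile_gaussian.
Variables (R : realType) (d n : nat).
Hypotheses (n0 : (0 < n)%N) (d0 : (0 < d)%N).
Implicit Types (x : dtorus d n) (sigma : dtorus d n -> R).

Lemma sandpile_init_mass sigma : \sum_x sandpile_init sigma x = n%:R ^+ d.
Proof.
have nd0 : n%:R ^+ d != 0 :> R by rewrite expf_neq0// pnatr_eq0 -lt0n.
rewrite /sandpile_init sumrB big_split/= !sumr_const dtorus_card -[_ *+ #|_|]mulr_natl dtorus_card.
by rewrite mulrA mulfV// mul1r addrK.
Qed.

(** Summation by parts against a solution g of the Poisson equation for f; the
    constant in the odometer equation disappears since g has mean zero. *)
Lemma odometer_pairing sigma (f g : dtorus d n -> R) :
  (forall x, grid_laplacian g x = - f x) -> \sum_x g x = 0 ->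
  \sum_x odometer (sandpile_init sigma) x * f x = \sum_x g x * sigma x.
Proof.
move=> gE g0; pose u := odometer (sandpile_init sigma).
have uE x : grid_laplacian u x = (n%:R ^+ d)^-1 * (\sum_z sigma z) - sigma x.
  have := odometer_eq n0 d0 (sandpile_init_mass sigma) x.
  rewrite -/u {1}/sandpile_init; lra.
transitivity (- \sum_x grid_laplacian u x * g x).
  rewrite grid_laplacian_sym -sumrN; apply: eq_bigr => x _.
  by rewrite gE mulrN opprK.
under eq_bigr do rewrite uE mulrBl.
rewrite sumrB -mulr_sumr g0 mulr0 sub0r opprK.
by apply: eq_bigr => x _; rewrite mulrC.
Qed.

Lemma kernel_K_Re (s : R) (k : 'I_d -> int) :
  complex.Re (kernel_K s n k) = scale_a R d n `^ (2 * s) *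
    \sum_(xi : dtorus d n | dnonzero xi) (- eigval R xi) `^ (- (2 * s)) *
    cos (2 * pi * \sum_(i < d) (k i)%:~R * ((xi i)%:R / n%:R)).
Proof.
have ReM (r : R) (z : R[i]) : complex.Re (r%:C%C * z) = r * complex.Re z.
  by case: z => a b /=; rewrite mul0r subr0.
have ReD : {morph (@complex.Re R) : z w / z + w} by case=> a b [].
rewrite /kernel_K ReM (big_morph _ ReD (erefl : complex.Re 0 = 0)).
by congr (_ * _); apply: eq_bigr => xi _; rewrite ReM.
Qed.

(** Spectral form of the variance below: the factor 2s comes from the covariance
    of the noise and the additional 2 from solving the Poisson equation for the
    odometer. *)
Definition pairing_var (s : R) (f : dtorus d n -> R) : R :=
  \sum_(xi : dtorus d n | dnonzero xi)
    (scale_a R d n / grid_eig R n (freq xi)) `^ (2 * s + 2) *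
    \sum_b dco f (freq xi) b ^+ 2.

Lemma scale_a_gt0 : 0 < scale_a R d n.
Proof.
by rewrite /scale_a !mulr_gt0 ?invr_gt0 ?exprn_gt0 ?mulr_gt0 ?pi_gt0 ?ltr0n.
Qed.

Lemma pairing_var_ge0 s f : 0 <= pairing_var s f.
Proof.
apply: sumr_ge0 => xi _; rewrite mulr_ge0 ?powR_ge0// sumr_ge0// => b _.
exact: sqr_ge0.
Qed.

(** The pairing is an explicit linear combination of the noise; its variance is
    diagonal in the Fourier basis because the covariance is a convolution. *)
Lemma odometer_gaussian (s : R) disp (T : measurableType disp)
    (P : probability T R) (sigma : dtorus d n -> T -> R) (f : dtorus d n -> R) :
  gaussian_with_cov P (kernel_K s n) sigma -> \sum_z f z = 0 ->
  has_gaussian_law P (fun w => \sum_z scale_a R d n *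
      odometer (sandpile_init (fun z => sigma z w)) z * f z) 0 (pairing_var s f).
Proof.
move=> gs f0; have [g g0 gE] := poisson_solution n0 d0 f0.
have [v0 lG] := gaussian_with_cov_law (fun z => scale_a R d n * g z) gs.
have -> : (fun w => \sum_z scale_a R d n *
      odometer (sandpile_init (fun z => sigma z w)) z * f z) =
    (fun w => \sum_z scale_a R d n * g z * sigma z w).
  apply/funext => w; under eq_bigr do rewrite -mulrA.
  rewrite -mulr_sumr (odometer_pairing _ gE g0) mulr_sumr.
  by apply: eq_bigr => z _; rewrite mulrA.
suff <- : \sum_x \sum_y scale_a R d n * g x * (scale_a R d n * g y) *
    complex.Re (kernel_K s n (fun i => (x i)%:Z - (y i)%:Z)) = pairing_var s f by [].
have nR0 : n%:R != 0 :> R by rewrite pnatr_eq0 -lt0n.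
set a := scale_a R d n; have a0 : 0 < a := scale_a_gt0.
pose e (xi : dtorus d n) : R := grid_eig R n (freq xi).
transitivity (\sum_(xi : dtorus d n | dnonzero xi) \sum_x \sum_y
    a ^+ 2 * a `^ (2 * s) * e xi `^ (- (2 * s)) * (g x * g y *
    cos (2 * pi * (zdot (freq xi) (grid_pt R x) - zdot (freq xi) (grid_pt R y))))).
  rewrite [RHS]exchange_big/=; apply: eq_bigr => x _; rewrite [RHS]exchange_big/=; apply: eq_bigr => y _.
  rewrite kernel_K_Re !mulr_sumr; apply: eq_bigr => xi _.
  rewrite eigvalE -/(e xi) -/a.
  have -> : \sum_(i < d) ((x i)%:Z - (y i)%:Z)%:~R * ((xi i)%:R / n%:R) =
      zdot (freq xi) (grid_pt R x) - zdot (freq xi) (grid_pt R y).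
    rewrite /zdot -sumrB; apply: eq_bigr => i _; rewrite !mxE intrB.
    by rewrite -[(xi i)%:Z%:~R]/((xi i)%:R : R) -[(x i)%:Z%:~R]/((x i)%:R : R)
      -[(y i)%:Z%:~R]/((y i)%:R : R); field.
  by ring.
apply: eq_bigr => xi xi0; have e0 : 0 < e xi := grid_eig_gt0 R n0 d0 xi0.
transitivity (a ^+ 2 * a `^ (2 * s) * e xi `^ (- (2 * s)) * \sum_b dco g (freq xi) b ^+ 2).
  under eq_bigr do rewrite -mulr_sumr.
  rewrite -mulr_sumr; congr (_ * _).
  under [RHS]eq_bigr => b _ do rewrite expr2 /dco mulr_suml.
  rewrite [RHS]exchange_big; apply: eq_bigr => x _.
  under [RHS]eq_bigr => b _ do rewrite mulr_sumr.
  rewrite [RHS]exchange_big; apply: eq_bigr => y _.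
  rewrite -sum_bool_mode mulr_sumr; apply: eq_bigr => b _; ring.
have dE b : dco f (freq xi) b = e xi * dco g (freq xi) b.
  have -> : f = fun x => - grid_laplacian g x by apply/funext => x; rewrite gE opprK.
  transitivity (- dco (grid_laplacian g) (freq xi) b).
    by rewrite /dco -sumrN; apply: eq_bigr => z _; rewrite mulNr.
  by rewrite dco_laplacian// mulNr opprK.
under [in RHS]eq_bigr do rewrite dE exprMn.
rewrite -mulr_sumr mulrA; congr (_ * _).
rewrite -/a -/(e xi) powRD; last by rewrite (gt_eqF (divr_gt0 a0 e0)) implybT.
have -> : (a / e xi) `^ 2 = (a / e xi) ^+ 2 by rewrite -(powR_mulrn 2 (ltW (divr_gt0 a0 e0))).
have -> : (a / e xi) `^ (2 * s) = a `^ (2 * s) * (e xi `^ (2 * s))^-1.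
  rewrite powRM ?invr_ge0 ?ltW//; congr (_ * _).
  by rewrite -powR_inv1 ?ltW// -powRrM mulN1r powRN.
rewrite powRN; have e0' := lt0r_neq0 e0; have p0 := lt0r_neq0 (powR_gt0 (2 * s) e0).
by field; rewrite e0' p0.
Qed.

End sandpile_gaussian.

(** * Lattice sums *)

Section lattice.
Variables (R : realType) (d : nat).
Implicit Types (nu mu : 'rV[int]_d) (N M : nat).

(** The punctured boxes as explicit sequences, on which sums compute. *)
Definition boxseq N : seq 'rV[int]_d :=
  [seq nu <- [seq (\row_i ((k i)%:Z - N%:Z))%R | k : {ffun 'I_d -> 'I_(N.*2.+1)}] | nu != 0].

Lemma mem_boxseq N nu : (nu \in boxseq N) = (nu != 0) && [forall i, `|nu 0 i| <= N%:Z].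
Proof.
rewrite mem_filter; congr (_ && _); apply/mapP/forallP => [[k _ ->] i|H].
  rewrite mxE; move: (nat_of_ord (k i)) (ltn_ord (k i)) => t; rewrite ltnS -addnn => tN.
  by rewrite ler_norml; apply/andP; split; lia.
have kl (i : 'I_d) : (absz (nu 0%R i + N%:Z)%R < N.*2.+1)%N.
  by have := H i; rewrite -addnn; lia.
exists [ffun i => Ordinal (kl i)]; first by rewrite mem_enum.
 apply/rowP => i; rewrite mxE ffunE/=.
by have := H i; lia.
Qed.

Lemma boxseq_uniq N : uniq (boxseq N).
Proof.
apply: filter_uniq; rewrite map_inj_in_uniq ?enum_uniq// => k k' _ _ /rowP H.
by apply/ffunP => i; apply/val_inj; have := H i; rewrite !mxE /=; lia.
Qed.

Lemma size_boxseq N : (size (boxseq N) <= N.*2.+1 ^ d)%N.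
Proof.
rewrite size_filter (leq_trans (count_size _ _))// size_map -cardE.
by rewrite card_ffun !card_ord.
Qed.

Lemma boxseq_sub N M : (N <= M)%N -> {subset boxseq N <= boxseq M}.
Proof.
move=> NM nu; rewrite !mem_boxseq => /andP[-> /forallP H]/=; apply/forallP => i.
by rewrite (le_trans (H i))// lez_nat.
Qed.

Lemma boxseqN N nu : (- nu \in boxseq N) = (nu \in boxseq N).
Proof.
rewrite !mem_boxseq oppr_eq0; congr (_ && _); apply: eq_forallb => i.
by rewrite mxE normrN.
Qed.

Lemma sum_boxseqN (V : nmodType) N (F : 'rV[int]_d -> V) :
  \sum_(nu <- boxseq N) F (- nu) = \sum_(nu <- boxseq N) F nu.
Proof.
rewrite -(big_map (fun nu => - nu) xpredT F); apply: perm_big; apply: uniq_perm.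
- by rewrite map_inj_uniq ?boxseq_uniq//; exact: oppr_inj.
- exact: boxseq_uniq.
- by move=> nu; rewrite -{1}[nu]opprK mem_map ?boxseqN//; exact: oppr_inj.
Qed.

(** Links these sequences with the finitely supported sums of the definition of
    the fractional Laplacian. *)
Lemma sum_punctured_box (V : nmodType) N (F : 'rV[int]_d -> V) :
  \sum_(nu \in @punctured_box d N) F nu = \sum_(nu <- boxseq N) F nu.
Proof.
rewrite (fsbig_seq _ _ (boxseq_uniq N)).
suff -> : @punctured_box d N = [set` boxseq N] by [].
apply/seteqP; split => nu /=.
  move=> [n0 H]; rewrite mem_boxseq; apply/andP; split; last by apply/forallP; exact: H.
  apply/eqP => e; move/eqP : n0; apply; rewrite e.
  by apply/funext => i; apply/funext => j; rewrite mxE.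
rewrite mem_boxseq => /andP[n0 /forallP H]; split => //.
apply/eqP => e; move/eqP : n0; apply; apply/matrixP => i j; rewrite mxE.
exact: (congr1 (fun f => f i j) e).
Qed.

Lemma enorm_sqr nu : enorm R nu ^+ 2 = \sum_i (nu 0 i)%:~R ^+ 2.
Proof. by rewrite sqr_sqrtr// sumr_ge0// => i _; exact: sqr_ge0. Qed.

Lemma enorm_ge0 nu : 0 <= enorm R nu.
Proof. exact: sqrtr_ge0. Qed.

Lemma enorm_ge nu i : `|(nu 0 i)%:~R| <= enorm R nu.
Proof.
rewrite -[leLHS]sqrtr_sqr ler_sqrt ?sumr_ge0//; last by move=> j _; exact: sqr_ge0.
by rewrite (bigD1 i)//= lerDl sumr_ge0// => j _; exact: sqr_ge0.
Qed.

Lemma enormN nu : enorm R (- nu) = enorm R nu.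
Proof. by congr Num.sqrt; apply: eq_bigr => i _; rewrite mxE mulrNz sqrrN. Qed.

Lemma row_neq0 nu : nu != 0 -> exists i, nu 0 i != 0.
Proof.
move=> nu0; apply/existsP; apply: contraNT nu0; rewrite negb_exists => /forallP H.
by apply/eqP/rowP => i; rewrite mxE; have := H i; rewrite negbK => /eqP.
Qed.

Lemma enorm_ge1 nu : nu != 0 -> 1 <= enorm R nu.
Proof.
move=> /row_neq0[i nui]; apply: le_trans (enorm_ge nu i).
by rewrite -intr_norm ler1z; lia.
Qed.

Lemma enorm_gt0 nu : nu != 0 -> 0 < enorm R nu.
Proof. by move=> /enorm_ge1; exact: lt_le_trans. Qed.

Lemma enorm_off_box N nu : nu != 0 -> nu \notin boxseq N -> N.+1%:R <= enorm R nu.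
Proof.
move=> nu0 off.
have [i H] : exists i, N%:Z < `|nu 0 i|.
  apply: contrapT => /forallNP H; move/negP: off; apply; rewrite mem_boxseq nu0.
  by apply/forallP => i; rewrite leNgt; apply/negP; exact: H.
apply: le_trans (enorm_ge nu i).
by rewrite -intr_norm -[N.+1%:R]/(N.+1%:Z%:~R) ler_int; lia.
Qed.

Lemma enorm_le_sum nu : enorm R nu <= \sum_i `|(nu 0 i)%:~R|.
Proof.
rewrite -(@ler_pXn2r _ 2)// ?nnegrE ?enorm_ge0 ?sumr_ge0// enorm_sqr expr2 mulr_suml.
apply: ler_sum => i _; rewrite -real_normK ?num_real// expr2 ler_wpM2l//.
by rewrite (bigD1 i)//= lerDl sumr_ge0.
Qed.

(** The dyadic shell between the boxes of radii 2^J and 2^(J+1) has at most K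
    2^(dJ) points where the norm is at least 2^J, so the shells are dominated by
    a geometric series. *)
Lemma lattice_sum (p : R) : d%:R < p ->
  exists C, forall N, \sum_(nu <- boxseq N) enorm R nu `^ (- p) <= C.
Proof.
move=> dp; pose F nu : R := enorm R nu `^ (- p).
have F0 nu : 0 <= F nu by exact: powR_ge0.
have p0 : 0 <= p by rewrite (le_trans _ (ltW dp)).
(* The ratio of two consecutive shells; p > d makes it smaller than 1. *)
pose rho : R := 2 ^+ d * 2 `^ (- p).
have rho0 : 0 <= rho by rewrite mulr_ge0 ?exprn_ge0 ?powR_ge0.
have rho1 : rho < 1.
  rewrite /rho -powR_mulrn// -powRD; last by rewrite pnatr_eq0 implybT.
  have a1 : 0 < ln 2 :> R by rewrite ln_gt0// ltr1n.
  have a2 : d%:R - p < 0 by rewrite subr_lt0.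
  by rewrite /powR pnatr_eq0 /= -[ltRHS]expR0 ltr_expR nmulr_rlt0.
pose B := \sum_(nu <- boxseq 1) F nu; pose K : R := (2 ^+ 3) ^+ d.
have step J : \sum_(nu <- boxseq (2 ^ J)) F nu <= B + K * \sum_(j < J) rho ^+ j.
  elim: J => [|J IH]; first by rewrite big_ord0 mulr0 addr0.
  rewrite big_ord_recr/= mulrDr addrA.
  rewrite (sum_split_sub _ (boxseq_uniq (2 ^ J)) (boxseq_uniq _)); last first.
    by apply: boxseq_sub; rewrite leq_exp2l.
  rewrite lerD//.
  apply: (@le_trans _ _ (\sum_(nu <- boxseq (2 ^ J.+1) | nu \notin boxseq (2 ^ J))
      (2 `^ (- p)) ^+ J)).
    rewrite big_seq_cond [leRHS]big_seq_cond; apply: ler_sum => nu /andP[].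
    rewrite mem_boxseq => /andP[nu0 _] off; have h := enorm_off_box nu0 off.
    rewrite /F powRN -powR_mulrn ?powR_ge0// -powRrM mulNr powRN lef_pV2; last 2 first.
    - by rewrite posrE powR_gt0// enorm_gt0.
    - by rewrite posrE powR_gt0.
    rewrite mulrC powRrM powR_mulrn//; apply: ge0_ler_powR => //; rewrite ?nnegrE ?exprn_ge0 ?enorm_ge0//.
    by rewrite (le_trans _ h)// -natrX ler_nat.
  have -> : K * rho ^+ J = K * (2 ^+ d) ^+ J * (2 `^ (- p)) ^+ J by rewrite /rho exprMn mulrA.
  rewrite big_const_seq iter_addr_0 -[leLHS]mulr_natl ler_wpM2r ?exprn_ge0 ?powR_ge0// /K.
  rewrite -!natrX -natrM ler_nat (leq_trans (count_size _ _))// (leq_trans (size_boxseq _))//.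
  have mono e x y : (x <= y -> x ^ e <= y ^ e)%N.
    by move=> xy; elim: e => // e IHe; rewrite !expnS leq_mul.
  rewrite -[X in (_ <= _ * X)%N]expnM [(d * J)%N]mulnC expnM -expnMn mono// expnS.
  have := expn_gt0 2 J; lia.
have geo J : \sum_(j < J) rho ^+ j <= (1 - rho)^-1.
  have h : (1 - rho) * \sum_(j < J) rho ^+ j = 1 - rho ^+ J.
    elim: J => [|J IH]; first by rewrite big_ord0 mulr0 expr0 subrr.
    by rewrite big_ord_recr/= mulrDr IH exprS; ring.
  have r1 : 0 < 1 - rho by rewrite subr_gt0.
  rewrite -(ler_pM2l r1) h mulfV ?gt_eqF// lerBlDr lerDl exprn_ge0//.
exists (B + K * (1 - rho)^-1) => N.
apply: (@le_trans _ _ (\sum_(nu <- boxseq (2 ^ N)) F nu)).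
  apply: ler_sum_sub => //; [exact: boxseq_uniq|exact: boxseq_uniq|].
  by apply: boxseq_sub; exact: ltnW (ltn_expl _ _).
by rewrite (le_trans (step N))// lerD2l ler_wpM2l ?exprn_ge0.
Qed.

End lattice.

Section box_series.
Variables (R : realType) (d : nat) (V : completeNormedModType R).
Variables (u : 'rV[int]_d -> V) (a : 'rV[int]_d -> R) (A : R).
Hypothesis ua : forall nu, nu != 0 -> `|u nu| <= a nu.
Hypothesis aA : forall N, \sum_(nu <- boxseq d N) a nu <= A.
Hypothesis a0 : forall nu, 0 <= a nu.

Let sa N := \sum_(nu <- boxseq d N) a nu.
Let su N := \sum_(nu <- boxseq d N) u nu.

Lemma box_sum_nondecreasing : nondecreasing_seq sa.
Proof.
by move=> N M NM; apply: ler_sum_sub => //; [exact: boxseq_uniq|exact: boxseq_uniq|exact: boxseq_sub].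
Qed.

Lemma box_sum_cvg : sa @ \oo --> limn sa.
Proof.
apply: nondecreasing_is_cvgn; first exact: box_sum_nondecreasing.
by exists A => _ [N _ <-]; exact: aA.
Qed.

Lemma box_sum_le N : sa N <= limn sa.
Proof.
apply: nondecreasing_cvgn_le; first exact: box_sum_nondecreasing.
exact: box_sum_cvg.
Qed.

Definition box_tail N : R := limn sa - sa N.

Lemma box_tail_cvg : box_tail @ \oo --> (0 : R).
Proof.
rewrite -(subrr (limn sa)); apply: cvgB; [exact: cvg_cst|exact: box_sum_cvg].
Qed.

Lemma box_dist N M : (N <= M)%N -> `|su M - su N| <= box_tail N.
Proof.
move=> NM; rewrite /su (sum_split_sub _ (boxseq_uniq d N) (boxseq_uniq d M) (boxseq_sub NM)).
rewrite addrC addKr.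
apply: (@le_trans _ _ (\sum_(nu <- boxseq d M | nu \notin boxseq d N) a nu)).
  apply: (le_trans (ler_norm_sum _ _ _)).
  rewrite big_seq_cond [leRHS]big_seq_cond; apply: ler_sum => nu /andP[].
  by rewrite mem_boxseq => /andP[nu0 _] _; exact: ua.
rewrite /box_tail lerBrDl; apply: le_trans (box_sum_le M).
by rewrite /sa (sum_split_sub _ (boxseq_uniq d N) (boxseq_uniq d M) (boxseq_sub NM)).
Qed.

(** Normal convergence in a complete space, along the increasing boxes. *)
Lemma box_series_cvg : su @ \oo --> limn su.
Proof.
apply: cauchy_cvg; apply: cauchy_exP => e e0.
have /cvgrPdist_lt/(_ e e0)[N _ H] := box_tail_cvg.
exists (su N); exists N => // M /= NM; rewrite -ball_normE /= distrC.
apply: (le_lt_trans (box_dist NM)).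
by have := H N (leqnn N); rewrite /= sub0r normrN; apply: le_lt_trans; exact: ler_norm.
Qed.

Lemma box_series_dist N : `|limn su - su N| <= box_tail N.
Proof.
have h : (fun M => `|su M - su N|) @ \oo --> `|limn su - su N|.
  by apply: cvg_norm; apply: cvgB; [exact: box_series_cvg|exact: cvg_cst].
apply: (ler_cvg_to h (cvg_cst (box_tail N))).
by exists N => // M NM; exact: box_dist.
Qed.

End box_series.

(** * Cells of the grid *)

Section box_volume.
Variable R : realType.
Notation leb := (@lebesgue_measure R).

Lemma torus_int_box d (A : 'I_d -> set R) : (forall i, measurable (A i : set (measurableTypeR R))) ->
  torus_int (box_indic A) = \prod_i \int[leb]_(t in @torus1 R) \1_(A i) t.
Proof.
elim: d A => [|d IH] A mA; first by rewrite /= /box_indic !big_ord0.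
rewrite torus_intS big_ord_recl -IH//.
have E t : torus_int (fun x : 'rV[R]_d => box_indic A (cons_mx t x)) =
    torus_int (box_indic (fun i => A (lift ord0 i))) * \1_(A ord0) t.
  rewrite mulrC -(torus_niceZ _ _).2.
    congr torus_int; apply/funext => x; rewrite /box_indic big_ord_recl cons_mx0.
    by congr (_ * _); apply: eq_bigr => i _; rewrite cons_mxS.
  have := bounded_lipschitz_box_nice (@bounded_lipschitz_cst R d 1) (fun i => mA (lift ord0 i)).
  rewrite (_ : (fun x : 'rV[R]_d => 1 * _) = box_indic (fun i : 'I_d => A (lift ord0 i)))//.
  by apply/funext => x; rewrite mul1r.
under eq_Rintegral do rewrite E.
rewrite mulrC RintegralZl//; first exact: measurable_torus1.
have := @integrable_torus1 R (\1_(A ord0)) 1; apply.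
  exact: (measurable_indic (mA ord0)).
by move=> t; rewrite indicE; case: (_ \in _); rewrite ?normr1 ?normr0.
Qed.

End box_volume.

Section cells.
Variables (R : realType) (d n : nat).
Hypothesis n0 : (0 < n)%N.
Notation leb := (@lebesgue_measure R).
Implicit Types (x y v : 'rV[R]_d) (z : dtorus d n) (f g : 'rV[R]_d -> R).

Let nR0 : 0 < n%:R :> R. Proof. by rewrite ltr0n. Qed.
Let half : R := (2 * n%:R)^-1.
Let half0 : 0 < half. Proof. by rewrite invr_gt0 mulr_gt0. Qed.

(** The cells are periodized before being cut out of the fundamental domain, so
    that no cell of the grid is special. *)
Definition cell1 : set R := [set t | exists k : int, `|t + k%:~R| < half].

Definition cell : 'rV[R]_d -> R := box_indic (fun=> cell1).

Lemma cellP x : (cell x = 1 /\ exists k : 'rV[int]_d, forall i, `|x 0 i + (k 0 i)%:~R| < half) \/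
  (cell x = 0 /\ ~ exists k : 'rV[int]_d, forall i, `|x 0 i + (k 0 i)%:~R| < half).
Proof.
have [H|H] := pselect (forall i, cell1 (x 0 i)).
  left; split.
    by rewrite /cell /box_indic big1// => i _; rewrite indicE mem_set.
  have [k Hk] := choice H; exists (\row_i k i) => i; rewrite mxE; exact: Hk.
right; split; last by move=> [k Hk]; apply: H => i; exists (k 0 i).
have [i Hi] : exists i, ~ cell1 (x 0 i) by apply/existsNP.
by rewrite /cell /box_indic (bigD1 i)//= indicE memNset// mul0r.
Qed.

Lemma cell_periodic : Defs.periodic cell.
Proof.
move=> k x.
have sh : (exists j : 'rV[int]_d, forall i, `|(x + map_mx intr k) 0 i + (j 0 i)%:~R| < half) <->
    (exists j : 'rV[int]_d, forall i, `|x 0 i + (j 0 i)%:~R| < half).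
  split=> -[j H].
    by exists (k + j) => i; have := H i; rewrite !mxE intrD addrA.
  by exists (j - k) => i; have := H i; rewrite !mxE intrD mulrNz addrACA subrr addr0.
case: (cellP x) => -[-> H]; case: (cellP (x + map_mx intr k)) => -[-> H'] //.
  by case: H'; apply/sh.
by case: H; apply/sh.
Qed.

(** The sup-norm ball of the torus is a product of one-dimensional cells, whose
    indicator is accessible to the iterated integral. *)
Lemma cell_ball z x :
  \1_(torus_ball (grid_pt R z) half) x = cell (x - grid_pt R z).
Proof.
have H : torus_ball (grid_pt R z) half x <->
    exists k : 'rV[int]_d, forall i, `|(x - grid_pt R z) 0 i + (k 0 i)%:~R| < half.
  split=> -[k Hk]; exists k.
    move=> i; have := Hk.2 0 i; rewrite /ball/= distrC; rewrite !mxE.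
    by rewrite addrAC.
  split => // i j; have := Hk j; rewrite (ord1 i) /ball/= distrC !mxE.
  by rewrite addrAC.
rewrite indicE; case: (cellP (x - grid_pt R z)) => -[-> h].
  by rewrite mem_set//; apply/H.
by rewrite memNset// => /H.
Qed.

Lemma measurable_cell1 : measurable (cell1 : set (measurableTypeR R)).
Proof.
have -> : cell1 = \bigcup_(k in [set: int]) ball (- k%:~R : R) half.
  apply/seteqP; split => [t [k kt]|t [k _]].
    by exists k => //; rewrite /ball/= -opprD normrN addrC.
  by rewrite /ball/= -opprD normrN addrC => h; exists k.
apply: open_measurable; apply: bigcup_open => k _; exact: ball_open.
Qed.

Lemma integral_cell1 : \int[leb]_(t in @torus1 R) \1_cell1 t = n%:R^-1.
Proof.
transitivity (\int[leb]_(t in @torus1 R) \1_(`]- half, half[%classic) t).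
  apply: eq_Rintegral => t; rewrite inE /torus1 /= in_itv/= => /andP[t0 t1].
  have h2 : half <= 2^-1.
    by rewrite lef_pV2 ?posrE ?mulr_gt0// ler_peMr// ler1n.
  rewrite !indicE; congr (_%:R); congr nat_of_bool; apply/idP/idP; rewrite !inE /=.
    move=> [k]; have [->|k0] := eqVneq k 0; first by rewrite addr0 in_itv/= ltr_norml.
    rewrite ltNge => /negP[]; apply: (le_trans h2).
    have k1 : 1 <= `|k%:~R| :> R by rewrite -intr_norm ler1z; lia.
    have := ler_normB (t + k%:~R) t; rewrite addrAC subrr add0r.
    have : `|t| <= 2^-1 by rewrite ler_norml t0 t1.
    lra.
  by rewrite in_itv/= -ltr_norml => tl; exists 0; rewrite addr0.
have hm : half <= 2^-1.
  by rewrite lef_pV2 ?posrE ?mulr_gt0// ler_peMr// ler1n.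
rewrite /Rintegral integral_indic//; last first.
  exact: measurable_itv.
rewrite (_ : _ `&` _ = `]- half, half[%classic); last first.
  apply/setIidPl => t /=; rewrite /torus1/= !in_itv/= => /andP[t0 t1]; lra.
rewrite [X in fine X](_ : _ = (n%:R^-1)%:E)//.
apply: (etrans (@lebesgue_measure_itv R `]- half, half[%R)).
rewrite /= lte_fin ifT; last by have := half0; lra.
rewrite -EFinD opprK /half; congr EFin; by field; rewrite gt_eqF.
Qed.

Lemma cell_nice f : bounded_lipschitz f -> torus_nice (fun x => f x * cell x).
Proof. by move=> bf; apply: bounded_lipschitz_box_nice bf (fun=> measurable_cell1). Qed.

Lemma cell_mass : torus_int cell = (n%:R ^+ d)^-1.
Proof.
rewrite torus_int_box; last by move=> i; exact: measurable_cell1.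
by under eq_bigr do rewrite integral_cell1; rewrite prodr_const card_ord exprVn.
Qed.

Lemma cell_nice1 : torus_nice cell.
Proof.
have := cell_nice (@bounded_lipschitz_cst R d 1).
by under eq_fun do rewrite mul1r.
Qed.

Lemma bounded_lipschitz_shift f v : bounded_lipschitz f -> bounded_lipschitz (fun x => f (x + v)).
Proof.
move=> [L [M [L0 M0 fL fM]]]; exists L, M; split => // x y.
apply: (le_trans (fL _ _)); rewrite /l1dist ler_wpM2l//; apply: ler_sum => i _.
by rewrite !mxE opprD addrACA subrr addr0.
Qed.

Definition cell_int f (v : 'rV[R]_d) : R := torus_int (fun x => f (x + v) * cell x).

Lemma cell_int_periodic f : Defs.periodic f -> Defs.periodic (cell_int f).
Proof.
by move=> pf k v; congr torus_int; apply/funext => x; rewrite addrA pf.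
Qed.

Lemma cell_int_shift f v : Defs.periodic f -> bounded_lipschitz f ->
  torus_int (fun x => f x * cell (x - v)) = cell_int f v.
Proof.
move=> pf bf; have pg : Defs.periodic (fun x => f (x + v) * cell x).
  by move=> k x; rewrite addrAC pf cell_periodic.
rewrite /cell_int -(torus_int_shift (- v) pg (cell_nice (bounded_lipschitz_shift v bf))).
by congr torus_int; apply/funext => x; rewrite subrK.
Qed.

Lemma le_cell_int f v (e : R) : bounded_lipschitz f ->
  (forall x, cell x = 1 -> `|f (x + v)| <= e) -> 0 <= e -> `|cell_int f v| <= e / n%:R ^+ d.
Proof.
move=> bf fe e0; have nf := cell_nice (bounded_lipschitz_shift v bf).
have [nc ec] := torus_niceZ e cell_nice1; have [nc' ec'] := torus_niceZ (- e) cell_nice1.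
have bd x : `|f (x + v) * cell x| <= e * cell x.
  case: (cellP x) => -[h _]; rewrite h ?mulr1 ?mulr0 ?normr0//; exact: fe.
rewrite -cell_mass -ec ler_norml -mulN1r -(torus_niceZ (-1) nc).2; apply/andP; split.
- apply: le_torus_int => //; first exact: (torus_niceZ (-1) nc).1.
  by move=> x; rewrite mulN1r; have := bd x; rewrite ler_norml => /andP[].
- by apply: le_torus_int => // x; have := bd x; rewrite ler_norml => /andP[].
Qed.

Lemma cell_intB f g v : bounded_lipschitz f -> bounded_lipschitz g ->
  cell_int (fun x => f x - g x) v = cell_int f v - cell_int g v.
Proof.
move=> bf bg.
rewrite -(torus_niceB (cell_nice (bounded_lipschitz_shift v bf)) (cell_nice (bounded_lipschitz_shift v bg))).2.
by congr torus_int; apply/funext => x; rewrite mulrBl.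
Qed.

Lemma cell_int_cst c v : cell_int (fun=> c) v = c / n%:R ^+ d.
Proof. by rewrite /cell_int (torus_niceZ c cell_nice1).2 cell_mass. Qed.

Lemma cells_disjoint z z' x :
  cell (x - grid_pt R z) = 1 -> cell (x - grid_pt R z') = 1 -> z = z'.
Proof.
case: (cellP (x - grid_pt R z)) => -[-> h] e1; last by move/eqP : e1; rewrite eq_sym oner_eq0.
case: (cellP (x - grid_pt R z')) => -[-> h'] e2; last by move/eqP : e2; rewrite eq_sym oner_eq0.
move: h h' => [k Hk] [k' Hk']; apply/ffunP => i; apply/val_inj/eqP => /=.
have := Hk i; have := Hk' i; rewrite !mxE => h1 h2.
have : `|((z i)%:R - (z' i)%:R + (k' 0 i - k 0 i)%:~R * n%:R : R)| < 1.
  have -> : (z i)%:R - (z' i)%:R + (k' 0 i - k 0 i)%:~R * n%:R =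
      ((x 0 i - (z' i)%:R / n%:R + (k' 0 i)%:~R) - (x 0 i - (z i)%:R / n%:R + (k 0 i)%:~R)) * n%:R :> R.
    by rewrite intrB; field; rewrite gt_eqF.
  rewrite normrM [`|n%:R|]gtr0_norm// -ltr_pdivlMr// mul1r.
  apply: (le_lt_trans (ler_normB _ _)).
  apply: (lt_le_trans (ltrD h1 h2)); rewrite le_eqVlt; apply/orP; left; apply/eqP.
  by rewrite /half; field; rewrite gt_eqF.
have -> : (z i)%:R - (z' i)%:R + (k' 0 i - k 0 i)%:~R * n%:R =
    ((z i)%:Z - (z' i)%:Z + (k' 0 i - k 0 i) * n%:Z)%:~R :> R.
  by rewrite [in RHS]intrD intrM [in RHS]intrB.
rewrite -intr_norm -[1]/(1%:~R) ltr_int.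
set m := k' 0 i - k 0 i => hz.
have m0 : m = 0.
  have := ltn_ord (z i); have := ltn_ord (z' i); nia.
by move: hz; rewrite m0 mul0r addr0; lia.
Qed.

Lemma sum_cells_le1 x : 0 <= \sum_(z : dtorus d n) cell (x - grid_pt R z) <= 1.
Proof.
have c0 z : 0 <= cell (x - grid_pt R z).
  by case: (cellP (x - grid_pt R z)) => -[-> _].
apply/andP; split; first exact: sumr_ge0.
have [[z Hz]|H] := pselect (exists z, cell (x - grid_pt R z) = 1).
  rewrite (bigD1 z)//= Hz big1 ?addr0// => z' z'z.
  case: (cellP (x - grid_pt R z')) => -[h _]//.
  by have e := cells_disjoint Hz h; rewrite e eqxx in z'z.
rewrite big1// => z _; case: (cellP (x - grid_pt R z)) => -[h _]//.
by case: H; exists z.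
Qed.

(** The cells are open and miss a null set; since they are disjoint, it suffices
    that their volumes, n^-d each, add up to 1. *)
Lemma sum_cell_int f : Defs.periodic f -> bounded_lipschitz f ->
  \sum_(z : dtorus d n) cell_int f (grid_pt R z) = torus_int f.
Proof.
move=> pf bf; have [_ [M [_ M0 _ fM]]] := bf.
have nz g z : bounded_lipschitz g -> torus_nice (fun x => g x * cell (x - grid_pt R z)).
  move=> bg; have := bounded_lipschitz_box_nice (A := fun i => [set t | cell1 (t - grid_pt R z 0 i)]) bg.
  have -> : box_indic (fun i => [set t | cell1 (t - grid_pt R z 0 i)]) = fun x => cell (x - grid_pt R z).
    apply/funext => x; apply: eq_bigr => i _; rewrite !indicE !mxE.
    by congr (_%:R); congr nat_of_bool; apply/idP/idP; rewrite !inE.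
  apply=> i.
  have m1 : measurable_fun [set: R] (fun t : R => t - grid_pt R z 0 i) by exact: measurable_funB.
  by have := m1 measurableT _ measurable_cell1; rewrite setTI.
have [nS eS] := torus_nice_sum (index_enum (dtorus d n)) (fun z => nz _ z bf).
rewrite (eq_bigr (fun z => torus_int (fun x => f x * cell (x - grid_pt R z)))); last first.
  by move=> z _; rewrite cell_int_shift.
rewrite -eS; apply/eqP; rewrite -subr_eq0 -normr_le0.
have nf := bounded_lipschitz_nice bf.
have b1 := @bounded_lipschitz_cst R d 1.
have [nS1 eS1] := torus_nice_sum (index_enum (dtorus d n)) (fun z => nz _ z b1).
have [nM eM] := torus_niceZ M (torus_niceB (bounded_lipschitz_nice b1) nS1).1.
rewrite -(torus_niceB nS nf).2.
(* The complement of the cells has measure zero, as 1 - n^d n^-d = 0. *)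
have Z : torus_int (fun x => M * (1 - \sum_(z : dtorus d n) 1 * cell (x - grid_pt R z))) = 0.
  rewrite eM (torus_niceB (bounded_lipschitz_nice b1) nS1).2 torus_int_cst eS1.
  under eq_bigr do rewrite (cell_int_shift _ _ b1)// cell_int_cst.
  rewrite sumr_const card_ffun !card_ord -[_ *+ _]mulr_natr natrX mul1r mulVf ?subrr ?mulr0//.
  by rewrite expf_neq0// gt_eqF.
rewrite -[leRHS]Z; pose D x := \sum_(z : dtorus d n) f x * cell (x - grid_pt R z) - f x.
rewrite -/D.
have bd x : `|D x| <= M * (1 - \sum_(z : dtorus d n) 1 * cell (x - grid_pt R z)).
  rewrite /D -mulr_sumr; under [in leRHS]eq_bigr do rewrite mul1r.
  rewrite -{2}[f x]mulr1 -mulrBr normrM distrC ler_pM//.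
  by have /andP[_ h] := sum_cells_le1 x; rewrite ger0_norm// subr_ge0.
have nD : torus_nice D := (torus_niceB nS nf).1.
rewrite ler_norml -mulN1r -(torus_niceZ (-1) nM).2; apply/andP; split.
- apply: le_torus_int => //; first exact: (torus_niceZ (-1) nM).1.
  by move=> x; rewrite mulN1r; have := bd x; rewrite ler_norml => /andP[].
- by apply: le_torus_int => // x; have := bd x; rewrite ler_norml => /andP[].
Qed.

Lemma cell_oscillation (L : R) f v x : 0 <= L -> l1_lipschitz L f -> Defs.periodic f ->
  cell x = 1 -> `|f (x + v) - f v| <= L * d%:R / n%:R.
Proof.
move=> L0 fL pf; case: (cellP x) => -[-> h] c1; last by move/eqP : c1; rewrite eq_sym oner_eq0.
move: h => [k Hk]; rewrite -(pf k (x + v)); apply: (le_trans (fL _ _)).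
rewrite -mulrA ler_wpM2l// /l1dist.
apply: (@le_trans _ _ (\sum_(i < d) n%:R^-1)); last first.
  by rewrite sumr_const card_ord mulr_natl.
apply: ler_sum => i _; rewrite !mxE.
have -> : x 0 i + v 0 i + (k 0 i)%:~R - v 0 i = x 0 i + (k 0 i)%:~R by ring.
apply: ltW; apply: (lt_le_trans (Hk i)).
by rewrite lef_pV2 ?posrE ?mulr_gt0// ler_peMl// ?ler1n// ltW.
Qed.

(** Translation invariance of the integral moves each cell to the origin. *)
Lemma formal_field_pairing (u : dtorus d n -> R) f : Defs.periodic f -> bounded_lipschitz f ->
  torus_nice (fun x => formal_field u x * f x) /\
  torus_int (fun x => formal_field u x * f x) = \sum_z u z * cell_int f (grid_pt R z).
Proof.
move=> pf bf.
have nz g z : bounded_lipschitz g -> torus_nice (fun x => g x * cell (x - grid_pt R z)).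
  move=> bg; have := bounded_lipschitz_box_nice (A := fun i => [set t | cell1 (t - grid_pt R z 0 i)]) bg.
  have -> : box_indic (fun i => [set t | cell1 (t - grid_pt R z 0 i)]) = fun x => cell (x - grid_pt R z).
    apply/funext => x; apply: eq_bigr => i _; rewrite !indicE !mxE.
    by congr (_%:R); congr nat_of_bool; apply/idP/idP; rewrite !inE.
  apply=> i.
  have m1 : measurable_fun [set: R] (fun t : R => t - grid_pt R z 0 i) by exact: measurable_funB.
  by have := m1 measurableT _ measurable_cell1; rewrite setTI.
have [nS eS] := torus_nice_sum (index_enum (dtorus d n))
  (fun z => (torus_niceZ (u z) (nz _ z bf)).1).
have -> : (fun x => formal_field u x * f x) =
    (fun x => \sum_(z : dtorus d n) u z * (f x * cell (x - grid_pt R z))).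
  apply/funext => x; rewrite /formal_field mulr_suml; apply: eq_bigr => z _.
  by rewrite -mulrA cell_ball [_ * f x]mulrC.
split=> //; rewrite eS; apply: eq_bigr => z _.
by rewrite (torus_niceZ (u z) (nz _ z bf)).2 cell_int_shift.
Qed.

Lemma formal_field_bounded (u : dtorus d n -> R) x : `|formal_field u x| <= \sum_z `|u z|.
Proof.
apply: (le_trans (ler_norm_sum _ _ _)); apply: ler_sum => z _.
rewrite normrM ler_piMr// indicE; case: (_ \in _); rewrite ?normr1 ?normr0//.
Qed.

End cells.

(** * Discrete Sobolev norms *)

Section symmetric_frequencies.
Variables (R : realType) (d n : nat).
Hypotheses (n0 : (0 < n)%N) (d0 : (0 < d)%N).
Implicit Types (nu mu : 'rV[int]_d) (xi : dtorus d n) (b : bool).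

Let nR0 : 0 < n%:R :> R. Proof. by rewrite ltr0n. Qed.
Let dR0 : 0 < d%:R :> R. Proof. by rewrite ltr0n. Qed.

(** Discrete eigenvalues normalized by a_n, which makes them converge to |nu|^2.
    *)
Definition lam nu : R := grid_eig R n nu / scale_a R d n.

Lemma lamE nu : lam nu = \sum_i (n%:R / pi * sin (pi * (nu 0 i)%:~R / n%:R)) ^+ 2.
Proof.
rewrite /lam /grid_eig /scale_a mulrAC mulr_sumr; apply: eq_bigr => i _.
have p0 := lt0r_neq0 (pi_gt0 R); have nn := lt0r_neq0 nR0; have dn := lt0r_neq0 dR0.
by move: p0; move: (pi : R) => p p0; field; rewrite dn nn p0.
Qed.

(** For frequencies in the symmetric range the arguments of the sines are at
    most pi/2, where the sine is comparable to its argument. *)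
Lemma lam_ge nu : (forall i, (2 * `|nu 0 i| <= n%:Z)%R) -> enorm R nu ^+ 2 / 16 <= lam nu.
Proof.
move=> H; rewrite lamE enorm_sqr mulr_suml; apply: ler_sum => i _.
have p0 := pi_gt0 R.
have key (t : R) : 0 <= t -> 2 * t <= n%:R -> t / 4 <= n%:R / pi * sin (pi * t / n%:R).
  move=> t0 tn.
  have h : 0 <= pi * t / n%:R <= pi / 2.
    apply/andP; split; first by rewrite divr_ge0// ?mulr_ge0// ltW.
    rewrite -mulrA ler_pM2l// ler_pdivrMr//; lra.
  have := sin_ge_quarter h.
  have np : 0 < n%:R / pi :> R by rewrite divr_gt0.
  rewrite -(ler_pM2l np); apply: le_trans; rewrite le_eqVlt; apply/orP; left; apply/eqP.
  by move: p0; move: (pi : R) => p p0; field; rewrite !gt_eqF.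
have ki := H i.
pose t : R := `|(nu 0 i)%:~R|.
have E : (n%:R / pi * sin (pi * (nu 0 i)%:~R / n%:R)) ^+ 2 =
    (n%:R / pi * sin (pi * t / n%:R)) ^+ 2.
  rewrite /t; have [k0|k0] := leP 0 ((nu 0 i)%:~R : R); first by rewrite ger0_norm.
  by rewrite ltr0_norm// mulrN mulNr sinN mulrN sqrrN.
rewrite E; have t0 : 0 <= t by exact: normr_ge0.
have tn : 2 * t <= n%:R.
  rewrite /t -intr_norm -[2]/(2%:~R : R) -intrM -[n%:R]/(n%:Z%:~R) ler_int//.
have h := key t t0 tn.
have -> : (nu 0 i)%:~R ^+ 2 / 16 = (t / 4) ^+ 2 :> R.
  by rewrite expr_div_n /t real_normK ?num_real//; field.
by rewrite lerXn2r ?nnegrE// ?divr_ge0// (le_trans _ h)// divr_ge0.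
Qed.

Lemma lam_ge0 nu : 0 <= lam nu.
Proof. by rewrite lamE sumr_ge0// => i _; exact: sqr_ge0. Qed.

Lemma row_mulrn mu k i : (mu *+ k) 0 i = mu 0 i * k%:Z.
Proof. by rewrite mulmxnE -mulr_natr natz. Qed.

Lemma zdot_grid_int mu (z : dtorus d n) :
  zdot (mu *+ n) (grid_pt R z) = (\sum_i mu 0 i * (z i)%:Z)%:~R.
Proof.
rewrite /zdot rmorph_sum/=; apply: eq_bigr => i _.
rewrite row_mulrn mxE !intrM -[n%:Z%:~R]/(n%:R : R) -[(z i)%:Z%:~R]/((z i)%:R : R).
by field; rewrite gt_eqF.
Qed.

Lemma mode_grid_shift nu mu b (z : dtorus d n) :
  mode (nu + mu *+ n) b (grid_pt R z) = mode nu b (grid_pt R z).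
Proof. by rewrite /mode zdotDl zdot_grid_int mulrDr sin2pi_int cos2pi_int. Qed.

Lemma dco_shift g nu mu b : @dco R d n g (nu + mu *+ n) b = dco g nu b.
Proof. by apply: eq_bigr => z _; rewrite mode_grid_shift. Qed.

Lemma sin2_cos (x : R) : sin x ^+ 2 = (1 - cos (2 * x)) / 2.
Proof.
have -> : 2 * x = x *+ 2 by rewrite mulr_natl.
by rewrite cos_mulr2n cos2sin2; field.
Qed.

Lemma grid_eig_shift nu mu : grid_eig R n (nu + mu *+ n) = grid_eig R n nu.
Proof.
congr (_ * _); apply: eq_bigr => i _; rewrite !sin2_cos; congr ((1 - _) / 2).
rewrite -[RHS](cos2pi_int (mu 0 i)); congr cos.
have -> : (nu + mu *+ n) 0 i = nu 0 i + mu 0 i * n%:Z.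
  by rewrite mxE row_mulrn.
rewrite intrD intrM -[n%:Z%:~R]/(n%:R : R); field; by rewrite gt_eqF.
Qed.

(** The residue of a frequency modulo n lying in (-n/2, n/2]^d, the range where
    discrete and continuous eigenvalues are comparable. *)
Definition sfreq xi : 'rV[int]_d :=
  \row_i (if (2 * xi i <= n)%N then (xi i)%:Z else (xi i)%:Z - n%:Z).

Lemma freq_sfreq xi : exists mu, freq xi = sfreq xi + mu *+ n.
Proof.
exists (\row_i if (2 * xi i <= n)%N then 0 else 1); apply/rowP => i.
by rewrite mxE mxE row_mulrn !mxE; case: ifP => _; lia.
Qed.

Definition symseq : seq 'rV[int]_d :=
  [seq sfreq xi | xi <- enum {: dtorus d n} & dnonzero xi].

(** Passage from residues to symmetric representatives for n-periodic summands.
    *)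
Lemma sum_symseq (V : nmodType) (G : 'rV[int]_d -> V) :
  (forall nu mu, G (nu + mu *+ n) = G nu) ->
  \sum_(xi : dtorus d n | dnonzero xi) G (freq xi) = \sum_(nu <- symseq) G nu.
Proof.
move=> pG; rewrite big_map big_filter [RHS]big_enum_cond/=.
by apply: eq_bigr => xi _; have [mu ->] := freq_sfreq xi; rewrite pG.
Qed.

Lemma symseq_uniq : uniq symseq.
Proof.
rewrite map_inj_in_uniq; first by apply: filter_uniq; exact: enum_uniq.
move=> x y _ _ /rowP H.
apply/ffunP => i; apply/val_inj => /=; have := H i; rewrite !mxE.
move: (nat_of_ord (x i)) (ltn_ord (x i)) => t ht; move: (nat_of_ord (y i)) (ltn_ord (y i)) => t' ht'.
by do 2!case: leqP => ?; lia.
Qed.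

Lemma symseq_mem nu : nu \in symseq -> nu != 0 /\ forall i, (2 * `|nu 0 i| <= n%:Z)%R.
Proof.
case/mapP => xi; rewrite mem_filter => /andP[/existsP[i xi0] _] ->; split.
  apply/eqP => /rowP/(_ i); rewrite !mxE; move: (nat_of_ord (xi i)) (ltn_ord (xi i)) xi0 => t hx xi0.
  by case: leqP => ?; lia.
by move=> j; rewrite mxE; move: (nat_of_ord (xi j)) (ltn_ord (xi j)) => t hx; case: leqP => ?; lia.
Qed.

Lemma boxseq_symseq N : (2 * N < n)%N -> {subset boxseq d N <= symseq}.
Proof.
move=> Nn nu; rewrite mem_boxseq => /andP[nu0 /forallP H].
have kl (i : 'I_d) : (absz (if 0 <= nu 0%R i then nu 0%R i else nu 0%R i + n%:Z)%R < n)%N.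
  by move: (nu 0%R i) (H i) => m hi; case: leP => ?; lia.
pose xi : dtorus d n := [ffun i => Ordinal (kl i)].
have E : nu = sfreq xi.
  apply/rowP => i; rewrite mxE ffunE /=; move: (nu 0 i) (H i) => m hi.
  by case: leP => ?; case: leqP => ?; lia.
apply/mapP; exists xi => //; rewrite mem_filter mem_enum andbT.
have [i nui] := row_neq0 nu0; apply/existsP; exists i.
by rewrite ffunE /=; move: nui; move: (nu 0 i) (H i) => m hi nui; case: leP => ?; lia.
Qed.

(** Squared homogeneous Sobolev norm of order - q on the grid. *)
Definition dsob (q : R) (g : dtorus d n -> R) : R :=
  \sum_(nu <- symseq) (lam nu)^-1 `^ q * \sum_b dco g nu b ^+ 2.

(** The variance of the pairings is a negative Sobolev norm of order 2s + 2. *)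
Lemma pairing_varE s g : pairing_var s g = dsob (2 * s + 2) g.
Proof.
rewrite /pairing_var (sum_symseq (G := fun nu => (scale_a R d n / grid_eig R n nu) `^ (2 * s + 2) *
  \sum_b dco g nu b ^+ 2)).
  by apply: eq_bigr => nu _; rewrite /lam invf_div.
move=> nu mu; rewrite grid_eig_shift; congr (_ * _).
by apply: eq_bigr => b _; rewrite dco_shift.
Qed.

Lemma sum_symseq_dco (g h : dtorus d n -> R) : \sum_z g z = 0 ->
  \sum_(nu <- symseq) \sum_b dco g nu b * dco h nu b = n%:R ^+ d * \sum_z g z * h z.
Proof.
move=> g0; rewrite -dco_parseval// [RHS](bigID (@dnonzero d n))/=.
rewrite [X in _ = _ + X]big1 ?addr0.
  rewrite -sum_symseq// => nu mu; by apply: eq_bigr => b _; rewrite !dco_shift.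
move=> xi /freq0 ->; rewrite big1// => b _; by rewrite dco0// mul0r.
Qed.

Lemma dsob0 g : \sum_z g z = 0 -> dsob 0 g = n%:R ^+ d * \sum_z g z ^+ 2.
Proof.
move=> g0; rewrite /dsob -[RHS](sum_symseq_dco g g0).
by apply: eq_bigr => nu _; rewrite powRr0 mul1r; apply: eq_bigr => b _; rewrite expr2.
Qed.

(** Multiplying the coefficients by the eigenvalue is applying the Laplacian;
    then discrete Parseval. *)
Lemma dirichlet_energy (g : dtorus d n -> R) : \sum_z g z = 0 ->
  \sum_(nu <- symseq) lam nu * (\sum_b dco g nu b ^+ 2) =
  n%:R ^+ d * \sum_z g z * (- grid_laplacian g z / scale_a R d n).
Proof.
move=> g0; rewrite -sum_symseq_dco//; apply: eq_bigr => nu _.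
rewrite mulr_sumr; apply: eq_bigr => b _.
have -> : dco (fun z => - grid_laplacian g z / scale_a R d n) nu b = lam nu * dco g nu b.
  transitivity (- (scale_a R d n)^-1 * dco (grid_laplacian g) nu b).
    by rewrite /dco mulr_sumr; apply: eq_bigr => z _; ring.
  by rewrite dco_laplacian// /lam; ring.
by rewrite expr2 mulrCA.
Qed.

Lemma lam_symseq nu : nu \in symseq -> 16^-1 <= lam nu /\ enorm R nu ^+ 2 / 16 <= lam nu.
Proof.
move=> /symseq_mem[nu0 H]; have h := lam_ge H; split => //.
apply: le_trans h; rewrite -[leLHS]mul1r ler_pM2r ?invr_gt0//.
by rewrite exprn_ege1// enorm_ge1.
Qed.

End symmetric_frequencies.

(** From |sin x - x| <= |x|^3 / 2 at x = pi k / n. *)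
Lemma lam_cvg (R : realType) d (nu : 'rV[int]_d) : (0 < d)%N ->
  (fun n => lam R n nu) @ \oo --> enorm R nu ^+ 2.
Proof.
move=> d0; rewrite enorm_sqr.
suff sc (k : int) : (fun n : nat => n%:R / pi * sin (pi * k%:~R / n%:R)) @ \oo --> (k%:~R : R).
  under eq_cvg => n.
    rewrite (_ : lam R n nu = \sum_(i < d) (n%:R / pi * sin (pi * (nu 0 i)%:~R / n%:R)) ^+ 2); last first.
      case: n => [|n]; last by rewrite lamE.
      rewrite /lam /grid_eig !big1 ?mulr0 ?mul0r// => i _; first by rewrite !mul0r expr0n.
      by rewrite invr0 mulr0 sin0 expr0n.
    over.
  apply: (@cvg_sumr R R _ _ _ (fun i n => (n%:R / pi * sin (pi * (nu 0 i)%:~R / n%:R)) ^+ 2)) => i.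
  under eq_cvg do rewrite expr2.
  by rewrite expr2; apply: cvgM; exact: sc.
have p0 := pi_gt0 R.
have sin_dist (x : R) : `|sin x - x| <= `|x| * (x ^+ 2 / 2).
  wlog x0 : x / 0 <= x.
    move=> W; have [|xn] := leP 0 x; first exact: W.
    have := W (- x); rewrite oppr_ge0 (ltW xn) => /(_ isT).
    by rewrite sinN -opprD !normrN sqrrN.
  have [|c + E] := @MVT_segment R (@sin R) (@cos R) 0 x x0.
    exact: (continuous_subspaceT (@continuous_sin R)).
  rewrite in_itv/= => /andP[c0 cx]; move: E; rewrite sin0 !subr0 => ->.
  rewrite -[X in _ * x - X]mul1r -mulrBl normrM mulrC ler_wpM2l//.
  have := cos_ge_sqr c; have := cos_le1 c.
  have : c ^+ 2 <= x ^+ 2 by rewrite lerXn2r ?nnegrE.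
  rewrite ler_norml => h1 h2 h3; apply/andP; split; lra.
apply/cvgrPdist_le => e e0.
pose K : R := `|k%:~R| * ((pi * k%:~R) ^+ 2 / 2).
have K0 : 0 <= K by rewrite mulr_ge0// divr_ge0// sqr_ge0.
have : (fun n : nat => K * n.+1%:R^-1) @ \oo --> K * 0.
  by apply: cvgMl_tmp; exact: cvg_harmonic.
rewrite mulr0 => /cvgrPdist_le/(_ e e0)[N _ HN].
exists N.+1 => // -[//|n] /= Nn.
have nn : 0 < n.+1%:R :> R by [].
have HNn := HN n Nn; rewrite /= sub0r normrN in HNn; apply: le_trans HNn; rewrite distrC.
set x := pi * k%:~R / n.+1%:R.
have -> : n.+1%:R / pi * sin x - k%:~R = n.+1%:R / pi * (sin x - x).
  by rewrite /x; move: (sin _) p0 => y; move: (pi : R) => p p0; field; rewrite !gt_eqF.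
rewrite normrM [`|_ / pi|]ger0_norm; last by rewrite divr_ge0// ltW.
have step : n.+1%:R / pi * `|sin x - x| <= n.+1%:R / pi * (`|x| * (x ^+ 2 / 2)).
  by rewrite ler_wpM2l// divr_ge0// ltW.
apply: (le_trans step).
have -> : n.+1%:R / pi * (`|x| * (x ^+ 2 / 2)) = K / n.+1%:R * n.+1%:R^-1.
  rewrite /x /K !normrM normfV [`|pi|]gtr0_norm// [`|n.+1%:R|]gtr0_norm//.
  by move: p0; move: (pi : R) => p p0; field; rewrite !gt_eqF.
rewrite [leRHS]ger0_norm; last by rewrite divr_ge0.
rewrite ler_piMr//; first by rewrite divr_ge0.
by rewrite invf_le1// ler1n.
Qed.

(** * Cell averages of test functions and convergence of the variances *)

(** Integrals against the real modes; see [mode] for the normalization. *)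
Definition coef (R : realType) d (f : 'rV[R]_d -> R) (nu : 'rV[int]_d) (b : bool) : R :=
  torus_int (fun x => f x * mode nu b x).

Definition coef2 (R : realType) d (f : 'rV[R]_d -> R) (nu : 'rV[int]_d) : R :=
  \sum_b coef f nu b ^+ 2.

Lemma coef2_ge0 (R : realType) d (f : 'rV[R]_d -> R) nu : 0 <= coef2 f nu.
Proof. by apply: sumr_ge0 => b _; exact: sqr_ge0. Qed.

Lemma bounded_lipschitzB (R : realType) d (f g : 'rV[R]_d -> R) :
  bounded_lipschitz f -> bounded_lipschitz g -> bounded_lipschitz (fun x => f x - g x).
Proof.
move=> bf bg.
rewrite (_ : (fun x => _) = fun x => f x + -1 * g x).
  exact: bounded_lipschitzD bf (bounded_lipschitzM (@bounded_lipschitz_cst R d (-1)) bg).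
by apply/funext => x; rewrite mulN1r.
Qed.

Section cell_spectrum.
Variables (R : realType) (d : nat).
Hypothesis d0 : (0 < d)%N.
Variables (f : 'rV[R]_d -> R) (M : R).
Hypothesis tf : test_function f.
Hypothesis fM : forall x, `|f x| <= M.

Let pf : Defs.periodic f. Proof. by case: tf. Qed.
Let sf : smooth f. Proof. by case: tf. Qed.
Let bf : bounded_lipschitz f. Proof. exact: test_function_lipschitz tf. Qed.
Let M0 : 0 <= M. Proof. exact: le_trans (normr_ge0 _) (fM 0). Qed.

Notation bcst := (@bounded_lipschitz_cst R d).

Section fixed_n.
Variable n : nat.
Hypothesis n0 : (0 < n)%N.
Let nR0 : 0 < n%:R :> R. Proof. by rewrite ltr0n. Qed.
Let nd0 : 0 < n%:R ^+ d :> R. Proof. by rewrite exprn_gt0. Qed.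

Definition cell_avg (z : dtorus d n) : R := cell_int n f (grid_pt R z).

Lemma cell_avg_sum0 : \sum_z cell_avg z = 0.
Proof. by rewrite sum_cell_int//; case: tf. Qed.

Lemma cell_avg_le z : `|cell_avg z| <= M / n%:R ^+ d.
Proof. by apply: le_cell_int => // x _. Qed.

Lemma sum_dtorus_cst (c : R) : \sum_(z : dtorus d n) c / n%:R ^+ d = c.
Proof. by rewrite sumr_const -[_ *+ _]mulr_natr dtorus_card mulfVK// gt_eqF. Qed.

Lemma dsob0_le : dsob 0 cell_avg <= M ^+ 2.
Proof.
rewrite dsob0 ?cell_avg_sum0// mulr_sumr.
rewrite -[leRHS]sum_dtorus_cst; apply: ler_sum => z _.
rewrite -(real_normK (num_real (cell_avg z))).
have h := cell_avg_le z.
apply: (@le_trans _ _ (n%:R ^+ d * (M / n%:R ^+ d) ^+ 2)).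
  rewrite ler_wpM2l ?(ltW nd0)// lerXn2r ?nnegrE// divr_ge0// ltW//.
by rewrite le_eqVlt; apply/orP; left; apply/eqP; field; rewrite gt_eqF.
Qed.

(** Nonzero discrete frequencies have normalized eigenvalues at least 1/16,
    which compares all orders with order 0, where Parseval applies. The bound is
    uniform in n. *)
Lemma dsob_le (q : R) : 0 <= q -> dsob q cell_avg <= 16 `^ q * M ^+ 2.
Proof.
move=> q0; apply: le_trans (ler_wpM2l (powR_ge0 _ _) dsob0_le).
rewrite /dsob mulr_sumr big_seq [leRHS]big_seq; apply: ler_sum => nu nus.
rewrite mulrA ler_wpM2r ?sumr_ge0// => [b _|]; first exact: sqr_ge0.
have [h _] := @lam_symseq R d n n0 d0 nu nus.
rewrite powRr0 ?mulr1; apply: ge0_ler_powR => //.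
- by rewrite nnegrE invr_ge0 lam_ge0.
- by rewrite nnegrE.
- rewrite -[leRHS]invrK lef_pV2 ?posrE//; apply: lt_le_trans h; by rewrite invr_gt0.
Qed.

(** Two applications of the mean value theorem. *)
Lemma second_difference (i : 'I_d) (M2 h : R) x :
  (forall y, `|iter_partial [:: i; i] f y| <= M2) ->
  `|f (x + h *: delta_mx 0 i) + f (x - h *: delta_mx 0 i) - 2 * f x| <= M2 * h ^+ 2.
Proof.
move=> fM2; set e := h *: delta_mx 0 i.
have sfe : smooth (fun y => f (y + e)) /\
    (forall y, 'D_(delta_mx 0 i) (fun y => f (y + e)) y = 'D_(delta_mx 0 i) f (y + e)).
  by split; [exact: smooth_shift|move=> y; have := iter_partial_shift f e [:: i]; move/(congr1 (fun g => g y))].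
have sg := smooth_lin (-1) sf sfe.1.
have gM y : `|'D_(delta_mx 0 i) (fun y => -1 * f y + f (y + e)) y| <= M2 * `|h|.
  have -> : 'D_(delta_mx 0 i) (fun y => -1 * f y + f (y + e)) y =
      'D_(delta_mx 0 i) f (y + e) - 'D_(delta_mx 0 i) f y.
    have := iter_partial_lin (-1) [:: i] sf sfe.1; move/(congr1 (fun g => g y)) => /= ->.
    by rewrite sfe.2 mulN1r addrC.
  exact: (partial_lipschitz (i := i) h y (smooth_deriv i sf)).
have := partial_lipschitz (i := i) (- h) x sg gM.
rewrite scaleNr -/e subrK !mulN1r normrN -mulrA -expr2 real_normK ?num_real//.
by rewrite -normrN; congr (`|_| <= _); ring.
Qed.

(** The Laplacian of the cell averages is made of second differences of size
    n^-2, the order of a_n: the energy is bounded uniformly in n. *)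
Lemma cell_energy (M2 : R) : 0 <= M2 ->
  (forall i y, `|iter_partial [:: i; i] f y| <= M2) ->
  \sum_(nu <- symseq d n) lam R n nu * (\sum_b dco cell_avg nu b ^+ 2) <=
  M * M2 * d%:R / (4 * pi ^+ 2).
Proof.
move=> M20 fM2; rewrite (dirichlet_energy n0 d0 cell_avg_sum0) mulr_sumr.
have a0 := scale_a_gt0 R n0 d0; have p0 := pi_gt0 R.
have dR0 : 0 < d%:R :> R by rewrite ltr0n.
rewrite -[leRHS]sum_dtorus_cst; apply: ler_sum => z _.
apply: (le_trans (ler_norm _)).
have L : `|grid_laplacian cell_avg z| <= (M2 / (2 * n%:R ^+ 2)) / n%:R ^+ d.
  have -> : grid_laplacian cell_avg z = (2 * d%:R)^-1 * \sum_(i < d)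
      (cell_avg (shift_up z i) + cell_avg (shift_down z i) - 2 * cell_avg z).
    rewrite /grid_laplacian sumrB mulrBr sumr_const card_ord -[_ *+ d]mulr_natr.
    by congr (_ - _); field; rewrite gt_eqF.
  rewrite normrM gtr0_norm ?invr_gt0 ?mulr_gt0//.
  apply: (@le_trans _ _ ((2 * d%:R)^-1 * \sum_(i < d) (M2 / n%:R ^+ 2) / n%:R ^+ d)).
    rewrite ler_wpM2l ?invr_ge0 ?mulr_ge0//; apply: (le_trans (ler_norm_sum _ _ _)).
    apply: ler_sum => i _.
    rewrite /cell_avg (periodic_shift_up n0 z i (@cell_int_periodic R d n f pf)).
    rewrite (periodic_shift_down n0 z i (@cell_int_periodic R d n f pf)).
    set v := grid_pt R z; set e := n%:R^-1 *: delta_mx 0 i.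
    pose g x := f (x + e) + f (x - e) - 2 * f x.
    have b1 := bounded_lipschitz_shift e bf; have b2 := bounded_lipschitz_shift (- e) bf.
    have b3 := bounded_lipschitzM (bcst 2) bf.
    have b12 := bounded_lipschitzD b1 b2.
    have -> : cell_int n f (v + e) + cell_int n f (v - e) - 2 * cell_int n f v = cell_int n g v.
      rewrite /g (cell_intB n v b12 b3).
      rewrite /cell_int -(torus_niceD _ _).2 -?(torus_niceZ 2 _).2.
      - congr (_ - _); congr torus_int; apply/funext => x; last by rewrite mulrA.
        by rewrite mulrDl !addrA.
      - exact: cell_nice (bounded_lipschitz_shift v bf).
      - exact: cell_nice (bounded_lipschitz_shift _ bf).
      - exact: cell_nice (bounded_lipschitz_shift _ bf).
    apply: le_cell_int => //.
    - exact: bounded_lipschitzB b12 b3.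
    - move=> x _; rewrite -exprVn; exact: second_difference.
    - by rewrite divr_ge0// exprn_ge0// ltW.
  rewrite sumr_const card_ord -[_ *+ d]mulr_natr le_eqVlt; apply/orP; left; apply/eqP.
  by field; rewrite !gt_eqF.
rewrite !normrM normrN normfV (gtr0_norm a0) (gtr0_norm nd0).
apply: (@le_trans _ _ (n%:R ^+ d * (M / n%:R ^+ d * ((M2 / (2 * n%:R ^+ 2)) / n%:R ^+ d / scale_a R d n)))).
  rewrite ler_wpM2l ?(ltW nd0)// ler_pM//; first by rewrite divr_ge0// ltW.
    exact: cell_avg_le.
  by rewrite ler_wpM2r// invr_ge0 ltW.
rewrite le_eqVlt; apply/orP; left; apply/eqP; rewrite /scale_a.
by move: p0; move: (pi : R) => p p0; field; rewrite !gt_eqF.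
Qed.

(** Both sides integrate f over cells, against the mode and against its value at
    the center. *)
Lemma dco_cell_avg (L : R) nu b : 0 <= L -> l1_lipschitz L (mode nu b) ->
  `|dco cell_avg nu b - coef f nu b| <= M * (L * d%:R / n%:R).
Proof.
move=> L0 eL; have be := @mode_bounded_lipschitz R d nu b.
have bfe := bounded_lipschitzM bf be.
have pfe : Defs.periodic (fun x => f x * mode nu b x).
  by move=> k x; rewrite pf mode_periodic.
rewrite /coef -(sum_cell_int n0 pfe bfe) /dco -sumrB.
apply: (le_trans (ler_norm_sum _ _ _)).
rewrite -[leRHS]sum_dtorus_cst; apply: ler_sum => z _.
set v := grid_pt R z.
have bcf := bounded_lipschitzM bf (bcst (mode nu b v)).
have -> : cell_avg z * mode nu b v - cell_int n (fun x => f x * mode nu b x) v =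
    cell_int n (fun x => f x * mode nu b v - f x * mode nu b x) v.
  rewrite (cell_intB n v bcf bfe); congr (_ - _).
  rewrite /cell_avg /cell_int mulrC -(torus_niceZ _ _).2.
    by congr torus_int; apply/funext => x; ring.
  exact: cell_nice (bounded_lipschitz_shift v bf).
apply: le_cell_int.
- exact: n0.
- exact: bounded_lipschitzB bcf bfe.
- move=> x cx; rewrite -mulrBr normrM ler_pM// distrC.
  exact: (cell_oscillation n0 v L0 eL (@mode_periodic R d nu b) cx).
- by rewrite mulr_ge0// divr_ge0// mulr_ge0.
Qed.

(** Riemann sum estimate for the square, using the oscillation of f on the
    cells. *)
Lemma cell_avg_sqr (L : R) : 0 <= L -> l1_lipschitz L f ->
  `|dsob 0 cell_avg - torus_int (fun x => f x ^+ 2)| <= M * (2 * (L * d%:R / n%:R)).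
Proof.
move=> L0 fL; rewrite (dsob0 n0 d0 cell_avg_sum0).
have bff := bounded_lipschitzM bf bf.
have pff : Defs.periodic (fun x => f x * f x) by move=> k x; rewrite pf.
have -> : torus_int (fun x => f x ^+ 2) = torus_int (fun x => f x * f x).
  by congr torus_int; apply/funext => x; rewrite expr2.
rewrite -(sum_cell_int n0 pff bff) mulr_sumr -sumrB.
apply: (le_trans (ler_norm_sum _ _ _)).
rewrite -[leRHS]sum_dtorus_cst; apply: ler_sum => z _.
set v := grid_pt R z; pose m := n%:R ^+ d * cell_avg z.
have osc x : cell n x = 1 -> `|f (x + v) - f v| <= L * d%:R / n%:R.
  by move=> cx; exact: (cell_oscillation n0 v L0 fL pf cx).
have mv : `|m - f v| <= L * d%:R / n%:R.
  have bfv := bounded_lipschitzD bf (bcst (- f v)).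
  have := @le_cell_int _ _ _ n0 (fun x => f x - f v) v (L * d%:R / n%:R) bfv osc.
  rewrite (cell_intB n v bf (bcst (f v))) cell_int_cst// => h.
  have {h} := h (divr_ge0 (mulr_ge0 L0 (ler0n _ _)) (ltW nR0)).
  rewrite -(ler_pM2l nd0) [leRHS]mulrCA mulfV ?gt_eqF// mulr1; apply: le_trans.
  rewrite -{1}(gtr0_norm nd0) -normrM mulrBr mulrCA mulfV ?gt_eqF// mulr1 //.
have bmf := bounded_lipschitzM bf (bcst m).
have -> : n%:R ^+ d * cell_avg z ^+ 2 - cell_int n (fun x => f x * f x) v =
    cell_int n (fun x => f x * m - f x * f x) v.
  rewrite (cell_intB n v bmf bff); congr (_ - _).
  rewrite expr2 mulrA -/m /cell_avg /cell_int -(torus_niceZ _ _).2.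
    by congr torus_int; apply/funext => x; ring.
  exact: cell_nice (bounded_lipschitz_shift v bf).
apply: le_cell_int.
- exact: n0.
- exact: bounded_lipschitzB bmf bff.
- move=> x cx; rewrite -mulrBr normrM ler_pM//.
  have -> : m - f (x + v) = (m - f v) - (f (x + v) - f v) by ring.
  apply: (le_trans (ler_normB _ _)); have := osc x cx; lra.
- by rewrite mulr_ge0// mulr_ge0// divr_ge0// mulr_ge0.
Qed.

End fixed_n.

End cell_spectrum.

Lemma cvg_powRr (R : realType) (u : nat -> R) (l q : R) : 0 < l ->
  u @ \oo --> l -> (fun n => u n `^ q) @ \oo --> l `^ q.
Proof.
move=> l0 ul.
have hln : (fun n => ln (u n)) @ \oo --> ln l by exact: continuous_cvg (continuous_ln l0) ul.
have hl : (fun n => expR (q * ln (u n))) @ \oo --> expR (q * ln l).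
  exact: continuous_cvg (@continuous_expR R _) (cvgMl_tmp hln).
have -> : l `^ q = expR (q * ln l) by rewrite /powR gt_eqF.
apply: (cvg_trans _ hl); apply: near_eq_cvg.
have /cvgrPdist_lt/(_ l l0) := ul; apply: filterS => n h.
rewrite /powR gt_eqF//; move: h; rewrite ltr_norml; lra.
Qed.

Section spectral_limit.
Variables (R : realType) (d : nat).
Hypothesis d0 : (0 < d)%N.
Variables (f : 'rV[R]_d -> R).
Hypothesis tf : test_function f.

Let pf : Defs.periodic f. Proof. by case: tf. Qed.
Let sf : smooth f. Proof. by case: tf. Qed.

Lemma test_function_bounded : exists2 M, 0 <= M & forall x, `|f x| <= M.
Proof. exact: continuous_periodic_bounded (smooth_continuous sf) pf. Qed.

Lemma iter_partial_bounded (l : seq 'I_d) : exists2 M, 0 <= M & forall x, `|iter_partial l f x| <= M.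
Proof.
have pl : Defs.periodic (iter_partial l f).
  by elim: l => [|i l IH] /=; [exact: pf|exact: deriv_periodic].
by have [cl _] := sf l; exact: continuous_periodic_bounded cl pl.
Qed.

Lemma second_partial_bounded : exists2 M, 0 <= M &
  forall i y, `|iter_partial [:: i; i] f y| <= M.
Proof.
pose M i := projT1 (cid2 (iter_partial_bounded [:: i; i])).
have HM i : 0 <= M i /\ forall y, `|iter_partial [:: i; i] f y| <= M i.
  by rewrite /M; case: cid2.
exists (\sum_i M i); first by apply: sumr_ge0 => i _; have [] := HM i.
move=> i y; have [_ h] := HM i; apply: (le_trans (h y)).
by rewrite (bigD1 i)//= lerDl sumr_ge0// => j _; have [] := HM j.
Qed.

Lemma coef_cvg nu b : (fun n => dco (cell_avg f (n := n)) nu b) @ \oo --> coef f nu b.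
Proof.
have [M M0 fM] := test_function_bounded.
have [L [N [L0 _ eL _]]] := @mode_bounded_lipschitz R d nu b.
apply/cvgrPdist_le => e e0.
have : (fun n : nat => M * (L * d%:R) * n.+1%:R^-1) @ \oo --> M * (L * d%:R) * 0.
  by apply: cvgMl_tmp; exact: cvg_harmonic.
rewrite mulr0 => /cvgrPdist_le/(_ e e0)[m _ Hm].
exists m.+1 => // -[//|n] /= mn; rewrite distrC.
have h := dco_cell_avg tf fM (ltn0Sn n) L0 eL; apply: (le_trans h).
have := Hm n mn; rewrite sub0r normrN; apply: le_trans.
by rewrite -!mulrA ler_norm.
Qed.

(** Partial sums of the spectral series of order - q, the limit of [dsob]. *)
Definition spec (q : R) (N : nat) : R :=
  \sum_(nu <- boxseq d N) (enorm R nu ^+ 2)^-1 `^ q * coef2 f nu.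

Lemma spec_term_ge0 q nu : 0 <= (enorm R nu ^+ 2)^-1 `^ q * coef2 f nu.
Proof. by rewrite mulr_ge0 ?powR_ge0// coef2_ge0. Qed.

Lemma spec_nondecreasing q : nondecreasing_seq (spec q).
Proof.
move=> N M NM; apply: ler_sum_sub; [exact: boxseq_uniq|exact: boxseq_uniq|exact: boxseq_sub|].
by move=> nu; exact: spec_term_ge0.
Qed.

Let dspec q N n : R := \sum_(nu <- boxseq d N) (lam R n nu)^-1 `^ q *
  \sum_b dco (cell_avg f (n := n)) nu b ^+ 2.

Lemma dspec_cvg q N : (fun n => dspec q N n) @ \oo --> spec q N.
Proof.
rewrite /spec big_seq; under eq_cvg do rewrite /dspec big_seq.
pose F nu n := if nu \in boxseq d N then (lam R n nu)^-1 `^ q * \sum_b dco (cell_avg f (n := n)) nu b ^+ 2 else 0.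
pose G nu := if nu \in boxseq d N then (enorm R nu ^+ 2)^-1 `^ q * coef2 f nu else 0.
have FG nu : F nu @ \oo --> G nu.
  rewrite /F /G; case: ifPn => [nuN|_]; last exact: cvg_cst.
  have nu0 : nu != 0 by move: nuN; rewrite mem_boxseq => /andP[].
  have e0 : 0 < enorm R nu ^+ 2 by rewrite exprn_gt0// enorm_gt0.
  apply: cvgM.
    apply: cvg_powRr; first by rewrite invr_gt0.
    by apply: cvgV; [rewrite gt_eqF|exact: lam_cvg].
  apply: cvg_sumr => b; under eq_cvg do rewrite expr2.
  by rewrite expr2; apply: cvgM; exact: coef_cvg.
have := @cvg_sumr R R _ (boxseq d N) xpredT F G FG.
rewrite /G -big_mkcond/= => h; apply: cvg_trans h; apply: near_eq_cvg; apply: nearW => n.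
by rewrite /F -big_mkcond.
Qed.

Lemma dspec_le q N n : (2 * N < n)%N -> dspec q N n <= dsob q (cell_avg f (n := n)).
Proof.
move=> Nn; have n0 : (0 < n)%N by exact: leq_ltn_trans Nn.
apply: ler_sum_sub.
- exact: boxseq_uniq.
- exact: (symseq_uniq R n0 d0).
- exact: (boxseq_symseq R n0 d0 Nn).
- by move=> nu; rewrite mulr_ge0 ?powR_ge0// sumr_ge0// => b _; exact: sqr_ge0.
Qed.

(** Inherited from the uniform bound on the discrete sums, of which the box sums
    are limits. *)
Lemma spec_bounded q (M : R) N : 0 <= q -> (forall x, `|f x| <= M) ->
  spec q N <= 16 `^ q * M ^+ 2.
Proof.
move=> q0 fM; apply: (ler_cvg_to (@dspec_cvg q N) (cvg_cst (16 `^ q * M ^+ 2))).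
exists (2 * N).+1%N => // n /= Nn; apply: (le_trans (dspec_le q Nn)).
by apply: dsob_le => //; exact: leq_ltn_trans Nn.
Qed.

Lemma spec_cvg q : 0 <= q -> spec q @ \oo --> limn (spec q).
Proof.
move=> q0; have [M M0 fM] := test_function_bounded.
apply: nondecreasing_is_cvgn; first exact: spec_nondecreasing.
by exists (16 `^ q * M ^+ 2) => _ [N _ <-]; exact: spec_bounded.
Qed.

(** Outside the box the weight lam^-q is at most t lam with t = O(1/N), so the
    tail is controlled by the Dirichlet energy, uniformly in the mesh. *)
Lemma dspec_tail : exists2 C : R, 0 <= C & forall q N n, 0 <= q -> (3 < N)%N -> (2 * N < n)%N ->
  dsob q (cell_avg f (n := n)) - dspec q N n <= C / N.+1%:R.
Proof.
have [M M0 fM] := test_function_bounded; have [M2 M20 fM2] := second_partial_bounded.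
pose E := M * M2 * d%:R / (4 * pi ^+ 2).
have E0 : 0 <= E by rewrite divr_ge0// !mulr_ge0// pi_ge0.
exists (16 * E) => [|q N n q0 N3 Nn]; first by rewrite mulr_ge0.
have n0 : (0 < n)%N by exact: leq_ltn_trans Nn.
rewrite /dsob (sum_split_sub _ (boxseq_uniq d N) (symseq_uniq R n0 d0) (boxseq_symseq R n0 d0 Nn)).
rewrite addrAC subrr add0r.
have N0 : 0 < N.+1%:R :> R by [].
pose t : R := 16 / N.+1%:R ^+ 2.
have t0 : 0 < t by rewrite divr_gt0// exprn_gt0.
have t1 : t <= 16 / N.+1%:R.
  by rewrite ler_pM2l// lef_pV2 ?posrE ?exprn_gt0// expr2 ler_peMl// ler1n.
have tt : t <= 1.
  rewrite ler_pdivrMr ?exprn_gt0// mul1r -natrX ler_nat.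
  by apply: (@leq_trans (4 ^ 2)) => //; rewrite leq_exp2r// leqW.
(* Outside the box lam >= (N+1)^2 / 16, so lam^(-q-1) <= t^(q+1) <= t. *)
have st (nu : 'rV[int]_d) : nu \in symseq d n -> nu \notin boxseq d N ->
    (lam R n nu)^-1 `^ q <= t * lam R n nu.
  move=> nus off; have [l1 l2] := @lam_symseq R d n n0 d0 nu nus.
  have lp : 0 < lam R n nu by apply: lt_le_trans l1; rewrite invr_gt0.
  have [nu0 _] := @symseq_mem R d n n0 d0 nu nus.
  have lt : (lam R n nu)^-1 <= t.
    rewrite -[leRHS]invrK lef_pV2 ?posrE ?invr_gt0//; apply: le_trans l2.
    rewrite /t invf_div ler_pM2r ?invr_gt0//.
    by rewrite lerXn2r ?nnegrE ?enorm_ge0 ?ler0n//; exact: enorm_off_box.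
  rewrite -ler_pdivrMr// -{2}[(lam R n nu)^-1]powRr1; last by rewrite invr_ge0 ltW.
  rewrite -powRD; last by rewrite invr_eq0 (gt_eqF lp) implybT.
  apply: (@le_trans _ _ (t `^ (q + 1))).
    by apply: ge0_ler_powR; rewrite ?nnegrE ?invr_ge0 ?addr_ge0// ltW.
  rewrite -[leRHS]powRr1; last exact: ltW.
  apply: ger_powR; first by rewrite t0.
  by rewrite lerDr.
apply: (@le_trans _ _ (\sum_(nu <- symseq d n | nu \notin boxseq d N)
    t * (lam R n nu * \sum_b dco (cell_avg f (n := n)) nu b ^+ 2))).
  rewrite big_seq_cond [leRHS]big_seq_cond; apply: ler_sum => nu /andP[nus off].
  by rewrite mulrA ler_wpM2r ?sumr_ge0// => [b _|]; [exact: sqr_ge0|exact: st].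
rewrite -mulr_sumr; set T := \sum_(_ <- _ | _) _.
have pos nu : 0 <= lam R n nu * \sum_b dco (cell_avg f (n := n)) nu b ^+ 2.
  by rewrite mulr_ge0 ?lam_ge0// sumr_ge0// => b _; exact: sqr_ge0.
have T0 : 0 <= T by apply: sumr_ge0.
have TE : T <= E.
  apply: le_trans (cell_energy d0 tf fM n0 M20 fM2).
  by rewrite [leRHS](bigID (mem (boxseq d N)))/= lerDr sumr_ge0.
apply: (@le_trans _ _ (16 / N.+1%:R * T)); first by rewrite ler_wpM2r.
by rewrite mulrAC ler_wpM2r ?invr_ge0// ler_wpM2l.
Qed.

(** Finitely many frequencies converge one by one, and the tails are uniformly
    small. *)
Lemma dsob_cvg q : 0 <= q ->
  (fun n => dsob q (cell_avg f (n := n))) @ \oo --> limn (spec q).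
Proof.
move=> q0; have [C C0 HC] := dspec_tail; apply: cvg_uniform_approx => e e0.
have /cvgrPdist_le/(_ e e0)[N1 _ H1] := spec_cvg q0.
have : (fun n : nat => C * n.+1%:R^-1) @ \oo --> C * 0.
  by apply: cvgMl_tmp; exact: cvg_harmonic.
rewrite mulr0 => /cvgrPdist_le/(_ e e0)[N2 _ H2].
pose N := maxn 4 (maxn N1 N2).
exists (dspec q N), (spec q N); split; first exact: dspec_cvg.
- exists (2 * N).+1%N => // n /= Nn; rewrite distrC ger0_norm ?subr_ge0 ?dspec_le//.
  apply: (le_trans (HC q N n q0 _ Nn)); first by rewrite /N leq_max.
  have := H2 N; rewrite /= sub0r normrN => h; apply: le_trans (h _); first exact: ler_norm.
  by rewrite /N !leq_max leqnn !orbT.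
- by rewrite distrC; apply: H1; rewrite /= /N !leq_max leqnn !orbT.
Qed.

(** The case q = 0 of the convergence of the discrete norms, compared with the
    Riemann sums of f^2. *)
Lemma parseval : limn (spec 0) = torus_int (fun x => f x ^+ 2).
Proof.
have [M M0 fM] := test_function_bounded.
have [L [N [L0 _ fL _]]] := test_function_lipschitz tf.
apply: (cvg_unique _ (dsob_cvg (lexx 0))) => //.
apply/cvgrPdist_le => e e0.
have : (fun n : nat => M * (2 * (L * d%:R)) * n.+1%:R^-1) @ \oo --> M * (2 * (L * d%:R)) * 0.
  by apply: cvgMl_tmp; exact: cvg_harmonic.
rewrite mulr0 => /cvgrPdist_le/(_ e e0)[m _ Hm].
exists m.+1 => // -[//|n] /= mn; rewrite distrC.
apply: (le_trans (cell_avg_sqr d0 tf fM (ltn0Sn n) L0 fL)).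
have := Hm n mn; rewrite sub0r normrN; apply: le_trans.
by rewrite -!mulrA ler_norm.
Qed.

End spectral_limit.

(** * Fourier series of test functions *)

Section fourier_series.
Variables (R : realType) (d : nat).
Hypothesis d0 : (0 < d)%N.
Implicit Types (f g : 'rV[R]_d -> R) (nu mu : 'rV[int]_d) (b : bool).

Lemma coefN f nu b : torus_nice (fun x => f x * mode nu b x) ->
  coef f (- nu) b = (-1) ^+ b * coef f nu b.
Proof.
move=> nf; rewrite /coef -(torus_niceZ _ nf).2; congr torus_int.
by apply/funext => x; rewrite modeN mulrCA.
Qed.

Lemma coefN_lip f nu b : bounded_lipschitz f -> coef f (- nu) b = (-1) ^+ b * coef f nu b.
Proof.
move=> bf; apply: coefN; apply: bounded_lipschitz_nice.
exact: bounded_lipschitzM bf (@mode_bounded_lipschitz R d nu b).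
Qed.

Lemma coef_le f nu b (M : R) : bounded_lipschitz f -> (forall x, `|f x| <= M) ->
  `|coef f nu b| <= M.
Proof.
move=> bf fM; apply: torus_int_bounds.
  by apply: bounded_lipschitz_nice; exact: bounded_lipschitzM bf (@mode_bounded_lipschitz R d nu b).
by move=> x; rewrite normrM -[M]mulr1 ler_pM// mode_le1.
Qed.

Lemma coefB f g nu b : bounded_lipschitz f -> bounded_lipschitz g ->
  coef (fun x => f x - g x) nu b = coef f nu b - coef g nu b.
Proof.
move=> bf bg; have be := @mode_bounded_lipschitz R d nu b.
rewrite /coef -(torus_niceB (bounded_lipschitz_nice (bounded_lipschitzM bf be))
  (bounded_lipschitz_nice (bounded_lipschitzM bg be))).2.
by congr torus_int; apply/funext => x; rewrite mulrBl.
Qed.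

Definition box_trig (c : 'rV[int]_d -> bool -> R) (N : nat) (x : 'rV[R]_d) : R :=
  \sum_(nu <- boxseq d N) \sum_b c nu b * mode nu b x.

Lemma box_trig_lipschitz c N : bounded_lipschitz (box_trig c N).
Proof.
apply: bounded_lipschitz_sum => nu; apply: bounded_lipschitz_sum => b.
exact: bounded_lipschitzM (@bounded_lipschitz_cst R d _) (@mode_bounded_lipschitz R d nu b).
Qed.

(** The step functions of the sandpile and the Lipschitz functions are treated
    together through this property, which allows integration against every test
    function. *)
Definition multiplier (F : 'rV[R]_d -> R) : Prop :=
  forall g, Defs.periodic g -> bounded_lipschitz g -> torus_nice (fun x => F x * g x).

Lemma bounded_lipschitz_multiplier f : bounded_lipschitz f -> multiplier f.
Proof. by move=> bf g _ bg; apply: bounded_lipschitz_nice; exact: bounded_lipschitzM. Qed.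

Lemma pair_box_trig F c N : multiplier F ->
  torus_int (fun x => F x * box_trig c N x) =
  \sum_(nu <- boxseq d N) \sum_b c nu b * coef F nu b.
Proof.
move=> mF.
have nm nu b := mF _ (@mode_periodic R d nu b) (@mode_bounded_lipschitz R d nu b).
have n1 nu b := (torus_niceZ (c nu b) (nm nu b)).1.
have n2 nu := (torus_nice_sum (index_enum bool) (n1 nu)).1.
transitivity (torus_int (fun x => \sum_(nu <- boxseq d N) \sum_b c nu b * (F x * mode nu b x))).
  congr torus_int; apply/funext => x; rewrite mulr_sumr; apply: eq_bigr => nu _.
  by rewrite mulr_sumr; apply: eq_bigr => b _; rewrite mulrCA.
rewrite (torus_nice_sum _ n2).2; apply: eq_bigr => nu _.
rewrite (torus_nice_sum _ (n1 nu)).2; apply: eq_bigr => b _.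
by rewrite (torus_niceZ _ (nm nu b)).2.
Qed.

(** The symmetry of the coefficients of a function: cosine coefficients are
    even, sine coefficients odd. It is the condition under which the redundant
    family of modes determines the coefficients. *)
Definition hermitian (c : 'rV[int]_d -> bool -> R) : Prop :=
  forall nu b, c (- nu) b = (-1) ^+ b * c nu b.

Lemma coef_box_trig c N nu b : hermitian c ->
  coef (box_trig c N) nu b = (nu \in boxseq d N)%:R * c nu b.
Proof.
move=> hc; rewrite /coef.
have -> : (fun x => box_trig c N x * mode nu b x) = (fun x => mode nu b x * box_trig c N x).
  by apply/funext => x; rewrite mulrC.
rewrite (pair_box_trig _ _ (bounded_lipschitz_multiplier (@mode_bounded_lipschitz R d nu b))).
rewrite /coef.
under eq_bigr do under eq_bigr do rewrite torus_int_modeM.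
have E mu : \sum_b' c mu b' * ((b == b')%:R * 2^-1 * ((nu == mu)%:R + (-1) ^+ b * (nu == - mu)%:R)) =
    2^-1 * (c mu b * (nu == mu)%:R) + 2^-1 * ((-1) ^+ b * c mu b * (nu == - mu)%:R).
  rewrite (bigD1 b)//= eqxx (_ : true%:R = 1 :> R)// big1 ?addr0; first by ring.
  by move=> b' bb; rewrite eq_sym (negbTE bb) !mul0r mulr0.
under eq_bigr do rewrite E.
rewrite big_split/= -!mulr_sumr.
rewrite [X in 2^-1 * _ + 2^-1 * X](_ : _ = \sum_(mu <- boxseq d N) c mu b * (nu == mu)%:R); last first.
  rewrite -[RHS]sum_boxseqN; apply: eq_bigr => mu _; rewrite hc.
  by rewrite mulrAC.
have -> : \sum_(mu <- boxseq d N) c mu b * (nu == mu)%:R = (nu \in boxseq d N)%:R * c nu b.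
  have [nuN|nuN] := boolP (nu \in boxseq d N).
    rewrite (bigD1_seq nu)//= ?boxseq_uniq// eqxx mulr1 mul1r big1 ?addr0//.
    by move=> mu; rewrite eq_sym => /negbTE ->; rewrite mulr0.
  rewrite mul0r big_seq big1// => mu muN; case: eqP => [e|_]; last by rewrite mulr0.
  by rewrite e muN in nuN.
by field.
Qed.

Lemma box_trig_norm c N : hermitian c ->
  torus_int (fun x => box_trig c N x ^+ 2) = \sum_(nu <- boxseq d N) \sum_b c nu b ^+ 2.
Proof.
move=> hc; transitivity (torus_int (fun x => box_trig c N x * box_trig c N x)).
  by congr torus_int; apply/funext => x; rewrite expr2.
rewrite (pair_box_trig _ _ (bounded_lipschitz_multiplier (box_trig_lipschitz c N))).
rewrite big_seq [RHS]big_seq; apply: eq_bigr => nu nuN; apply: eq_bigr => b _.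
by rewrite coef_box_trig// nuN mul1r expr2.
Qed.

(** Expansion of the square, with the orthogonality relations. *)
Lemma fourier_remainder f N : bounded_lipschitz f ->
  torus_int (fun x => (f x - box_trig (coef f) N x) ^+ 2) =
  torus_int (fun x => f x ^+ 2) - \sum_(nu <- boxseq d N) coef2 f nu.
Proof.
move=> bf; have bS := box_trig_lipschitz (coef f) N.
have hc : hermitian (coef f) by move=> nu b; exact: coefN_lip.
have n1 := bounded_lipschitz_nice (bounded_lipschitzM bf bf).
have n2 := bounded_lipschitz_nice (bounded_lipschitzM bf bS).
have n3 := bounded_lipschitz_nice (bounded_lipschitzM bS bS).
have e3 : torus_int (fun x => box_trig (coef f) N x * box_trig (coef f) N x) =
    \sum_(nu <- boxseq d N) coef2 f nu.
  rewrite /coef2 -box_trig_norm//; congr torus_int; apply/funext => x; by rewrite expr2.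
have e2 : torus_int (fun x => f x * box_trig (coef f) N x) = \sum_(nu <- boxseq d N) coef2 f nu.
  rewrite (pair_box_trig _ _ (bounded_lipschitz_multiplier bf)).
  by apply: eq_bigr => nu _; apply: eq_bigr => b _; rewrite expr2.
have [m2 i2] := torus_niceZ (-2) n2.
have [m12 i12] := torus_niceD n1 m2.
have [m123 i123] := torus_niceD m12 n3.
transitivity (torus_int (fun x => f x * f x + -2 * (f x * box_trig (coef f) N x) +
    box_trig (coef f) N x * box_trig (coef f) N x)).
  by congr torus_int; apply/funext => x; ring.
rewrite i123 i12 i2 e2 e3.
have -> : torus_int (fun x => f x ^+ 2) = torus_int (fun x => f x * f x).
  by congr torus_int; apply/funext => x; rewrite expr2.
by ring.
Qed.

Lemma bessel f N : bounded_lipschitz f ->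
  \sum_(nu <- boxseq d N) coef2 f nu <= torus_int (fun x => f x ^+ 2).
Proof.
move=> bf; rewrite -subr_ge0 -fourier_remainder//.
by apply: torus_int_ge0 => x; exact: sqr_ge0.
Qed.

Lemma spec0E f N : spec f 0 N = \sum_(nu <- boxseq d N) coef2 f nu.
Proof. by apply: eq_bigr => nu _; rewrite powRr0 mul1r. Qed.

(** The Fourier series of f converges to f in mean square, by Parseval, and F is
    bounded. *)
Lemma pairing_series F (B : R) f : multiplier F -> (forall x, `|F x| <= B) ->
  test_function f ->
  (fun N => \sum_(nu <- boxseq d N) \sum_b coef f nu b * coef F nu b) @ \oo --> l2dot F f.
Proof.
move=> mF FB tf; have bf := test_function_lipschitz tf.
have B0 : 0 <= B by exact: le_trans (normr_ge0 _) (FB 0).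
have pf : Defs.periodic f by case: tf.
have rem : (fun N => torus_int (fun x => (f x - box_trig (coef f) N x) ^+ 2)) @ \oo --> (0 : R).
  have h : (fun N => torus_int (fun x => f x ^+ 2) - spec f 0 N) @ \oo -->
      torus_int (fun x => f x ^+ 2) - limn (spec f 0).
    by apply: cvgB; [exact: cvg_cst|exact: (spec_cvg d0 tf (lexx 0))].
  rewrite (parseval d0 tf) subrr in h; apply: cvg_trans h; apply: near_eq_cvg.
  by apply: nearW => N; rewrite (fourier_remainder _ bf) -spec0E.
under eq_cvg do rewrite -(pair_box_trig _ _ mF).
apply/cvgrPdist_le => e e0.
have B1 : 0 < B + 1 by rewrite ltr_wpDl.
pose del := e / (B + 1); have del0 : 0 < del by rewrite divr_gt0.
have de0 : 0 < e * del / (B + 1) by apply: divr_gt0 => //; exact: mulr_gt0.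
have /cvgrPdist_le/(_ _ de0) := rem; apply: filterS => N; rewrite sub0r normrN => hN.
have bS := box_trig_lipschitz (coef f) N.
have pS : Defs.periodic (box_trig (coef f) N).
  by move=> k x; apply: eq_bigr => nu _; apply: eq_bigr => b _; rewrite mode_periodic.
have nf := mF f pf bf; have nS := mF _ pS bS.
rewrite /l2dot -(torus_niceB nf nS).2.
pose r x := f x - box_trig (coef f) N x.
have br : bounded_lipschitz r by exact: bounded_lipschitzB.
have nr2 := bounded_lipschitz_nice (bounded_lipschitzM br br).
(* |r| <= r^2 / (2 del) + del / 2 turns mean square convergence into convergence
   of the pairing. *)
pose A := B * (2 * del)^-1.
have [nA iA] := torus_niceZ A nr2.
have [nD iD] := torus_niceD nA (torus_nice_cst d (B * (del / 2))).
have bd x : `|F x * f x - F x * box_trig (coef f) N x| <= A * (r x * r x) + B * (del / 2).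
  rewrite -mulrBr normrM -/(r x).
  apply: (@le_trans _ _ (B * `|r x|)); first by rewrite ler_wpM2r.
  have -> : A * (r x * r x) + B * (del / 2) = B * (`|r x| + (2 * del)^-1 * (`|r x| - del) ^+ 2).
    have -> : r x * r x = `|r x| * `|r x| by rewrite -normrM ger0_norm// -expr2 sqr_ge0.
    by rewrite /A; field; rewrite gt_eqF.
  by rewrite ler_wpM2l// lerDl mulr_ge0 ?sqr_ge0// invr_ge0 mulr_ge0// ltW.
have nFB := (torus_niceB nf nS).1.
have ub : torus_int (fun x => A * (r x * r x) + B * (del / 2)) <= e.
  rewrite iD iA torus_int_cst.
  have -> : torus_int (fun x => r x * r x) = torus_int (fun x => (f x - box_trig (coef f) N x) ^+ 2).
    by congr torus_int; apply/funext => x; rewrite expr2.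
  have hN' := le_trans (ler_norm _) hN.
  apply: (@le_trans _ _ (A * (e * del / (B + 1)) + B * (del / 2))).
    by rewrite lerD2r ler_wpM2l// mulr_ge0// invr_ge0 mulr_ge0// ltW.
  have -> : A * (e * del / (B + 1)) + B * (del / 2) = e * (B / (B + 1)).
    by rewrite /A /del; field; rewrite !gt_eqF.
  by rewrite ler_piMr ?(ltW e0)// ler_pdivrMr// mul1r lerDl.
apply: le_trans ub; rewrite ler_norml -mulN1r -(torus_niceZ (-1) nD).2.
apply/andP; split; apply: le_torus_int => //.
- exact: (torus_niceZ (-1) nD).1.
- by move=> x; rewrite mulN1r; have := bd x; rewrite ler_norml => /andP[].
- by move=> x; have := bd x; rewrite ler_norml => /andP[].
Qed.

End fourier_series.

Section decay.
Variables (R : realType) (d : nat).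
Hypothesis d0 : (0 < d)%N.
Implicit Types (f g : 'rV[R]_d -> R) (nu mu : 'rV[int]_d) (b : bool) (i : 'I_d).

(** Translating by half a period of the mode in one direction changes its sign,
    so that a coefficient is half that of a difference. *)
Lemma coef_half_shift f nu b i : Defs.periodic f -> bounded_lipschitz f -> nu 0 i != 0 ->
  coef f nu b =
  2^-1 * coef (fun x => -1 * f (x + (2 * (nu 0 i)%:~R)^-1 *: delta_mx 0 i) + f x) nu b.
Proof.
move=> pf bf nui; set h := (2 * (nu 0 i)%:~R)^-1; set e := h *: delta_mx 0 i.
have nuR : (nu 0 i)%:~R != 0 :> R by rewrite intr_eq0.
have be := @mode_bounded_lipschitz R d nu b.
have bfe := bounded_lipschitz_shift e bf.
have sh x : mode nu b (x + e) = - mode nu b x.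
  have zE : 2 * pi * zdot nu e = pi :> R.
    by rewrite zdot_step /h; field; rewrite nuR.
  by rewrite /mode zdotD mulrDr zE sinDpi cosDpi; case: b {be}.
have n1 := bounded_lipschitz_nice (bounded_lipschitzM bf be).
have n2 := bounded_lipschitz_nice (bounded_lipschitzM bfe be).
have H : coef (fun x => f (x + e)) nu b = - coef f nu b.
  have p1 : Defs.periodic (fun x => f x * mode nu b x) by move=> k x; rewrite pf mode_periodic.
  rewrite /coef -[in RHS](torus_int_shift e p1 n1) -mulN1r -(torus_niceZ _ _).2; last first.
    exact: bounded_lipschitz_nice (bounded_lipschitz_shift e (bounded_lipschitzM bf be)).
  by congr torus_int; apply/funext => x; rewrite sh mulrN mulN1r opprK.
have -> : coef (fun x => -1 * f (x + e) + f x) nu b = - coef (fun x => f (x + e)) nu b + coef f nu b.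
  have [m2 i2] := torus_niceZ (-1) n2; have [m3 i3] := torus_niceD m2 n1.
  rewrite /coef -[X in X + _]mulN1r -i2 -i3.
  by congr torus_int; apply/funext => x; rewrite mulrDl mulrA.
by rewrite H; field.
Qed.

(** Each use of the half-period difference trades one derivative for one power
    of the frequency; this replaces integration by parts. *)
Lemma coef_decay1 k f nu b i (M : R) : Defs.periodic f -> smooth f -> nu 0 i != 0 ->
  (forall x, `|iter_partial (nseq k i) f x| <= M) ->
  `|coef f nu b| * `|(nu 0 i)%:~R| ^+ k <= M.
Proof.
move=> + + nui; have nu1 : 1 <= `|(nu 0 i)%:~R| :> R by rewrite -intr_norm ler1z; lia.
elim: k f M => [|k IH] f M pf sf fM.
  by rewrite expr0 mulr1; apply: coef_le => //; exact: smooth_periodic_lipschitz.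
pose h : R := (2 * (nu 0 i)%:~R)^-1; pose e : 'rV[R]_d := h *: delta_mx 0 i.
pose g x := -1 * f (x + e) + f x.
have sfe := smooth_shift e sf.
have sg : smooth g by exact: smooth_lin.
have pg : Defs.periodic g by move=> l x; rewrite /g addrAC !pf.
have M0 : 0 <= M by exact: le_trans (normr_ge0 _) (fM 0).
have gM x : `|iter_partial (nseq k i) g x| <= M * `|h|.
  rewrite /g (iter_partial_lin _ _ sfe sf) iter_partial_shift mulN1r addrC distrC.
  have sk : smooth (iter_partial (nseq k i) f).
    by move=> l; have := sf (l ++ nseq k i); rewrite /iter_partial foldr_cat.
  exact: (partial_lipschitz (i := i) h x sk).
have := IH g _ pg sg gM.
rewrite (coef_half_shift b pf (smooth_periodic_lipschitz sf pf) nui) -/h -/e -/g.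
set a := `|(nu 0 i)%:~R|; set c := coef g nu b.
have hE : `|h| = (2 * a)^-1 by rewrite /h normfV normrM [`|2|]ger0_norm.
rewrite hE normrM [`|2^-1|]ger0_norm ?invr_ge0// => H.
have a0 : 0 < a by apply: lt_le_trans nu1.
rewrite exprS; have -> : 2^-1 * `|c| * (a * a ^+ k) = 2^-1 * a * (`|c| * a ^+ k) by ring.
apply: (@le_trans _ _ (2^-1 * a * (M * (2 * a)^-1))).
  by rewrite ler_wpM2l// mulr_ge0 ?invr_ge0// ltW.
have -> : 2^-1 * a * (M * (2 * a)^-1) = M / 4 by field; rewrite gt_eqF.
by rewrite ler_pdivrMr// ler_peMr// ler1n.
Qed.

(** The largest coordinate of nu is used for the one-dimensional estimate. *)
Lemma coef_decay f (p : R) : test_function f -> 0 <= p ->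
  exists2 C, 0 <= C & forall nu b, nu != 0 -> `|coef f nu b| <= C * enorm R nu `^ (- p).
Proof.
move=> tf p0; have [pf sf _] := tf.
(* A whole number of derivatives, at least p. *)
pose k := (Num.truncn p).+1.
have pk : p <= k%:R by exact: ltW (real_truncnS_gt (num_real p)).
pose M i := projT1 (cid2 (iter_partial_bounded tf (nseq k i))).
have HM i : 0 <= M i /\ forall y, `|iter_partial (nseq k i) f y| <= M i.
  by rewrite /M; case: cid2.
exists (d%:R ^+ k * \sum_i M i) => [|nu b nu0].
  by rewrite mulr_ge0 ?exprn_ge0// sumr_ge0// => i _; have [] := HM i.
have e1 := enorm_ge1 R nu0; have e0 := enorm_gt0 R nu0.
apply: (@le_trans _ _ (d%:R ^+ k * (\sum_i M i) * enorm R nu `^ (- k%:R))); last first.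
  rewrite ler_wpM2l ?mulr_ge0 ?exprn_ge0 ?sumr_ge0// => [i _|]; first by have [] := HM i.
  by apply: ler_powR => //; rewrite lerN2.
rewrite powRN powR_mulrn ?enorm_ge0// ler_pdivlMr ?exprn_gt0//.
have key i : `|coef f nu b| * `|(nu 0 i)%:~R| ^+ k <= \sum_i M i.
  have [Mi hM] := HM i; apply: (@le_trans _ _ (M i)); last first.
    by rewrite (bigD1 i)//= lerDl sumr_ge0// => j _; have [] := HM j.
  have [nui|nui] := eqVneq (nu 0 i) 0; first by rewrite nui normr0 /k expr0n mulr0.
  exact: coef_decay1 pf sf nui hM.
pose a (j : 'I_d) : R := `|(nu 0 j)%:~R|.
have [i Hi] : exists i, forall j, a j <= a i.
  have [i _ Hi] := @arg_maxP _ _ 'I_d (Ordinal d0) xpredT a isT.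
  by exists i => j; exact: Hi.
have mx : enorm R nu <= d%:R * a i.
  apply: (le_trans (enorm_le_sum R nu)); rewrite mulr_natl -[X in _ *+ X]card_ord -sumr_const.
  by apply: ler_sum => j _; exact: Hi.
apply: (@le_trans _ _ (`|coef f nu b| * (d%:R * a i) ^+ k)).
  by rewrite ler_wpM2l// lerXn2r ?nnegrE ?enorm_ge0 ?mulr_ge0// normr_ge0.
by rewrite exprMn mulrCA ler_wpM2l ?exprn_ge0//; exact: key.
Qed.

Lemma coef_summable f (p : R) : test_function f -> 0 <= p ->
  exists C, forall N, \sum_(nu <- boxseq d N) (enorm R nu `^ p * \sum_b `|coef f nu b|) <= C.
Proof.
move=> tf p0; pose q : R := p + d%:R + 1.
have q0 : 0 <= q by rewrite !addr_ge0.
have [C C0 HC] := coef_decay tf q0.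
have [K HK] := @lattice_sum R d (d%:R + 1) (ltr_pwDr ltr01 (lexx _)).
exists (2 * C * K) => N.
apply: (@le_trans _ _ (\sum_(nu <- boxseq d N) 2 * C * enorm R nu `^ (- (d%:R + 1)))); last first.
  by rewrite -mulr_sumr ler_wpM2l ?mulr_ge0.
rewrite big_seq [leRHS]big_seq; apply: ler_sum => nu; rewrite mem_boxseq => /andP[nu0 _].
have e0 := enorm_gt0 R nu0.
have -> : 2 * C * enorm R nu `^ (- (d%:R + 1)) =
    enorm R nu `^ p * (C * enorm R nu `^ (- q) + C * enorm R nu `^ (- q)).
  have -> : - (d%:R + 1) = p + (- q) by rewrite /q; ring.
  rewrite powRD; last by rewrite (gt_eqF e0) implybT.
  by ring.
by rewrite ler_wpM2l ?powR_ge0// big_bool lerD// HC.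
Qed.

End decay.

Section trigonometric_series.
Variables (R : realType) (d : nat).
Variables (c : 'rV[int]_d -> bool -> R) (a : 'rV[int]_d -> R) (A A' : R).
Hypothesis hc : hermitian c.
Hypothesis ca : forall nu, nu != 0 -> \sum_b `|c nu b| <= a nu.
Hypothesis a0 : forall nu, 0 <= a nu.
Hypothesis aA : forall N, \sum_(nu <- boxseq d N) a nu <= A.
Hypothesis aA' : forall N, \sum_(nu <- boxseq d N) enorm R nu * a nu <= A'.
Implicit Types (x y : 'rV[R]_d).

Definition trig_series x : R := limn (fun N => box_trig c N x).

Let ut x nu := \sum_b c nu b * mode nu b x.

Let ua x nu : nu != 0 -> `|ut x nu| <= a nu.
Proof.
move=> nu0; apply: le_trans (ca nu0); apply: (le_trans (ler_norm_sum _ _ _)).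
by apply: ler_sum => b _; rewrite normrM ler_piMr// mode_le1.
Qed.

Lemma trig_series_cvg x : (fun N => box_trig c N x) @ \oo --> trig_series x.
Proof. exact: (@box_series_cvg R d R (ut x) a A (@ua x) aA a0). Qed.

Lemma trig_series_dist N x : `|trig_series x - box_trig c N x| <= box_tail a N.
Proof. exact: (@box_series_dist R d R (ut x) a A (@ua x) aA a0). Qed.

Lemma box_trig_le N x : `|box_trig c N x| <= A.
Proof.
apply: le_trans (aA N); apply: (le_trans (ler_norm_sum _ _ _)).
rewrite big_seq [leRHS]big_seq; apply: ler_sum => nu; rewrite mem_boxseq => /andP[nu0 _].
exact: ua.
Qed.

Lemma trig_series_le x : `|trig_series x| <= A.
Proof.
apply: (ler_cvg_to (cvg_norm (@trig_series_cvg x)) (cvg_cst A)).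
by apply: nearW => N; exact: box_trig_le.
Qed.

(** The box sums have a common Lipschitz constant because the first-order series
    converges. *)
Lemma trig_series_lipschitz : bounded_lipschitz trig_series.
Proof.
have p0 := pi_ge0 R.
have A0 : 0 <= A by exact: le_trans (normr_ge0 _) (trig_series_le 0).
have A'0 : 0 <= A'.
  by apply: le_trans (aA' 0); apply: sumr_ge0 => nu _; rewrite mulr_ge0 ?enorm_ge0.
exists (2 * pi * d%:R * A'), A; split => //.
- by rewrite !mulr_ge0.
- move=> x y; apply: (ler_cvg_to (cvg_norm (cvgB (@trig_series_cvg x) (@trig_series_cvg y)))
    (cvg_cst (2 * pi * d%:R * A' * l1dist x y))).
  apply: nearW => N; rewrite [X in `|X|](_ : _ = box_trig c N x - box_trig c N y)//.
  rewrite /box_trig -sumrB.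
  apply: (le_trans (ler_norm_sum _ _ _)).
  apply: (@le_trans _ _ (\sum_(nu <- boxseq d N) (2 * pi * d%:R * l1dist x y) * (enorm R nu * a nu))).
    rewrite big_seq [leRHS]big_seq; apply: ler_sum => nu; rewrite mem_boxseq => /andP[nu0 _].
    rewrite -sumrB; apply: (le_trans (ler_norm_sum _ _ _)).
    apply: (@le_trans _ _ (\sum_b `|c nu b| * (2 * pi * d%:R * l1dist x y * enorm R nu))).
      apply: ler_sum => b _; rewrite -mulrBr normrM ler_wpM2l//.
      apply: (le_trans (mode_lipschitz nu b x y)).
      have -> : 2 * pi * d%:R * l1dist x y * enorm R nu = 2 * pi * (d%:R * enorm R nu) * l1dist x y by ring.
      rewrite ler_wpM2r ?l1dist_ge0// ler_wpM2l ?mulr_ge0//.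
      rewrite mulr_natl -[X in _ *+ X]card_ord -sumr_const.
      by apply: ler_sum => i _; exact: enorm_ge.
    rewrite -mulr_suml; set K := 2 * pi * d%:R * l1dist x y.
    have K0 : 0 <= K by rewrite /K !mulr_ge0// l1dist_ge0.
    rewrite [leLHS]mulrCA; apply: ler_wpM2l => //; rewrite mulrC.
    by rewrite ler_wpM2l ?enorm_ge0//; exact: ca.
  have -> : 2 * pi * d%:R * A' * l1dist x y = 2 * pi * d%:R * l1dist x y * A' by ring.
  rewrite -mulr_sumr; apply: ler_wpM2l; last exact: aA'.
  by rewrite !mulr_ge0// l1dist_ge0.
- exact: trig_series_le.
Qed.

(** Orthogonality for the box sums, which converge uniformly. *)
Lemma trig_series_norm :
  (fun N => \sum_(nu <- boxseq d N) \sum_b c nu b ^+ 2) @ \oo -->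
  torus_int (fun x => trig_series x ^+ 2).
Proof.
have A0 : 0 <= A by exact: le_trans (normr_ge0 _) (trig_series_le 0).
have -> : torus_int (fun x => trig_series x ^+ 2) = torus_int (fun x => trig_series x * trig_series x).
  by congr torus_int; apply/funext => x; rewrite expr2.
have bT := trig_series_lipschitz.
have nT := bounded_lipschitz_nice (bounded_lipschitzM bT bT).
apply/cvgrPdist_le => e e0.
have : (fun N => 2 * A * box_tail a N) @ \oo --> 2 * A * 0.
  by apply: cvgMl_tmp; exact: (box_tail_cvg aA a0).
rewrite mulr0 => /cvgrPdist_le/(_ e e0); apply: filterS => N; rewrite sub0r normrN => h.
rewrite -box_trig_norm//.
have -> : torus_int (fun x => box_trig c N x ^+ 2) = torus_int (fun x => box_trig c N x * box_trig c N x).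
  by congr torus_int; apply/funext => x; rewrite expr2.
have bS := box_trig_lipschitz c N.
have nS := bounded_lipschitz_nice (bounded_lipschitzM bS bS).
rewrite -(torus_niceB nT nS).2; apply: (le_trans _ h); apply: (le_trans _ (ler_norm _)).
apply: torus_int_bounds; first exact: (torus_niceB nT nS).1.
move=> x; have -> : trig_series x * trig_series x - box_trig c N x * box_trig c N x =
  (trig_series x + box_trig c N x) * (trig_series x - box_trig c N x) by ring.
rewrite normrM ler_pM//; last exact: trig_series_dist.
apply: (le_trans (ler_normD _ _)); have := trig_series_le x; have := box_trig_le N x; lra.
Qed.

End trigonometric_series.

(** * The norm of the fractional Laplacian *)

Section fractional_laplacian.
Variables (R : realType) (d : nat).
Hypothesis d0 : (0 < d)%N.
Implicit Types (f g : 'rV[R]_d -> R) (nu mu : 'rV[int]_d) (b : bool).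

Lemma fourierE f nu : bounded_lipschitz f ->
  complex.Re (fourier f nu) = coef f nu false /\
  complex.Im (fourier f nu) = - coef f nu true.
Proof.
move=> bf; rewrite /fourier /torus_intC /=; split.
  congr torus_int; apply/funext => x; rewrite /cis /= mul0r subr0 cosN.
  by [].
have nf := bounded_lipschitz_nice (bounded_lipschitzM bf (@mode_bounded_lipschitz R d nu true)).
rewrite -mulN1r -(torus_niceZ _ nf).2; congr torus_int; apply/funext => x.
by rewrite /cis /= mul0r addr0 sinN mulrN mulN1r.
Qed.

Lemma normc_sqr (z : R[i]) : ComplexField.Normc.normc z ^+ 2 = complex.Re z ^+ 2 + complex.Im z ^+ 2.
Proof. by case: z => a b /=; rewrite sqr_sqrtr// addr_ge0// sqr_ge0. Qed.

Lemma fourier_normc f nu : bounded_lipschitz f ->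
  ComplexField.Normc.normc (fourier f nu) ^+ 2 = coef2 f nu.
Proof.
move=> bf; rewrite normc_sqr; have [-> ->] := fourierE nu bf.
by rewrite /coef2 big_bool /= sqrrN addrC.
Qed.

Lemma powR_sqrV (x q : R) : 0 < x -> (x ^+ 2)^-1 `^ q = x `^ (- (2 * q)).
Proof. by move=> x0; rewrite -powR_invn ?ltW// -powRrM mulNr. Qed.

Lemma Re_sum (I : Type) (r : seq I) (F : I -> R[i]) :
  complex.Re (\sum_(i <- r) F i) = \sum_(i <- r) complex.Re (F i).
Proof. by rewrite (big_morph (@complex.Re R) (_ : {morph _ : x y / x + y}) (erefl _))// => -[? ?] []. Qed.

Lemma Im_sum (I : Type) (r : seq I) (F : I -> R[i]) :
  complex.Im (\sum_(i <- r) F i) = \sum_(i <- r) complex.Im (F i).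
Proof. by rewrite (big_morph (@complex.Im R) (_ : {morph _ : x y / x + y}) (erefl _))// => -[? ?] []. Qed.

(** The real part of the defining series is the trigonometric series with
    coefficients |nu|^(-2t) coef f, and the imaginary part vanishes by the
    symmetry nu -> - nu; Parseval for absolutely convergent series concludes. *)
Lemma frac_laplacian_norm f (t : R) : test_function f -> 0 < t ->
  l2norm_sq (frac_laplacian (- t) f) = limn (spec f (2 * t)).
Proof.
move=> tf t0; have bf := test_function_lipschitz tf.
pose q nu := enorm R nu `^ (2 * - t); pose c nu b := q nu * coef f nu b.
have qN nu : q (- nu) = q nu by rewrite /q enormN.
have hc : hermitian c by move=> nu b; rewrite /c qN coefN_lip// mulrCA.
have q1 nu : nu != 0 -> q nu <= 1.
  move=> nu0; rewrite /q -[leRHS](powRr0 (enorm R nu)); apply: ler_powR; first exact: enorm_ge1.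
  by rewrite mulrN oppr_le0 mulr_ge0// ltW.
pose a nu : R := \sum_b `|coef f nu b|.
have a0 nu : 0 <= a nu by exact: sumr_ge0.
have ca nu : nu != 0 -> \sum_b `|c nu b| <= a nu.
  move=> nu0; apply: ler_sum => b _; rewrite normrM ger0_norm ?powR_ge0//.
  by rewrite ler_piMl// q1.
have [A HA] := coef_summable d0 tf (lexx 0).
have [A' HA'] := coef_summable d0 tf ler01.
have aA N : \sum_(nu <- boxseq d N) a nu <= A.
  apply: le_trans (HA N); apply: ler_sum => nu _.
  by rewrite powRr0 mul1r.
have aA' N : \sum_(nu <- boxseq d N) enorm R nu * a nu <= A'.
  apply: le_trans (HA' N); apply: ler_sum => nu _.
  by rewrite powRr1 ?enorm_ge0.
(* The series defining the fractional Laplacian is real. *)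
have E x : frac_laplacian (- t) f x = (trig_series c x +i* 0)%C.
  rewrite /frac_laplacian; congr (_ +i* _)%C.
    rewrite /trig_series (_ : (fun N => complex.Re _) = (fun N => box_trig c N x))//.
    apply/funext => N.
    rewrite sum_punctured_box Re_sum; apply: eq_bigr => nu _.
    have [eR eI] := fourierE nu bf.
    rewrite /cis; move: eR eI; case: (fourier f nu) => u v /= -> ->.
    rewrite big_bool /= /c /q /mode; ring.
  rewrite (_ : (fun N => _) = fun=> 0) ?lim_cst//.
  apply/funext => N; rewrite sum_punctured_box Im_sum.
  pose G nu := complex.Im ((enorm R nu `^ (2 * - t))%:C%C * fourier f nu * cis (2 * pi * zdot nu x)).
  rewrite -[LHS]/(\sum_(nu <- boxseq d N) G nu).
  have GE nu : G nu = q nu * (coef f nu false * mode nu true x - coef f nu true * mode nu false x).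
    rewrite /G; have [eR eI] := fourierE nu bf.
    rewrite /cis; move: eR eI; case: (fourier f nu) => u v /= -> ->.
    by rewrite /q /mode; ring.
  have GN nu : G (- nu) = - G nu.
    by rewrite !GE qN !coefN_lip// !modeN /=; ring.
  have := sum_boxseqN N G; under eq_bigr do rewrite GN.
  by rewrite sumrN => /eqP; rewrite eq_sym -subr_eq0 opprK -mulr2n mulrn_eq0 /= => /eqP.
rewrite /l2norm_sq (_ : (fun x => _) = fun x => trig_series c x ^+ 2); last first.
  by apply/funext => x; rewrite E normc_sqr /= expr0n addr0.
have := trig_series_norm hc ca a0 aA aA'.
have <- : spec f (2 * t) = (fun N => \sum_(nu <- boxseq d N) \sum_b c nu b ^+ 2).
  apply/funext => N; rewrite /spec big_seq [RHS]big_seq; apply: eq_bigr => nu.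
  rewrite mem_boxseq => /andP[nu0 _]; rewrite powR_sqrV ?enorm_gt0// /coef2 mulr_sumr.
  apply: eq_bigr => b _; rewrite /c exprMn; congr (_ * _).
  by rewrite /q -powR_mulrn ?powR_ge0// -powRrM; congr (_ `^ _); ring.
by move=> h; apply/esym/cvg_lim.
Qed.

End fractional_laplacian.

(** * The Sobolev completion *)

Section sobolev.
Variables (R : realType) (d : nat) (s eps : R).
Hypothesis d0 : (0 < d)%N.
Hypothesis se0 : 0 <= s + eps.
Variable H : sobolev_space (fun xi : 'rV[int]_d => enorm R xi `^ (- (4 * s))) (- eps).
Notation emb := (sob_emb H).
Implicit Types (f g : 'rV[R]_d -> R) (nu mu : 'rV[int]_d) (b : bool) (h : H).

(** Square root of the multiplier of the Sobolev norm; it bounds the norm of the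
    mode and is summable in the range of exponents considered. *)
Definition rad nu : R := enorm R nu `^ (- (2 * (s + eps))).

Lemma rad_ge0 nu : 0 <= rad nu. Proof. exact: powR_ge0. Qed.

Lemma radN nu : rad (- nu) = rad nu. Proof. by rewrite /rad enormN. Qed.

Lemma rad_sqr nu : nu != 0 ->
  rad nu ^+ 2 = enorm R nu `^ (- (4 * s)) * enorm R nu `^ (4 * - eps).
Proof.
move=> nu0; rewrite -powRD; last by rewrite (gt_eqF (enorm_gt0 R nu0)) implybT.
rewrite -powR_mulrn ?rad_ge0// -powRrM; congr (_ `^ _); ring.
Qed.

Lemma rad_le1 nu : nu != 0 -> rad nu <= 1.
Proof.
move=> nu0; rewrite /rad -[leRHS](powRr0 (enorm R nu)); apply: ler_powR; first exact: enorm_ge1.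
by rewrite oppr_le0 mulr_ge0.
Qed.

Let term f nu : \bar R := (enorm R nu `^ (- (4 * s)) * enorm R nu `^ (4 * - eps) *
     ComplexField.Normc.normc (fourier f nu) ^+ 2)%R%:E.

Let termE f nu : test_function f -> nu != 0 -> term f nu = (rad nu ^+ 2 * coef2 f nu)%:E.
Proof.
move=> tf nu0; rewrite /term fourier_normc ?rad_sqr//.
exact: test_function_lipschitz.
Qed.

Lemma emb_box_le f N : test_function f ->
  \sum_(nu <- boxseq d N) rad nu ^+ 2 * coef2 f nu <= `|emb f| ^+ 2.
Proof.
move=> tf; rewrite -lee_fin (sob_emb_norm H tf) /sobolev_norm_sq.
apply: esum_ge; exists [set` boxseq d N].
  split; first exact: finite_seq.
  by move=> nu /=; rewrite mem_boxseq => /andP[].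
rewrite -fsbig_seq ?boxseq_uniq// -sumEFin big_seq [leRHS]big_seq.
apply: lee_sum => nu; rewrite mem_boxseq => /andP[nu0 _].
by rewrite -termE.
Qed.

(** The norm is a supremum over finite sets of frequencies, each contained in a
    box. *)
Lemma emb_le f (B : R) : test_function f ->
  (forall N, \sum_(nu <- boxseq d N) rad nu ^+ 2 * coef2 f nu <= B) -> `|emb f| ^+ 2 <= B.
Proof.
move=> tf HB; rewrite -lee_fin (sob_emb_norm H tf) /sobolev_norm_sq.
apply: ge_ereal_sup => _ [A [finA subA] <-].
have /finite_seqP[r rA] := finA.
have rA' : A = [set` undup r].
  by rewrite rA; apply/seteqP; split => x /=; rewrite mem_undup.
have [N HN] : exists N, A `<=` [set` boxseq d N].
  exists (\sum_(nu <- r) \sum_i absz (nu 0%R i))%N => nu Anu /=.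
  rewrite mem_boxseq; apply/andP; split; first exact: subA.
  apply/forallP => i; have nr : nu \in r by move: Anu; rewrite rA.
  rewrite -abszE lez_nat (big_rem nu)//= (bigD1 i)//= -addnA leq_addr//.
rewrite rA' -fsbig_seq ?undup_uniq//.
rewrite (eq_big_seq (fun nu => (rad nu ^+ 2 * coef2 f nu)%:E)); last first.
  move=> nu nr; rewrite -/(term f nu) termE//; apply: subA; by rewrite rA'.
rewrite sumEFin lee_fin; apply: le_trans (HB N); apply: ler_sum_sub.
- exact: undup_uniq.
- exact: boxseq_uniq.
- by move=> nu nr; apply: HN; rewrite rA'.
- by move=> nu; rewrite mulr_ge0 ?sqr_ge0// coef2_ge0.
Qed.

Lemma emb_coef_le f nu b : test_function f -> nu != 0 -> rad nu * `|coef f nu b| <= `|emb f|.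
Proof.
move=> tf nu0; rewrite -(@ler_pXn2r _ 2)// ?nnegrE ?mulr_ge0 ?rad_ge0//.
pose N := (\sum_i absz (nu 0%R i))%N.
have nuN : nu \in boxseq d N.
  rewrite mem_boxseq nu0; apply/forallP => i.
  by rewrite -abszE lez_nat /N (bigD1 i)//= leq_addr.
apply: le_trans (emb_box_le N tf).
rewrite (bigD1_seq nu)//= ?boxseq_uniq// exprMn real_normK ?num_real//.
rewrite -[leLHS]addr0 lerD//.
  rewrite ler_wpM2l ?sqr_ge0// /coef2 (bigD1 b)//= lerDl sumr_ge0// => c _; exact: sqr_ge0.
by apply: sumr_ge0 => mu _; rewrite mulr_ge0 ?sqr_ge0// coef2_ge0.
Qed.

(** The only nonzero coefficients of a mode are at its frequency and the
    opposite one; Bessel bounds them together by 1. *)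
Lemma emb_mode_le nu b : nu != 0 -> `|emb (mode nu b)| <= rad nu.
Proof.
move=> nu0; rewrite -(@ler_pXn2r _ 2)// ?nnegrE ?rad_ge0//.
apply: emb_le; first exact: mode_test_function.
move=> N; have be := @mode_bounded_lipschitz R d nu b.
apply: (@le_trans _ _ (\sum_(mu <- boxseq d N) rad nu ^+ 2 * coef2 (mode nu b) mu)).
  apply: ler_sum => mu _.
  have [e|ne] := pselect (mu = nu \/ mu = - nu).
    by case: e => ->; rewrite ?radN.
  have -> : coef2 (@mode R d nu b) mu = 0.
    rewrite /coef2 big1// => c _; rewrite /coef torus_int_modeM.
    have [e1|_] := eqVneq nu mu; first by case: ne; left.
    have [e2|_] := eqVneq nu (- mu); first by case: ne; right; rewrite e2 opprK.
    by rewrite mulr0 addr0 mulr0 expr0n.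
  by rewrite !mulr0.
rewrite -mulr_sumr ler_piMr ?sqr_ge0// (le_trans (bessel N be))//.
apply: le_trans (ler_norm _) _; apply: torus_int_bounds.
  have := bounded_lipschitz_nice (bounded_lipschitzM be be).
  by rewrite (_ : (fun x => _ * _) = (fun x => mode nu b x ^+ 2))//; apply/funext => x; rewrite expr2.
by move=> x; rewrite normrX expr_le1// mode_le1.
Qed.

Lemma emb0 : emb (fun=> 0) = 0.
Proof.
have := sob_emb_linear H 1 (@test_function0 R d) (@test_function0 R d).
have E : (fun _ : 'rV[R]_d => 1 * 0 + 0 : R) = fun=> 0 by apply/funext => x; rewrite mulr0 addr0.
rewrite E.
by rewrite scale1r => /eqP; rewrite -subr_eq subrr eq_sym => /eqP.
Qed.

Lemma emb_sum (I : eqType) (r : seq I) (a : I -> R) (F : I -> 'rV[R]_d -> R) :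
  {in r, forall i, test_function (F i)} ->
  test_function (fun x => \sum_(i <- r) a i * F i x) /\
  emb (fun x => \sum_(i <- r) a i * F i x) = \sum_(i <- r) a i *: emb (F i).
Proof.
elim: r => [|i r IH] tF.
  rewrite big_nil; under eq_fun do rewrite big_nil.
  by split; [exact: test_function0|exact: emb0].
have [tr er] := IH (fun j jr => tF j (mem_behead (s := i :: r) jr)).
have ti := tF i (mem_head _ _).
rewrite big_cons; under eq_fun do rewrite big_cons.
by split; [exact: test_function_lin|rewrite sob_emb_linear// er].
Qed.

Lemma test_functionB f g : test_function f -> test_function g ->
  test_function (fun x => f x - g x) /\ emb (fun x => f x - g x) = emb f - emb g.
Proof.
move=> tf tg; rewrite (_ : (fun x => _) = fun x => -1 * g x + f x); last first.
  by apply/funext => x; rewrite mulN1r addrC.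
by split; [exact: test_function_lin|rewrite sob_emb_linear// scaleN1r addrC].
Qed.

Lemma box_trig_sum c N (x : 'rV[R]_d) : box_trig c N x =
  \sum_(i <- [seq (nu, b) | nu <- boxseq d N, b <- [:: true; false]]) c i.1 i.2 * mode i.1 i.2 x.
Proof.
rewrite big_allpairs/=; apply: eq_bigr => nu _.
by rewrite big_bool !big_cons big_nil addr0.
Qed.

Lemma box_trig_test c N : test_function (@box_trig R d c N) /\
  emb (box_trig c N) = \sum_(nu <- boxseq d N) \sum_b c nu b *: emb (mode nu b).
Proof.
have E : box_trig c N = fun x => \sum_(i <- [seq (nu, b) | nu <- boxseq d N, b <- [:: true; false]])
    c i.1 i.2 * mode i.1 i.2 x by apply/funext => x; exact: box_trig_sum.
have tm : {in [seq (nu, b) | nu <- boxseq d N, b <- [:: true; false]],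
    forall i, test_function (@mode R d i.1 i.2)}.
  move=> i /allpairsP[[nu b] /= [nuN _ ->]] /=; apply: mode_test_function.
  by move: nuN; rewrite mem_boxseq => /andP[].
have [t e] := emb_sum (fun i => c i.1 i.2) tm.
rewrite -E in t; rewrite -E in e; split => //; rewrite e big_allpairs/=.
by apply: eq_bigr => nu _; rewrite big_bool !big_cons big_nil addr0.
Qed.

(** The coefficients of f decay fast enough to compensate the negative order of
    the norm. *)
Lemma l2dot_bounded f : test_function f ->
  exists2 C, 0 <= C & forall g, test_function g -> `|l2dot g f| <= C * `|emb g|.
Proof.
move=> tf; have p0 : 0 <= 2 * (s + eps) by rewrite mulr_ge0.
have [C HC] := coef_summable d0 tf p0.
exists C => [|g tg].
  apply: le_trans (HC 0%N); apply: sumr_ge0 => nu _.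
  by rewrite mulr_ge0 ?powR_ge0// sumr_ge0.
have bg := test_function_lipschitz tg; have [M M0 gM] := test_function_bounded tg.
apply: (ler_cvg_to (cvg_norm (pairing_series d0 (bounded_lipschitz_multiplier bg) gM tf))
  (cvg_cst (C * `|emb g|))).
apply: nearW => N; apply: (le_trans (ler_norm_sum _ _ _)).
apply: le_trans (ler_wpM2r (normr_ge0 _) (HC N)).
rewrite mulr_suml big_seq [leRHS]big_seq; apply: ler_sum => nu.
rewrite mem_boxseq => /andP[nu0 _]; apply: (le_trans (ler_norm_sum _ _ _)).
rewrite mulr_sumr mulr_suml; apply: ler_sum => b _; rewrite normrM.
have rE : enorm R nu `^ (2 * (s + eps)) * rad nu = 1.
  by rewrite /rad powRN mulfV// gt_eqF// powR_gt0// enorm_gt0.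
have -> : `|coef f nu b| * `|coef g nu b| =
    enorm R nu `^ (2 * (s + eps)) * `|coef f nu b| * (rad nu * `|coef g nu b|).
  transitivity ((enorm R nu `^ (2 * (s + eps)) * rad nu) * (`|coef f nu b| * `|coef g nu b|)).
    by rewrite rE mul1r.
  by ring.
rewrite ler_wpM2l ?mulr_ge0 ?powR_ge0//.
exact: emb_coef_le.
Qed.

(** McShane's extension of a Lipschitz function from the image of the test
    functions to the whole completion. *)
Lemma pairing_extension f : test_function f -> exists2 L : H -> R, continuous L &
  forall g, test_function g -> L (emb g) = l2dot g f.
Proof.
move=> tf; have [C C0 HC] := l2dot_bounded tf.
have lin g g' : test_function g -> test_function g' ->
    l2dot g f - l2dot g' f <= C * `|emb g - emb g'|.
  move=> tg tg'; have [tB <-] := test_functionB tg tg'.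
  apply: le_trans (HC _ tB); apply: le_trans (ler_norm _).
  have bf := test_function_lipschitz tf.
  have n1 := bounded_lipschitz_nice (bounded_lipschitzM (test_function_lipschitz tg) bf).
  have n2 := bounded_lipschitz_nice (bounded_lipschitzM (test_function_lipschitz tg') bf).
  rewrite /l2dot -(torus_niceB n1 n2).2 le_eqVlt; apply/orP; left; apply/eqP.
  by congr torus_int; apply/funext => x; rewrite mulrBl.
(* Values allowed at h by each test function and the Lipschitz constant; the
   extension is their infimum. *)
pose S h := [set l2dot g f + C * `|h - emb g| | g in @test_function R d].
have S0 h : S h !=set0 by exists (l2dot (fun=> 0) f + C * `|h - emb (fun=> 0)|); exists (fun=> 0) => //; exact: test_function0.
have Slb h : has_lbound (S h).
  exists (- (C * `|h|)) => _ [g tg <-].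
  have := HC g tg; rewrite ler_norml => /andP[h1 _].
  have : `|emb g| <= `|h| + `|h - emb g|.
    by have := ler_normB h (h - emb g); rewrite opprB addrCA subrr addr0.
  move=> /(ler_wpM2l C0); rewrite mulrDr; lra.
pose L h := inf (S h).
have LL h h' : L h <= L h' + C * `|h - h'|.
  rewrite -lerBlDr; apply: lb_le_inf => // _ [g tg <-]; rewrite lerBlDr.
  apply: (@le_trans _ _ (l2dot g f + C * `|h - emb g|)); first by apply: ge_inf => //; exists g.
  rewrite -addrA lerD2l -mulrDr ler_wpM2l//.
  by have := ler_normD (h' - emb g) (h - h'); rewrite addrC addrA subrK.
exists L.
  move=> h; apply/cvgrPdist_lt => e e0.
  have C1 : 0 < C + 1 by rewrite ltr_wpDl.
  apply/nbhs_ballP; exists (e / (C + 1)); first by rewrite /= divr_gt0.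
  move=> h' /=; rewrite -ball_normE /= => hh.
  have : C * `|h - h'| < e.
    have : (C + 1) * `|h - h'| < e by rewrite mulrC -ltr_pdivlMr.
    have := normr_ge0 (h - h'); lra.
  have := LL h h'; have := LL h' h; rewrite [`|h' - h|]distrC => h1 h2 h3.
  by rewrite ltr_norml; apply/andP; split; lra.
move=> g tg; apply/eqP; rewrite eq_le; apply/andP; split.
  rewrite -[leRHS]addr0 -(mulr0 C) -(normr0 H) -(subrr (emb g)).
  by apply: ge_inf => //; exists g.
apply: lb_le_inf => // _ [g' tg' <-].
by have := lin g g' tg tg'; lra.
Qed.

(** The chosen value of the pairing is not the default one, since an extension
    exists. *)
Lemma sob_pairing_spec f : test_function f ->
  continuous (@sob_pairing R d _ _ H f) /\
  forall g, test_function g -> sob_pairing f (emb g) = l2dot g f.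
Proof.
move=> tf; have [L cL LE] := pairing_extension tf.
have := @xgetI (H -> R) (fun=> 0) [set L : H -> R | continuous L /\
    forall g, test_function g -> L (sob_emb H g) = l2dot g f] L; apply.
by split.
Qed.

End sobolev.

Lemma seq_continuous (T U : topologicalType) (L : T -> U) (u : nat -> T) (x : T) :
  {for x, continuous L} -> u @ \oo --> x -> (fun n => L (u n)) @ \oo --> L x.
Proof. by move=> cL ux; exact: continuous_cvg. Qed.

Section box_index.
Variables (d N : nat).

(** The modes of a box as a finite type, to index finite families of random
    variables. *)
Definition bidx := ('I_(size (boxseq d N)) * bool)%type.

Definition bnu (i : bidx) : 'rV[int]_d := nth 0 (boxseq d N) i.1.

Lemma bnu_mem i : bnu i \in boxseq d N.
Proof. exact: mem_nth. Qed.

Lemma bnu_neq0 i : bnu i != 0.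
Proof. by have := bnu_mem i; rewrite mem_boxseq => /andP[]. Qed.

Lemma sum_bidx (V : nmodType) (F : 'rV[int]_d -> bool -> V) :
  \sum_(i : bidx) F (bnu i) i.2 = \sum_(nu <- boxseq d N) \sum_b F nu b.
Proof.
rewrite [RHS](big_nth 0) big_mkord pair_big/=.
by apply: eq_bigr => -[i b] _.
Qed.

End box_index.

Section sobolev_projections.
Variables (R : realType) (d : nat) (s eps : R).
Hypothesis d0 : (0 < d)%N.
Hypothesis se1 : 1 <= s + eps.
Variable H : sobolev_space (fun xi : 'rV[int]_d => enorm R xi `^ (- (4 * s))) (- eps).
Notation emb := (sob_emb H).
Implicit Types (f g : 'rV[R]_d -> R) (nu mu : 'rV[int]_d) (b : bool) (h : H).

Let se0 : 0 <= s + eps. Proof. exact: le_trans se1. Qed.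

Lemma dense_approx h (e : R) : 0 < e -> exists2 g, test_function g & `|h - emb g| < e.
Proof.
move=> e0; have [|x [hx [g tg gx]]] := @sob_emb_dense R d _ _ H (ball h e) _ (ball_open h e).
  by exists h; exact: ballxx.
by exists g => //; rewrite gx; move: hx; rewrite -ball_normE.
Qed.

Lemma dense_seq h : exists2 g_ : nat -> 'rV[R]_d -> R, forall k, test_function (g_ k) &
  (fun k => emb (g_ k)) @ \oo --> h.
Proof.
have H1 (k : nat) : exists g, test_function g /\ `|h - emb g| < k.+1%:R^-1.
  have [|g tg hg] := @dense_approx h (k.+1%:R^-1); first by rewrite invr_gt0.
  by exists g.
have [g_ Hg] := choice H1.
exists g_ => [k|]; first by have [] := Hg k.
apply/cvgrPdist_lt => e e0.
have /cvgrPdist_lt/(_ e e0) := @cvg_harmonic R; apply: filterS => k.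
rewrite sub0r normrN => h1; apply: (lt_trans _ (le_lt_trans (ler_norm _) h1)).
by have [] := Hg k.
Qed.

Lemma eq_dense (T : normedModType R) (L L' : H -> T) : continuous L -> continuous L' ->
  (forall g, test_function g -> L (emb g) = L' (emb g)) -> forall h, L h = L' h.
Proof.
move=> cL cL' LL' h; have [g_ tg gh] := dense_seq h.
have h1 := seq_continuous (cL h) gh; have h2 := seq_continuous (cL' h) gh.
apply: (cvg_unique _ h1) => //.
by apply: cvg_trans h2; apply: near_eq_cvg; apply: nearW => k; exact/esym/LL'.
Qed.

Lemma continuous_sum (T : normedModType R) (I : finType) (F : I -> H -> T) :
  (forall i, continuous (F i)) -> continuous (fun h => \sum_i F i h).
Proof.
move=> cF; elim: (index_enum I) => [|i r IH] h.
  have E : (fun h' => \sum_(j <- [::]) F j h') = fun=> 0.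
    by apply/funext => h'; rewrite big_nil.
  by rewrite E; exact: cst_continuous.
have E : (fun h' => \sum_(j <- i :: r) F j h') = (fun h' => F i h' + \sum_(j <- r) F j h').
  by apply/funext => h'; rewrite big_cons.
by rewrite /continuous_at big_cons E; apply: cvgD; [exact: cF|exact: IH].
Qed.

Notation md i := (@mode R d (bnu i) i.2).

Lemma mode_pairing_continuous N (i : bidx d N) : continuous (sob_pairing (md i) : H -> R).
Proof. by have [] := sob_pairing_spec d0 se0 H (mode_test_function R i.2 (bnu_neq0 i)). Qed.

Lemma mode_pairing_emb N (i : bidx d N) g : test_function g ->
  sob_pairing (md i) (emb g) = coef g (bnu i) i.2.
Proof. by have [_] := sob_pairing_spec d0 se0 H (mode_test_function R i.2 (bnu_neq0 i)); apply. Qed.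

Definition mode_comb N (c : bidx d N -> R) (x : 'rV[R]_d) : R := \sum_i c i * md i x.

Lemma mode_comb_test N (c : bidx d N -> R) : test_function (mode_comb c).
Proof.
by apply: test_function_sum => i; apply: mode_test_function; exact: bnu_neq0.
Qed.

Lemma l2dot_mode_comb F N (c : bidx d N -> R) : multiplier F ->
  l2dot F (mode_comb c) = \sum_i c i * coef F (bnu i) i.2.
Proof.
move=> mF; pose nm (i : bidx d N) := mF _ (@mode_periodic R d (bnu i) i.2) (@mode_bounded_lipschitz R d (bnu i) i.2).
have n1 (i : bidx d N) := (torus_niceZ (c i) (nm i)).1.
transitivity (torus_int (fun x => \sum_i c i * (F x * md i x))).
  congr torus_int; apply/funext => x; rewrite mulr_sumr; apply: eq_bigr => i _.
  by rewrite mulrCA.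
rewrite (torus_nice_sum _ n1).2; apply: eq_bigr => i _.
by rewrite (torus_niceZ _ (nm i)).2.
Qed.

(** Linearity of the pairing in its test function, by density. *)
Lemma pairing_mode_comb N (c : bidx d N -> R) h :
  sob_pairing (mode_comb c) h = \sum_i c i * sob_pairing (md i) h.
Proof.
have [cL LE] := sob_pairing_spec d0 se0 H (mode_comb_test c).
have cS : continuous (fun h => \sum_i c i * sob_pairing (md i) h : R).
  by apply: continuous_sum => i h'; apply: cvgMl_tmp; exact: mode_pairing_continuous.
apply: (@eq_dense R^o (sob_pairing (mode_comb c)) _ cL cS).
move=> g tg; rewrite LE// l2dot_mode_comb; last first.
  by apply: bounded_lipschitz_multiplier; exact: test_function_lipschitz.
by apply: eq_bigr => i _; rewrite mode_pairing_emb.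
Qed.

Definition proj N (h : H) : H := \sum_(i : bidx d N) sob_pairing (md i) h *: emb (md i).

Lemma proj_continuous N : continuous (proj N).
Proof.
apply: continuous_sum => i h; apply: cvgZr_tmp.
exact: mode_pairing_continuous.
Qed.

Lemma proj_emb N g : test_function g -> proj N (emb g) = emb (box_trig (coef g) N).
Proof.
move=> tg; rewrite (box_trig_test H (coef g) N).2.
rewrite -(sum_bidx N (fun nu b => coef g nu b *: emb (mode nu b))).
by apply: eq_bigr => i _; rewrite mode_pairing_emb.
Qed.

Lemma box_trig_emb_le N g : test_function g -> `|emb (box_trig (coef g) N)| <= `|emb g|.
Proof.
move=> tg; rewrite -(@ler_pXn2r _ 2)// ?nnegrE//.
apply: (emb_le H (box_trig_test H (coef g) N).1) => M.
apply: le_trans (emb_box_le H M tg); apply: ler_sum => nu _.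
rewrite ler_wpM2l ?sqr_ge0//; apply: ler_sum => b _.
have hc : hermitian (coef g) by move=> mu c; exact: coefN_lip (test_function_lipschitz tg).
rewrite coef_box_trig//; case: (nu \in _); first by rewrite mul1r.
by rewrite mul0r expr0n sqr_ge0.
Qed.

(** On the image of the test functions the projection removes terms of the norm;
    then density. *)
Lemma proj_contract N h h' : `|proj N h - proj N h'| <= `|h - h'|.
Proof.
have [g_ tg gh] := dense_seq h; have [g'_ tg' gh'] := dense_seq h'.
have h1 : (fun k => `|proj N (emb (g_ k)) - proj N (emb (g'_ k))|) @ \oo --> `|proj N h - proj N h'|.
  apply: cvg_norm; apply: cvgB; first exact: (seq_continuous (@proj_continuous N h) gh).
  exact: (seq_continuous (@proj_continuous N h') gh').
have h2 : (fun k => `|emb (g_ k) - emb (g'_ k)|) @ \oo --> `|h - h'|.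
  by apply: cvg_norm; exact: cvgB.
apply: (ler_cvg_to h1 h2); apply: nearW => k.
have [tB <-] := test_functionB H (tg k) (tg' k).
rewrite !proj_emb//.
have [tS eS] := test_functionB H (box_trig_test H (coef (g_ k)) N).1 (box_trig_test H (coef (g'_ k)) N).1.
rewrite -eS; have := box_trig_emb_le N tB; congr (`|emb _| <= _).
apply/funext => x; rewrite /box_trig -sumrB; apply: eq_bigr => nu _.
rewrite -sumrB; apply: eq_bigr => b _; rewrite -mulrBl coefB//; exact: test_function_lipschitz.
Qed.

Lemma rad_off_box N nu : nu != 0 -> nu \notin boxseq d N -> rad s eps nu <= N.+1%:R^-1.
Proof.
move=> nu0 off; have e1 := enorm_off_box R nu0 off; have e0 := enorm_gt0 R nu0.
have e2 := enorm_ge1 R nu0.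
apply: (@le_trans _ _ (enorm R nu)^-1); last by rewrite lef_pV2 ?posrE.
rewrite -powR_inv1 ?enorm_ge0// /rad; apply: ler_powR => //.
by rewrite lerN2; have := se1; lra.
Qed.

(** The coefficients left out are at distance at least N + 1 from the origin,
    where the multiplier is at most 1/(N+1)^2 because s + eps >= 1. *)
Lemma proj_emb_cvg g : test_function g -> (fun N => proj N (emb g)) @ \oo --> emb g.
Proof.
move=> tg; have bg := test_function_lipschitz tg.
pose E := torus_int (fun x => g x ^+ 2).
have E0 : 0 <= E by apply: torus_int_ge0 => x; exact: sqr_ge0.
(* The remainder of g has the coefficients of g outside the box and none inside.
   *)
have key N : `|emb g - proj N (emb g)| <= (E + 1) * N.+1%:R^-1.
  rewrite proj_emb//; have tS := (box_trig_test H (coef g) N).1.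
  have [tB <-] := test_functionB H tg tS.
  have N1 : 0 <= N.+1%:R^-1 :> R by rewrite invr_ge0.
  rewrite -(@ler_pXn2r _ 2)// ?nnegrE ?mulr_ge0 ?addr_ge0//.
  apply: (@le_trans _ _ (N.+1%:R^-1 ^+ 2 * E)); last first.
    rewrite exprMn mulrC ler_wpM2r ?sqr_ge0//; have := E0; nra.
  have hc : hermitian (coef g) by move=> mu c; exact: coefN_lip.
  apply: (emb_le H tB) => M; apply: le_trans (ler_wpM2l (sqr_ge0 _) (bessel M bg)).
  rewrite mulr_sumr big_seq [leRHS]big_seq; apply: ler_sum => nu; rewrite mem_boxseq => /andP[nu0 _].
  have cE b : coef (fun x => g x - box_trig (coef g) N x) nu b = (nu \notin boxseq d N)%:R * coef g nu b.
    rewrite coefB//; last exact: box_trig_lipschitz.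
    rewrite coef_box_trig//; case: (nu \in _) => /=; first by rewrite mul1r subrr mul0r.
    by rewrite mul0r subr0 mul1r.
  have -> : coef2 (fun x => g x - box_trig (coef g) N x) nu = (nu \notin boxseq d N)%:R * coef2 g nu.
    rewrite /coef2 mulr_sumr; apply: eq_bigr => b _; rewrite cE.
    by case: (nu \notin _); rewrite ?mul1r// !mul0r expr0n.
  have [off|on] := boolP (nu \notin boxseq d N).
    rewrite mul1r ler_wpM2r ?coef2_ge0// lerXn2r ?nnegrE ?rad_ge0//.
    exact: rad_off_box.
  by rewrite mul0r mulr0 mulr_ge0 ?sqr_ge0// coef2_ge0.
apply/cvgrPdist_le => e e0.
have : (fun N : nat => (E + 1) * N.+1%:R^-1) @ \oo --> (E + 1) * 0.
  by apply: cvgMl_tmp; exact: cvg_harmonic.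
rewrite mulr0 => /cvgrPdist_le/(_ e e0); apply: filterS => N; rewrite sub0r normrN => h.
by apply: (le_trans (key N)); apply: (le_trans (ler_norm _)).
Qed.

(** Convergence on a dense set and uniform Lipschitz constants. *)
Lemma proj_cvg h : (fun N => proj N h) @ \oo --> h.
Proof.
apply/cvgrPdist_lt => e e0; have e3 : 0 < e / 3 by rewrite divr_gt0.
have [g tg hg] := dense_approx h e3.
have /cvgrPdist_lt/(_ _ e3) := proj_emb_cvg tg; apply: filterS => N hN.
have -> : h - proj N h = (h - emb g) + (emb g - proj N (emb g)) + (proj N (emb g) - proj N h).
  by rewrite !addrA !subrK.
apply: (le_lt_trans (ler_normD _ _)).
have h1 := proj_contract N (emb g) h; rewrite distrC in hg.
have := ler_normD (h - emb g) (emb g - proj N (emb g)); rewrite [`|h - emb g|]distrC.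
by move: hg h1 hN; lra.
Qed.

Lemma rad_summable : d%:R < 2 * (s + eps) ->
  exists C, forall N, \sum_(nu <- boxseq d N) rad s eps nu <= C.
Proof. exact: lattice_sum. Qed.

Section series.
Variables (c : 'rV[int]_d -> bool -> R) (A : R).
Hypothesis cA : forall N, \sum_(nu <- boxseq d N) rad s eps nu * (\sum_b `|c nu b|) <= A.

(** Both the sandpile field and the limit field are constructed in this form. *)
Definition series_elt : H := limn (fun N => emb (box_trig c N)).

Let u nu : H := \sum_b c nu b *: emb (mode nu b).
Let a nu : R := rad s eps nu * \sum_b `|c nu b|.

Let ua nu : nu != 0 -> `|u nu| <= a nu.
Proof.
move=> nu0; apply: (le_trans (ler_norm_sum _ _ _)); rewrite /a mulr_sumr.
apply: ler_sum => b _; rewrite normrZ mulrC ler_wpM2r//.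
exact: (emb_mode_le H b nu0).
Qed.

Let a0 nu : 0 <= a nu.
Proof. by rewrite mulr_ge0 ?rad_ge0// sumr_ge0. Qed.

Let uE : (fun N => emb (box_trig c N)) = (fun N => \sum_(nu <- boxseq d N) u nu).
Proof. by apply/funext => N; rewrite (box_trig_test H c N).2. Qed.

Lemma series_elt_cvg : (fun N => emb (box_trig c N)) @ \oo --> series_elt.
Proof. by rewrite /series_elt uE; exact: (box_series_cvg ua cA a0). Qed.

(** By continuity of the pairing along the box sums. *)
Lemma series_elt_pairing f : test_function f ->
  (fun N => \sum_(nu <- boxseq d N) \sum_b c nu b * coef f nu b) @ \oo -->
  sob_pairing f series_elt.
Proof.
move=> tf; have [cL LE] := sob_pairing_spec d0 se0 H tf.
have h := seq_continuous (cL series_elt) series_elt_cvg.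
apply: cvg_trans h; apply: near_eq_cvg; apply: nearW => N.
rewrite LE; last exact: (box_trig_test H c N).1.
rewrite -(pair_box_trig _ _ (bounded_lipschitz_multiplier (test_function_lipschitz tf))).
by congr torus_int; apply/funext => x; rewrite mulrC.
Qed.

End series.

End sobolev_projections.

(** * Borel measurability and Lipschitz envelopes in normed spaces *)

Section borel_measurability.
Context (R : realType) disp (T : measurableType disp) (V : normedModType R).

Lemma measurable_borel (f : T -> borel V) :
  (forall U : set V, open U -> measurable (f @^-1` U)) -> measurable_fun setT f.
Proof.
move=> mf; apply: (@measurability _ _ T (borel V) setT f (@open V)) => // _ [U oU <-].
by rewrite setTI; exact: mf.
Qed.

Lemma measurable_borel_preimage (f : T -> borel V) (U : set V) :
  measurable_fun setT f -> open U -> measurable (f @^-1` U).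
Proof.
move=> mf oU; have := mf measurableT U; rewrite setTI; apply.
exact: sub_sigma_algebra.
Qed.

Let thick (U : set V) (r : R) : set V := \bigcup_(y in ~` U) ball y r.

Let thick_open U r : 0 < r -> open (thick U r).
Proof. by move=> r0; apply: bigcup_open => y _; exact: ball_open. Qed.

(** The limit is in an open set U exactly when the sequence eventually keeps a
    fixed distance 1/(m+1) from the complement of U, and keeping this distance
    is a closed condition. *)
Lemma measurable_borel_lim (f_ : nat -> T -> borel V) (f : T -> borel V) :
  (forall j, measurable_fun setT (f_ j)) ->
  (forall w, (fun j => f_ j w : V) @ \oo --> (f w : V)) -> measurable_fun setT f.
Proof.
move=> mf ff; apply: measurable_borel => U oU.
have -> : f @^-1` U = \bigcup_m \bigcup_J \bigcap_(j in [set j | (J <= j)%N])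
    ((f_ j) @^-1` (~` thick U m.+1%:R^-1)).
  apply/seteqP; split => w /=.
    move=> Uw; have /nbhs_ballP[e /= e0 He] : nbhs (f w : V) U by exact: open_nbhs_nbhs.
    have e2 : 0 < e / 2 by rewrite divr_gt0.
    have /cvgrPdist_lt/(_ _ e2)[m _ /(_ m (leqnn _)) hm] := @cvg_harmonic R.
    have /cvgrPdist_lt/(_ _ e2)[J _ HJ] := ff w.
    exists m => //; exists J => // j /HJ hj [y nUy]; rewrite -ball_normE /= => hy.
    apply: nUy; apply: He; rewrite -ball_normE /=.
    have {}hm : m.+1%:R^-1 < e / 2 by move: hm; rewrite sub0r normrN; exact: le_lt_trans (ler_norm _).
    apply: (le_lt_trans (ler_distD (f_ j w : V) _ _)); rewrite (splitr e).
    by apply: ltrD => //; rewrite distrC; exact: lt_trans hy hm.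
  move=> [m _ [J _ HJ]]; apply: contrapT => nUw.
  have m0 : 0 < m.+1%:R^-1 :> R by rewrite invr_gt0.
  have /cvgrPdist_lt/(_ _ m0)[K _ HK] := ff w.
  have := HJ (maxn J K) (leq_maxl _ _); apply; exists (f w) => //.
  by rewrite -ball_normE /=; apply: HK; exact: leq_maxr.
apply: bigcupT_measurable => m; apply: bigcupT_measurable => J.
apply: bigcap_measurable => [|j _]; first by exists J => /=.
rewrite preimage_setC; apply: measurableC.
have o : open (thick U m.+1%:R^-1) by apply: thick_open; rewrite invr_gt0.
exact: measurable_borel_preimage (mf j) o.
Qed.

(** The coefficients are rounded down to multiples of 1/(j+1), so that the
    combination takes countably many values and every preimage is a countable
    union of measurable sets. *)
Lemma measurable_borel_sum (I : finType) (c : I -> T -> R) (v : I -> V) :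
  (forall i, measurable_fun setT (c i)) ->
  measurable_fun setT (fun w => \sum_i c i w *: v i : borel V).
Proof.
move=> mc; pose fl (j : nat) (t : R) : int := Num.floor (j.+1%:R * t).
apply: (@measurable_borel_lim (fun j w => \sum_i ((fl j (c i w))%:~R / j.+1%:R) *: v i)).
  move=> j; apply: measurable_borel => U oU.
  pose D (q : {ffun I -> int}) : set T := if `[< U (\sum_i ((q i)%:~R / j.+1%:R) *: v i) >] then
    \bigcap_(i in [set: I]) ((fun w => j.+1%:R * c i w) @^-1` `[(q i)%:~R, (q i + 1)%:~R[%classic) else set0.
  have flE w i (q : int) : (j.+1%:R * c i w) \in `[q%:~R, (q + 1)%:~R[ = (fl j (c i w) == q).
    rewrite in_itv /=; apply/idP/eqP => [h|<-]; first exact: floor_def.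
    by rewrite floor_le_tmp floorD1_gt.
  have -> : (fun w => \sum_i ((fl j (c i w))%:~R / j.+1%:R) *: v i : V) @^-1` U = \bigcup_q D q.
    apply/seteqP; split => w /=.
      move=> Uw; exists [ffun i => fl j (c i w)] => //; rewrite /D.
      under eq_bigr do rewrite ffunE.
      rewrite asboolT// => i _ /=; rewrite ffunE; have := flE w i (fl j (c i w)).
      by rewrite eqxx => ->.
    move=> [q _]; rewrite /D; case: asboolP => // Uq Hq.
    rewrite (_ : \sum_i _ = \sum_i ((q i)%:~R / j.+1%:R) *: v i)//; apply: eq_bigr => i _.
    by have := Hq i Logic.I => /=; rewrite flE => /eqP ->.
  apply: countable_bigcupT_measurable; first exact: countableP.
  move=> q; rewrite /D; case: asboolP => // _; apply: fin_bigcap_measurable.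
    exact: finite_finset.
  move=> i _; have mci : measurable_fun [set: T] (fun w => j.+1%:R * c i w).
    by apply: measurable_funM.
  by have := mci measurableT `[(q i)%:~R, (q i + 1)%:~R[%classic (measurable_itv _); rewrite setTI.
move=> w; apply: cvg_sumr => i; apply: cvgZr_tmp.
apply/cvgrPdist_le => e e0.
have /cvgrPdist_le/(_ _ e0) := @cvg_harmonic R; apply: filterS => j.
rewrite sub0r normrN /harmonic => h; apply: le_trans (le_trans (ler_norm _) h).
have j0 : 0 < j.+1%:R :> R by [].
have h1 := floor_le_tmp (j.+1%:R * c i w); have h2 := floorD1_gt (j.+1%:R * c i w).
rewrite -/(fl j (c i w)) in h1 h2; move: h2; rewrite intrD mulr1z => h2.
have -> : c i w - (fl j (c i w))%:~R / j.+1%:R = (j.+1%:R * c i w - (fl j (c i w))%:~R) / j.+1%:R.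
  by rewrite mulrBl [j.+1%:R * _]mulrC mulfK ?gt_eqF.
by rewrite normrM [ `|_^-1| ]gtr0_norm ?invr_gt0// ler_piMl ?invr_ge0 ?(ltW j0)// ger0_norm; lra.
Qed.

End borel_measurability.

Lemma measurable_borel_continuous (R : realType) (V : normedModType R) (L : V -> R) :
  continuous L -> measurable_fun [set: borel V] (L : borel V -> R).
Proof.
move=> cL; apply: (@measurability _ _ (borel V) _ setT L _ (RGenOpens.measurableE R)).
move=> _ [_ [a [b ->]] <-]; rewrite setTI; apply: sub_sigma_algebra.
by apply: open_comp => [x _|]; [exact: cL|exact: itv_open].
Qed.

Lemma measurable_borel_comp (R : realType) disp (T : measurableType disp) (V : normedModType R)
    (L : V -> R) (f : T -> borel V) : continuous L -> measurable_fun setT f ->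
  measurable_fun setT (fun w => L (f w)).
Proof.
by move=> cL mf; exact: (measurableT_comp (measurable_borel_continuous cL) mf).
Qed.

(** Fatou's lemma. *)
Lemma le_integral_lim (R : realType) disp (T : measurableType disp) (P : probability T R)
    (f_ : nat -> T -> R) (f : T -> R) (K : R) :
  (forall m, measurable_fun setT (f_ m)) -> (forall m w, 0 <= f_ m w) ->
  (forall w, f_ ^~ w @ \oo --> f w) ->
  (forall m, (\int[P]_w (f_ m w)%:E <= K%:E)%E) -> (\int[P]_w (f w)%:E <= K%:E)%E.
Proof.
move=> mf f0 ff fK.
have mE m : measurable_fun setT (fun w => (f_ m w)%:E) by apply/measurable_EFinP; exact: mf.
have fE w : (f w)%:E = limn_einf (fun m => (f_ m w)%:E).
  have h : (fun m => (f_ m w)%:E) @ \oo --> (f w)%:E by apply: cvg_EFin; [exact: nearW|exact: ff].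
  rewrite is_cvg_limn_einfE; first by apply/esym; exact: cvg_lim h.
  by apply/cvg_ex; exists (f w)%:E.
rewrite (eq_integral (fun w => limn_einf (fun m => (f_ m w)%:E))) => [|w _]; last exact: fE.
apply: (le_trans (fatou P measurableT mE _)); first by move=> m w _; rewrite lee_fin.
rewrite limn_einf_lim; apply: lime_le; first exact: is_cvg_einfs.
apply: nearW => m; apply: le_trans (fK m); apply: ereal_inf_lbound.
by exists m => /=.
Qed.

Lemma integral_sum_le (R : realType) disp (T : measurableType disp) (P : probability T R)
    (I : eqType) (r : seq I) (F : I -> T -> R) (a : I -> R) :
  (forall i, measurable_fun setT (F i)) -> (forall i w, 0 <= F i w) ->
  (forall i, i \in r -> (\int[P]_w (F i w)%:E <= (a i)%:E)%E) ->
  (\int[P]_w (\sum_(i <- r) F i w)%:E <= (\sum_(i <- r) a i)%:E)%E.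
Proof.
move=> mF F0; elim: r => [|i r IH] Fa.
  under eq_integral do rewrite big_nil.
  by rewrite big_nil integral0.
have {}IH := IH (fun j jr => Fa j (mem_behead (s := i :: r) jr)).
rewrite big_cons; under eq_integral do rewrite big_cons.
under eq_integral do rewrite EFinD.
rewrite ge0_integralD//.
- by rewrite EFinD leeD// Fa// mem_head.
- by move=> w _; rewrite lee_fin.
- by apply/measurable_EFinP; exact: mF.
- by move=> w _; rewrite lee_fin sumr_ge0.
- by apply/measurable_EFinP; exact: measurable_sum.
Qed.

Lemma integral_pair_le (R : realType) disp (T : measurableType disp) (P : probability T R)
    (Y : bool -> T -> R) (r K : R) : 0 <= r ->
  (forall b, measurable_fun setT (Y b)) -> (forall b w, 0 <= Y b w) ->
  (forall b, (\int[P]_w (Y b w)%:E <= K%:E)%E) ->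
  (\int[P]_w (r * \sum_b Y b w)%:E <= (r * (2 * K))%:E)%E.
Proof.
move=> r0 mY Y0 YK; under eq_integral do rewrite EFinM.
rewrite ge0_integralZl//; last 2 first.
- by apply/measurable_EFinP; exact: measurable_sum.
- by move=> w _; rewrite lee_fin sumr_ge0.
rewrite EFinM; apply: lee_wpmul2l; first by rewrite lee_fin.
have -> : 2 * K = \sum_(b : bool) K by rewrite big_bool mulr2n mulrDl mul1r.
by apply: (@integral_sum_le _ _ _ P _ _ Y (fun=> K)).
Qed.

Section lipschitz_envelope.
Context (R : realType) (V : normedModType R) (phi : V -> R) (M : R).
Hypothesis phiM : forall x, `|phi x| <= M.

(** Inf-convolution with a cone of slope k: Lipschitz minorants of a bounded
    function. *)
Definition envelope (k : nat) (x : V) : R := inf [set phi y + k%:R * `|x - y| | y in [set: V]].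

Let S0 k x : [set phi y + k%:R * `|x - y| | y in [set: V]] !=set0.
Proof. by exists (phi x + k%:R * `|x - x|); exists x. Qed.

Let Slb k x : lbound [set phi y + k%:R * `|x - y| | y in [set: V]] (- M).
Proof.
move=> _ [y _ <-]; have := phiM y; rewrite ler_norml => /andP[h _].
by apply: (le_trans h); rewrite lerDl mulr_ge0.
Qed.

Lemma envelope_le k x : envelope k x <= phi x.
Proof.
apply: ge_inf; first by exists (- M); exact: Slb.
by exists x => //; rewrite subrr normr0 mulr0 addr0.
Qed.

Lemma envelope_bounded k x : `|envelope k x| <= M.
Proof.
have := phiM x; rewrite !ler_norml => /andP[_ h]; apply/andP; split.
  by apply: lb_le_inf => //; exact: Slb.
exact: le_trans (envelope_le k x) h.
Qed.

Lemma envelope_lipschitz k x y : `|envelope k x - envelope k y| <= k%:R * `|x - y|.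
Proof.
have key x' y' : envelope k x' <= envelope k y' + k%:R * `|x' - y'|.
  rewrite -lerBlDr; apply: lb_le_inf => // _ [z _ <-]; rewrite lerBlDr.
  apply: (@le_trans _ _ (phi z + k%:R * `|x' - z|)).
    by apply: ge_inf; [exists (- M); exact: Slb|exists z].
  rewrite -addrA lerD2l -mulrDr ler_wpM2l//.
  by have := ler_normD (y' - z) (x' - y'); rewrite addrC addrA subrK.
have h1 := key x y; have h2 := key y x; rewrite [ `|y - x|]distrC in h2.
by rewrite ler_norml; apply/andP; split; lra.
Qed.

(** Competitors y at distance at least r from x are too expensive once k r
    exceeds the oscillation 2 M; closer ones have values close to phi x. *)
Lemma envelope_cvg x : {for x, continuous phi} -> (fun k => envelope k x) @ \oo --> phi x.
Proof.
move=> cphi; apply/cvgrPdist_le => e e0.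
have /cvgrPdist_le/(_ e e0)/nbhs_ballP[r /= r0 Hr] := cphi.
have M0 : 0 <= M := le_trans (normr_ge0 _) (phiM x).
have /cvgrPdist_lt/(_ (r / (2 * M + 1))) := @cvg_harmonic R.
have q0 : 0 < 2 * M + 1 by lra.
case; first by rewrite divr_gt0.
move=> K _ HK; exists K.+1 => // -[//|k] /= Kk.
have /= := HK k Kk; rewrite sub0r normrN /harmonic ger0_norm ?invr_ge0// => hk.
have kr : 2 * M + 1 < k.+1%:R * r.
  rewrite -ltr_pdivrMr// -[ltRHS]invrK -[ltLHS]invrK ltf_pV2 ?posrE ?invr_gt0// ?divr_gt0//.
  by rewrite invf_div.
rewrite ger0_norm ?subr_ge0 ?envelope_le//.
rewrite lerBlDr -lerBlDl; apply: lb_le_inf => // _ [y _ <-].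
have [yr|yr] := ltP `|x - y| r.
  have := Hr y; rewrite -ball_normE /= => /(_ yr); rewrite ler_norml => /andP[_ h].
  by have : 0 <= k.+1%:R * `|x - y| by []; lra.
have : k.+1%:R * r <= k.+1%:R * `|x - y| by rewrite ler_wpM2l.
have := phiM x; have := phiM y; rewrite !ler_norml => /andP[h1 h2] /andP[h3 h4].
by lra.
Qed.

End lipschitz_envelope.

(** * The sandpile field as an element of the completion *)

Section odometer_measurability.
Context (R : realType) (d n : nat) disp (T : measurableType disp).
Hypotheses (n0 : (0 < n)%N) (d0 : (0 < d)%N).

Lemma measurable_excess (S : T -> dtorus d n -> R) :
  (forall x, measurable_fun setT (fun w => S w x)) ->
  forall x, measurable_fun setT (fun w => excess (S w) x).
Proof.
move=> mS x.
have E : (fun w => excess (S w) x) = (fun w => Num.max (S w x - 1) 0).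
  apply/funext => w; rewrite /excess; case: ltP => h.
    by apply/esym/max_idPl; rewrite subr_ge0 ltW.
  by apply/esym/max_idPr; rewrite subr_le0.
by rewrite E; apply: measurable_maxr => //; apply: measurable_funB.
Qed.

Lemma measurable_topple (S : T -> dtorus d n -> R) :
  (forall x, measurable_fun setT (fun w => S w x)) ->
  forall k x, measurable_fun setT (fun w => iter k (@topple R d n) (S w) x).
Proof.
move=> mS; elim=> [|k IH] x; first exact: mS.
have me := measurable_excess IH; rewrite /topple /=.
apply: measurable_funD; first by apply: measurable_funB; [exact: IH|exact: me].
apply: measurable_funM => //; apply: measurable_sum => i.
by apply: measurable_funD; exact: me.
Qed.

(** The odometer is a limit of the masses emitted in finite time. *)
Lemma measurable_odometer (sigma : dtorus d n -> T -> R) :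
  (forall x, measurable_fun setT (sigma x)) ->
  forall x, measurable_fun setT (fun w => odometer (sandpile_init (fun z => sigma z w)) x).
Proof.
move=> ms x; pose S w := sandpile_init (fun z => sigma z w).
have mS z : measurable_fun setT (fun w => S w z).
  rewrite /S /sandpile_init; apply: measurable_funB.
    by apply: measurable_funD => //; exact: ms.
  by apply: measurable_funM => //; apply: measurable_sum => y; exact: ms.
apply: (@measurable_fun_cvg _ _ _ setT (fun t w => emitted (S w) t x)).
  move=> t; rewrite /emitted; apply: measurable_sum => k.
  by apply: measurable_excess => z; exact: measurable_topple.
by move=> w _; apply: emitted_cvg => //; exact: sandpile_init_mass.
Qed.

Lemma jointly_gaussian_measurable (P : probability T R) (I : finType) (Y : I -> T -> R) :
  jointly_gaussian P Y -> forall i, measurable_fun setT (Y i).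
Proof.
move=> gY i; have [m [v [_ [mY _]]]] := gY (fun j => (j == i)%:R).
apply: eq_measurable_fun mY => w _; rewrite (bigD1 i)//= eqxx mul1r big1 ?addr0// => j ji.
by rewrite (negbTE ji) mul0r.
Qed.

End odometer_measurability.

Section rescaled_field.
Variables (R : realType) (d : nat).
Hypothesis d0 : (0 < d)%N.
Variable n : nat.
Implicit Types (u : dtorus d n -> R) (f : 'rV[R]_d -> R).

Definition scaled_field u (x : 'rV[R]_d) : R := scale_a R d n * formal_field u x.

(** Also valid for n = 0, where the scaling factor vanishes. *)
Lemma scaled_field_pairing u f : Defs.periodic f -> bounded_lipschitz f ->
  torus_nice (fun x => scaled_field u x * f x) /\
  torus_int (fun x => scaled_field u x * f x) =
    \sum_z scale_a R d n * u z * cell_int n f (grid_pt R z).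
Proof.
move=> pf bf; have [n1|n0] := posnP n.
  have a0 : scale_a R d n = 0 by rewrite /scale_a n1 expr0n invr0 mulr0.
  rewrite (_ : (fun x => _) = fun=> 0); last by apply/funext => x; rewrite /scaled_field a0 !mul0r.
  split; first exact: torus_nice_cst.
  rewrite big1 => [|z _]; last by rewrite a0 !mul0r.
  by have := (torus_niceZ 0 (torus_nice_cst d (0 : R))).2; rewrite !mul0r.
have [nf E] := formal_field_pairing n0 u pf bf; have [nZ EZ] := torus_niceZ (scale_a R d n) nf.
rewrite (_ : (fun x => _) = fun x => scale_a R d n * (formal_field u x * f x)); last first.
  by apply/funext => x; rewrite /scaled_field mulrA.
by split => //; rewrite EZ E mulr_sumr; apply: eq_bigr => z _; rewrite mulrA.
Qed.

Lemma scaled_field_multiplier u : multiplier (scaled_field u).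
Proof. by move=> g pg bg; have [] := scaled_field_pairing u pg bg. Qed.

Lemma coef_scaled_field u nu b : coef (scaled_field u) nu b =
  \sum_z scale_a R d n * u z * cell_int n (mode nu b) (grid_pt R z).
Proof.
by have [_] := scaled_field_pairing u (@mode_periodic R d nu b) (@mode_bounded_lipschitz R d nu b).
Qed.

Definition field_bound u : R := `|scale_a R d n| * \sum_z `|u z|.

Lemma scaled_field_le u x : `|scaled_field u x| <= field_bound u.
Proof. by rewrite normrM ler_wpM2l// formal_field_bounded. Qed.

Lemma coef_scaled_field_le u nu b : `|coef (scaled_field u) nu b| <= field_bound u.
Proof.
apply: torus_int_bounds.
  exact: scaled_field_multiplier (@mode_periodic R d nu b) (@mode_bounded_lipschitz R d nu b).
by move=> x; rewrite normrM -[leRHS]mulr1 ler_pM// ?scaled_field_le// mode_le1.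
Qed.

Variables (s eps : R).
Hypothesis se1 : 1 <= s + eps.
Hypothesis sd : d%:R < 2 * (s + eps).
Variable H : sobolev_space (fun xi : 'rV[int]_d => enorm R xi `^ (- (4 * s))) (- eps).

Definition field_elt u : H := series_elt H (coef (scaled_field u)).

Let field_summable u : exists A, forall N,
  \sum_(nu <- boxseq d N) rad s eps nu * (\sum_b `|coef (scaled_field u) nu b|) <= A.
Proof.
have [C HC] := rad_summable sd; exists (C * (2 * field_bound u)) => N.
apply: le_trans (ler_wpM2r _ (HC N)); last first.
  by rewrite mulr_ge0// mulr_ge0// sumr_ge0.
rewrite mulr_suml; apply: ler_sum => nu _; rewrite ler_wpM2l ?rad_ge0//.
by rewrite big_bool mulr2n mulrDl mul1r lerD// coef_scaled_field_le.
Qed.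

(** Pairings with a test function are the sums of the products of Fourier
    coefficients, both in the completion and for functions. *)
Lemma field_elt_represents u : represents (field_elt u) (scaled_field u).
Proof.
move=> f tf; have [A HA] := field_summable u.
have h1 := series_elt_pairing d0 se1 HA tf.
have h2 := pairing_series d0 (@scaled_field_multiplier u) (scaled_field_le u) tf.
apply: (cvg_unique _ (h1 H)) => //; apply: cvg_trans h2; apply: near_eq_cvg; apply: nearW => N.
by apply: eq_bigr => nu _; apply: eq_bigr => b _; rewrite mulrC.
Qed.

Lemma measurable_series_elt disp (T : measurableType disp) (c : T -> 'rV[int]_d -> bool -> R) :
  (forall nu b, measurable_fun setT (fun w => c w nu b)) ->
  (forall w, exists A, forall N,
     \sum_(nu <- boxseq d N) rad s eps nu * (\sum_b `|c w nu b|) <= A) ->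
  measurable_fun setT (fun w => series_elt H (c w) : borel H).
Proof.
move=> mc cA.
apply: (@measurable_borel_lim R _ T H (fun N w => sob_emb H (box_trig (c w) N))); last first.
  by move=> w; have [A HA] := cA w; exact: (series_elt_cvg HA).
move=> N; have E : (fun w => sob_emb H (box_trig (c w) N)) =
    (fun w => \sum_(i : bidx d N) c w (bnu i) i.2 *: sob_emb H (mode (bnu i) i.2)).
  apply/funext => w; rewrite (box_trig_test H (c w) N).2.
  by rewrite -(sum_bidx N (fun nu b => c w nu b *: sob_emb H (mode nu b))).
by rewrite E; apply: measurable_borel_sum => i; exact: mc.
Qed.

Lemma measurable_field_elt disp (T : measurableType disp) (u : T -> dtorus d n -> R) :
  (forall z, measurable_fun setT (fun w => u w z)) ->
  measurable_fun setT (fun w => field_elt (u w) : borel H).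
Proof.
move=> mu; apply: measurable_series_elt => [nu b|w]; last exact: field_summable.
under eq_fun do rewrite coef_scaled_field.
apply: measurable_sum => z; apply: measurable_funM => //; exact: measurable_funM.
Qed.

End rescaled_field.

(** * Existence of the limit field *)

Section null_sets.
Context (R : realType) disp (T : measurableType disp) (P : probability T R).

(** The supremum of the partial sums is integrable, hence almost surely finite.
    *)
Lemma bounded_series_ae (S : nat -> T -> R) (K : R) :
  (forall N, measurable_fun setT (S N)) -> (forall N w, 0 <= S N w) ->
  (forall w, nondecreasing_seq (fun N => S N w)) ->
  (forall N, (\int[P]_w (S N w)%:E <= K%:E)%E) ->
  exists2 Z : set T, measurable Z /\ P Z = 0%E &
    forall w, ~ Z w -> exists A, forall N, S N w <= A.
Proof.
move=> mS S0 ndS SK; pose g N w := (S N w)%:E.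
have mg N : measurable_fun setT (g N) by apply/measurable_EFinP; exact: mS.
have ndg w : nondecreasing_seq (g ^~ w) by move=> a b ab; rewrite lee_fin; exact: ndS.
pose F w : \bar R := limn (g ^~ w).
have gF w : g ^~ w @ \oo --> F w by apply/cvg_ex; eexists; exact: ereal_nondecreasing_cvgn.
have mF : measurable_fun setT F by exact: (@emeasurable_fun_cvg _ _ R setT g F mg (fun w _ => gF w)).
have gle N w : (g N w <= F w)%E.
  apply: lime_ge; first by apply/cvg_ex; exists (F w); exact: gF.
  by exists N => // M /= NM; exact: ndg.
have F0 w : (0 <= F w)%E by apply: le_trans (gle 0%N w); rewrite lee_fin.
have iF : P.-integrable setT F.
  apply/integrableP; split => //; apply: (@le_lt_trans _ _ K%:E); last exact: ltry.
  under eq_integral do rewrite gee0_abs//.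
  have h := @cvg_monotone_convergence _ T R P setT measurableT g mg (fun N w _ => S0 N w)
    (fun w _ => @ndg w).
  rewrite -(cvg_lim _ h)//; apply: lime_le; first by apply/cvg_ex; eexists; exact: h.
  exact: nearW.
have [Z [mZ PZ HZ]] := integrable_ae measurableT iF.
exists Z => // w nZ.
have : F w \is a fin_num by apply: contrapT => h; apply: nZ; apply: HZ => /= /(_ Logic.I).
move=> /fineK Fw; exists (fine (F w)) => N.
by rewrite -lee_fin Fw; exact: gle.
Qed.

Lemma probability_null_eq (Z A B : set T) : measurable Z -> P Z = 0%E ->
  measurable A -> measurable B -> (forall w, ~ Z w -> A w <-> B w) -> P A = P B.
Proof.
move=> mZ PZ mA mB AB.
have key A' B' : measurable A' -> measurable B' -> (forall w, ~ Z w -> A' w -> B' w) -> (P A' <= P B')%E.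
  move=> mA' mB' H; apply: (@le_trans _ _ (P (B' `|` Z))).
    apply: le_measure; rewrite ?inE//; first exact: measurableU.
    by move=> w Aw; have [Zw|nZ] := pselect (Z w); [right|left; exact: H].
  have h : (P (B' `|` Z) <= P B' + P Z)%E by exact: measureU2.
  by rewrite PZ adde0 in h.
by apply/eqP; rewrite eq_le !key// => w nZ; have [] := AB w nZ.
Qed.

Lemma has_gaussian_law_null (Z : set T) (X Y : T -> R) m v : measurable Z -> P Z = 0%E ->
  measurable_fun setT X -> (forall w, ~ Z w -> X w = Y w) ->
  has_gaussian_law P Y m v -> has_gaussian_law P X m v.
Proof.
move=> mZ PZ mX XY [mY lY]; split => // A mA; rewrite -(lY A mA).
have mXA := mX measurableT A mA; rewrite setTI in mXA.
have mYA := mY measurableT A mA; rewrite setTI in mYA.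
by apply: (probability_null_eq mZ PZ) => // w nZ; rewrite /preimage /= XY.
Qed.

End null_sets.

Section limit_field.
Variables (R : realType) (d : nat) (s eps : R).
Hypothesis d0 : (0 < d)%N.
Hypothesis s0 : 0 < s.
Hypothesis se1 : 1 <= s + eps.
Hypothesis sd : d%:R < 2 * (s + eps).
Variable H : sobolev_space (fun xi : 'rV[int]_d => enorm R xi `^ (- (4 * s))) (- eps).

Let q (nu : 'rV[int]_d) : R := enorm R nu `^ (- (2 * (s + 1))).
Let g (i : 'rV[int]_d * bool) (w : measurableTypeR R) : R := q i.1 * normal_seq (pickle i) w.

Let mg i : measurable_fun setT (g i).
Proof. by apply: measurable_funM => //; exact: measurable_normal_seq. Qed.

Let q_le1 nu : nu != 0 -> q nu <= 1.
Proof.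
move=> nu0; rewrite /q -[leRHS](powRr0 (enorm R nu)); apply: ler_powR; first exact: enorm_ge1.
by rewrite oppr_le0 mulr_ge0// ltW// ltr_wpDr.
Qed.

Let S (N : nat) (w : measurableTypeR R) : R :=
  \sum_(nu <- boxseq d N) rad s eps nu * \sum_b `|g (nu, b) w|.

Let mabs i : measurable_fun setT (fun w => `|g i w|).
Proof. by apply: measurableT_comp => //; exact: mg. Qed.

Let g_abs i : i.1 != 0 -> (\int[unif R]_w `|g i w|%:E <= 1%:E)%E.
Proof.
move=> i0; have L := normal_seq_law (fun j => q j.1) (isT : uniq [:: i]).
have v0 : 0 <= \sum_(j <- [:: i]) q j.1 ^+ 2 by apply: sumr_ge0 => j _; exact: sqr_ge0.
have := gaussian_abs_le v0 L erefl.
rewrite big_seq1 sqrtr_sqr ger0_norm; last exact: powR_ge0.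
move=> h; apply: (@le_trans _ _ (q i.1)%:E); last by rewrite lee_fin q_le1.
apply: le_trans h; rewrite le_eqVlt; apply/orP; left; apply/eqP.
by apply: eq_integral => w _; rewrite big_seq1.
Qed.

Let good : exists2 Z : set (measurableTypeR R), measurable Z /\ unif R Z = 0%E &
    forall w, ~ Z w -> exists A, forall N, S N w <= A.
Proof.
have [C HC] := rad_summable sd.
apply: (@bounded_series_ae _ _ _ (unif R) S (2 * C)).
- move=> N; apply: measurable_sum => nu; apply: measurable_funM => //.
  by apply: measurable_sum => b; exact: mabs.
- by move=> N w; apply: sumr_ge0 => nu _; rewrite mulr_ge0 ?rad_ge0// sumr_ge0.
- move=> w N M NM; apply: ler_sum_sub; [exact: boxseq_uniq|exact: boxseq_uniq|exact: boxseq_sub|].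
  by move=> nu; rewrite mulr_ge0 ?rad_ge0// sumr_ge0.
move=> N; apply: (@le_trans _ _ (\sum_(nu <- boxseq d N) rad s eps nu * (2 * 1))%:E); last first.
  by rewrite -mulr_suml lee_fin mulr1 mulrC ler_wpM2l.
apply: integral_sum_le => [nu|nu w|nu].
- by apply: measurable_funM => //; apply: measurable_sum => b; exact: mabs.
- by rewrite mulr_ge0 ?rad_ge0// sumr_ge0.
rewrite mem_boxseq => /andP[nu0 _]; apply: integral_pair_le => [|b|//|b].
- exact: rad_ge0.
- exact: mabs.
- exact: (@g_abs (nu, b)).
Qed.

(** The field with independent Gaussian coefficients of standard deviations
    |nu|^(-2(s+1)). Its coefficients are set to zero on the null set where the
    series fails to converge, so that it is defined everywhere; its law has the
    prescribed pairings by Parseval and the stability of Gaussian laws under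
    limits. *)
Lemma limit_field_exists : exists mu : probability (borel H) R, is_limit_field_law s mu.
Proof.
have [Z [mZ PZ] HZ] := good.
pose c (w : measurableTypeR R) nu b : R := \1_(~` Z) w * g (nu, b) w.
have cE w nu b : ~ Z w -> c w nu b = g (nu, b) w.
  by move=> nZ; rewrite /c indicE mem_set// mul1r.
have mc nu b : measurable_fun setT (fun w => c w nu b).
  apply: measurable_funM; last exact: mg.
  by apply: measurable_indic; exact: measurableC.
have cA w : exists A, forall N,
    \sum_(nu <- boxseq d N) rad s eps nu * (\sum_b `|c w nu b|) <= A.
  have [Zw|nZ] := pselect (Z w).
    exists 0 => N; rewrite big1// => nu _; rewrite big1 ?mulr0// => b _.
    by rewrite /c indicE memNset ?mul0r ?normr0//; apply.
  have [A HA] := HZ w nZ; exists A => N; apply: le_trans (HA N).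
  rewrite le_eqVlt; apply/orP; left; apply/eqP; apply: eq_bigr => nu _.
  by congr (_ * _); apply: eq_bigr => b _; rewrite cE.
pose Y w : borel H := series_elt H (c w).
have mY : measurable_fun setT Y := measurable_series_elt mc cA.
have law f : test_function f -> has_gaussian_law (unif R) (fun w => sob_pairing f (Y w : H)) 0
    (l2norm_sq (frac_laplacian (- (s + 1)) f)).
  move=> tf; have s1 : 0 < s + 1 by rewrite addr_gt0.
  have s2 : 0 <= 2 * (s + 1) by rewrite mulr_ge0 ?ltW.
  rewrite frac_laplacian_norm//.
  pose X N (w : measurableTypeR R) := \sum_(nu <- boxseq d N) \sum_b c w nu b * coef f nu b.
  apply: (@gaussian_law_limit _ _ _ (unif R) X _ (spec f (2 * (s + 1)))).
  - by move=> N; apply: sumr_ge0 => nu _; exact: spec_term_ge0.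
  - exact: spec_cvg.
  - move=> N; pose r := [seq (nu, b) | nu <- boxseq d N, b <- [:: true; false]].
    have ur : uniq r by apply: allpairs_uniq => //; [exact: boxseq_uniq|case=> a b [a' b']].
    have rE (F : 'rV[int]_d * bool -> R) : \sum_(i <- r) F i = \sum_(nu <- boxseq d N) \sum_b F (nu, b).
      rewrite big_allpairs; apply: eq_bigr => nu _.
      by rewrite big_bool !big_cons big_nil /= addr0.
    have L := normal_seq_law (fun i => q i.1 * coef f i.1 i.2) ur.
    (* The variance of the partial sum is the partial sum of the spectral
       series. *)
    have -> : spec f (2 * (s + 1)) N = \sum_(i <- r) (q i.1 * coef f i.1 i.2) ^+ 2.
      rewrite rE; apply: eq_big_seq => nu; rewrite mem_boxseq => /andP[nu0 _] /=.
      rewrite /coef2 mulr_sumr; apply: eq_bigr => b _; rewrite exprMn /q; congr (_ * _).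
      have e0 := enorm_gt0 R nu0.
      by rewrite powR_sqrV// -powR_mulrn ?powR_ge0// -powRrM; congr (_ `^ _); ring.
    apply: (has_gaussian_law_null mZ PZ _ _ L).
      apply: measurable_sum => nu; apply: measurable_sum => b.
      by apply: measurable_funM => //; exact: mc.
    move=> w nZ; rewrite rE; apply: eq_bigr => nu _; apply: eq_bigr => b _.
    by rewrite cE// /g /= mulrAC.
  - move=> w; have [A HA] := cA w.
    exact: (series_elt_pairing d0 se1 HA tf).
exists (distribution (unif R) (mfun_Sub (mem_set mY))) => f tf; split.
  apply: measurable_borel_continuous.
  by have [] := sob_pairing_spec d0 (le_trans ler01 se1) H tf.
by move=> A mA; have [_ <-] := law f tf.
Qed.

End limit_field.

(** * Convergence in law *)

Lemma integrable_borel_comp (R : realType) disp (T : measurableType disp) (P : probability T R)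
    (V : normedModType R) (phi : V -> R) (M : R) (f : T -> borel V) :
  continuous phi -> (forall x, `|phi x| <= M) -> measurable_fun setT f ->
  P.-integrable setT (EFin \o (fun w => phi (f w))).
Proof.
move=> cphi phiM mf.
exact: (@integrable_bounded_prob _ T R P (fun w => phi (f w)) M (measurable_borel_comp cphi mf)
  (fun w => phiM (f w))).
Qed.

Section portmanteau.
Context (R : realType) (V : normedModType R) (disp : nat -> measure_display)
  (Omega : forall n, measurableType (disp n)) (P : forall n, probability (Omega n) R)
  (X : forall n, Omega n -> borel V) (mu : probability (borel V) R).
Arguments X : clear implicits.
Hypothesis mX : forall n, measurable_fun setT (X n).

Let lipschitz_on (phi : V -> R) := exists2 L, 0 <= L &
  forall x y, `|phi x - phi y| <= L * `|x - y|.

Hypothesis HL : forall (phi : V -> R) (M : R), lipschitz_on phi -> (forall x, `|phi x| <= M) ->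
  (fun n => \int[P n]_w phi (X n w)) @ \oo --> \int[mu]_(x in [set: borel V]) phi x.

Lemma lipschitz_continuous_fun (phi : V -> R) L :
  (forall x y, `|phi x - phi y| <= L * `|x - y|) -> 0 <= L -> continuous phi.
Proof.
move=> phiL L0 x; apply/cvgrPdist_lt => e e0.
have L1 : 0 < L + 1 by rewrite ltr_wpDl.
apply/nbhs_ballP; exists (e / (L + 1)); first by rewrite /= divr_gt0.
move=> y; rewrite -ball_normE /= ltr_pdivlMr// => h.
apply: (le_lt_trans (phiL x y)); have := normr_ge0 (x - y); nra.
Qed.

Let lower (phi : V -> R) (M e : R) : continuous phi -> (forall x, `|phi x| <= M) -> 0 < e ->
  \forall n \near \oo, \int[mu]_(x in [set: borel V]) phi x - e <= \int[P n]_w phi (X n w).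
Proof.
move=> cphi phiM e0; have e2 : 0 < e / 2 by rewrite divr_gt0.
have ce k : continuous (envelope phi k).
  exact: (lipschitz_continuous_fun (@envelope_lipschitz R V phi M phiM k) (ler0n _ k)).
have eM k x := @envelope_bounded R V phi M phiM k x.
have h : (fun k => \int[mu]_(x in [set: borel V]) envelope phi k x) @ \oo -->
    \int[mu]_(x in [set: borel V]) phi x.
  apply: (@Rintegral_cvg_bounded _ (borel V) R mu (fun k => envelope phi k) phi M).
  - by move=> k; exact: measurable_borel_continuous.
  - by move=> k x; exact: eM.
  - by move=> x; exact: (@envelope_cvg R V phi M phiM x (cphi x)).
have /cvgrPdist_le/(_ _ e2)[k _ /(_ k (leqnn k)) /= hk] := h.
have /cvgrPdist_le/(_ _ e2) := HL (ex_intro2 _ _ k%:R (ler0n _ k) (@envelope_lipschitz R V phi M phiM k)) (eM k).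
apply: filterS => n hn.
have le1 : \int[P n]_w envelope phi k (X n w) <= \int[P n]_w phi (X n w).
  apply: (@le_Rintegral _ _ _ (P n)); first exact: measurableT.
  - exact: (integrable_borel_comp (P n) (ce k) (eM k) (@mX n)).
  - exact: (integrable_borel_comp (P n) cphi phiM (@mX n)).
  - by move=> w _; exact: (@envelope_le R V phi M phiM).
move: hn hk; rewrite !ler_norml => /andP[_ hn] /andP[_ hk].
by rewrite (splitr e) opprD addrA lerBlDr; apply: le_trans (lerD le1 (lexx _)); lra.
Qed.

(** A bounded continuous function is the increasing limit of Lipschitz
    minorants; applied to the function and its opposite, this gives the lower
    and the upper bound. *)
Lemma cvg_law_of_lipschitz : converges_in_law P X mu.
Proof.
move=> phi cphi [M phiM]; apply/cvgrPdist_le => e e0.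
have cN : continuous (fun x => -1 * phi x) by move=> x; apply: cvgMl_tmp; exact: cphi.
have NM x : `|-1 * phi x| <= M by rewrite mulN1r normrN.
apply: filterS2 (lower cphi phiM e0) (lower cN NM e0) => n h1.
have i1 : mu.-integrable [set: borel V] (EFin \o (phi : borel V -> R)).
  exact: (integrable_borel_comp mu cphi phiM (@measurable_id _ (borel V) setT)).
have i2 : (P n).-integrable setT (EFin \o (fun w => phi (X n w))).
  exact: (integrable_borel_comp (P n) cphi phiM (@mX n)).
rewrite (@RintegralZl _ _ _ mu _ (phi : borel V -> R) (-1) measurableT i1).
rewrite (@RintegralZl _ _ _ (P n) _ _ (-1) measurableT i2) !mulN1r => h2.
by rewrite ler_norml; apply/andP; split; lra.
Qed.

End portmanteau.

Section tails.
Variables (R : realType) (d : nat) (s eps : R).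
Hypothesis d0 : (0 < d)%N.
Hypothesis se1 : 1 <= s + eps.
Hypothesis sd : d%:R < 2 * (s + eps).
Variable H : sobolev_space (fun xi : 'rV[int]_d => enorm R xi `^ (- (4 * s))) (- eps).
Notation emb := (sob_emb H).
Notation "'md' i" := (@mode R d (bnu i) i.2) (at level 10).
Notation tail := (box_tail (rad s eps : 'rV[int]_d -> R)).

Lemma tail_cvg : tail @ \oo --> (0 : R).
Proof.
have [C HC] := rad_summable sd.
by apply: (box_tail_cvg HC) => nu; exact: rad_ge0.
Qed.

Lemma proj_dist N M (h : H) : (N <= M)%N -> `|proj M h - proj N h| <=
  \sum_(nu <- boxseq d M | nu \notin boxseq d N)
     rad s eps nu * \sum_b `|sob_pairing (mode nu b) h|.
Proof.
move=> NM; rewrite /proj.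
rewrite (sum_bidx M (fun nu b => sob_pairing (mode nu b) h *: emb (mode nu b))).
rewrite (sum_bidx N (fun nu b => sob_pairing (mode nu b) h *: emb (mode nu b))).
rewrite (sum_split_sub _ (boxseq_uniq d N) (boxseq_uniq d M) (boxseq_sub NM)) addrC addKr.
apply: (le_trans (ler_norm_sum _ _ _)).
rewrite big_seq_cond [leRHS]big_seq_cond; apply: ler_sum => nu /andP[].
rewrite mem_boxseq => /andP[nu0 _] _; apply: (le_trans (ler_norm_sum _ _ _)).
rewrite mulr_sumr; apply: ler_sum => b _; rewrite normrZ mulrC ler_wpM2r//.
exact: (emb_mode_le H b nu0).
Qed.

(** A uniform bound on the first moments of the Fourier coefficients controls
    the remainder of the Fourier expansion, whatever their joint law; this
    replaces tightness. *)
Lemma proj_remainder disp (T : measurableType disp) (P : probability T R)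
    (X : T -> borel H) (K : R) N :
  measurable_fun setT X ->
  (forall nu b, nu != 0 -> (\int[P]_w `|sob_pairing (mode nu b) (X w : H)|%:E <= K%:E)%E) ->
  (\int[P]_w `|(X w : H) - proj N (X w : H)|%:E <= (2 * K * tail N)%:E)%E.
Proof.
move=> mX XK.
(* Nonnegativity is read off the bound at one nonzero frequency. *)
have K0 : 0 <= K.
  have n0 : const_mx 1 != 0 :> 'rV[int]_d.
    by apply/eqP => /rowP/(_ (Ordinal d0)); rewrite !mxE.
  rewrite -lee_fin; apply: le_trans (XK _ true n0).
  by apply: integral_ge0 => w _; rewrite lee_fin.
have cp M : continuous (fun h : H => `|proj M h - proj N h|).
  move=> h; apply: cvg_norm; apply: cvgB; exact: (proj_continuous d0 se1).
(* The remainder is the limit of differences of two projections, to which Fatou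
   applies. *)
apply: (@le_integral_lim _ _ _ P (fun M w => `|proj (N + M) (X w : H) - proj N (X w : H)|)).
- by move=> M; exact: (measurable_borel_comp (cp (N + M)%N) mX).
- by [].
- move=> w; apply: cvg_norm; apply: cvgB; last exact: cvg_cst.
  have := @proj_cvg _ _ _ _ d0 se1 H (X w); rewrite -(cvg_shiftn N).
  have -> : (fun M => proj (N + M) (X w : H)) = (fun M => proj (M + N) (X w : H)).
    by apply/funext => M; rewrite addnC.
  exact.
move=> M; pose F nu w := rad s eps nu * \sum_b `|sob_pairing (mode nu b) (X w : H)|.
have mm (nu : 'rV[int]_d) b : nu != 0 -> measurable_fun setT (fun w => `|sob_pairing (mode nu b) (X w : H)|).
  move=> nu0; apply: measurableT_comp => //; apply: (measurable_borel_comp _ mX).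
  by have [] := sob_pairing_spec d0 (le_trans ler01 se1) H (mode_test_function R b nu0).
pose G nu w := if nu == 0 then 0 else F nu w.
have mG nu : measurable_fun setT (G nu).
  rewrite /G; have [_|nu0] := eqVneq nu 0; first exact: measurable_cst.
  by apply: measurable_funM => //; apply: measurable_sum => b; exact: mm.
have G0 nu w : 0 <= G nu w.
  by rewrite /G; case: eqP => // _; rewrite mulr_ge0 ?rad_ge0 ?sumr_ge0.
pose r := [seq nu <- boxseq d (N + M) | nu \notin boxseq d N].
have GK nu : nu \in r -> (\int[P]_w (G nu w)%:E <= (rad s eps nu * (2 * K))%:E)%E.
  rewrite mem_filter => /andP[_]; rewrite mem_boxseq => /andP[nu0 _]; rewrite /G (negbTE nu0).
  apply: integral_pair_le => [|b|//|b]; [exact: rad_ge0|exact: mm|exact: XK].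
have := @integral_sum_le _ _ _ P _ r G _ mG G0 GK.
move=> h; apply: le_trans (le_trans h _).
  apply: ge0_le_integral => //.
  - by apply/measurable_EFinP; exact: (measurable_borel_comp (cp (N + M)%N) mX).
  - by apply/measurable_EFinP; exact: measurable_sum.
  - move=> w _; rewrite lee_fin; apply: (le_trans (proj_dist _ (leq_addr M N))).
    rewrite big_filter le_eqVlt; apply/orP; left; apply/eqP; rewrite [LHS]big_seq_cond [RHS]big_seq_cond.
    apply: eq_bigr => nu /andP[+ _]; rewrite mem_boxseq => /andP[nu0 _].
    by rewrite /G (negbTE nu0).
have [C HC] := rad_summable sd.
rewrite big_filter -mulr_suml mulrC lee_fin ler_wpM2l ?mulr_ge0//.
rewrite /box_tail lerBrDl; apply: le_trans (box_sum_le HC _ (N + M)); last exact: rad_ge0.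
by rewrite (sum_split_sub _ (boxseq_uniq d N) (boxseq_uniq d (N + M)) (boxseq_sub (leq_addr M N))).
Qed.

Section convergence.
Context (disp : nat -> measure_display)
  (Omega : forall n, measurableType (disp n)) (P : forall n, probability (Omega n) R)
  (X : forall n, Omega n -> borel H) (mu : probability (borel H) R).
Arguments X : clear implicits.
Hypothesis mX : forall n, measurable_fun setT (X n).
Variables (v : nat -> ('rV[R]_d -> R) -> R) (v' : ('rV[R]_d -> R) -> R) (K : R).
Hypothesis v0 : forall n f, test_function f -> 0 <= v n f.
Hypothesis v'0 : forall f, test_function f -> 0 <= v' f.
Hypothesis Xv : forall n f, test_function f ->
  has_gaussian_law (P n) (fun w => sob_pairing f (X n w : H)) 0 (v n f).
Hypothesis muv : forall f, test_function f ->
  has_gaussian_law mu (sob_pairing f : borel H -> R) 0 (v' f).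
Hypothesis vv : forall f, test_function f -> v ^~ f @ \oo --> v' f.
Hypothesis vK : forall n nu b, nu != 0 -> v n (mode nu b) <= K ^+ 2.
Hypothesis K0 : 0 <= K.

Let family d' (T : measurableType d') (Q : probability T R) (Z : T -> H) (w : ('rV[R]_d -> R) -> R) N :
  (forall f, test_function f -> 0 <= w f) ->
  (forall f, test_function f -> has_gaussian_law Q (fun x => sob_pairing f (Z x)) 0 (w f)) ->
  gaussian_family Q (fun (i : bidx d N) x => sob_pairing (md i) (Z x)) (fun c => w (mode_comb c)).
Proof.
move=> w0 Zw c; have tc := mode_comb_test c; split; first exact: w0.
have := Zw _ tc; congr has_gaussian_law; apply/funext => x.
exact: pairing_mode_comb.
Qed.

Let moment d' (T : measurableType d') (Q : probability T R) (Z : T -> H) (w : ('rV[R]_d -> R) -> R) :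
  (forall f, test_function f -> 0 <= w f) ->
  (forall f, test_function f -> has_gaussian_law Q (fun x => sob_pairing f (Z x)) 0 (w f)) ->
  (forall nu b, nu != 0 -> w (mode nu b) <= K ^+ 2) ->
  forall nu b, nu != 0 -> (\int[Q]_x `|sob_pairing (mode nu b) (Z x)|%:E <= K%:E)%E.
Proof.
move=> w0 Zw wK nu b nu0; have tm := mode_test_function R b nu0.
apply: (le_trans (gaussian_abs_le (w0 _ tm) (Zw _ tm) erefl)).
rewrite lee_fin -(ger0_norm K0) -sqrtr_sqr; apply: ler_wsqrtr; exact: wK.
Qed.

Let v'K nu b : nu != 0 -> v' (mode nu b) <= K ^+ 2.
Proof.
move=> nu0; have h := vv (mode_test_function R b nu0).
by apply: (ler_cvg_to h (cvg_cst (K ^+ 2))); apply: nearW => n; exact: vK.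
Qed.

(** The expectation of a Lipschitz function changes little when the field is
    projected on finitely many modes, uniformly in n; the projections depend on
    a finite Gaussian family, to which the convergence of variances applies. *)
Lemma gaussian_fields_cvg : converges_in_law P X mu.
Proof.
apply: cvg_law_of_lipschitz => // phi M [L L0 phiL] phiM.
have cphi := lipschitz_continuous_fun phiL L0.
have mid : measurable_fun setT (id : borel H -> borel H) by exact: measurable_id.
pose psi N (y : bidx d N -> R) := phi (\sum_i y i *: emb (md i)).
have psiL N : sum_lipschitz L (psi N).
  move=> y z; apply: (le_trans (phiL _ _)); rewrite ler_wpM2l// -sumrB.
  apply: (le_trans (ler_norm_sum _ _ _)); apply: ler_sum => i _.
  rewrite -scalerBl normrZ ler_piMr//.
  exact: le_trans (emb_mode_le H i.2 (bnu_neq0 i)) (rad_le1 (le_trans ler01 se1) (bnu_neq0 i)).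
have cpp N : continuous (fun h : H => phi (proj N h)).
  by move=> h; apply: (@continuous_comp _ _ _ (@proj _ _ _ _ H N) phi); [exact: (proj_continuous d0 se1)|exact: cphi].
have cd N : continuous (fun h : H => L * `|h - proj N h|).
  move=> h; apply: cvgMl_tmp; apply: cvg_norm; apply: cvgB; first exact: cvg_id.
  exact: (proj_continuous d0 se1).
have close d' (T : measurableType d') (Q : probability T R) (Z : T -> borel H) N :
    measurable_fun setT Z ->
    (forall nu b, nu != 0 -> (\int[Q]_x `|sob_pairing (mode nu b) (Z x : H)|%:E <= K%:E)%E) ->
    `|\int[Q]_x phi (proj N (Z x : H)) - \int[Q]_x phi (Z x)| <= L * (2 * K * tail N).
  move=> mZ ZK.
  apply: (@Rintegral_dist_le _ _ _ Q _ _ (fun x => L * `|(Z x : H) - proj N (Z x : H)|) M).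
  - exact: (measurable_borel_comp (cpp N) mZ).
  - by move=> x; exact: phiM.
  - exact: (measurable_borel_comp cphi mZ).
  - by move=> x; exact: phiM.
  - exact: (measurable_borel_comp (cd N) mZ).
  - by move=> x; rewrite distrC; exact: phiL.
  under eq_integral do rewrite EFinM.
  rewrite ge0_integralZl//; last first.
    apply/measurable_EFinP; apply: (@measurable_borel_comp _ _ _ H (fun h => `|h - proj N h|)) => //.
    move=> h; apply: cvg_norm; apply: cvgB; first exact: cvg_id.
    exact: (proj_continuous d0 se1).
  rewrite EFinM; apply: lee_wpmul2l; first by rewrite lee_fin.
  exact: proj_remainder.
apply: cvg_uniform_approx => e e0.
have : (fun N => L * (2 * K * tail N)) @ \oo --> L * (2 * K * 0).
  by apply: cvgMl_tmp; apply: cvgMl_tmp; exact: tail_cvg.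
rewrite !mulr0 => /cvgrPdist_le/(_ e e0)[N _ /(_ N (leqnn N)) /=].
rewrite sub0r normrN => /(le_trans (ler_norm _)) HN.
exists (fun n => \int[P n]_w phi (proj N (X n w : H))), (\int[mu]_(h in [set: borel H]) phi (proj N h)).
split.
- have := gaussian_family_cvg (fun n => @family _ _ _ _ _ N (@v0 n) (@Xv n)) (@family _ _ _ _ _ N v'0 muv)
    (fun c => vv (mode_comb_test c)) L0 (psiL N) (fun y => phiM _).
  exact.
- apply: nearW => n; apply: le_trans HN.
  exact: (close _ _ _ _ N (@mX n) (moment (@v0 n) (@Xv n) (@vK n))).
- by apply: le_trans HN; exact: (close _ _ _ _ N mid (moment v'0 muv v'K)).
Qed.

End convergence.

End tails.

(** * The scaling limit *)

Section field_law.
Variables (R : realType) (d : nat) (s eps : R).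
Hypothesis d0 : (0 < d)%N.
Hypothesis s0 : 0 < s.
Hypothesis se1 : 1 <= s + eps.
Hypothesis sd : d%:R < 2 * (s + eps).
Variable H : sobolev_space (fun xi : 'rV[int]_d => enorm R xi `^ (- (4 * s))) (- eps).

(** Variance of the pairing at mesh 1/(n+1); the empty torus n = 0 is left
    aside. *)
Definition field_variance n (f : 'rV[R]_d -> R) : R :=
  pairing_var s (cell_avg f (n := n.+1)).

Lemma field_pairing_law n disp (T : measurableType disp) (P : probability T R)
    (sigma : dtorus d n.+1 -> T -> R) f :
  gaussian_with_cov P (kernel_K s n.+1) sigma -> test_function f ->
  has_gaussian_law P (fun w => sob_pairing f
    (field_elt H (odometer (sandpile_init (fun z => sigma z w))))) 0 (field_variance n f).
Proof.
move=> gs tf; have := odometer_gaussian (ltn0Sn n) d0 gs (cell_avg_sum0 tf (ltn0Sn n)).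
congr has_gaussian_law; apply/funext => w.
rewrite (field_elt_represents d0 se1 sd)// /l2dot.
have pf : Defs.periodic f by case: tf.
by rewrite (scaled_field_pairing _ pf (test_function_lipschitz tf)).2.
Qed.

Lemma field_variance_ge0 n f : 0 <= field_variance n f.
Proof. by apply: pairing_var_ge0. Qed.

Let t0 : 0 <= 2 * s + 2. Proof. by rewrite addr_ge0// mulr_ge0// ltW. Qed.

Lemma field_variance_cvg f : test_function f ->
  field_variance ^~ f @ \oo --> l2norm_sq (frac_laplacian (- (s + 1)) f).
Proof.
move=> tf; rewrite frac_laplacian_norm ?addr_gt0//.
have -> : 2 * (s + 1) = 2 * s + 2 by ring.
have -> : field_variance ^~ f = (fun n => dsob (2 * s + 2) (cell_avg f (n := n.+1))).
  by apply/funext => n; rewrite -pairing_varE.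
by have := dsob_cvg d0 tf t0; rewrite -cvg_shiftS.
Qed.

(** The modes are bounded by 1, so their variances are bounded uniformly in the
    frequency and the mesh. *)
Lemma field_variance_mode n nu b : nu != 0 ->
  field_variance n (mode nu b) <= Num.sqrt (16 `^ (2 * s + 2)) ^+ 2.
Proof.
move=> nu0; rewrite sqr_sqrtr ?powR_ge0// /field_variance pairing_varE//.
have m1 x : `|@mode R d nu b x| <= 1 by exact: mode_le1.
have := dsob_le d0 (mode_test_function R b nu0) m1 (ltn0Sn n) t0.
by rewrite expr1n mulr1.
Qed.

End field_law.

Theorem proposition14 (R : realType) (d : nat) (s eps : R)
    (hd : (1 <= d)%N) (hs : 0 < s)
    (heps : Num.max (d%:R / 2) (1 + d%:R / 4) < eps)
    (H : sobolev_space (fun xi : 'rV[int]_d => enorm R xi `^ (- (4 * s)))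
           (- eps))
    (disp : nat -> measure_display)
    (Omega : forall n, measurableType (disp n))
    (P : forall n, probability (Omega n) R)
    (sigma : forall n, dtorus d n -> Omega n -> R)
    (hsigma : forall n, gaussian_with_cov (P n) (kernel_K s n) (sigma n)) :
  exists X : forall n, Omega n -> H,
    [/\ forall n w,
          represents (X n w)
            (fun x => scale_a R d n *
               formal_field
                 (odometer (sandpile_init (fun z => sigma n z w))) x),
        forall n, measurable_fun setT (X n : Omega n -> borel H),
        exists mu : probability (borel H) R, is_limit_field_law s mu
      & forall mu : probability (borel H) R, is_limit_field_law s mu ->
          converges_in_law P X mu].
Proof.
move: heps; rewrite gt_max => /andP[e1 e2].
have d1 : 0 <= d%:R :> R by [].
(* The second bound gives eps > 1, and eps > d/2 with s > 0 makes the norms of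
   the modes summable. *)
have se1 : 1 <= s + eps by lra.
have sd : d%:R < 2 * (s + eps) by lra.
pose X n w : H := field_elt H (odometer (sandpile_init (fun z => sigma n z w))).
have mX n : measurable_fun setT (X n : Omega n -> borel H).
  apply: (measurable_field_elt sd); case: n => [|n] z.
    by case: (z (Ordinal hd)).
  apply: measurable_odometer => // x; have [gj _ _] := hsigma n.+1.
  exact: jointly_gaussian_measurable gj x.
exists X; split => //.
- by move=> n w; exact: (field_elt_represents hd se1 sd).
- exact: limit_field_exists.
move=> mu muL phi cphi bphi; rewrite -cvg_shiftS.
apply: (@gaussian_fields_cvg R d s eps hd se1 sd H _ _ (fun n => P n.+1) (fun n => X n.+1) mu
  (fun n => mX n.+1) (@field_variance R d s) _ (Num.sqrt (16 `^ (2 * s + 2))) _ _ _ muL).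
- by move=> n f _; exact: field_variance_ge0.
- move=> f tf; rewrite frac_laplacian_norm ?addr_gt0//; apply: limr_ge.
    by apply: spec_cvg => //; rewrite mulr_ge0// ltW// addr_gt0.
  by apply: nearW => N; apply: sumr_ge0 => nu _; exact: spec_term_ge0.
- by move=> n f tf; exact: field_pairing_law.
- by move=> f tf; exact: field_variance_cvg.
- by move=> n nu b nu0; exact: field_variance_mode.
- exact: sqrtr_ge0.
- exact: cphi.
- exact: bphi.
Qed.
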